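(* Consider the parametric family of analytic planar systems $$\dot x=y+X(x,y,\delta),\qquad \dot y=Y(x,y,\delta),$$ with $\delta\in D\subset\mathbb{R}^l$, $D$ a simply connected domain, and $X,Y=\mathcal{O}(|x,y|^2)$. Let $y=f(x,\delta)$ be its characteristic curve and put $$F(x,\delta)=-Y(x,f(x,\delta),\delta),\qquad G(x,\delta)=-\Big(\frac{\partial X}{\partial x}+\frac{\partial Y}{\partial y}\Big)(x,f(x,\delta),\delta).$$ Assume that for some integer $n\ge2$ and all $\delta\in D$, $$F(x,\delta)=\sum_{j\ge 2n-1}a_j(\delta)x^j,\quad a_{2n-1}(\delta)>0,\qquad G(x,\delta)=\sum_{j\ge n-1}b_j(\delta)x^j,\quad b_{n-1}(\delta)^2-4n\,a_{2n-1}(\delta)<0 .$$ Let $\Gamma(\delta_0)$ be a spiral trajectory of the system near the origin for some $\delta_0\in D$, and let $P(x,\delta_0)$ be the Poincaré map of the system near the focus on the characteristic curve $y=f(x,\delta_0)$. Let $k\ge1$ be an integer and suppose that the sequence $S(x_1)=(x_i)_{i\ge1}$ defined by $x_{i+1}=P(x_i,\delta_0)$ (stable focus) or $x_{i+1}=P^{-1}(x_i,\delta_0)$ (unstable focus), with $x_1\in(0,r)$ and $r>0$ small, has box dimension $\dim_BS(x_1)=1-\frac{1}{2k+1}$ or $1-\frac{1}{2k+2}$. Then for all $\delta\in D$ near $\delta_0$ the system has at most $k$ limit cycles in a neighborhood of the origin.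
   Context: The characteristic curve $y=f(x,\delta)$ is the solution near the origin of $y+X(x,y,\delta)=0$ with $f(0,\delta)=0$. Under the stated conditions the origin is a nilpotent center or focus for every $\delta\in D$. Poincaré map: for $\delta\in D$ and $x_0\ne0$ with $|x_0|$ small, let $(x(t,x_0,\delta),y(t,x_0,\delta))$ be the solution with initial condition $(x_0,f(x_0,\delta))$ at $t=0$. There is a least positive number $\tau=\tau(x_0,\delta)$ such that $y(\tau,x_0,\delta)=f(x(\tau,x_0,\delta),\delta)$ and $x_0\,x(\tau,x_0,\delta)>0$; define $P(x_0,\delta)=x(\tau,x_0,\delta)$. Box dimension: for bounded $A\subset\mathbb{R}^N$ let $A_\varepsilon$ be its $\varepsilon$-neighborhood and $|A_\varepsilon|$ its Lebesgue measure. For $s\ge0$ put $\mathcal M_*^s(A)=\liminf_{\varepsilon\to0}|A_\varepsilon|/\varepsilon^{N-s}$ and $\mathcal M^{*s}(A)=\limsup_{\varepsilon\to0}|A_\varepsilon|/\varepsilon^{N-s}$. The lower and upper box dimensions are $\inf\{s>0:\mathcal M_*^s(A)=0\}$ and $\inf\{s>0:\mathcal M^{*s}(A)=0\}$; if equal, the common value is $\dim_BA$. A sequence is identified with its set of points. *)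

(* Defs.v *)
From mathcomp Require Export all_boot all_order all_algebra.
From mathcomp Require Export all_classical all_reals all_analysis.
Export Order.TTheory GRing.Theory Num.Theory.
Export numFieldNormedType.Exports.

Set Implicit Arguments.
Unset Strict Implicit.
Unset Printing Implicit Defensive.

Local Open Scope classical_set_scope.
Local Open Scope ring_scope.

(* Real analyticity at p: g is, on a cube centred at p, the sum of an absolutely
   convergent multivariate power series.  The multi-indices are the finite
   functions 'I_m -> nat; absolute convergence makes the sum independent of the
   order of summation, so the limit of the sums over the boxes [0, N)^m is the
   sum of the series. *)
Definition monomial (R : realType) (m : nat) (h : 'rV[R]_m)
    (alpha : {ffun 'I_m -> nat}) : R :=
  \prod_(i < m) h ord0 i ^+ alpha i.

Definition analytic_at (R : realType) (m : nat) (g : 'rV[R]_m -> R)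
    (p : 'rV[R]_m) : Prop :=
  exists (c : {ffun 'I_m -> nat} -> R) (rho : R), 0 < rho /\
    forall h : 'rV[R]_m, (forall i, `|h ord0 i| < rho) ->
      summable setT (fun alpha => (c alpha * monomial h alpha)%:E) /\
      (\sum_(alpha : {ffun 'I_m -> 'I_N})
          c [ffun i => alpha i : nat] * monomial h [ffun i => alpha i : nat])
        @[N --> \oo] --> g (p + h).

(* Joint analyticity in (x, y, delta), where (x, y, delta) is the row vector
   whose first two entries are x and y. *)
Definition jointly_analytic_at (R : realType) (l : nat)
    (X : R -> R -> 'rV[R]_l -> R) (x y : R) (delta : 'rV[R]_l) : Prop :=
  @analytic_at R (1 + (1 + l))
    (fun v => X (lsubmx v ord0 ord0) (lsubmx (rsubmx v) ord0 ord0)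
                (rsubmx (rsubmx v)))
    (row_mx x%:M (row_mx y%:M delta)).

Definition path_connected (R : realType) (T : topologicalType) (D : set T)
    : Prop :=
  forall p q : T, D p -> D q ->
    exists gamma : R -> T,
      [/\ {within `[0, 1], continuous gamma},
          gamma 0 = p, gamma 1 = q & gamma @` `[0, 1] `<=` D].

(* Null-homotopy of loops is relative to the base point. *)
Definition simply_connected (R : realType) (T : topologicalType) (D : set T)
    : Prop :=
  path_connected R D /\
  forall gamma : R -> T,
    {within `[0, 1], continuous gamma} -> gamma 0 = gamma 1 ->
    gamma @` `[0, 1] `<=` D ->
    exists H : R * R -> T,
      [/\ {within `[0, 1] `*` `[0, 1], continuous H},
          H @` (`[0, 1] `*` `[0, 1]) `<=` D,
          forall t, t \in `[0, 1] -> H (0, t) = gamma t,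
          forall t, t \in `[0, 1] -> H (1, t) = gamma 0 &
          forall s, s \in `[0, 1] -> H (s, 0) = gamma 0 /\ H (s, 1) = gamma 0].

Definition simply_connected_domain (R : realType) (l : nat)
    (D : set 'rV[R]_l) : Prop :=
  [/\ open D, D !=set0 & simply_connected R D].

Section System.
Variables (R : realType) (l : nat) (X Y : R -> R -> 'rV[R]_l -> R).

(* (x, y) satisfies x' = y + X(x, y, delta), y' = Y(x, y, delta) at the times in
   I.  The derivatives are two-sided also at endpoints of I; since solutions
   extend beyond closed time intervals, nothing is lost. *)
Definition solves (delta : 'rV[R]_l) (I : set R) (x y : R -> R) : Prop :=
  forall t, I t ->
    is_derive t 1 x (y t + X (x t) (y t) delta) /\
    is_derive t 1 y (Y (x t) (y t) delta).

(* The continuity at 0 selects the branch through the origin, which is unique by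
   the implicit function theorem; f(., delta) matters only as a germ at 0. *)
Definition characteristic_curve (f : R -> 'rV[R]_l -> R) (delta : 'rV[R]_l)
    : Prop :=
  [/\ f 0 delta = 0,
      f x delta @[x --> 0] --> (0 : R) &
      \forall x \near (0 : R), f x delta + X x (f x delta) delta = 0].

Definition char_F (f : R -> 'rV[R]_l -> R) (x : R) (delta : 'rV[R]_l) : R :=
  - Y x (f x delta) delta.

Definition char_G (f : R -> 'rV[R]_l -> R) (x : R) (delta : 'rV[R]_l) : R :=
  - (derive1 (fun u => X u (f x delta) delta) x +
     derive1 (fun v => Y x v delta) (f x delta)).

Definition first_return (f : R -> 'rV[R]_l -> R) (delta : 'rV[R]_l)
    (x0 x1 : R) : Prop :=
  exists (x y : R -> R) (tau : R),
    let hit t := y t = f (x t) delta /\ 0 < x0 * x t in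
    [/\ 0 < tau, solves delta `[0, tau] x y,
        x 0 = x0 /\ y 0 = f x0 delta,
        hit tau /\ (forall t, 0 < t < tau -> ~ hit t) &
        x1 = x tau].

(* The value at an x0 without a first return is the junk value 0. *)
Definition poincare_map (f : R -> 'rV[R]_l -> R) (x0 : R) (delta : 'rV[R]_l)
    : R :=
  xget 0 [set x1 | first_return f delta x0 x1].

(* A stable spiral tends to the origin as t -> +oo and winds around it infinitely
   often: its polar angle, taken continuous in t, is unbounded. *)
Definition stable_spiral (delta : 'rV[R]_l) (x y : R -> R) : Prop :=
  [/\ solves delta `[0, +oo[ x y,
      x t @[t --> +oo] --> (0 : R),
      y t @[t --> +oo] --> (0 : R) &
      exists rho theta : R -> R,
        [/\ {within `[0, +oo[, continuous theta},
            forall t, 0 <= t ->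
              [/\ 0 < rho t, x t = rho t * cos (theta t)
                & y t = rho t * sin (theta t)] &
            `|theta t| @[t --> +oo] --> +oo]].

Definition unstable_spiral (delta : 'rV[R]_l) (x y : R -> R) : Prop :=
  [/\ solves delta `]-oo, 0] x y,
      x t @[t --> -oo] --> (0 : R),
      y t @[t --> -oo] --> (0 : R) &
      exists rho theta : R -> R,
        [/\ {within `]-oo, 0], continuous theta},
            forall t, t <= 0 ->
              [/\ 0 < rho t, x t = rho t * cos (theta t)
                & y t = rho t * sin (theta t)] &
            `|theta t| @[t --> -oo] --> +oo]].

Definition periodic_orbit (delta : 'rV[R]_l) (C : set (R * R)) : Prop :=
  exists (x y : R -> R) (T : R),
    [/\ 0 < T, solves delta setT x y,
        forall t, x (t + T) = x t /\ y (t + T) = y t,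
        exists t, (x t, y t) <> (x 0, y 0) &
        C = range (fun t => (x t, y t))].

Definition limit_cycle (delta : 'rV[R]_l) (C : set (R * R)) : Prop :=
  periodic_orbit delta C /\
  exists W : set (R * R), [/\ open W, C `<=` W &
    forall C', periodic_orbit delta C' -> C' `<=` W -> C' = C].

End System.

Section BoxDimension.
Variable R : realType.
Local Open Scope ereal_scope.

Definition eps_nbhd (A : set R) (e : R) : set R := \bigcup_(a in A) ball a e.

Definition lower_minkowski (A : set R) (s : R) : \bar R :=
  limf_einf (fun e : R =>
    lebesgue_measure (eps_nbhd A e) * ((e `^ (1 - s))^-1)%:E) 0^'+.

Definition upper_minkowski (A : set R) (s : R) : \bar R :=
  limf_esup (fun e : R =>
    lebesgue_measure (eps_nbhd A e) * ((e `^ (1 - s))^-1)%:E) 0^'+.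

Definition lower_box_dim (A : set R) : \bar R :=
  ereal_inf [set s%:E | s in [set s : R | (0 < s)%R /\ lower_minkowski A s = 0]].

Definition upper_box_dim (A : set R) : \bar R :=
  ereal_inf [set s%:E | s in [set s : R | (0 < s)%R /\ upper_minkowski A s = 0]].

Definition has_box_dim (A : set R) (d : R) : Prop :=
  lower_box_dim A = d%:E /\ upper_box_dim A = d%:E.

End BoxDimension.

(* Main.v *)
Require Import Defs.
From mathcomp Require Import zify ring lra.

Local Open Scope classical_set_scope.
Local Open Scope ring_scope.

(** Replace y by u = y - p(x), where the polynomial p = p(., delta) agrees to high
    order with the characteristic curve, and put x = r cos t, u = - r^n sin t.
    The condition b^2 < 4 n a on the leading coefficients makes the quadratic form
    of the angular velocity definite ([definite_form]), so for small r the angle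
    is a time and the orbits are the solutions of dr/dt = F(t, delta, r), where F
    vanishes at r = 0, is 2 pi-periodic in t and Lipschitz in r.  Closed orbits
    become 2 pi-periodic solutions ([periodic_lift]): by uniqueness on a line a
    solution that closes up after several turns closes up after one.

    All that is needed of F is that F / r has an expansion in r of finite order,
    with coefficients continuous in delta at delta_0 and remainders bounded in
    every submultiplicative norm on the functions on a finite set of nodes
    ([polar_field]).
    The linear system solved by [transport_coefficients] gives functions phi_j of
    the angle with phi_1 = 1 and phi_j = 0 at angle 0 otherwise, such that
    V(t, r) = sum_j phi_j(t) r^j is constant along the solutions at
    delta_0 up to the order of truncation: V is a truncated first integral, and
    V(2 pi, r) - V(0, r) plays the part of the displacement function.  Let m be an
    index at most 2k + 2 for which phi_m(2 pi) and phi_m(0) differ, if there is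
    one.

    If m exists, the system near delta_0 has few cycles.  Evaluate the r-values of
    m + 1 distinct small periodic solutions in the norm of [node_norm], for
    which a function on the nodes acts as a matrix whose entries are its scaled
    divided differences.  The identity for V shows that the divided difference
    of order m of the displacement is close to phi_m(2 pi) - phi_m(0), whereas it
    vanishes for periodic solutions.  This is the Rolle argument without
    derivatives ([periodic_solutions_bound]).  Every closed orbit gives two such
    solutions, itself and its reflection r -> - r (with the angle shifted by pi or
    reversed, according to the parity of n), and r = 0 is another one; k + 1
    cycles would therefore give 2k + 3 > m periodic solutions ([few_cycles]).

    If no such m exists, V returns to itself after one turn up to order 2k + 3, so
    the return map satisfies |P(x) - x| <= K x^(2k+3) ([step_bound]).  A sequence
    with steps this short has box dimension at least 1 - 1/(2k+3)
    ([slow_sequence_dim]), because its tail is so dense that the neighbourhoods of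
    its points of radius epsilon cover a whole interval.  This excludes
    both assumed dimensions, 1 - 1/(2k+1) and 1 - 1/(2k+2).  The spiral serves to
    trap the return sequence: consecutive points of the sequence are compared with
    the turns of the spiral, so the sequence converges to the origin
    ([stable_sequence], [unstable_sequence]). *)

Set Implicit Arguments.
Unset Strict Implicit.
Unset Printing Implicit Defensive.

(** * Function algebra norms and majorised power series *)

Ltac nn := repeat first [ assumption | exact: ler01 | exact: normr_ge0
  | exact: ler0n | by apply: ltW | apply: mulr_ge0 | apply: addr_ge0
  | apply: exprn_ge0 | rewrite invr_ge0 ].

(** A submultiplicative norm on the functions on d nodes.  The number kappa bounds
    the norm of 1, and closure under pointwise limits lets power series be
    estimated term by term. *)
Record algnorm (R : realType) (kappa : R) (d : nat)
    (N : ('I_d -> R) -> R) : Prop := AlgNorm {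
  an_ge0 : forall g, 0 <= N g;
  an_add : forall g h, N (fun i => g i + h i) <= N g + N h;
  an_scale : forall c g, N (fun i => c * g i) <= `|c| * N g;
  an_mul : forall g h, N (fun i => g i * h i) <= N g * N h;
  an_one : N (fun=> 1) <= kappa;
  an_pt : forall g i, `|g i| <= N g;
  an_lim : forall (u : nat -> 'I_d -> R) g K, (forall n, N (u n) <= K) ->
    (forall i, u n i @[n --> \oo] --> g i) -> N g <= K }.

Section Majorants.
Variable R : realType.
Implicit Types I : finType.

Definition mono (I : finType) (h : I -> R) (a : I -> nat) : R := \prod_i h i ^+ a i.
Definition meval I (A : seq (R * (I -> nat))) (h : I -> R) : R :=
  \sum_(t <- A) t.1 * mono h t.2.
Definition maj I (A : seq (R * (I -> nat))) (rho : R) : R :=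
  \sum_(t <- A) `|t.1| * mono (fun=> rho) t.2.

(** Analyticity through finite approximations: only the uniform bound on the
    majorants of the approximating polynomials is used, which spares any summation
    over multi-indices and survives taking divided differences. *)
Definition analytic_germ I (g : (I -> R) -> R) : Prop :=
  exists (rho K : R) (A : nat -> seq (R * (I -> nat))),
    [/\ 0 < rho, forall n, maj (A n) rho <= K &
      forall h, (forall i, `|h i| <= rho) ->
        meval (A n) h @[n --> \oo] --> g h].

Lemma mono_norm I (h : I -> R) (rho : R) a :
  (forall i, `|h i| <= rho) -> `|mono h a| <= mono (fun=> rho) a.
Proof.
move=> hh; rewrite normr_prod; apply: ler_prod => i _.
by rewrite normr_ge0 normrX lerXn2r ?nnegrE// (le_trans _ (hh i)).
Qed.

Lemma meval_norm I (A : seq (R * (I -> nat))) h rho :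
  (forall i, `|h i| <= rho) -> `|meval A h| <= maj A rho.
Proof.
move=> hh; apply: le_trans (ler_norm_sum _ _ _) _; apply: ler_sum => t _.
by rewrite normrM ler_wpM2l// mono_norm.
Qed.

Lemma mono_ge0 I (rho : R) (a : I -> nat) : 0 <= rho -> 0 <= mono (fun=> rho) a.
Proof. by move=> r0; apply: prodr_ge0 => i _; rewrite exprn_ge0. Qed.

Lemma maj_le I (A : seq (R * (I -> nat))) r1 r2 : 0 <= r1 -> r1 <= r2 ->
  maj A r1 <= maj A r2.
Proof.
move=> r10 r12; apply: ler_sum => t _; rewrite ler_wpM2l//.
rewrite -[leLHS]ger0_norm ?mono_ge0//; apply: mono_norm => i.
by rewrite ger0_norm.
Qed.

Lemma maj_ge0 I (A : seq (R * (I -> nat))) r : 0 <= r -> 0 <= maj A r.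
Proof. by move=> r0; apply: sumr_ge0 => t _; rewrite mulr_ge0// mono_ge0. Qed.

Section norm.
Variables (kappa : R) (d : nat) (N : ('I_d -> R) -> R).
Hypothesis hN : algnorm kappa N.

Lemma an_ext f g : (forall i, f i = g i) -> N f = N g.
Proof. by move=> fg; congr N; apply/funext. Qed.

Lemma an0 : N (fun=> 0) = 0.
Proof.
apply/eqP; rewrite eq_le (an_ge0 hN) andbT.
have := an_scale hN 0 (fun=> 0).
rewrite (@an_ext _ (fun=> 0)) => [|i]; last by rewrite mul0r.
by rewrite normr0 mul0r.
Qed.

Lemma an_const c : N (fun=> c) <= `|c| * kappa.
Proof.
have := an_scale hN c (fun=> 1).
rewrite (@an_ext _ (fun=> c)) => [|i]; last by rewrite mulr1.
by move=> /le_trans; apply; rewrite ler_wpM2l// (an_one hN).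
Qed.

Lemma an_kappa_ge0 : 0 <= kappa.
Proof. exact: le_trans (an_ge0 hN _) (an_one hN). Qed.

Lemma an_sum (J : Type) (s : seq J) (P : pred J) (F : J -> 'I_d -> R) :
  N (fun t => \sum_(j <- s | P j) F j t) <= \sum_(j <- s | P j) N (F j).
Proof.
elim: s => [|j s IH].
  by rewrite big_nil (@an_ext _ (fun=> 0)) ?an0// => i; rewrite big_nil.
rewrite big_cons; case: ifP => Pj; last first.
  by rewrite (@an_ext _ (fun t => \sum_(j <- s | P j) F j t))// => t; rewrite big_cons Pj.
rewrite (@an_ext _ (fun t => F j t + \sum_(j <- s | P j) F j t)); last first.
  by move=> t; rewrite big_cons Pj.
by apply: le_trans (an_add hN _ _) _; rewrite lerD2l.
Qed.

Lemma an_expM h g rho k : N h <= rho ->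
  N (fun t => h t ^+ k * g t) <= rho ^+ k * N g.
Proof.
move=> hr; have r0 : 0 <= rho by apply: le_trans hr; apply: (an_ge0 hN).
elim: k => [|k IH].
  by rewrite expr0 mul1r (@an_ext _ g)// => t; rewrite mul1r.
rewrite (@an_ext _ (fun t => h t * (h t ^+ k * g t))) ?exprS -?mulrA; last first.
  by move=> t; rewrite exprS mulrA.
by apply: le_trans (an_mul hN _ _) _; rewrite ler_pM// (an_ge0 hN).
Qed.

Lemma an_exp h rho k : N h <= rho -> N (fun t => h t ^+ k) <= rho ^+ k * kappa.
Proof.
move=> hr; have := an_expM (fun=> 1) k hr.
rewrite (@an_ext _ (fun t => h t ^+ k)); last by move=> t; rewrite mulr1.
move/le_trans; apply; rewrite ler_wpM2l ?(an_one hN)// exprn_ge0//.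
by apply: le_trans hr; apply: (an_ge0 hN).
Qed.

Lemma an_mono I (h : I -> 'I_d -> R) rho a : (forall i, N (h i) <= rho) ->
  N (fun t => mono (fun i => h i t) a) <= mono (fun=> rho) a * kappa.
Proof.
move=> hr; rewrite /mono; elim: (index_enum I) => [|i s IH].
  rewrite big_nil mul1r (@an_ext _ (fun=> 1)) ?(an_one hN)// => t.
  by rewrite big_nil.
rewrite big_cons -mulrA (@an_ext _
  (fun t => h i t ^+ a i * \prod_(j <- s) h j t ^+ a j)); last first.
  by move=> t; rewrite big_cons.
apply: le_trans (an_expM _ _ (hr i)) _; rewrite ler_wpM2l// exprn_ge0//.
by apply: le_trans (hr i); apply: (an_ge0 hN).
Qed.

Lemma an_meval I A (h : I -> 'I_d -> R) rho : (forall i, N (h i) <= rho) ->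
  N (fun t => meval A (fun i => h i t)) <= maj A rho * kappa.
Proof.
move=> hr; apply: le_trans (an_sum _ _ _) _; rewrite mulr_suml.
apply: ler_sum => t _; apply: le_trans (an_scale hN _ _) _.
by rewrite -mulrA ler_wpM2l// an_mono.
Qed.

End norm.

Lemma germ_bounded I (g : (I -> R) -> R) : analytic_germ g ->
  exists rho K : R, [/\ 0 < rho, 0 <= K &
    forall kappa d (N : ('I_d -> R) -> R), algnorm kappa N ->
    forall h : I -> 'I_d -> R, (forall i, N (h i) <= rho) ->
    N (fun t => g (fun i => h i t)) <= K * kappa].
Proof.
move=> [rho [K [A [rho0 AK Ag]]]]; exists rho, K; split=> //.
  by apply: le_trans (AK 0%N); rewrite maj_ge0// ltW.
move=> kappa d N hN h hr.
apply: (an_lim hN (u := fun n t => meval (A n) (fun i => h i t))).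
  move=> n; apply: le_trans (an_meval hN _ hr) _.
  by rewrite ler_wpM2r// (an_kappa_ge0 hN).
by move=> t; apply: Ag => i; apply: le_trans (an_pt hN _ _) _.
Qed.

Definition upd I (h : I -> R) (i : I) (k : R) : I -> R :=
  fun j => if j == i then k else h j.
Definition ext I (h : I -> R) (k : R) : (I + unit)%type -> R :=
  fun o => if o is inl j then h j else k.

Definition dd_term I (i : I) (t : R * (I -> nat)) :
    seq (R * ((I + unit)%type -> nat)) :=
  [seq (t.1, fun o => match o with
     | inl j => if j == i then (t.2 i).-1 - b else t.2 j
     | inr _ => b end)%N | b <- index_iota 0 (t.2 i)].
Definition dd_list I (i : I) (A : seq (R * (I -> nat))) :=
  flatten [seq dd_term i t | t <- A].

Lemma mono_split I (h : I -> R) i a :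
  mono h a = h i ^+ a i * \prod_(j | j != i) h j ^+ a j.
Proof. by rewrite /mono (bigD1 i). Qed.

Lemma mono_ext I (h : I -> R) k i b c (a : I -> nat) :
  mono (ext h k) (fun o => match o with
     | inl j => if j == i then c else a j
     | inr _ => b end)%N
  = h i ^+ c * k ^+ b * \prod_(j | j != i) h j ^+ a j.
Proof.
rewrite /mono big_sumType /= (bigD1 i)//= eqxx.
rewrite (eq_bigr (fun j => h j ^+ a j)); last by move=> j /negbTE ->.
rewrite (bigD1 tt)//= [X in _ * _ * (_ * X)]big1; last by case.
by rewrite mulr1 mulrAC.
Qed.

Lemma meval_dd I (i : I) A h k :
  meval A h = meval A (upd h i k)
    + (h i - k) * meval (dd_list i A) (ext h k).
Proof.
rewrite /meval /dd_list; elim: A => [|t A IH].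
  by rewrite !big_nil mulr0 addr0.
rewrite /= big_cat /= !big_cons IH mulrDr addrACA; congr (_ + _).
rewrite /dd_term big_map big_mkord /=.
under eq_bigr do rewrite mono_ext.
rewrite !(mono_split _ i) /upd eqxx.
rewrite [X in k ^+ _ * X](eq_bigr (fun j => h j ^+ t.2 j)); last first.
  by move=> j /negbTE ->.
set P := \prod_(_ | _) _; under eq_bigr do rewrite mulrA.
rewrite -mulr_suml -mulr_sumr mulrCA !mulrA.
have := subrXX (h i) k (t.2 i) => /eqP; rewrite subr_eq => /eqP ->.
by ring.
Qed.

Lemma maj_dd I (i : I) A (rho : R) : 0 < rho ->
  maj (dd_list i A) (rho / 2) <= 2 / rho * maj A rho.
Proof.
move=> rho0; rewrite /maj /dd_list; elim: A => [|t A IH].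
  by rewrite !big_nil mulr0.
rewrite /= big_cat big_cons /= mulrDr lerD// {IH} /dd_term big_map big_mkord /=.
rewrite -mulr_sumr mulrCA ler_wpM2l//.
rewrite (_ : (fun=> rho / 2) = ext (fun=> rho / 2) (rho / 2)); last first.
  by apply/funext; case.
under eq_bigr do rewrite mono_ext.
rewrite -mulr_suml (mono_split _ i) mulrA ler_pM//.
- by apply: sumr_ge0 => b _; rewrite mulr_ge0// exprn_ge0// divr_ge0// ltW.
- by apply: prodr_ge0 => j _; rewrite exprn_ge0// divr_ge0// ltW.
- case: (t.2 i) => [|m]; first by rewrite big_ord0 mulr_ge0// divr_ge0// ltW.
  rewrite (eq_bigr (fun=> (rho / 2) ^+ m)) => [|b _]; last first.
    by rewrite -exprD /= subnK// -ltnS.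
  rewrite sumr_const card_ord exprS mulrA divfK ?gt_eqF// expr_div_n.
  rewrite -[leLHS]mulr_natr -mulrA [leRHS]mulrC ler_wpM2l ?exprn_ge0 ?(ltW rho0)//.
  rewrite [leLHS]mulrC ler_pdivrMr ?exprn_gt0// -exprS -natrX ler_nat.
  exact: ltnW (ltn_expl _ _).
- have r2 : 0 <= rho / 2 by rewrite divr_ge0// ltW.
  apply: ler_prod => j _; rewrite exprn_ge0//= lerXn2r ?nnegrE ?(ltW rho0)//.
  by rewrite ler_pdivrMr// ler_peMr 1?ltW// ltr1n.
Qed.

Lemma cvg_of_approx (u : nat -> R) :
  (forall eta : R, 0 < eta -> exists2 v : nat -> R, cvg (v n @[n --> \oo]) &
     forall n, `|u n - v n| <= eta) -> cvg (u n @[n --> \oo]).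
Proof.
move=> happ; apply/cauchy_cvgP; apply: cauchy_exP => e e0.
have e2 : 0 < e / 2 by rewrite divr_gt0.
have [v /cvg_ex[/= l vl] uv] := happ _ e2.
exists l; move/cvgr_dist_lt: vl => /(_ _ e2).
apply: filterS => n /= ln; rewrite /ball/=.
rewrite (_ : l - u n = (l - v n) - (u n - v n)); last by ring.
apply: le_lt_trans (ler_normB _ _) _.
by rewrite [e]splitr ltr_leD.
Qed.

Lemma other_point (k a r eta : R) : 0 < r -> 0 < eta -> `|k| <= r ->
  exists k', [/\ `|k'| <= r, k' != a & `|k - k'| <= eta].
Proof.
move=> r0 eta0 kr.
have e0 : 0 < Num.min eta r by rewrite lt_min r0 eta0.
have [le1 le2] : Num.min eta r <= eta /\ Num.min eta r <= r.
  by split; rewrite ge_min lexx ?orbT.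
move: (Num.min _ _) => e in e0 le1 le2.
have [ka|ka] := eqVneq k a; last first.
  by exists k; split=> //; rewrite subrr normr0 ltW.
move: kr; rewrite ler_norml => /andP[kr1 kr2].
have [hk|hk] := lerP k 0; [exists (k + e)|exists (k - e)].
all: split; [by rewrite ler_norml; apply/andP; split; lra | |].
all: try by rewrite -ka; apply/eqP; lra.
- by rewrite opprD addrA subrr add0r normrN gtr0_norm.
- by rewrite opprB addrCA subrr addr0 gtr0_norm.
Qed.

(** The divided difference of a monomial is again a sum of monomials whose
    majorant at a smaller radius is controlled, so the quotient is an analytic germ
    in one more variable. *)
Lemma germ_dd I (g : (I -> R) -> R) (i : I) : analytic_germ g ->
  exists D : ((I + unit)%type -> R) -> R, analytic_germ D /\
  exists2 rho : R, 0 < rho & forall h k, (forall j, `|h j| <= rho) ->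
    `|k| <= rho -> g h = g (upd h i k) + (h i - k) * D (ext h k).
Proof.
move=> [rho [K [A [rho0 AK Ag]]]].
pose B n := dd_list i (A n).
have hB n h k : meval (A n) h = meval (A n) (upd h i k)
    + (h i - k) * meval (B n) (ext h k) by exact: meval_dd.
have r20 : 0 < rho / 2 by rewrite divr_gt0.
have r40 : 0 < rho / 2 / 2 by rewrite divr_gt0.
have BK n : maj (B n) (rho / 2) <= 2 / rho * K.
  by apply: le_trans (maj_dd _ _ rho0) _; rewrite ler_wpM2l// divr_ge0// ltW.
have K0 : 0 <= K by apply: le_trans (AK 0%N); rewrite maj_ge0// ltW.
have le42 : rho / 2 / 2 <= rho / 2.
  by rewrite ler_pdivrMr// ler_peMr 1?ltW// ltr1n.
have le2 : rho / 2 <= rho by rewrite ler_pdivrMr// ler_peMr 1?ltW// ltr1n.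
have extE (h : (I + unit)%type -> R) : h = ext (fun j => h (inl j)) (h (inr tt)).
  by apply/funext; case=> // -[].
have updr (h : I -> R) j k (r : R) : (forall j, `|h j| <= r) -> `|k| <= r ->
    `|upd h i k j| <= r by move=> hh kr; rewrite /upd; case: ifP.
have cB (h : (I + unit)%type -> R) : (forall j, `|h j| <= rho / 2 / 2) ->
    cvg (meval (B n) h @[n --> \oo]).
  pose h' j := h (inl j); pose k := h (inr tt).
  have hE : h = ext h' k by exact: extE.
  move=> hr; rewrite hE.
  apply: cvg_of_approx => eta eta0.
  pose C := 2 / (rho / 2) * (2 / rho * K) + 1.
  have C1 : 1 <= C.
    by rewrite /C lerDr; nn.
  have C0 : 0 < C by apply: lt_le_trans C1.
  have [k' [k'r k'h k'k]] : exists k', [/\ `|k'| <= rho / 2 / 2, k' != h' i &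
      `|k - k'| <= eta / C].
    by apply: other_point => //; [rewrite divr_gt0 | apply: (hr (inr tt))].
  exists (fun n => meval (B n) (ext h' k')).
    have hk : h' i - k' != 0 by rewrite subr_eq0 eq_sym.
    pose L := (g h' - g (upd h' i k')) / (h' i - k').
    apply/cvg_ex; exists L.
    rewrite (_ : (fun n => _) = fun n =>
      (meval (A n) h' - meval (A n) (upd h' i k')) / (h' i - k')); last first.
      by apply/funext => n; rewrite (hB n h' k') addrAC subrr add0r mulrC mulKf.
    have h'r j : `|h' j| <= rho / 2 / 2 by apply: hr.
    apply: cvgM; last exact: cvg_cst.
    have le4 := le_trans le42 le2.
    apply: cvgB; apply: Ag => j; first exact: le_trans (h'r j) le4.
    exact: le_trans (updr _ j _ _ h'r k'r) le4.
  move=> n.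
  rewrite (meval_dd (inr tt) (B n) (ext h' k) k').
  rewrite (_ : upd _ _ _ = ext h' k'); last first.
    by apply/funext; case=> // -[].
  rewrite addrAC subrr add0r normrM /=.
  have hm : `|meval (dd_list (inr tt) (B n)) (ext (ext h' k) k')| <= C.
    apply: le_trans (meval_norm (rho := rho / 2 / 2) _ _) _.
      by case=> [[j|[]]|[]] /=; rewrite /k /h'.
    apply: le_trans (maj_dd _ _ r20) _; rewrite /C.
    have : 2 / (rho / 2) * maj (B n) (rho / 2) <= 2 / (rho / 2) * (2 / rho * K).
      by rewrite ler_wpM2l// divr_ge0// ltW.
    by move=> /le_trans; apply; rewrite lerDl.
  apply: le_trans (ler_pM _ _ k'k hm) _ => //.
  by rewrite divfK// gt_eqF.
exists (fun h => lim (meval (B n) h @[n --> \oo])); split.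
  exists (rho / 2 / 2), (2 / rho * K), B; split=> // n.
  by apply: le_trans (BK n); apply: maj_le => //; apply: ltW.
exists (rho / 2 / 2) => // h k hr kr.
have er j : `|ext h k j| <= rho / 2 / 2 by case: j => [j|[]] /=.
have lh : meval (A n) h @[n --> \oo] --> g h.
  by apply: Ag => j; rewrite (le_trans (hr _) (le_trans le42 le2)).
have lu : meval (A n) (upd h i k) @[n --> \oo] --> g (upd h i k).
  by apply: Ag => j; rewrite (le_trans (updr _ j _ _ hr kr) (le_trans le42 le2)).
apply/esym; apply: (cvg_unique _ _ lh) => //.
rewrite (_ : (fun n => _) = (fun n => meval (A n) (upd h i k)
    + (h i - k) * meval (B n) (ext h k))); last exact/funext.
apply: cvgD => //; apply: cvgM; first exact: cvg_cst.
exact: cB.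
Qed.

Lemma analytic_at_germ (m : nat) (g : 'rV[R]_m -> R) (p : 'rV[R]_m) :
  analytic_at g p ->
  analytic_germ (fun h : 'I_m -> R => g (p + \row_i h i)).
Proof.
move=> [c [rho [rho0 hc]]].
have r20 : 0 < rho / 2 by rewrite divr_gt0.
have r2 : rho / 2 < rho by rewrite ltr_pdivrMr// ltr_pMr// ltr1n.
pose up N (al : {ffun 'I_m -> 'I_N}) := [ffun i => al i : nat].
pose A N := [seq (c (up N al), up N al : 'I_m -> nat)
            | al <- index_enum {ffun 'I_m -> 'I_N}].
have hmono (h : 'rV[R]_m) (al : {ffun 'I_m -> nat}) :
  monomial h al = mono (fun i => h ord0 i) al by [].
pose hh : 'rV[R]_m := \row_i (rho / 2).
have [sm _] : summable setT (fun al => (c al * monomial hh al)%:E) /\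
    (\sum_(al : {ffun 'I_m -> 'I_N}) c (up N al) * monomial hh (up N al))
      @[N --> \oo] --> g (p + hh).
  by apply: hc => i; rewrite mxE gtr0_norm.
pose S := (\esum_(al in [set: {ffun 'I_m -> nat}])
   `| (c al * monomial hh al)%:E |)%E.
have S0 : (0 <= S)%E by apply: esum_ge0.
have Sfin : S \is a fin_num by rewrite ge0_fin_numE.
exists (rho / 2), (fine S), A; split=> //.
  move=> N; rewrite -lee_fin fineK// /maj /A big_map /=.
  apply: esum_ge; exists [set` [seq up N al | al <- index_enum _]].
    by split=> //; apply: finite_seq.
  rewrite -fsbig_seq; last first.
    rewrite map_inj_uniq ?index_enum_uniq// => a b /ffunP ab.
    by apply/ffunP => i; apply: val_inj; have := ab i; rewrite !ffunE.
  rewrite big_map -sumEFin; apply: lee_sum => al _.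
  rewrite lee_fin normrM hmono [X in _ <= _ * X]ger0_norm; last first.
    by apply: prodr_ge0 => i _; rewrite exprn_ge0// mxE ltW.
  rewrite (_ : (fun i => hh ord0 i) = (fun=> rho / 2))//.
  by apply/funext => i; rewrite mxE.
move=> h hr.
have [|_ H] := hc (\row_i h i); first by move=> i; rewrite mxE (le_lt_trans (hr i)).
suff -> : (fun n => meval (A n) h) = (fun N => \sum_(al : {ffun 'I_m -> 'I_N})
  c (up N al) * monomial (\row_i h i) (up N al)) by exact: H.
apply/funext => N; rewrite /meval /A.
rewrite big_map; apply: eq_bigr => al _ /=; rewrite hmono; congr (_ * mono _ _).
by apply/funext => i; rewrite mxE.
Qed.
End Majorants.

(** * Expansions in the radius with uniform remainders *)

Section Expansions.
Variables (R : realType) (l : nat) (del0 : 'rV[R]_l) (kappa : R).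
Hypothesis hkappa : 1 <= kappa.
Notation Fn2 := (R -> 'rV[R]_l -> R).
Notation Fn3 := (R -> 'rV[R]_l -> R -> R).

Definition coef (c : Fn2) : Prop :=
  [/\ forall t, (c^~ del0) x @[x --> t] --> c t del0,
      exists K : R, forall t, `|c t del0| <= K &
      forall eps : R, 0 < eps -> \forall e \near (0 : R)^'+,
        forall del : 'rV[R]_l, `|del - del0| <= e ->
        forall t, `|c t del - c t del0| <= eps].

(** A remainder must be bounded in every node norm, not only pointwise: pointwise
    bounds give no control on divided differences. *)
Definition bnd (q : Fn3) : Prop :=
  exists K : R, 0 <= K /\ \forall e \near (0 : R)^'+,
    forall del : 'rV[R]_l, `|del - del0| <= e -> forall t,
    forall d (N : ('I_d -> R) -> R), algnorm kappa N ->
    forall r : 'I_d -> R, N r <= e -> N (fun i => q t del (r i)) <= K.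

Definition near_eq (p q : Fn3) : Prop := \forall e \near (0 : R)^'+,
  forall del : 'rV[R]_l, `|del - del0| <= e -> forall t r, `|r| <= e ->
  p t del r = q t del r.

Fixpoint expandable n (q : Fn3) : Prop :=
  if n is n'.+1 then exists c q', [/\ coef c, expandable n' q' &
    near_eq q (fun t del r => c t del + r * q' t del r)]
  else bnd q.

Lemma coef_bound c : coef c -> exists K : R, 0 < K /\
  \forall e \near (0 : R)^'+, forall del : 'rV[R]_l, `|del - del0| <= e ->
    forall t, `|c t del| <= K.
Proof.
move=> [_ [K hK] /(_ 1 ltr01) h]; exists (`|K| + 1); split.
  by rewrite ltr_wpDl.
apply: filterS h => e h del hd t; have := h _ hd t; have := hK t.
move=> h1 h2; rewrite -[c t del](subrK (c t del0)).
rewrite (le_trans (ler_normD _ _))// addrC lerD//.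
exact: le_trans h1 (ler_norm _).
Qed.

Lemma coef_cst k : coef (fun _ _ => k).
Proof.
split=> [t||eps e0]; first exact: cvg_cst.
  by exists `|k|.
by near=> e => del _ t; rewrite subrr normr0 ltW.
Unshelve. all: by end_near. Qed.

Lemma coefD c d : coef c -> coef d -> coef (fun t del => c t del + d t del).
Proof.
move=> [c1 [K c2] c3] [d1 [L d2] d3]; split.
- by move=> t; apply: cvgD; [exact: c1|exact: d1].
- by exists (K + L) => t; rewrite (le_trans (ler_normD _ _))// lerD.
- move=> eps e0; have e2 : 0 < eps / 2 by rewrite divr_gt0.
  apply: filterS2 (c3 _ e2) (d3 _ e2) => e h1 h2 del hd t.
  rewrite opprD addrACA [eps]splitr (le_trans (ler_normD _ _))// lerD//.
    exact: h1.
  exact: h2.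
Qed.

Lemma coefM c d : coef c -> coef d -> coef (fun t del => c t del * d t del).
Proof.
move=> hc hd; have [K [K0 hK]] := coef_bound hc.
move: hc hd => [c1 [K' c2] c3] [d1 [L' d2] d3].
pose L : R := `|L'| + 1; have L0 : 0 < L by rewrite /L ltr_wpDl.
have hL t : `|d t del0| <= L.
  by rewrite (le_trans (d2 t))// (le_trans (ler_norm _))// lerDl.
split.
- by move=> t; apply: cvgM; [exact: c1|exact: d1].
- by exists (K' * L) => t; rewrite normrM ler_pM.
- move=> eps e0.
  have eK : 0 < eps / 2 / K by rewrite !divr_gt0.
  have eL : 0 < eps / 2 / L by rewrite !divr_gt0.
  apply: filterS3 hK (c3 _ eL) (d3 _ eK) => e h0 h1 h2 del hd t.
  rewrite (_ : _ - _ = c t del * (d t del - d t del0)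
    + (c t del - c t del0) * d t del0); last by ring.
  rewrite (le_trans (ler_normD _ _))// [eps]splitr lerD// normrM.
    have -> : eps / 2 = K * (eps / 2 / K) by rewrite [RHS]mulrC divfK ?gt_eqF.
    by rewrite ler_pM//; [exact: h0|exact: h2].
  have -> : eps / 2 = eps / 2 / L * L by rewrite divfK ?gt_eqF.
  by rewrite ler_pM//; exact: h1.
Qed.

Lemma coefN c : coef c -> coef (fun t del => - c t del).
Proof.
move=> hc; have := coefM (coef_cst (-1)) hc.
by under eq_fun do under eq_fun do rewrite mulN1r.
Qed.

Lemma coefV c (c0 : R) : 0 < c0 -> (forall t, c0 <= `|c t del0|) -> coef c ->
  coef (fun t del => (c t del)^-1).
Proof.
move=> c00 hc0 [c1 [K c2] c3].
have cn0 t : c t del0 != 0 by rewrite -normr_gt0 (lt_le_trans c00).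
split.
- by move=> t; apply: cvgV => //; exact: c1.
- exists c0^-1 => t; rewrite normrV ?unitfE// lef_pV2 ?posrE//.
  by rewrite normr_gt0.
- move=> eps e0; have c02 : 0 < c0 / 2 by rewrite divr_gt0.
  have ec : 0 < eps * (c0 / 2 * c0) by rewrite !mulr_gt0// invr_gt0.
  apply: filterS2 (c3 _ c02) (c3 _ ec) => e h1 h2 del hd t.
  have h3 : c0 / 2 <= `|c t del|.
    have := h1 _ hd t; have := hc0 t; rewrite distrC => a1 a2.
    have := ler_normD (c t del0 - c t del) (c t del); rewrite subrK.
    by lra.
  have cn : c t del != 0 by rewrite -normr_gt0 (lt_le_trans c02).
  rewrite (_ : _ - _ = (c t del0 - c t del) / (c t del * c t del0)); last first.
    by field; rewrite cn cn0.
  rewrite normrM normrV ?unitfE ?mulf_neq0// ler_pdivrMr ?normr_gt0 ?mulf_neq0//.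
  rewrite distrC (le_trans (h2 _ hd t))// ler_wpM2l ?(ltW e0)// normrM.
  by rewrite ler_pM ?(ltW c00) ?(ltW c02).
Qed.

Lemma near_eq_refl p : near_eq p p.
Proof. by near=> e. Unshelve. all: by end_near. Qed.

Lemma near_eq_trans p q s : near_eq p q -> near_eq q s -> near_eq p s.
Proof.
by apply: filterS2 => e h1 h2 del hd t r hr; rewrite h1// h2.
Qed.

Lemma bnd_ext p q : near_eq p q -> bnd q -> bnd p.
Proof.
move=> pq [K [K0 hK]]; exists K; split=> //.
apply: filterS2 pq hK => e h1 h2 del hd t d N hN r hr.
rewrite (@an_ext _ _ N _ (fun i => q t del (r i))); first exact: h2 hN _ hr.
by move=> i; apply: h1 => //; apply: le_trans (an_pt hN _ _) hr.
Qed.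

Lemma bndD p q : bnd p -> bnd q -> bnd (fun t del r => p t del r + q t del r).
Proof.
move=> [K [K0 hK]] [L [L0 hL]]; exists (K + L); split; first exact: addr_ge0.
apply: filterS2 hK hL => e h1 h2 del hd t d N hN r hr.
rewrite (le_trans (an_add hN _ _))// lerD//; [exact: h1 hN _ hr|exact: h2 hN _ hr].
Qed.

Lemma bndM p q : bnd p -> bnd q -> bnd (fun t del r => p t del r * q t del r).
Proof.
move=> [K [K0 hK]] [L [L0 hL]]; exists (K * L); split; first exact: mulr_ge0.
apply: filterS2 hK hL => e h1 h2 del hd t d N hN r hr.
rewrite (le_trans (an_mul hN _ _))// ler_pM ?(an_ge0 hN)//; [exact: h1 hN _ hr|exact: h2 hN _ hr].
Qed.

Lemma bnd_coef c : coef c -> bnd (fun t del _ => c t del).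
Proof.
move=> /coef_bound[K [K0 hK]]; exists (K * kappa).
split; first by rewrite mulr_ge0 ?(ltW K0)// (le_trans ler01).
apply: filterS hK => e h del hd t d N hN r hr.
rewrite (le_trans (an_const hN _))// ler_wpM2r ?(an_kappa_ge0 hN)//.
exact: h.
Qed.

Lemma bnd_r : bnd (fun _ _ r => r).
Proof.
exists 1; split=> //; near=> e => del hd t d N hN r hr.
apply: le_trans hr _; near: e; exact: nbhs_right_le.
Unshelve. all: by end_near. Qed.

Lemma expandable_bnd n q : expandable n q -> bnd q.
Proof.
elim: n q => [//|n IH q [c [q' [hc hq' qE]]]].
apply: bnd_ext qE _; apply: bndD; first exact: bnd_coef.
by apply: bndM; [exact: bnd_r|exact: IH].
Qed.

Lemma expandable_ext n p q : near_eq p q -> expandable n q -> expandable n p.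
Proof.
case: n => [|n] pq; first exact: bnd_ext.
move=> [c [q' [hc hq' qE]]]; exists c, q'; split=> //.
exact: near_eq_trans qE.
Qed.

Lemma expandableW n q : expandable n.+1 q -> expandable n q.
Proof.
elim: n q => [q /expandable_bnd//|n IH q [c [q' [hc hq' qE]]]].
by exists c, q'; split=> //; apply: IH.
Qed.

Lemma expandable_coef n c : coef c -> expandable n (fun t del _ => c t del).
Proof.
elim: n c => [|n IH] c hc; first exact: bnd_coef.
exists c, (fun _ _ _ => 0); split=> //; first exact: IH (coef_cst 0).
by near=> e => del _ t r _; rewrite mulr0 addr0.
Unshelve. all: by end_near. Qed.

Lemma expandable_cst n k : expandable n (fun _ _ _ => k).
Proof. exact: expandable_coef (coef_cst k). Qed.

Lemma expandable_mulr n q : expandable n q ->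
  expandable n.+1 (fun t del r => r * q t del r).
Proof.
move=> hq; exists (fun _ _ => 0), q; split=> //; first exact: coef_cst.
by near=> e => del _ t r _; rewrite add0r.
Unshelve. all: by end_near. Qed.

Lemma expandable_r n : expandable n (fun _ _ r => r).
Proof.
apply: expandableW; apply: (@expandable_ext _ _ (fun t del r => r * 1)).
  by near=> e => del _ t r _; rewrite mulr1.
by apply: expandable_mulr; apply: expandable_cst.
Unshelve. all: by end_near. Qed.

Lemma expandableD n p q : expandable n p -> expandable n q ->
  expandable n (fun t del r => p t del r + q t del r).
Proof.
elim: n p q => [|n IH] p q; first exact: bndD.
move=> [c [p' [hc hp' pE]]] [d [q' [hd hq' qE]]].
exists (fun t del => c t del + d t del), (fun t del r => p' t del r + q' t del r).
split; [exact: coefD|exact: IH|].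
by apply: filterS2 pE qE => e h1 h2 del hdel t r hr; rewrite h1// h2//; ring.
Qed.

Lemma expandableM n p q : expandable n p -> expandable n q ->
  expandable n (fun t del r => p t del r * q t del r).
Proof.
elim: n p q => [|n IH] p q; first exact: bndM.
move=> hp hq; have hpW := expandableW hp; have hqW := expandableW hq.
move: hp hq => [c [p' [hc hp' pE]]] [d [q' [hd hq' qE]]].
exists (fun t del => c t del * d t del),
  (fun t del r => c t del * q' t del r + p' t del r * q t del r).
split; first exact: coefM.
  apply: expandableD; last exact: IH.
  by apply: (IH (fun t del _ => c t del)) => //; exact: expandable_coef.
apply: filterS2 pE qE => e h1 h2 del hdel t r hr.
by rewrite h1// mulrDl {1}h2//; ring.
Qed.

Lemma expandableN n q : expandable n q ->
  expandable n (fun t del r => - q t del r).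
Proof.
move=> hq; apply: (@expandable_ext _ _ (fun t del r => -1 * q t del r)).
  by near=> e => del _ t r _; rewrite mulN1r.
by apply: expandableM => //; apply: expandable_cst.
Unshelve. all: by end_near. Qed.

Lemma expandableB n p q : expandable n p -> expandable n q ->
  expandable n (fun t del r => p t del r - q t del r).
Proof. by move=> hp hq; apply: expandableD => //; apply: expandableN. Qed.

Lemma expandableX n q k : expandable n q ->
  expandable n (fun t del r => q t del r ^+ k).
Proof.
move=> hq; elim: k => [|k IH]; first exact: expandable_cst.
apply: (@expandable_ext _ _ (fun t del r => q t del r * q t del r ^+ k)).
  by near=> e => del _ t r _; rewrite exprS.
exact: expandableM.
Unshelve. all: by end_near. Qed.

Lemma expandable_sum n (J : Type) (s : seq J) (F : J -> Fn3) :
  (forall j, expandable n (F j)) ->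
  expandable n (fun t del r => \sum_(j <- s) F j t del r).
Proof.
move=> hF; elim: s => [|j s IH].
  apply: (@expandable_ext _ _ (fun _ _ _ => 0)); last exact: expandable_cst.
  by near=> e => del _ t r _; rewrite big_nil.
apply: (@expandable_ext _ _
  (fun t del r => F j t del r + \sum_(j <- s) F j t del r)).
  by near=> e => del _ t r _; rewrite big_cons.
exact: expandableD.
Unshelve. all: by end_near. Qed.

Lemma algnorm_abs : algnorm kappa (fun g : 'I_1 -> R => `|g ord0|).
Proof.
split=> //.
- by move=> g h; exact: ler_normD.
- by move=> a g; rewrite normrM.
- by move=> g h; rewrite normrM.
- by rewrite normr1.
- by move=> g i; rewrite ord1.
- move=> u g L uL ug; have := ug ord0 => /cvg_norm ug0.
  apply: (closed_cvg (fun x => x <= L) (@closed_le _ L) _ _ ug0).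
  by near=> k; apply: uL.
Unshelve. all: by end_near. Qed.

Lemma near0_mul (K eps : R) : 0 <= K -> 0 < eps ->
  \forall e \near (0 : R)^'+, e * K <= eps.
Proof.
move=> K0 eps0; have h : 0 < eps / (K + 1) by rewrite divr_gt0// ltr_wpDl.
near=> e; have e0 : 0 < e by [].
have he : e <= eps / (K + 1) by near: e; exact: nbhs_right_le.
rewrite (@le_trans _ _ (e * (K + 1)))//; first by rewrite ler_pM2l// lerDl.
by rewrite -ler_pdivlMr// ltr_wpDl.
Unshelve. all: by end_near. Qed.

Lemma bnd_inv c q (c0 : R) : 0 < c0 -> coef c -> (forall t, c0 <= c t del0) ->
  bnd q -> bnd (fun t del r => (c t del + r * q t del r)^-1).
Proof.
move=> c00 hc hc0 [K [K0 hK]].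
have c02 : 0 < c0 / 2 by rewrite divr_gt0.
have c04 : 0 < c0 / 4 by rewrite divr_gt0.
exists (4 * kappa / c0); split.
  by rewrite !mulr_ge0 ?invr_ge0 ?(ltW c00)// (le_trans ler01).
have [_ _ /(_ _ c02) h3] := hc.
apply: filterS3 hK h3 (near0_mul K0 c04) => e h1 h2 h4 del hd t d N hN r hr.
have cE : c0 / 2 <= c t del.
  have := h2 _ hd t; have := hc0 t; rewrite ler_norml => a1 /andP[a2 a3]; lra.
have hq := h1 _ hd t _ _ hN _ hr.
have rq : N (fun i => r i * q t del (r i)) <= c0 / 4.
  apply: le_trans (an_mul hN _ _) _; apply: le_trans h4.
  by apply: ler_pM => //; exact: (an_ge0 hN).
set w := fun i => (c t del + r i * q t del (r i))^-1.
have nz i : c t del + r i * q t del (r i) != 0.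
  rewrite gt_eqF//; have := an_pt hN (fun i => r i * q t del (r i)) i => /=.
  by rewrite ler_norml => /andP[a1 a2]; lra.
have wE i : w i = (c t del)^-1 * (1 + -1 * ((r i * q t del (r i)) * w i)).
  by rewrite /w; field; rewrite nz gt_eqF// (lt_le_trans c02).
have hw : N w <= (c t del)^-1 * (kappa + c0 / 4 * N w).
  rewrite {1}(an_ext N wE); apply: le_trans (an_scale hN _ _) _.
  rewrite gtr0_norm ?invr_gt0 ?(lt_le_trans c02)//.
  rewrite ler_wpM2l ?invr_ge0 ?(le_trans (ltW c02))//.
  apply: le_trans (an_add hN _ _) _; rewrite lerD ?(an_one hN)//.
  apply: le_trans (an_scale hN _ _) _; rewrite normrN normr1 mul1r.
  by apply: le_trans (an_mul hN _ _) _; rewrite ler_wpM2r ?(an_ge0 hN).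
move: hw; rewrite mulrC ler_pdivlMr ?(lt_le_trans c02)// => hw.
rewrite ler_pdivlMr//.
have : N w * (c0 / 2) <= kappa + c0 / 4 * N w.
  by apply: le_trans hw; rewrite ler_wpM2l ?(an_ge0 hN).
by lra.
Qed.

(** The identity 1/(c + r q) = 1/c - r q/(c (c + r q)) lowers the order by one. *)
Lemma expandable_inv_aux n c q (c0 : R) : 0 < c0 -> coef c ->
  (forall t, c0 <= c t del0) -> expandable n q ->
  expandable n (fun t del r => (c t del + r * q t del r)^-1).
Proof.
move=> c00 hc hc0; elim: n q => [|n IH] q hq; first exact: (bnd_inv c00).
 have hqW := expandableW hq; have hw := IH _ hqW.
have cV : coef (fun t del => (c t del)^-1).
  apply: (coefV c00) => // t; apply: le_trans (hc0 t) _; exact: ler_norm.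
have c02 : 0 < c0 / 2 by rewrite divr_gt0.
have c04 : 0 < c0 / 4 by rewrite divr_gt0.
have [_ _ /(_ _ c02) h3] := hc.
exists (fun t del => (c t del)^-1), (fun t del r =>
  -1 * ((c t del)^-1 * (q t del r * (c t del + r * q t del r)^-1))); split=> //.
  apply: expandableM; first exact: expandable_cst.
  apply: (@expandableM _ (fun t del _ => (c t del)^-1)).
    exact: (@expandable_coef n (fun t del => (c t del)^-1)).
  exact: expandableM.
have [K [K0 hK]] := expandable_bnd hqW.
have [M hM] := bnd_inv c00 hc hc0 (expandable_bnd hqW).
apply: filterS3 hK h3 (near0_mul K0 c04) => e h1 h2 h4 del hd t r hr.
have cE : c0 / 2 <= c t del.
  have := h2 _ hd t; have := hc0 t; rewrite ler_norml => a1 /andP[a2 a3]; lra.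
have hq1 : `|q t del r| <= K by exact: (h1 _ hd t _ _ algnorm_abs (fun=> r)).
have nz : c t del + r * q t del r != 0.
  rewrite gt_eqF//; have : `|r * q t del r| <= c0 / 4.
    by rewrite normrM (le_trans _ h4)// ler_pM.
  by rewrite ler_norml => /andP[a1 a2]; lra.
by field; rewrite nz gt_eqF// (lt_le_trans c02).
Qed.

Lemma expandable_inv n c q p (c0 : R) : 0 < c0 -> coef c ->
  (forall t, c0 <= c t del0) -> expandable n q ->
  near_eq p (fun t del r => c t del + r * q t del r) ->
  expandable n (fun t del r => (p t del r)^-1).
Proof.
move=> c00 hc hc0 hq pE.
apply: (expandable_ext _ (expandable_inv_aux c00 hc hc0 hq)).
by apply: filterS pE => e h del hd t r hr; rewrite h.
Qed.

Lemma bnd_scalar q : bnd q -> exists K : R, 0 <= K /\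
  \forall e \near (0 : R)^'+, forall del : 'rV[R]_l, `|del - del0| <= e ->
    forall t r, `|r| <= e -> `|q t del r| <= K.
Proof.
move=> [K [K0 hK]]; exists K; split=> //; apply: filterS hK => e h del hd t r hr.
exact: (h _ hd t _ _ algnorm_abs (fun=> r)).
Qed.

(* The norm max(|g0|,|g1|) + rho |g0 - g1| / D of functions on two points. *)
Lemma algnorm_lip (rho D : R) : 0 < rho -> 0 < D ->
  algnorm kappa (fun g : 'I_2 -> R =>
    Num.max `|g ord0| `|g ord_max| + rho / D * `|g ord0 - g ord_max|).
Proof.
move=> r0 D0; have rD : 0 < rho / D by rewrite divr_gt0.
move: (rho / D) rD => c c0 {rho D r0 D0}.
have mx (a b : R) : a <= Num.max a b /\ b <= Num.max a b.
  by split; rewrite le_max lexx ?orbT.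
split.
- by move=> g; rewrite addr_ge0 ?mulr_ge0 ?(ltW c0)// le_max normr_ge0.
- move=> g h; rewrite addrACA lerD//.
    have [a1 a2] := mx `|g ord0| `|g ord_max|; have [a3 a4] := mx `|h ord0| `|h ord_max|.
    by rewrite ge_max !(le_trans (ler_normD _ _)) ?lerD.
  by rewrite -mulrDr ler_wpM2l ?(ltW c0)// opprD addrACA ler_normD.
- move=> k g; rewrite mulrDr !normrM -mulrBr normrM mulrCA lerD2r.
  by rewrite maxr_pMr.
- move=> g h; have [a1 a2] := mx `|g ord0| `|g ord_max|.
  have [a3 a4] := mx `|h ord0| `|h ord_max|.
  set A := Num.max _ _ in a1 a2 *; set B := Num.max _ _ in a3 a4 *.
  have A0 : 0 <= A by apply: le_trans a1.
  have B0 : 0 <= B by apply: le_trans a3.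
  rewrite mulrDl !mulrDr -addrA lerD//.
    by rewrite ge_max !normrM !ler_pM.
  rewrite (_ : g ord0 * h ord0 - g ord_max * h ord_max =
    g ord0 * (h ord0 - h ord_max) + (g ord0 - g ord_max) * h ord_max); last by ring.
  apply: (@le_trans _ _ (A * (c * `|h ord0 - h ord_max|) + c * `|g ord0 - g ord_max| * B)).
    rewrite mulrCA -mulrA -mulrDr ler_wpM2l ?(ltW c0)//.
    rewrite (le_trans (ler_normD _ _))// !normrM lerD// ler_pM//.
  by rewrite lerD2l lerDl !mulr_ge0 ?(ltW c0).
- by rewrite subrr normr0 mulr0 addr0 maxxx normr1.
- move=> g i; have [a1 a2] := mx `|g ord0| `|g ord_max|.
  apply: (@le_trans _ _ (Num.max `|g ord0| `|g ord_max|)).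
    have := ltn_ord i; rewrite leq_eqVlt => /orP[/eqP i1|].
      by rewrite (_ : i = ord_max)//; apply: val_inj; case: i1.
    rewrite !ltnS leqn0 => /eqP i0.
    by rewrite (_ : i = ord0)//; apply: val_inj.
  by rewrite lerDl mulr_ge0 ?(ltW c0).
- move=> u g L uL ug.
  have h : (Num.max `|u n ord0| `|u n ord_max| + c * `|u n ord0 - u n ord_max|)
     @[n --> \oo] --> Num.max `|g ord0| `|g ord_max| + c * `|g ord0 - g ord_max|.
    apply: cvgD.
      have nn i : `|u n i| @[n --> \oo] --> `|g i| by apply: cvg_norm; exact: ug.
      have n0 := nn ord0; have n1 := nn ord_max.
      rewrite maxr_absE (_ : (fun _ => _) = fun n => (`|u n ord0| + `|u n ord_max|
        + `| `|u n ord0| - `|u n ord_max| |) / 2); last first.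
        by apply/funext => n; rewrite maxr_absE.
      apply: cvgM; last exact: cvg_cst.
      by apply: cvgD; [apply: cvgD|apply: cvg_norm; apply: cvgB].
    apply: cvgM; first exact: cvg_cst.
    by apply: cvg_norm; apply: cvgB; exact: ug.
  apply: (closed_cvg (fun x => x <= L) (@closed_le _ L) _ _ h).
  by near=> k; apply: uL.
Unshelve. all: by end_near. Qed.

(** The weighted two-point norm is a node norm, so boundedness in all node norms
    already contains the Lipschitz property. *)
Lemma bnd_lip q : bnd q -> exists K : R, 0 <= K /\
  \forall e \near (0 : R)^'+, forall del : 'rV[R]_l, `|del - del0| <= e ->
    forall t r1 r2, `|r1| <= e -> `|r2| <= e ->
    `|q t del r1 - q t del r2| <= K * `|r1 - r2|.
Proof.
move=> [K [K0 hK]].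
have [e0 e00 h0] : exists2 e0, 0 < e0 & forall e, 0 < e <= e0 ->
    forall del : 'rV[R]_l, `|del - del0| <= e -> forall t,
    forall d (N : ('I_d -> R) -> R), algnorm kappa N ->
    forall r : 'I_d -> R, N r <= e -> N (fun i => q t del (r i)) <= K.
  have [e0 /= e00 h] := hK; exists (e0 / 2); first by rewrite divr_gt0.
  move=> e /andP[ep ee]; apply: h => //=.
  rewrite sub0r normrN gtr0_norm// (le_lt_trans ee)//.
  by rewrite ltr_pdivrMr// ltr_pMr// ltr1n.
have e02 : 0 < e0 / 2 by rewrite divr_gt0.
exists (K / (e0 / 2)); split; first by rewrite mulr_ge0// invr_ge0 ltW.
near=> e => del hd t r1 r2 hr1 hr2.
have ee : e <= e0 / 2 by near: e; exact: nbhs_right_le.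
have [->|r12] := eqVneq r1 r2; first by rewrite !subrr !normr0 mulr0.
have D0 : 0 < `|r1 - r2| by rewrite normr_gt0 subr_eq0.
pose rr (i : 'I_2) := if i == ord0 then r1 else r2.
have hd0 : `|del - del0| <= e0.
  by apply: le_trans hd _; apply: le_trans ee _; rewrite ler_pdivrMr// ler_peMr ?ltW// ltr1n.
have e0e : 0 < e0 <= e0 by rewrite e00 lexx.
have := h0 e0 e0e _ hd0 t 2%N _ (algnorm_lip e02 D0) rr.
rewrite /rr /= => /(_ _)H.
have {H} : Num.max `|q t del r1| `|q t del r2| +
    e0 / 2 / `|r1 - r2| * `|q t del r1 - q t del r2| <= K.
  apply: H; rewrite divfK ?gt_eqF//.
  by rewrite [leRHS]splitr lerD// ge_max (le_trans hr1)// (le_trans hr2).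
move=> H; have {H} : e0 / 2 / `|r1 - r2| * `|q t del r1 - q t del r2| <= K.
  by apply: le_trans H; rewrite lerDr le_max normr_ge0.
rewrite mulrAC ler_pdivrMr// => H.
by rewrite mulrAC ler_pdivlMr// mulrC.
Unshelve. all: by end_near. Qed.

Lemma le_small0 (a C e : R) : 0 < e ->
  (forall r, 0 < r -> r <= e -> `|a| <= C * r) -> a = 0.
Proof.
move=> e0 h; apply/eqP; apply: contraT => a0.
have a1 : 0 < `|a| by rewrite normr_gt0.
have C0 : 0 < C.
  by have := h _ e0 (lexx _); rewrite -(pmulr_lgt0 _ e0); apply: lt_le_trans.
have r0 : 0 < Num.min e (`|a| / C / 2) by rewrite lt_min e0 !divr_gt0.
have := h _ r0; rewrite ge_min lexx => /(_ isT).
have : C * Num.min e (`|a| / C / 2) <= `|a| / 2.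
  rewrite -ler_pdivlMl// ge_min mulrC mulrAC lexx orbT//.
lra.
Qed.

Lemma expandable_lead s n q (v : Fn2) : expandable (s + n.+1) q ->
  (\forall e \near (0 : R)^'+, forall del : 'rV[R]_l, `|del - del0| <= e ->
    forall t, exists K e' : R, 0 < e' /\ forall r : R, r != 0 -> `|r| <= e' ->
      `|q t del r - v t del * r ^+ s| <= K * `|r| ^+ s.+1) ->
  exists c q', [/\ coef c, expandable n q',
    \forall e \near (0 : R)^'+, forall del : 'rV[R]_l, `|del - del0| <= e ->
      forall t, c t del = v t del &
    near_eq q (fun t del r => r ^+ s * (c t del + r * q' t del r))].
Proof.
elim: s q => [|s IH] q.
  rewrite add0n => -[c [q' [hc hq' qE]]] h; exists c, q'; split=> //; last first.
    by apply: filterS qE => e h1 del hd t r hr; rewrite expr0 mul1r h1.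
  have [K1 [K10 hK1]] := bnd_scalar (expandable_bnd hq').
  near=> e => del hd t; have e0 : 0 < e by [].
  have [K [e' [e'0 hK]]] : exists K e' : R, 0 < e' /\ forall r : R, r != 0 -> `|r| <= e' ->
      `|q t del r - v t del * r ^+ 0| <= K * `|r| ^+ 1 by apply: (near h e).
  apply/eqP; rewrite -subr_eq0; apply/eqP.
  apply: (@le_small0 _ (K + K1) (Num.min e e')); first by rewrite lt_min e0.
  move=> r r0; rewrite le_min => /andP[re re'].
  have nr : `|r| = r by rewrite gtr0_norm.
  have := hK r; rewrite gt_eqF// nr re' expr1 expr0 mulr1 => /(_ isT isT).
  rewrite (near qE e)// ?nr// => h2.
  have := near hK1 e _ _ hd t r; rewrite nr => /(_ _ re) h3.
  rewrite (_ : _ - _ = (c t del + r * q' t del r - v t del) - r * q' t del r);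
    last by ring.
  rewrite mulrDl (le_trans (ler_normB _ _))// lerD// normrM nr mulrC.
  by rewrite ler_wpM2r ?(ltW r0)// h3.
rewrite addSn => -[c [q1 [hc hq1 qE]]] h.
have [K1 [K10 hK1]] := bnd_scalar (expandable_bnd hq1).
have c0 : \forall e \near (0 : R)^'+, forall del : 'rV[R]_l, `|del - del0| <= e ->
    forall t, c t del = 0.
  near=> e => del hd t; have e0 : 0 < e by [].
  have [K [e' [e'0 hK]]] : exists K e' : R, 0 < e' /\ forall r : R, r != 0 -> `|r| <= e' ->
      `|q t del r - v t del * r ^+ s.+1| <= K * `|r| ^+ s.+2 by apply: (near h e).
  apply: (@le_small0 _ (`|K| + K1 + `|v t del|) (Num.min 1 (Num.min e e'))).
    by rewrite !lt_min e0 ltr01.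
  move=> r r0; rewrite !le_min => /and3P[r1 re re'].
  have nr : `|r| = r by rewrite gtr0_norm.
  have := hK r; rewrite gt_eqF// nr re' => /(_ isT isT).
  rewrite (near qE e)// ?nr// => h2.
  have := near hK1 e _ _ hd t r; rewrite nr => /(_ _ re) h3.
  rewrite (_ : c t del = (c t del + r * q1 t del r - v t del * r ^+ s.+1)
    + (- (r * q1 t del r) + v t del * r ^+ s.+1)); last by ring.
  have rs k : r ^+ k.+1 <= r.
    by rewrite exprS ler_piMr ?(ltW r0)// exprn_ile1 ?(ltW r0).
  rewrite mulrDl mulrDl -[leRHS]addrA (le_trans (ler_normD _ _))// lerD//.
    rewrite (le_trans h2)// (le_trans (ler_norm _))// normrM ler_wpM2l//.
    by rewrite ger0_norm ?exprn_ge0 ?(ltW r0).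
  rewrite (le_trans (ler_normD _ _))// normrN !normrM nr lerD//.
    by rewrite mulrC ler_wpM2r ?(ltW r0)// h3.
  by rewrite ler_wpM2l// ger0_norm ?exprn_ge0 ?(ltW r0).
have [|c' [q' [hc' hq' c'v q1E]]] := IH q1 hq1.
  near=> e => del hd t; have e0 : 0 < e by [].
  have [K [e' [e'0 hK]]] : exists K e' : R, 0 < e' /\ forall r : R, r != 0 -> `|r| <= e' ->
      `|q t del r - v t del * r ^+ s.+1| <= K * `|r| ^+ s.+2 by apply: (near h e).
  exists K, (Num.min e e'); split; first by rewrite lt_min e0.
  move=> r r0; rewrite le_min => /andP[re re'].
  have := hK r r0 re'; rewrite (near qE e)// (near c0 e)// add0r.
  rewrite exprS mulrCA -mulrBr normrM [X in _ <= _ * X]exprS mulrCA.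
  by rewrite ler_pM2l ?normr_gt0.
exists c', q'; split=> //.
apply: filterS3 qE c0 q1E => e h1 h2 h3 del hd t r hr.
by rewrite h1// h2// add0r h3// mulrA exprS.
Unshelve. all: by end_near. Qed.

Lemma germ_lip_list (I : finType) g : analytic_germ g -> forall s : seq I,
  exists K : R, 0 <= K /\ \forall e \near (0 : R)^'+,
  forall h k : I -> R, (forall i, `|h i| <= e) -> (forall i, `|k i| <= e) ->
  `|g h - g (fun i => if i \in s then k i else h i)| <=
    K * \sum_(i <- s) `|h i - k i|.
Proof.
move=> hg; elim=> [|i s [K [K0 hK]]].
  exists 0; split=> //; near=> e => h k _ _; rewrite big_nil mul0r.
  by rewrite (_ : (fun _ => _) = h) ?subrr ?normr0//; apply/funext.
have [D [hD [rho rho0 gD]]] := germ_dd i hg.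
have [rho' [L [rho'0 L0 hL]]] := germ_bounded hD.
exists (K + L * kappa); split; first by rewrite addr_ge0 ?mulr_ge0// (le_trans ler01).
near=> e => h k he ke.
have er : e <= rho by near: e; exact: nbhs_right_le.
have er' : e <= rho' by near: e; exact: nbhs_right_le.
pose h' j := if j \in s then k j else h j.
have h'e j : `|h' j| <= e by rewrite /h'; case: ifP.
have h1 : `|g h - g h'| <= K * \sum_(i <- s) `|h i - k i| by apply: (near hK e).
have h2 : g h' = g (upd h' i (k i)) + (h' i - k i) * D (ext h' (k i)).
  by apply: gD => [j|]; rewrite (le_trans _ er).
have h3 : `|D (ext h' (k i))| <= L * kappa.
  have := hL _ _ _ algnorm_abs (fun j _ => ext h' (k i) j); apply => j.
  by rewrite (le_trans _ er')//; case: j => //=.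
rewrite (_ : (fun j => if j \in i :: s then k j else h j) = upd h' i (k i)); last first.
  by apply/funext => j; rewrite /upd /h' in_cons; case: eqVneq => [->|].
rewrite (_ : _ - _ = (g h - g h') + (g h' - g (upd h' i (k i)))); last by ring.
rewrite big_cons (le_trans (ler_normD _ _))// mulrDl [X in _ <= X + _]mulrDr.
have S0 : 0 <= \sum_(j <- s) `|h j - k j| by apply: sumr_ge0.
have h'i : `|h' i - k i| <= `|h i - k i|.
  by rewrite /h'; case: ifP => // _; rewrite subrr normr0.
have : `|g h' - g (upd h' i (k i))| <= (L * kappa) * `|h i - k i|.
  by rewrite h2 addrAC subrr add0r normrM mulrC ler_pM.
move=> {}h2.
have : 0 <= K * `|h i - k i| by rewrite mulr_ge0.
have : 0 <= (L * kappa) * \sum_(j <- s) `|h j - k j|.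
  by rewrite mulr_ge0// mulr_ge0// (le_trans ler01).
rewrite mulrDr; lra.
Unshelve. all: by end_near. Qed.

Lemma germ_lip (I : finType) (g : (I -> R) -> R) : analytic_germ g ->
  exists K : R, 0 <= K /\ \forall e \near (0 : R)^'+,
  forall h k : I -> R, (forall i, `|h i| <= e) -> (forall i, `|k i| <= e) ->
  `|g h - g k| <= K * \sum_i `|h i - k i|.
Proof.
move=> /germ_lip_list /(_ (index_enum I))[K [K0 hK]]; exists K; split=> //.
apply: filterS hK => e H h k he ke; have := H h k he ke.
by rewrite (_ : (fun i => _) = k)//; apply/funext => i; rewrite mem_index_enum.
Qed.

Lemma coef_germ (I : finType) (g : (I -> R) -> R) (c : I -> Fn2) :
  analytic_germ g -> (forall i, coef (c i)) -> (forall i t, c i t del0 = 0) ->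
  coef (fun t del => g (fun i => c i t del)).
Proof.
move=> hg hc c0; have [K [K0 hK]] := germ_lip hg.
have g0 t : g (fun i => c i t del0) = g (fun=> 0).
  by congr g; apply/funext => i; rewrite c0.
split.
- move=> t; rewrite g0.
  by under eq_fun do rewrite g0; exact: cvg_cst.
- by exists `|g (fun=> 0)| => t; rewrite g0.
- move=> eps eps0; have [e0 e00 h0] : exists2 e0, 0 < e0 &
    forall h k : I -> R, (forall i, `|h i| <= e0) -> (forall i, `|k i| <= e0) ->
    `|g h - g k| <= K * \sum_i `|h i - k i|.
    by near (0 : R)^'+ => e; exists e => //; exact: (near hK e).
  have c00 : 0 < eps / (K * #|I|%:R + 1).
    by rewrite divr_gt0// ltr_wpDl// mulr_ge0.
  have m0 : 0 < Num.min e0 (eps / (K * #|I|%:R + 1)) by rewrite lt_min e00.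
  have h1 : \forall e \near (0 : R)^'+, forall i, forall del : 'rV[R]_l,
      `|del - del0| <= e -> forall t, `|c i t del - c i t del0| <=
      Num.min e0 (eps / (K * #|I|%:R + 1)).
    by apply: filter_forall => i; have [_ _ /(_ _ m0)] := hc i.
  apply: filterS h1 => e h1 del hd t; rewrite g0.
  have h2 i : `|c i t del| <= e0 /\ `|c i t del| <= eps / (K * #|I|%:R + 1).
    by have := h1 i _ hd t; rewrite c0 subr0 le_min => /andP[].
  apply: le_trans (h0 _ _ _ _) _.
  + by move=> i; have [] := h2 i.
  + by move=> i; rewrite normr0 ltW.
  + apply: (@le_trans _ _ (K * \sum_(i : I) (eps / (K * #|I|%:R + 1)))).
      rewrite ler_wpM2l//; apply: ler_sum => i _; rewrite subr0; by have [] := h2 i.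
    have D0 : 0 < K * #|I|%:R + 1 by rewrite ltr_wpDl// mulr_ge0.
    rewrite sumr_const -[X in K * X]mulr_natr !mulrA.
    rewrite mulrAC ler_pdivrMr// mulrAC [leLHS]mulrC ler_wpM2l ?(ltW eps0)//.
    by rewrite lerDl.
Unshelve. all: by end_near. Qed.

Lemma expandable_germ n : forall (I : finType) (g : (I -> R) -> R)
  (c : I -> Fn2) (H : I -> Fn3), analytic_germ g ->
  (forall i, coef (c i)) -> (forall i t, c i t del0 = 0) ->
  (forall i, expandable n (H i)) ->
  expandable n (fun t del r => g (fun i => c i t del + r * H i t del r)).
Proof.
elim: n => [|n IH] I g c H hg hc c0 hH.
  have [rho [L [rho0 L0 hL]]] := germ_bounded hg.
  have k0 : 0 <= kappa by rewrite (le_trans ler01).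
  have r4 : 0 < rho / 2 by rewrite divr_gt0.
  have r5 : 0 < rho / 2 / kappa by rewrite divr_gt0// (lt_le_trans ltr01).
  exists (L * kappa); split; first exact: mulr_ge0.
  have h1 : \forall e \near (0 : R)^'+, forall i, forall del : 'rV[R]_l,
      `|del - del0| <= e -> forall t, forall d (N : ('I_d -> R) -> R),
      algnorm kappa N -> forall r : 'I_d -> R, N r <= e ->
      N (fun j => c i t del + r j * H i t del (r j)) <= rho.
    apply: filter_forall => i; have [K [K0 hK]] := hH i.
    have [_ _ /(_ _ r5) ci] := hc i.
    apply: filterS3 hK ci (near0_mul K0 r4) => e h1 h2 h3 del hd t d N hN r hr.
    apply: le_trans (an_add hN _ _) _; rewrite [rho]splitr lerD//.
      apply: le_trans (an_const hN _) _.
      rewrite -ler_pdivlMr ?(lt_le_trans ltr01)//.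
      by have := h2 _ hd t; rewrite c0 subr0.
    apply: le_trans (an_mul hN _ _) _; apply: le_trans h3.
    by apply: ler_pM; rewrite ?(an_ge0 hN)//; exact: h1 hN _ hr.
  apply: filterS h1 => e h1 del hd t d N hN r hr.
  apply: (hL _ _ _ hN (fun i j => c i t del + r j * H i t del (r j))) => i.
  exact: h1 hN _ hr.
have hHW i : expandable n (H i) := expandableW (hH i).
have step (s : seq I) : exists q', expandable n q' /\
    near_eq (fun t del r => g (fun i => c i t del +
               r * (if i \in s then H i t del r else 0)))
            (fun t del r => g (fun i => c i t del) + r * q' t del r).
  elim: s => [|i s [q' [hq' q'E]]].
    exists (fun _ _ _ => 0); split; first exact: expandable_cst.
    near=> e => del _ t r _; transitivity (g (fun i => c i t del)).
      by congr g; apply/funext => i; rewrite in_nil mulr0 addr0.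
    by rewrite mulr0 addr0.
  have [D [hD [rho rho0 gD]]] := germ_dd i hg.
  have [is_|is_] := boolP (i \in s).
    exists q'; split=> //; apply: near_eq_trans q'E; near=> e => del _ t r _.
    congr g; apply/funext => j; congr (_ + _ * _).
    by rewrite in_cons; case: eqVneq => [->|]; rewrite ?is_.
  pose H' j : Fn3 := if j \in i :: s then H j else fun _ _ _ => 0.
  pose c' (j : (I + unit)%type) : Fn2 := if j is inl j' then c j' else c i.
  pose H'' (j : (I + unit)%type) : Fn3 := if j is inl j' then H' j' else fun _ _ _ => 0.
  pose E t del r := D (fun j => c' j t del + r * H'' j t del r).
  have hE : expandable n E.
    apply: (IH _ D c' H'' hD).
    - by case=> [j|[]]; exact: hc.
    - by case=> [j|[]] t; exact: c0.
    - case=> [j|[]]; last exact: expandable_cst.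
      by rewrite /H'' /H'; case: ifP => _; [exact: hHW|exact: expandable_cst].
  exists (fun t del r => q' t del r + H i t del r * E t del r); split.
    by apply: expandableD => //; apply: expandableM.
  have r4 : 0 < rho / 2 by rewrite divr_gt0.
  have h1 : \forall e \near (0 : R)^'+, forall j, forall del : 'rV[R]_l,
      `|del - del0| <= e -> forall t r, `|r| <= e ->
      `|c j t del| <= rho / 2 /\ `|r * H' j t del r| <= rho / 2.
    apply: filter_forall => j.
    have [K [K0 hK]] : exists K : R, 0 <= K /\ \forall e \near (0 : R)^'+,
        forall del : 'rV[R]_l, `|del - del0| <= e -> forall t r, `|r| <= e ->
        `|H' j t del r| <= K.
      apply: bnd_scalar; rewrite /H'; case: ifP => _; last exact: (expandable_cst 0).
      exact: (@expandable_bnd n).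
    have [_ _ /(_ _ r4) cj] := hc j.
    apply: filterS3 hK cj (near0_mul K0 r4) => e h1 h2 h3 del hd t r hr; split.
      by have := h2 _ hd t; rewrite c0 subr0.
    by rewrite normrM (le_trans _ h3)// ler_pM// h1.
  apply: filterS2 q'E h1 => e h2 h3 del hd t r hr.
  have H'E : (fun j => c j t del + r * (if j \in i :: s then H j t del r else 0)) =
             (fun j => c j t del + r * H' j t del r).
    by apply/funext => j; rewrite /H'; case: ifP.
  rewrite H'E (gD _ (c i t del)); last 2 first.
  - move=> j; have [a1 a2] := h3 j _ hd t r hr.
    by rewrite (le_trans (ler_normD _ _))// [rho]splitr lerD.
  - by have [a1 _] := h3 i _ hd t r hr; rewrite (le_trans a1)// ler_pdivrMr// ler_peMr ?ltW// ltr1n.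
  rewrite (_ : upd _ i _ = (fun j => c j t del +
      r * (if j \in s then H j t del r else 0))); last first.
    apply/funext => j; rewrite /upd /H' in_cons; case: eqVneq => [->|ji] /=.
      by rewrite (negbTE is_) mulr0 addr0.
    by case: ifP.
  rewrite h2//.
  have -> : D (ext (fun j => c j t del + r * H' j t del r) (c i t del)) = E t del r.
    rewrite /E; congr D; apply/funext; case=> [j|[]] //=.
    by rewrite mulr0 addr0.
  rewrite {1}/H' in_cons eqxx /=; ring.
have [q' [hq' qE]] := step (index_enum I).
exists (fun t del => g (fun i => c i t del)), q'; split=> //; first exact: coef_germ.
apply: near_eq_trans qE; near=> e => del hd t r hr.
by congr g; apply/funext => i; rewrite mem_index_enum.
Unshelve. all: by end_near. Qed.
End Expansions.

(** * Differential inequalities and linear equations *)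

Lemma cvg_sum_seq (R : realType) (U : Type) (F : set_system U) (FF : Filter F)
    (J : Type) (s : seq J) (f : J -> U -> R) (a : J -> R) :
  (forall j, f j x @[x --> F] --> a j) ->
  \sum_(j <- s) f j x @[x --> F] --> \sum_(j <- s) a j.
Proof.
move=> hF; elim: s => [|j s IH].
  rewrite big_nil (_ : (fun _ => _) = fun=> 0); first exact: cvg_cst.
  by apply/funext => x; rewrite big_nil.
rewrite big_cons (_ : (fun _ => _) = fun x => f j x + \sum_(j <- s) f j x).
  by apply: cvgD; [exact: hF|exact: IH].
by apply/funext => x; rewrite big_cons.
Qed.

Section Calculus.
Variable R : realType.
Implicit Types (f g th w V v : R -> R) (a b : R).

Lemma is_derive_cvg f (t df : R) : is_derive t 1 f df -> f x @[x --> t] --> f t.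
Proof.
by case=> d _; apply: differentiable_continuous; apply/derivable1_diffP.
Qed.

Lemma is_derive_val f (t c d : R) : is_derive t 1 f c -> c = d ->
  is_derive t 1 f d.
Proof. by move=> ? <-. Qed.

Lemma derive_nonincr f f' a b : a <= b ->
  (forall t, a <= t <= b -> is_derive t 1 f (f' t)) ->
  (forall t, a <= t <= b -> f' t <= 0) -> f b <= f a.
Proof.
move=> ab df f'0.
have cf : {within `[a, b], continuous f}.
  apply: derivable_within_continuous => t; rewrite in_itv /= => tab.
  by have := df t tab => -[].
have [t|c cab fE] := MVT_segment ab _ cf (df := f').
  by rewrite in_itv /= => /andP[t1 t2]; apply: df; rewrite !ltW.
rewrite -subr_le0 fE; move: cab; rewrite in_itv /= => cab.
by rewrite mulr_le0_ge0 ?subr_ge0// f'0.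
Qed.

Lemma derive_dominated f f' th w a b (K : R) : a <= b ->
  (forall t, a <= t <= b -> is_derive t 1 f (f' t)) ->
  (forall t, a <= t <= b -> is_derive t 1 th (w t)) ->
  (forall t, a <= t <= b -> `|f' t| <= K * w t) ->
  `|f b - f a| <= K * (th b - th a).
Proof.
move=> ab df dth h.
have h1 : f b - K * th b <= f a - K * th a.
  apply: (@derive_nonincr (fun t => f t - K * th t) (fun t => f' t - K * w t)) => // t tab.
    by have := df t tab; have := dth t tab => ? ?; apply: is_deriveB.
  by have := h t tab; rewrite ler_norml => /andP[_]; rewrite subr_le0.
have h2 : - f b - K * th b <= - f a - K * th a.
  apply: (@derive_nonincr (fun t => - f t - K * th t) (fun t => - f' t - K * w t)) => // t tab.
    by have := df t tab; have := dth t tab => ? ?; apply: is_deriveB.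
  by have := h t tab; rewrite ler_norml => /andP[+ _]; lra.
by rewrite ler_norml; apply/andP; split; lra.
Qed.

Lemma is_derive_exp (u : R -> R) (t du : R) : is_derive t 1 u du ->
  is_derive t 1 (fun t => expR (u t)) (expR (u t) * du).
Proof. by move=> hu; exact: (@is_derive1_comp _ expR u t _ _ (is_derive_expR _) hu). Qed.

Lemma gronwall V v th w a b (L : R) : a <= b ->
  (forall t, a <= t <= b -> is_derive t 1 V (v t)) ->
  (forall t, a <= t <= b -> is_derive t 1 th (w t)) ->
  (forall t, a <= t <= b -> v t <= L * w t * V t) ->
  V b <= V a * expR (L * (th b - th a)).
Proof.
move=> ab dV dth h.
pose E t := expR (- L * th t).
have H : V b * E b <= V a * E a.
  apply: (@derive_nonincr (fun t => V t * E t)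
    (fun t => V t * (E t * (- L * w t)) + E t * v t)) => // t tab.
    have d1 := dth t tab; have dV1 := dV t tab.
    have dE : is_derive t 1 E (E t * (- L * w t)) by apply: is_derive_exp.
    exact: is_deriveM.
  rewrite mulrCA -mulrDr mulr_ge0_le0 ?expR_ge0//.
  by have := h t tab; lra.
have -> : L * (th b - th a) = - (- L * th b) + (- L * th a) by ring.
rewrite expRD mulrCA -/(E a) -ler_pdivrMl ?expR_gt0// -expRN opprK.
by rewrite mulrC.
Qed.

Lemma gronwall_lower V v th w a b (L : R) : a <= b ->
  (forall t, a <= t <= b -> is_derive t 1 V (v t)) ->
  (forall t, a <= t <= b -> is_derive t 1 th (w t)) ->
  (forall t, a <= t <= b -> - (L * w t * V t) <= v t) ->
  V a <= V b * expR (L * (th b - th a)).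
Proof.
move=> ab dV dth h.
have H : - V b <= - V a * expR (- L * (th b - th a)).
  apply: (@gronwall (fun t => - V t) (fun t => - v t) th w) => // t tab.
    by have := dV t tab => ?; apply: is_deriveN.
  by have := h t tab; lra.
move: H; rewrite mulNr lerN2 mulNr expRN ler_pdivrMr ?expR_gt0//.
Qed.

Lemma continuous_induction w a b (B : R) : a <= b ->
  (forall t, a <= t <= b -> w x @[x --> t] --> w t) ->
  (forall t, a <= t <= b -> (forall s, a <= s < t -> w s < B) -> w t < B) ->
  forall t, a <= t <= b -> w t < B.
Proof.
move=> ab cw hw t1 t1ab; rewrite ltNge; apply/negP => Bt1.
pose S := [set t | a <= t <= b /\ B <= w t].
have hS : has_inf S.
  split; first by exists t1.
  by exists a => t [/andP[]].
pose s := inf S.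
have sa : a <= s by apply: lb_le_inf; [exists t1|move=> t [/andP[]]].
have sb : s <= b.
  have [_ /andP[_ t1b]] := (I, t1ab).
  by apply: le_trans t1b; apply: ge_inf => //; case: hS.
have ws : w s < B.
  apply: hw => [|t /andP[at_ ts]]; first by rewrite sa sb.
  rewrite ltNge; apply/negP => Bt.
  have : s <= t.
    apply: ge_inf; first by case: hS.
    by split=> //; rewrite at_ (le_trans (ltW ts)).
  by rewrite leNgt ts.
have sab : a <= s <= b by rewrite sa sb.
have := cvgr_lt _ (cw s sab) _ ws.
move=> [e /= e0 he].
have [t [tab Bt] ts] := inf_adherent e0 hS.
have st : s <= t by apply: ge_inf => //; case: hS.
have := he t; rewrite /= distrC ger0_norm ?subr_ge0// ltrBlDl => /(_ ts).
by rewrite ltNge Bt.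
Qed.

Lemma antiderivative f : (forall t, f x @[x --> t] --> f t) ->
  exists F : R -> R, F 0 = 0 /\ forall t : R, is_derive t 1 F (f t).
Proof.
move=> cf.
have local (M : R) : 0 < M -> exists F : R -> R, F 0 = 0 /\
    forall t : R, `|t| < M -> is_derive t 1 F (f t).
  move=> M0.
  pose F x := (\int[lebesgue_measure]_(t in [set` `[(- M), x]]) (f t))%R.
  have intf : lebesgue_measure.-integrable `[(- M), M] (EFin \o f).
    apply: continuous_compact_integrable; first exact: segment_compact.
    by apply: continuous_subspaceT => x; exact: cf.
  have key (t : R) : `|t| < M -> derivable F t 1 /\ derive1 F t = f t.
    rewrite ltr_norml => /andP[t1 t2].
    exact: (continuous_FTC1_closed t2 intf t1 (cf t)).
  move: (F) key => {intf} {}F key.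
  exists (fun x => F x - F 0); split; first by rewrite subrr.
  move=> t /key[dF Ft].
  have dF' : is_derive t 1 F (f t) by split; [exact: dF|rewrite -derive1E].
  have := is_deriveB dF' (is_derive_cst (F 0) t 1).
  by rewrite subr0.
have pos (t : R) : 0 < `|t| + 1 by rewrite ltr_wpDl.
have [G hG] := choice (fun t => local _ (pos t)).
have uniq (F1 F2 : R -> R) (M : R) : F1 0 = 0 -> F2 0 = 0 ->
    (forall t : R, `|t| < M -> is_derive t 1 F1 (f t)) ->
    (forall t : R, `|t| < M -> is_derive t 1 F2 (f t)) ->
    forall t : R, `|t| < M -> F1 t = F2 t.
  move=> F10 F20 d1 d2 t tM.
  have dd (s : R) : `|s| < M -> is_derive s 1 (fun x => F1 x - F2 x) 0.
    move=> sM; have := d1 s sM; have := d2 s sM => ? ?.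
    by rewrite -(subrr (f s)); apply: is_deriveB.
  apply/eqP; rewrite -subr_eq0 -normr_le0.
  have tM' := tM; move: tM; rewrite ltr_norml => /andP[tM1 tM2].
  have [t0|t0] := leP 0 t.
    have : `|(F1 t - F2 t) - (F1 0 - F2 0)| <= 0 * (t - 0).
      apply: (@derive_dominated (fun x => F1 x - F2 x) (fun=> 0) id (fun=> 1)) => // s s1.
        move: s1 => /andP[s0 st]; apply: dd.
        by rewrite ger0_norm//; exact: le_lt_trans tM2.
      by rewrite normr0 mul0r.
    by rewrite F10 F20 subrr subr0 mul0r.
  have : `|(F1 0 - F2 0) - (F1 t - F2 t)| <= 0 * (0 - t).
    apply: (@derive_dominated (fun x => F1 x - F2 x) (fun=> 0) id (fun=> 1)) => //.
    - exact: ltW.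
    - move=> s /andP[ts s0]; apply: dd; rewrite ler0_norm// ltrNl.
      exact: lt_le_trans ts.
    - by move=> s _; rewrite normr0 mul0r.
  by rewrite F10 F20 subrr sub0r normrN mul0r.
exists (fun t => G t t); split; first by have [] := hG 0.
move=> t; have [Ht dt] := hG t.
pose M : R := `|t| + 2; have M0 : 0 < M by rewrite ltr_wpDl.
have [F [F0 dF]] := local _ M0.
have tM : `|t| < M by rewrite ltrDl.
have h1 : \forall s \near t, F s = G s s.
  exists 1; first exact: ltr01.
  move=> s /= ts; have [G0 dG] := hG s.
  have sM : `|s| + 1 <= M.
    have := ler_normD t (s - t); rewrite [t + _]addrC subrK (distrC s t).
    by move: ts; rewrite /M; lra.
  apply: (uniq _ _ (`|s| + 1)) => //; last by rewrite ltrDl.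
  by move=> x xs; apply: dF; apply: lt_le_trans sM.
exact: near_eq_is_derive h1 (dF t tM).
Qed.

Lemma linear_ode (al be : R -> R) (c : R) :
  (forall t, al x @[x --> t] --> al t) -> (forall t, be x @[x --> t] --> be t) ->
  exists phi : R -> R, phi 0 = c /\
    forall t : R, is_derive t 1 phi (al t * phi t + be t).
Proof.
move=> ca cb; have [A [A0 dA]] := antiderivative ca.
have cA t : A x @[x --> t] --> A t.
  exact: is_derive_cvg (dA t).
have dEA (t : R) : is_derive t 1 (fun t => expR (A t)) (expR (A t) * al t).
  exact: is_derive_exp.
have [|B [B0 dB]] := @antiderivative (fun t => expR (- A t) * be t).
  move=> t; apply: cvgM; last exact: cb.
  have d := dA t.
  exact: (is_derive_cvg (@is_derive_exp (fun t => - A t) t _ (is_deriveN d))).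
exists (fun t => expR (A t) * (c + B t)); split; first by rewrite A0 B0 expR0 mul1r addr0.
move=> t; have d1 := dEA t; have d2 := dB t.
have d3 : is_derive t 1 (fun t => c + B t) (0 + expR (- A t) * be t).
  exact: is_deriveD.
apply: (is_derive_val (is_deriveM d1 d3)).
rewrite add0r !scalerAl /GRing.scale /=.
have := expR_gt0 (A t) => E0; rewrite expRN; field.
by rewrite gt_eqF.
Qed.

(* The i-th derivative coefficient of the transport equation
   d/dt sum_j phi_j r^j = 0 along dr/dt = sum_j T_j r^j. *)
(** Comparing the coefficients of r^j in the equation saying that
    sum_j phi_j(t) r^j is constant along the field gives these linear equations,
    triangular in j. *)
Lemma transport_coefficients (T : nat -> R -> R) (M : nat) :
  (forall j t, T j x @[x --> t] --> T j t) ->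
  exists phi : nat -> R -> R, (forall j, phi j 0 = (j == 1)%:R) /\
    forall j (t : R), (j <= M)%N -> is_derive t 1 (phi j)
      (- \sum_(i < j) i.+1%:R * phi i.+1 t * T (j - i)%N t).
Proof.
move=> cT; elim: M => [|M [phi [phi0 dphi]]].
  exists (fun j _ => (j == 1)%:R); split=> // -[|//] t _.
  by rewrite big_ord0 oppr0; exact: is_derive_cst.
have cphi j t : (j <= M)%N -> phi j x @[x --> t] --> phi j t.
  by move=> jM; exact: is_derive_cvg (dphi j t jM).
have [||psi [psi0 dpsi]] := @linear_ode (fun t => - (M.+1%:R * T 1%N t))
   (fun t => - \sum_(i < M) i.+1%:R * phi i.+1 t * T (M.+1 - i)%N t) (M.+1 == 1)%:R.
- by move=> t; apply: cvgN; apply: cvgM; [exact: cvg_cst|exact: cT].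
- move=> t; apply: cvgN; apply: cvg_sum_seq => i.
  by apply: cvgM; [apply: cvgM; [exact: cvg_cst|exact: cphi]|exact: cT].
exists (fun j => if (j <= M)%N then phi j else if j == M.+1 then psi else
  fun=> (j == 1)%:R); split.
  move=> j; case: ifP => // jM; case: ifP => [/eqP ->//|].
  by [].
move=> j t; rewrite leq_eqVlt => /orP[/eqP ->|].
  rewrite ltnn eqxx big_ord_recr /= ltnn eqxx subSnn.
  apply: is_derive_val (dpsi t) _.
  rewrite [in RHS](eq_bigr (fun i : 'I_M => i.+1%:R * phi i.+1 t * T (M.+1 - i)%N t)).
    by ring.
  by move=> i _; rewrite ltn_ord.
rewrite ltnS => jM; rewrite jM; apply: is_derive_val (dphi j t jM) _.
congr (- _); apply: eq_bigr => i _.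
by rewrite (leq_trans (ltn_ord i) jM).
Qed.

(* Inverse of an increasing change of variable, on the interior of its range. *)
Lemma inverse_increasing (I : R -> Prop) (th w : R -> R) :
  (forall s t u, I s -> I u -> s <= t <= u -> I t) ->
  (forall t, I t -> is_derive t 1 th (w t)) -> (forall t, I t -> 0 < w t) ->
  exists T : R -> R, forall (p t1 t2 : R), I t1 -> I t2 -> th t1 < p < th t2 ->
    [/\ I (T p), th (T p) = p & is_derive p 1 T (w (T p))^-1].
Proof.
move=> cI dth w0.
have cth s t : I s -> I t -> {within `[s, t], continuous th}.
  move=> Is It; apply: derivable_within_continuous => x; rewrite in_itv /= => xst.
  by have [] := dth x (cI _ _ _ Is It xst).
have mono s t : I s -> I t -> s < t -> th s < th t.
  move=> Is It st; have [x|x] := MVT_segment (ltW st) _ (cth s t Is It) (df := w).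
    rewrite in_itv /= => /andP[x1 x2]; apply: dth; apply: (cI s _ t) => //.
    by rewrite !ltW.
  rewrite in_itv /= => xst E; rewrite -subr_gt0 E mulr_gt0 ?subr_gt0//.
  by apply: w0; apply: (cI s _ t).
have inj s t : I s -> I t -> th s = th t -> s = t.
  move=> Is It E; apply/eqP; rewrite eq_le !leNgt; apply/andP; split; apply/negP.
    by move=> /(mono _ _ It Is); rewrite E ltxx.
  by move=> /(mono _ _ Is It); rewrite E ltxx.
pose T p := xget 0 [set t | I t /\ th t = p].
have Tth t : I t -> T (th t) = t.
  move=> It; have [IT E] : I (T (th t)) /\ th (T (th t)) = th t.
    by rewrite /T; case: xgetP => [x -> //|/(_ t)[]].
  exact: inj.
exists T => p t1 t2 I1 I2 /andP[p1 p2].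
have t12 : t1 < t2.
  rewrite ltNge le_eqVlt; apply/negP => /orP[/eqP E|/(mono _ _ I2 I1) E].
    by move: (lt_trans p1 p2); rewrite E ltxx.
  by move: (lt_trans (lt_trans p1 p2) E); rewrite ltxx.
have [x] : exists2 c, c \in `[t1, t2] & th c = p.
  apply: IVT; [exact: ltW|exact: cth|].
  by rewrite ge_min le_max (ltW p1) (ltW p2) orbT.
rewrite in_itv /= => x12 xp.
have Ix : I x by exact: cI x12.
have xx : t1 < x < t2.
  move: x12 => /andP[]; rewrite !le_eqVlt => /orP[/eqP E|->]; last first.
    move=> /orP[/eqP E|->//]; by move: p2; rewrite -xp E ltxx.
  by move: p1; rewrite -xp E ltxx.
rewrite -xp Tth//; split=> //.
have nx : \forall y \near x, t1 < y < t2.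
  have := near_in_itvoo (_ : x \in `]t1, t2[); rewrite in_itv /= => /(_ xx).
  by apply: filterS => y; rewrite in_itv.
apply: is_derive_inverse.
- by apply: filterS nx => y /andP[y1 y2]; apply: Tth; apply: (cI t1 _ t2) => //; rewrite !ltW.
- apply: filterS nx => y /andP[y1 y2]; apply: differentiable_continuous.
  apply/derivable1_diffP; have [] // := dth y (cI t1 _ t2 I1 I2 _).
  by rewrite !ltW.
- exact: dth.
- by rewrite gt_eqF// w0.
Qed.

Lemma continuous_induction_le w a b (B : R) : a <= b ->
  (forall t, a <= t <= b -> w x @[x --> t] --> w t) -> w a < B ->
  (forall t, a <= t <= b -> (forall s, a <= s <= t -> w s <= B) -> w t < B) ->
  forall t, a <= t <= b -> w t < B.
Proof.
move=> ab cw wa hw; apply: continuous_induction => // t /andP[at_ tb] ht.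
apply: hw => [|s /andP[as_ st]]; first by rewrite at_.
move: st; rewrite le_eqVlt => /orP[/eqP ->|st]; last by rewrite ltW// ht// as_.
move: at_; rewrite le_eqVlt => /orP[/eqP <-|at_]; first exact: ltW.
rewrite leNgt; apply/negP => Bt.
have tab : a <= t <= b by rewrite ltW.
have [e /= e0 he] := cvgr_gt _ (cw t tab) _ Bt.
have m0 : 0 < Num.min e (t - a) by rewrite lt_min e0 subr_gt0.
have := he (t - Num.min e (t - a) / 2).
rewrite /= opprB addrCA subrr addr0 gtr0_norm ?divr_gt0// => h.
have [m1 m2] : Num.min e (t - a) <= e /\ Num.min e (t - a) <= t - a.
  by split; rewrite ge_min lexx ?orbT.
have {}h : B < w (t - Num.min e (t - a) / 2) by apply: h; lra.
have : w (t - Num.min e (t - a) / 2) < B by apply: ht; apply/andP; split; lra.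
by rewrite ltNge (ltW h).
Qed.

Lemma is_derive_sum_seq (J : Type) (s : seq J) (F : J -> R -> R) (t : R) (dF : J -> R) :
  (forall j, is_derive t 1 (F j) (dF j)) ->
  is_derive t 1 (fun x => \sum_(j <- s) F j x) (\sum_(j <- s) dF j).
Proof.
move=> hF; elim: s => [|j s IH].
  rewrite big_nil (_ : (fun _ => _) = fun=> 0); first exact: is_derive_cst.
  by apply/funext => x; rewrite big_nil.
rewrite big_cons (_ : (fun _ => _) = fun x => F j x + \sum_(j <- s) F j x).
  by have := hF j => ?; apply: is_deriveD.
by apply/funext => x; rewrite big_cons.
Qed.

Lemma is_derive_mul f g (t c d : R) : is_derive t 1 f c -> is_derive t 1 g d ->
  is_derive t 1 (fun x => f x * g x) (c * g t + f t * d).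
Proof.
move=> df dg; apply: (is_derive_val (is_deriveM df dg)).
by rewrite addrC /GRing.scale /= [g t * _]mulrC.
Qed.

Lemma is_derive_pow f (t c : R) n : is_derive t 1 f c ->
  is_derive t 1 (fun x => f x ^+ n.+1) (n.+1%:R * f t ^+ n * c).
Proof.
move=> df; elim: n => [|n IH].
  by rewrite expr0 !mul1r; under eq_fun do rewrite expr1.
have := is_derive_mul df IH; under eq_fun do rewrite -exprS.
move/is_derive_val; apply; rewrite (exprS _ n) [in RHS]mulrS; ring.
Qed.

Lemma is_derive_scale f (t c k : R) : is_derive t 1 f c ->
  is_derive t 1 (fun x => k * f x) (k * c).
Proof.
move=> df; have := is_derive_mul (is_derive_cst k t 1) df.
by move/is_derive_val; apply; rewrite mul0r add0r.
Qed.
End Calculus.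

(** * Transport of the expansion along the field *)

Lemma triangular_exchange (V : nmodType) (G : nat -> nat -> V) m :
  \sum_(l < m) \sum_(i < l.+1) G i (l - i)%N =
  \sum_(i < m) \sum_(j < m - i) G i j.
Proof.
elim: m => [|m IH]; first by rewrite !big_ord0.
rewrite big_ord_recr /= IH [in RHS]big_ord_recr /= subSnn big_ord1.
rewrite [X in _ + X]big_ord_recr /= subnn addrA; congr (_ + _).
rewrite -big_split /=; apply: eq_bigr => i _.
by rewrite subSn ?(ltnW (ltn_ord i))// big_ord_recr.
Qed.

Section Transport.
Variables (R : realType) (l : nat) (del0 : 'rV[R]_l) (kappa : R).
Hypothesis hkappa : 1 <= kappa.
Notation Fn2 := (R -> 'rV[R]_l -> R).
Notation Fn3 := (R -> 'rV[R]_l -> R -> R).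
Notation coef := (coef del0).
Notation bnd := (bnd del0 kappa).
Notation expandable := (expandable del0 kappa).
Notation near_eq := (near_eq del0).

Lemma expandable_taylor n q : expandable n q ->
  exists c : nat -> Fn2, (forall j, coef (c j)) /\
  forall p, (p <= n)%N -> exists Q, bnd Q /\
    near_eq q (fun t del r => \sum_(j < p) c j t del * r ^+ j + r ^+ p * Q t del r).
Proof.
elim: n q => [|n IH] q hq.
  exists (fun _ _ _ => 0); split=> [_|p]; first exact: coef_cst.
  rewrite leqn0 => /eqP ->; exists q; split=> //.
  by near=> e => del _ t r _; rewrite big_ord0 add0r expr0 mul1r.
have hb := expandable_bnd hkappa hq.
move: hq => [c0 [q' [hc0 hq' qE]]].
have [c [hc cE]] := IH q' hq'.
exists (fun j => if j is j'.+1 then c j' else c0); split; first by case.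
case=> [_|p].
  exists q; split=> //.
  by near=> e => del _ t r _; rewrite big_ord0 add0r expr0 mul1r.
rewrite ltnS => /cE[Q [hQ q'E]]; exists Q; split=> //.
apply: filterS2 qE q'E => e h1 h2 del hd t r hr.
rewrite h1// h2// big_ord_recl /= expr0 mulr1 -addrA mulrDr mulr_sumr.
congr (_ + (_ + _)); last by rewrite mulrA exprS.
by apply: eq_bigr => j _; rewrite mulrCA -exprS.
Unshelve. all: by end_near. Qed.

Lemma bounded_on_segment (f : R -> R) (a b : R) :
  (forall t, f x @[x --> t] --> f t) ->
  exists K : R, forall t, a <= t <= b -> `|f t| <= K.
Proof.
move=> cf; have [ab|ba] := leP a b; last first.
  exists 0 => t /andP[at_ tb]; have := le_trans at_ tb; by rewrite leNgt ba.
have [|c _ hc] := @EVT_max R (fun t => `|f t|) a b ab.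
  apply: continuous_subspaceT => t.
  by apply: cvg_norm; exact: cf.
by exists `|f c| => t tab; apply: hc; rewrite in_itv.
Qed.

(** By the choice of phi the terms of order at most m cancel at the base parameter;
    what remains is the truncation error and the variation eta of the first
    coefficients with the parameter. *)
Lemma transport_bound m M (phi : nat -> R -> R) (c : nat -> Fn2) (F : Fn3)
    (A B : R) : (m <= M)%N -> (forall j, coef (c j)) ->
  (forall p, (p <= M)%N -> exists Q, bnd Q /\ near_eq F
     (fun t del r => r * (\sum_(j < p) c j t del * r ^+ j + r ^+ p * Q t del r))) ->
  (forall j (t : R), (j <= M)%N -> is_derive t 1 (phi j)
      (- \sum_(i < j) i.+1%:R * phi i.+1 t * c (j - i).-1 t del0)) ->
  exists C : R, 0 <= C /\ \forall e \near (0 : R)^'+,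
    forall del : 'rV[R]_l, `|del - del0| <= e -> forall eta : R, 0 <= eta ->
    (forall j t, (j < m)%N -> `|c j t del - c j t del0| <= eta) ->
    forall t, A <= t <= B -> forall d (N : ('I_d -> R) -> R), algnorm kappa N ->
    forall r : 'I_d -> R, N r <= e ->
    N (fun a => \sum_(i < m)
        ((- \sum_(i' < i.+1) i'.+1%:R * phi i'.+1 t * c (i.+1 - i').-1 t del0)
           * r a ^+ i.+1
         + i.+1%:R * phi i.+1 t * r a ^+ i * F t del (r a)))
     <= C * (eta + N r ^+ m.+1).
Proof.
move=> mM hc hF dphi.
have k0 : 0 <= kappa by rewrite (le_trans ler01).
have [Kp [Kp0 hKp]] : exists K : R, 0 <= K /\ forall i t, (i < m)%N ->
    A <= t <= B -> `|i.+1%:R * phi i.+1 t| <= K.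
  have key n : (n <= m)%N -> exists K : R, 0 <= K /\ forall i t, (i < n)%N ->
    A <= t <= B -> `|i.+1%:R * phi i.+1 t| <= K.
    elim: n => [_|n IH nm]; first by exists 0.
    have [K [K0 hK]] := IH (ltnW nm).
    have [L hL] := @bounded_on_segment (fun t => n.+1%:R * phi n.+1 t) A B
       (fun t => cvgM (cvg_cst _) (is_derive_cvg (dphi n.+1 t (leq_trans nm mM)))).
    exists (K + `|L|); split; first by rewrite addr_ge0.
    move=> i t; rewrite ltnS leq_eqVlt => /orP[/eqP ->|im] tAB.
      by rewrite (le_trans (hL t tAB))// (le_trans (ler_norm _))// lerDr.
    by rewrite (le_trans (hK i t im tAB))// lerDl.
  exact: key (leqnn m).
have [KQ [KQ0 hKQ]] : exists K : R, 0 <= K /\ \forall e \near (0 : R)^'+,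
    forall del : 'rV[R]_l, `|del - del0| <= e -> forall t, forall i, (i < m)%N ->
    forall d (N : ('I_d -> R) -> R), algnorm kappa N ->
    forall r : 'I_d -> R, N r <= e -> exists Q : 'I_d -> R, N Q <= K /\
    forall a, F t del (r a) = r a * (\sum_(j < m - i) c j t del * r a ^+ j
       + r a ^+ (m - i) * Q a).
  have key n : (n <= m)%N -> exists K : R, 0 <= K /\ \forall e \near (0 : R)^'+,
    forall del : 'rV[R]_l, `|del - del0| <= e -> forall t, forall i, (i < n)%N ->
    forall d (N : ('I_d -> R) -> R), algnorm kappa N ->
    forall r : 'I_d -> R, N r <= e -> exists Q : 'I_d -> R, N Q <= K /\
    forall a, F t del (r a) = r a * (\sum_(j < m - i) c j t del * r a ^+ j
       + r a ^+ (m - i) * Q a).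
    elim: n => [_|n IH nm].
      by exists 0; split=> //; near=> e.
    have [K [K0 hK]] := IH (ltnW nm).
    have [|Q [[L [L0 hL]] QE]] := hF (m - n)%N.
      by rewrite (leq_trans (leq_subr _ _) mM).
    exists (K + L); split; first by rewrite addr_ge0.
    apply: filterS3 hK hL QE => e h1 h2 h3 del hd t i; rewrite ltnS leq_eqVlt.
    move=> /orP[/eqP ->|im] d N hN r hr.
      exists (fun a => Q t del (r a)); split.
        by rewrite (le_trans (h2 _ hd t _ _ hN _ hr))// lerDr.
      by move=> a; apply: h3 => //; apply: le_trans (an_pt hN _ _) hr.
    have [Q' [Q'1 Q'2]] := h1 _ hd t i im d N hN r hr.
    by exists Q'; split=> //; rewrite (le_trans Q'1)// lerDl.
  exact: key (leqnn m).
exists (m%:R * (Kp * (m%:R * kappa + KQ))); split; first by nn.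
have e1 : \forall e \near (0 : R)^'+, e <= 1 by exact: nbhs_right_le.
apply: filterS2 hKQ e1 => e hQ e1 del hd eta eta0 heta t tAB d N hN r hr.
have hQ' (i : 'I_m) := hQ _ hd t i (ltn_ord i) d N hN r hr.
have [Q hQQ] := choice hQ'.
have Nr1 : N r <= 1 by apply: le_trans e1.
have Nr0 := an_ge0 hN r.
have E a : \sum_(i < m)
        ((- \sum_(i' < i.+1) i'.+1%:R * phi i'.+1 t * c (i.+1 - i').-1 t del0)
           * r a ^+ i.+1
         + i.+1%:R * phi i.+1 t * r a ^+ i * F t del (r a)) =
    \sum_(i < m) (i.+1%:R * phi i.+1 t) * (\sum_(j < m - i)
       (c j t del - c j t del0) * r a ^+ (i + j).+1 + r a ^+ m.+1 * Q i a).
  rewrite big_split /=.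
  have -> : \sum_(i < m) (- (\sum_(i' < i.+1) i'.+1%:R * phi i'.+1 t *
       c (i.+1 - i').-1 t del0)) * r a ^+ i.+1 =
      - \sum_(i < m) \sum_(j < m - i) i.+1%:R * phi i.+1 t * c j t del0 * r a ^+ (i + j).+1.
    rewrite -(@triangular_exchange _ (fun i j => i.+1%:R * phi i.+1 t * c j t del0 * r a ^+ (i + j).+1)).
    rewrite -sumrN; apply: eq_bigr => i _; rewrite mulNr mulr_suml; congr (- _).
    apply: eq_bigr => i' _.
    have i'i : (i' <= i)%N by rewrite -ltnS.
    by rewrite subSn// subnKC.
  rewrite -sumrN -big_split; apply: eq_bigr => i _ /=.
  have [_ ->] := hQQ i.
  rewrite -sumrN !mulrDr !mulr_sumr addrA -big_split /=; congr (_ + _).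
    apply: eq_bigr => j _; rewrite exprS exprD; ring.
  have -> : r a ^+ m.+1 = r a * (r a ^+ i * r a ^+ (m - i)).
    by rewrite exprS -exprD subnKC// ltnW.
  ring.
rewrite (an_ext N E) (le_trans (an_sum hN _ _ _))//.
rewrite -mulrA mulr_natl -[X in _ *+ X](card_ord m) -sumr_const.
apply: ler_sum => i _; apply: le_trans (an_scale hN _ _) _.
rewrite -mulrA ler_pM ?(an_ge0 hN) ?hKp//.
apply: le_trans (an_add hN _ _) _; rewrite mulrDl lerD//.
  apply: le_trans (an_sum hN _ _ _) _.
  apply: (@le_trans _ _ (\sum_(j < m - i) eta * kappa)).
    apply: ler_sum => j _; apply: le_trans (an_scale hN _ _) _.
    rewrite ler_pM ?(an_ge0 hN) ?heta//.
      by rewrite (leq_trans (ltn_ord j))// leq_subr.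
    apply: le_trans (an_exp hN _ (lexx _)) _.
    by rewrite ler_piMl// exprn_ile1.
  rewrite sumr_const card_ord; apply: (@le_trans _ _ (m%:R * (eta * kappa))).
    by rewrite -[leLHS]mulr_natl ler_wpM2r ?mulr_ge0// ler_nat leq_subr.
  by rewrite -mulrA ler_wpM2l// mulrC ler_wpM2l// lerDl exprn_ge0.
apply: le_trans (an_expM hN _ _ (lexx _)) _.
have [hQ1 _] := hQQ i.
rewrite mulrC ler_pM ?(an_ge0 hN) ?exprn_ge0// lerDr//.
Unshelve. all: by end_near. Qed.
End Transport.

(** * The divided-difference norm on finitely many nodes *)

Section Frobenius.
Variable R : realType.

Lemma sum_cauchy_schwarz (I : finType) (a b : I -> R) :
  (\sum_i a i * b i) ^+ 2 <= (\sum_i a i ^+ 2) * (\sum_i b i ^+ 2).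
Proof.
set A := \sum_i a i ^+ 2; set B := \sum_i b i ^+ 2; set C := \sum_i a i * b i.
have B0 : 0 <= B by apply: sumr_ge0 => i _; exact: sqr_ge0.
have key : 0 <= B * (A * B - C ^+ 2).
  rewrite (_ : B * _ = \sum_i (B * a i - C * b i) ^+ 2).
    by apply: sumr_ge0 => i _; exact: sqr_ge0.
  rewrite (eq_bigr (fun i => B ^+ 2 * a i ^+ 2 - (B * C *+ 2) * (a i * b i)
    + C ^+ 2 * b i ^+ 2)); last by move=> i _; ring.
  by rewrite !big_split /= sumrN -!mulr_sumr -/A -/B -/C; ring.
move: B0; rewrite le_eqVlt => /orP[/eqP B0|B0].
  have b0 i : b i = 0.
    apply/eqP; rewrite -sqrf_eq0; apply/eqP.
    have /eqP := esym B0; rewrite psumr_eq0 => [|j _]; last exact: sqr_ge0.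
    by move=> /allP/(_ i); rewrite mem_index_enum => /(_ isT)/eqP.
  rewrite -B0 mulr0 /C big1 ?expr0n// => i _; by rewrite b0 mulr0.
by rewrite -subr_ge0 -(pmulr_rge0 _ B0).
Qed.

Definition fro m n (A : 'M[R]_(m, n)) : R := Num.sqrt (\sum_i \sum_j A i j ^+ 2).

Lemma fro_ge0 m n (A : 'M[R]_(m, n)) : 0 <= fro A.
Proof. exact: sqrtr_ge0. Qed.

Lemma fro_sqr m n (A : 'M[R]_(m, n)) : fro A ^+ 2 = \sum_i \sum_j A i j ^+ 2.
Proof.
by rewrite sqr_sqrtr//; apply: sumr_ge0 => i _; apply: sumr_ge0 => j _; apply: sqr_ge0.
Qed.

Lemma fro_le m n (A : 'M[R]_(m, n)) (K : R) : 0 <= K ->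
  (fro A <= K) = (\sum_i \sum_j A i j ^+ 2 <= K ^+ 2).
Proof.
by move=> K0; rewrite -fro_sqr ler_pXn2r ?nnegrE ?fro_ge0.
Qed.

Lemma fro_entry m n (A : 'M[R]_(m, n)) i j : `|A i j| <= fro A.
Proof.
rewrite -(@ler_pXn2r _ 2) ?nnegrE ?fro_ge0// fro_sqr real_normK ?num_real//.
rewrite (bigD1 i)//= (bigD1 j)//= -addrA lerDl addr_ge0//.
  by apply: sumr_ge0 => k _; exact: sqr_ge0.
by apply: sumr_ge0 => k _; apply: sumr_ge0 => h _; exact: sqr_ge0.
Qed.

Lemma fro_inner m n (A B : 'M[R]_(m, n)) :
  \sum_i \sum_j A i j * B i j <= fro A * fro B.
Proof.
rewrite pair_bigA /=.
apply: le_trans (ler_norm _) _.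
rewrite -(@ler_pXn2r _ 2) ?nnegrE ?mulr_ge0 ?fro_ge0//.
rewrite real_normK ?num_real// exprMn !fro_sqr !pair_bigA /=.
exact: (sum_cauchy_schwarz (fun p => A p.1 p.2) (fun p => B p.1 p.2)).
Qed.

Lemma fro_add m n (A B : 'M[R]_(m, n)) : fro (A + B) <= fro A + fro B.
Proof.
rewrite fro_le ?addr_ge0 ?fro_ge0// sqrrD !fro_sqr.
have -> : \sum_i \sum_j (A + B) i j ^+ 2 = \sum_i \sum_j A i j ^+ 2 +
    (\sum_i \sum_j A i j * B i j) *+ 2 + \sum_i \sum_j B i j ^+ 2.
  rewrite -sumrMnl -!big_split /=; apply: eq_bigr => i _.
  rewrite -sumrMnl -!big_split /=; apply: eq_bigr => j _.
  by rewrite mxE sqrrD.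
by rewrite lerD2r lerD2l lerMn2r fro_inner orbT.
Qed.

Lemma fro_scale m n c (A : 'M[R]_(m, n)) : fro (c *: A) = `|c| * fro A.
Proof.
apply/eqP; rewrite -(@eqrXn2 _ 2) ?mulr_ge0 ?fro_ge0// exprMn !fro_sqr.
rewrite real_normK ?num_real// mulr_sumr; apply/eqP; apply: eq_bigr => i _.
by rewrite mulr_sumr; apply: eq_bigr => j _; rewrite mxE exprMn.
Qed.

Lemma fro_mul m n p (A : 'M[R]_(m, n)) (B : 'M[R]_(n, p)) :
  fro (A *m B) <= fro A * fro B.
Proof.
rewrite fro_le ?mulr_ge0 ?fro_ge0// exprMn !fro_sqr mulr_suml.
apply: ler_sum => i _; rewrite exchange_big mulr_sumr /=.
apply: ler_sum => j _; rewrite mxE.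
exact: (sum_cauchy_schwarz (fun k => A i k) (fun k => B k j)).
Qed.

Lemma fro_le_sum m n (A : 'M[R]_(m, n)) : fro A <= \sum_i \sum_j `|A i j|.
Proof.
rewrite fro_le; last by apply: sumr_ge0 => i _; apply: sumr_ge0.
rewrite !pair_bigA /=.
have : forall s : seq ('I_m * 'I_n), \sum_(p <- s) A p.1 p.2 ^+ 2 <=
    (\sum_(p <- s) `|A p.1 p.2|) ^+ 2.
  elim=> [|p s IH]; first by rewrite !big_nil expr0n.
  rewrite !big_cons sqrrD real_normK ?num_real// -addrA lerD2l.
  apply: (le_trans IH); rewrite lerDr mulrn_wge0// mulr_ge0//.
  by apply: sumr_ge0.
exact.
Qed.

Lemma fro_scalar1 n : fro (1%:M : 'M[R]_n) <= n%:R.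
Proof.
apply: le_trans (fro_le_sum _) _.
rewrite -[X in _ <= X%:R]card_ord -sum1_card natr_sum; apply: ler_sum => i _.
rewrite (bigD1 i)//= big1 => [|j ij]; rewrite !mxE ?eqxx ?normr1 ?addr0//.
by rewrite eq_sym (negbTE ij) normr0.
Qed.

End Frobenius.

(* Functions of the nodes x_0, ..., x_m act on the bidiagonal matrix J with
   diagonal x and subdiagonal rho: the entry (m, 0) of p(J) is rho^m times the
   divided difference of p at the nodes. *)
Section NodeNorm.
Variables (R : realType) (m : nat) (x : 'I_m.+1 -> R) (rho : R).
Hypotheses (hx : injective x) (hrho : 0 < rho).
Local Notation d := m.+1.

Definition newton : 'M[R]_d :=
  \matrix_(i, b) \prod_(c < d | (c < b)%N) ((x i - x c) / rho).
Definition node_mx (g : 'I_d -> R) : 'M[R]_d :=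
  invmx newton *m diag_mx (\row_i g i) *m newton.
Definition bidiag : 'M[R]_d :=
  \matrix_(a, b) (x b *+ (a == b) + rho *+ (a == b.+1 :> nat)).
(** In the Newton basis a function of the nodes becomes a triangular matrix of
    scaled divided differences, so its Frobenius norm is submultiplicative. *)
Definition node_norm (g : 'I_d -> R) : R := fro (node_mx g).

Lemma newton_unit : newton \in unitmx.
Proof.
have trig : is_trig_mx newton.
  apply/is_trig_mxP => i j ij; rewrite mxE (bigD1 i)//= subrr mul0r mul0r//.
rewrite unitmxE det_trig// unitfE; apply/prodf_neq0 => i _.
rewrite mxE; apply/prodf_neq0 => c ci; rewrite mulf_neq0 ?invr_eq0 ?(gt_eqF hrho)//.
rewrite subr_eq0; apply/eqP => /hx E; by move: ci; rewrite E ltnn.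
Qed.

Lemma node_mxM g h : node_mx (fun i => g i * h i) = node_mx g *m node_mx h.
Proof.
rewrite /node_mx !mulmxA; congr (_ *m _).
rewrite -[invmx newton *m _ *m newton *m _]mulmxA mulmxV ?newton_unit// mulmx1.
rewrite -mulmxA; congr (_ *m _); rewrite mulmx_diag; congr diag_mx.
by apply/rowP => i; rewrite !mxE.
Qed.

Lemma node_mxD g h : node_mx (fun i => g i + h i) = node_mx g + node_mx h.
Proof.
rewrite /node_mx -mulmxDl -mulmxDr -raddfD /=; congr (_ *m diag_mx _ *m _).
by apply/rowP => i; rewrite !mxE.
Qed.

Lemma node_mxZ c g : node_mx (fun i => c * g i) = c *: node_mx g.
Proof.
rewrite /node_mx scalemxAl scalemxAr -linearZ /=; congr (_ *m diag_mx _ *m _).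
by apply/rowP => i; rewrite !mxE.
Qed.

Lemma node_mx1 : node_mx (fun=> 1) = 1%:M.
Proof.
rewrite /node_mx (_ : \row_i 1 = const_mx 1); last by apply/rowP => i; rewrite !mxE.
by rewrite diag_const_mx mulmx1 mulVmx ?newton_unit.
Qed.

Lemma node_mx_entry g a b : node_mx g a b =
  \sum_(k < d) (invmx newton a k * newton k b) * g k.
Proof.
rewrite /node_mx mul_mx_diag mxE; apply: eq_bigr => k _.
by rewrite !mxE mulrAC.
Qed.

(** Multiplication by the coordinate is bidiagonal in the Newton basis, hence
    small when the nodes and rho are small. *)
Lemma newton_bidiag : diag_mx (\row_i x i) *m newton = newton *m bidiag.
Proof.
apply/matrixP => i b; rewrite mul_diag_mx mxE [RHS]mxE mxE.
under [RHS]eq_bigr do rewrite [bidiag _ _]mxE mulrDr.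
rewrite big_split /= (bigD1 b)//= eqxx [X in _ + X + _]big1 => [|j /negbTE ->]; last by rewrite mulr0.
rewrite addr0 -[LHS](subrK (newton i b * x b)) addrC mxE mulr1n; congr (_ + _).
rewrite mulrC -mulrBr.
have [bm|bm] := ltnP b.+1 d.
  rewrite [RHS](bigD1 (Ordinal bm))//= eqxx mulr1n [X in _ = _ + X]big1 => [|j jb]; last first.
    by rewrite (_ : (j == b.+1 :> nat) = false) ?mulr0n ?mulr0//; apply/negbTE.
  rewrite addr0 mxE [in RHS](bigD1 b)//=.
  rewrite [in RHS](eq_bigl (fun c : 'I_d => (c < b)%N)) => [|c]; last first.
    by rewrite ltnS ltn_neqAle andbC.
  by field; rewrite gt_eqF.
have bE : b = ord_max.
  by apply: val_inj => /=; apply/eqP; rewrite eqn_leq -ltnS ltn_ord -ltnS bm.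
rewrite [RHS]big1 => [|j _]; last first.
  rewrite (_ : (j == b.+1 :> nat) = false) ?mulr0n ?mulr0//.
  by apply/negbTE; rewrite neq_ltn (leq_trans (ltn_ord j) bm).
have [->|ib] := eqVneq i b; first by rewrite subrr mulr0.
rewrite (bigD1 i)/= ?subrr ?mul0r ?mul0r//.
by rewrite ltn_neqAle ib /= bE -ltnS ltn_ord.
Qed.

Lemma node_mx_x : node_mx x = bidiag.
Proof. by rewrite /node_mx -mulmxA newton_bidiag mulKmx ?newton_unit. Qed.

Lemma node_mx_pow_entry j : (j <= m)%N ->
  node_mx (fun i => x i ^+ j) ord_max ord0 = if (j == m) then rho ^+ m else 0.
Proof.
have key k : (forall a b : 'I_d, (b + k < a)%N -> node_mx (fun i => x i ^+ k) a b = 0) /\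
    (forall a b : 'I_d, (a = b + k :> nat)%N -> node_mx (fun i => x i ^+ k) a b = rho ^+ k).
  elim: k => [|k [IH1 IH2]].
    have E : node_mx (fun i => x i ^+ 0) = 1%:M by rewrite -node_mx1.
    split=> a b; rewrite addn0 E mxE; first by move=> ba; rewrite gt_eqF.
    by move=> /val_inj ->; rewrite eqxx.
  have E : node_mx (fun i => x i ^+ k.+1) = bidiag *m node_mx (fun i => x i ^+ k).
    rewrite -node_mx_x -node_mxM; congr node_mx.
    by apply/funext => i; rewrite exprS.
  split=> a b ab; rewrite E mxE.
    rewrite big1// => c _; rewrite mxE.
    have [ac|ac] := eqVneq a c; first by rewrite IH1 ?mulr0// -ac; apply: leq_trans ab; rewrite addnS.
    have [ac1|ac1] := eqVneq (a : nat) c.+1; last by rewrite !mulr0n addr0 mul0r.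
    by rewrite IH1 ?mulr0//; move: ab; rewrite ac1 addnS ltnS.
  have bk : (b + k < d)%N by apply: leq_trans (ltn_ord a); rewrite ab addnS.
  rewrite (bigD1 (Ordinal bk))//= big1 => [|c cb].
    rewrite addr0 mxE (IH2 (Ordinal bk))// ab addnS eqxx -val_eqE /= ab addnS.
    by rewrite gtn_eqF// mulr0n add0r mulr1n exprS.
  rewrite mxE; have [ac|ac] := eqVneq a c.
    by rewrite IH1 ?mulr0// -ac ab addnS.
  rewrite (_ : (a == c.+1 :> nat) = false) ?mulr0n ?addr0 ?mul0r//.
  apply/negbTE; apply: contraNneq cb; rewrite ab addnS => -[E'].
  by apply/eqP/val_inj.
rewrite leq_eqVlt => /orP[/eqP ->|jm]; rewrite ?eqxx.
  by have [_ ->] := key m.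
by rewrite ltn_eqF//; have [-> //] := key j.
Qed.

Lemma node_norm_x (e : R) : (forall i, `|x i| <= e) ->
  node_norm x <= d%:R * d%:R * (e + rho).
Proof.
move=> xe; have e0 : 0 <= e by apply: le_trans (xe ord0).
rewrite /node_norm node_mx_x; apply: le_trans (fro_le_sum _) _.
apply: (@le_trans _ _ (\sum_(i < d) \sum_(j < d) (e + rho))).
  apply: ler_sum => i _; apply: ler_sum => j _; rewrite mxE.
  rewrite (le_trans (ler_normD _ _))// lerD//.
    by case: (i == j); rewrite ?mulr1n// mulr0n normr0.
  by case: (_ == _ :> nat); rewrite ?mulr1n ?mulr0n ?normr0 ?(ltW hrho)// gtr0_norm.
rewrite !sumr_const !card_ord -mulrnA -[leLHS]mulr_natl natrM.
by [].

Qed.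

(** Functions of the nodes act as commuting matrices, so the Frobenius norm is
    submultiplicative on them; the norm of 1 is the square root of the size. *)
Lemma node_norm_algnorm : algnorm d%:R node_norm.
Proof.
split.
- by move=> g; exact: fro_ge0.
- by move=> g h; rewrite /node_norm node_mxD fro_add.
- by move=> c g; rewrite /node_norm node_mxZ fro_scale.
- by move=> g h; rewrite /node_norm node_mxM fro_mul.
- by rewrite /node_norm node_mx1 fro_scalar1.
- move=> g i; have E : row i newton *m node_mx g = g i *: row i newton.
    rewrite /node_mx -row_mul -!mulmxA mulKVmx ?newton_unit//.
    rewrite row_mul row_diag_mx -scalemxAl -rowE; congr (_ *: _).
    by rewrite mxE.
  have f0 : 0 < fro (row i newton).
    rewrite lt_neqAle fro_ge0 andbT eq_sym; apply/eqP => f0.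
    have r0 : row i newton = 0.
      apply/rowP => j; rewrite [RHS]mxE; apply/eqP.
      by rewrite -normr_le0 -f0 fro_entry.
    have := row_free_unit newton; rewrite newton_unit => /row_freeP[B hB].
    have : row i newton *m B = row i 1%:M by rewrite -row_mul hB.
    rewrite r0 mul0mx => /rowP/(_ i); rewrite !mxE eqxx => /eqP.
    by rewrite eq_sym oner_eq0.
  have := fro_mul (row i newton) (node_mx g); rewrite E fro_scale mulrC.
  by rewrite ler_pM2l.
- move=> u g K uK ug; have K0 : 0 <= K by apply: le_trans (fro_ge0 _) (uK 0%N).
  rewrite /node_norm fro_le//.
  have cE a b : node_mx (u n) a b @[n --> \oo] --> node_mx g a b.
    rewrite node_mx_entry (_ : (fun _ => _) = fun n =>
      \sum_(k < d) (invmx newton a k * newton k b) * u n k); last first.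
      by apply/funext => n; rewrite node_mx_entry.
    by apply: cvg_sum_seq => k; apply: cvgM; [exact: cvg_cst|exact: ug].
  have h : \sum_i \sum_j node_mx (u n) i j ^+ 2 @[n --> \oo] -->
      \sum_i \sum_j node_mx g i j ^+ 2.
    apply: cvg_sum_seq => a; apply: cvg_sum_seq => b.
    rewrite expr2 (_ : (fun _ => _) = fun n => node_mx (u n) a b * node_mx (u n) a b).
      by apply: cvgM; exact: cE.
    by apply/funext => n; rewrite expr2.
  apply: (closed_cvg (fun y => y <= K ^+ 2) (@closed_le _ _) _ _ h).
  by near=> n; rewrite -fro_le//; exact: uK.
Unshelve. all: by end_near. Qed.

End NodeNorm.

(** * Bound on the number of small periodic solutions *)

Section PeriodicSolutions.
Variables (R : realType) (l : nat) (del0 : 'rV[R]_l) (M : nat).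
Notation kappa := (M.+1%:R : R).
Notation Fn2 := (R -> 'rV[R]_l -> R).
Notation Fn3 := (R -> 'rV[R]_l -> R -> R).

(** The displacement of the truncated first integral vanishes at every node, so
    its top divided difference vanishes too; but this divided difference is
    phi_m(2 pi) - phi_m(0) up to an error that is small with the parameter and the
    radius. *)
Lemma periodic_solutions_bound m (phi : nat -> R -> R) (c : nat -> Fn2)
    (F : Fn3) (L : R) : 0 <= L -> (0 < m <= M)%N ->
  (forall j, coef del0 (c j)) ->
  (forall p, (p <= M)%N -> exists Q, bnd del0 kappa Q /\ near_eq del0 F
     (fun t del r => r * (\sum_(j < p) c j t del * r ^+ j + r ^+ p * Q t del r))) ->
  (forall j (t : R), (j <= M)%N -> is_derive t 1 (phi j)
      (- \sum_(i < j) i.+1%:R * phi i.+1 t * c (j - i).-1 t del0)) ->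
  phi m L != phi m 0 ->
  \forall e \near (0 : R)^'+, forall del : 'rV[R]_l, `|del - del0| <= e ->
    forall r : 'I_m.+1 -> R -> R,
    (forall i (t : R), 0 <= t <= L -> is_derive t 1 (r i) (F t del (r i t))) ->
    (forall i, r i L = r i 0) -> injective (fun i => r i 0) ->
    (forall i, `|r i 0| <= e) -> False.
Proof.
move=> L0 /andP[m0 mM] hc hF dphi pm.
have k1 : 1 <= kappa by rewrite ler1n.
have [C [C0 hC]] := transport_bound k1 0 L mM hc hF dphi.
have [Q [[K [K0 hK]] FE]] := hF 0%N (leq0n _).
have [e1 [e10 h1 h2 h3]] : exists e1 : R, [/\ 0 < e1,
    forall del : 'rV[R]_l, `|del - del0| <= e1 -> forall eta : R, 0 <= eta ->
    (forall j t, (j < m)%N -> `|c j t del - c j t del0| <= eta) ->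
    forall t, 0 <= t <= L -> forall d (N : ('I_d -> R) -> R), algnorm kappa N ->
    forall r : 'I_d -> R, N r <= e1 ->
    N (fun a => \sum_(i < m)
        ((- \sum_(i' < i.+1) i'.+1%:R * phi i'.+1 t * c (i.+1 - i').-1 t del0)
           * r a ^+ i.+1
         + i.+1%:R * phi i.+1 t * r a ^+ i * F t del (r a)))
     <= C * (eta + N r ^+ m.+1),
    forall del : 'rV[R]_l, `|del - del0| <= e1 -> forall t,
    forall d (N : ('I_d -> R) -> R), algnorm kappa N ->
    forall r : 'I_d -> R, N r <= e1 -> N (fun i => Q t del (r i)) <= K &
    forall del : 'rV[R]_l, `|del - del0| <= e1 -> forall t r, `|r| <= e1 ->
    F t del r = r * Q t del r].
  near (0 : R)^'+ => e1; exists e1; split=> //.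
  - exact: (near hC e1).
  - exact: (near hK e1).
  - move=> del hd t r hr; have -> // := near FE e1 _ del hd t r hr.
    by rewrite big_ord0 add0r expr0 mul1r.
set d := m.+1; pose cd : R := d%:R * d%:R * 2.
pose G := cd * expR (K * L).
have cd0 : 0 < cd by rewrite !mulr_gt0// ltr0n.
have G0 : 0 < G by rewrite mulr_gt0// expR_gt0.
pose p := `|phi m L - phi m 0|; have p0 : 0 < p by rewrite normr_gt0 subr_eq0.
have [rho [rho0 rho1 rho2]] : exists rho : R, [/\ 0 < rho, G * rho < e1 &
    L * (C * G ^+ d) * rho <= p / 4].
  have b0 : 0 <= L * (C * G ^+ d) by nn.
  have p4 : 0 < p / 4 by rewrite divr_gt0.
  near (0 : R)^'+ => rho; exists rho; split=> //.
    rewrite -ltr_pdivlMl//; near: rho; apply: nbhs_right_lt.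
    by rewrite mulr_gt0// invr_gt0.
  rewrite mulrC; near: rho; exact: near0_mul.
have LC0 : 0 <= L * C by exact: mulr_ge0.
pose eta := p * rho ^+ m / 4 / (L * C + 1).
have eta0 : 0 < eta.
  by rewrite /eta !divr_gt0// ?mulr_gt0 ?exprn_gt0// ltr_wpDl.
have hetac : \forall e \near (0 : R)^'+, forall j : 'I_m, forall del : 'rV[R]_l,
    `|del - del0| <= e -> forall t, `|c j t del - c j t del0| <= eta.
  by apply: filter_forall => j; have [_ _ /(_ _ eta0)] := hc j.
near=> e => del hd r dr per inj re.
have e0 : 0 <= e by apply: le_trans (re ord0).
have ee1 : e <= e1 by near: e; exact: nbhs_right_le.
have erho : e <= rho by near: e; exact: nbhs_right_le.
have heta j t : (j < m)%N -> `|c j t del - c j t del0| <= eta.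
  by move=> jm; apply: (near hetac e _ (Ordinal jm)).
have hd1 : `|del - del0| <= e1 by apply: le_trans hd ee1.
pose x i := r i 0.
pose N := node_norm x rho.
have hN : algnorm kappa N.
  have := node_norm_algnorm inj rho0; rewrite -/N => -[n1 n2 n3 n4 n5 n6 n7].
  by split=> //; apply: le_trans n5 _; rewrite ler_nat.
pose w a b k := invmx (newton x rho) a k * newton x rho k b.
have mxE' g a b : node_mx x rho g a b = \sum_k w a b k * g k by exact: node_mx_entry.
pose rr t i := r i t.
pose Ff t i := F t del (r i t).
have dentry (t : R) a b : 0 <= t <= L ->
    is_derive t 1 (fun t => node_mx x rho (rr t) a b) (node_mx x rho (Ff t) a b).
  move=> tL; rewrite mxE' (_ : (fun _ => _) = fun t => \sum_k w a b k * r k t).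
    by apply: is_derive_sum_seq => k; apply: is_derive_scale; exact: dr.
  by apply/funext => s; rewrite mxE'.
pose V t := \sum_a \sum_b node_mx x rho (rr t) a b ^+ 2.
pose V' t := \sum_a \sum_b 2%:R * node_mx x rho (rr t) a b ^+ 1 * node_mx x rho (Ff t) a b.
have VN t : V t = N (rr t) ^+ 2 by rewrite /V /N /node_norm fro_sqr.
have dV (t : R) : 0 <= t <= L -> is_derive t 1 V (V' t).
  move=> tL; apply: is_derive_sum_seq => a; apply: is_derive_sum_seq => b.
  by apply: (is_derive_pow 1); exact: dentry.
have V'le t : V t <= e1 ^+ 2 -> V' t <= 2 * K * 1 * V t.
  rewrite VN ler_pXn2r ?nnegrE ?(an_ge0 hN) ?(ltW e10)// => Ne.
  have NF : N (Ff t) <= K * N (rr t).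
    rewrite (@an_ext _ _ N _ (fun i => r i t * Q t del (r i t))) => [|i]; last first.
      by apply: h3 => //; apply: le_trans (an_pt hN (rr t) i) Ne.
    apply: le_trans (an_mul hN _ _) _; rewrite mulrC ler_wpM2r ?(an_ge0 hN)//.
    exact: (h2 _ hd1 t _ _ hN (rr t)).
  rewrite /V' (_ : \sum_a _ = 2 * \sum_a \sum_b node_mx x rho (rr t) a b
      * node_mx x rho (Ff t) a b); last first.
    rewrite mulr_sumr; apply: eq_bigr => a _; rewrite mulr_sumr.
    by apply: eq_bigr => b _; rewrite expr1 mulrA.
  apply: (@le_trans _ _ (2 * (N (rr t) * N (Ff t)))).
    by rewrite ler_pM2l// /N /node_norm; exact: fro_inner.
  rewrite (_ : 2 * K * 1 * _ = 2 * (N (rr t) * (K * N (rr t)))); last by ring.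
  by rewrite ler_pM2l// ler_wpM2l ?(an_ge0 hN).
have Nx : N (rr 0) <= cd * rho.
  apply: le_trans (node_norm_x inj rho0 re) _.
  rewrite /cd -[leRHS]mulrA ler_wpM2l ?mulr_ge0// mulr2n mulrDl mul1r.
  by rewrite lerD2r.
have expK (t : R) : 0 <= t <= L -> expR (2 * K * t) <= expR (K * L) ^+ 2.
  move=> /andP[t0 tL]; rewrite -expRM_natl ler_expR.
  by rewrite -mulrA ler_pM2l// ler_wpM2l.
have V0 : V 0 <= (cd * rho) ^+ 2.
  by rewrite VN ler_pXn2r ?nnegrE ?(an_ge0 hN)// mulr_ge0 ?ltW.
have gr (t : R) : 0 <= t <= L -> (forall s, 0 <= s <= t -> V s <= e1 ^+ 2) ->
    V t <= (G * rho) ^+ 2.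
  move=> /andP[t0 tL] hs.
  have := @gronwall R V V' id (fun=> 1) 0 t (2 * K) t0.
  rewrite subr0 => H; apply: (@le_trans _ _ (V 0 * expR (2 * K * t))).
    apply: H => [s /andP[s0 st]|s _|s /andP[s0 st]].
    - by apply: dV; rewrite s0 (le_trans st).
    - exact: is_derive_id.
    - by apply: V'le; apply: hs; rewrite s0.
  rewrite (_ : (G * rho) ^+ 2 = (cd * rho) ^+ 2 * expR (K * L) ^+ 2); last first.
    by rewrite /G; ring.
  rewrite ler_pM ?expR_ge0//; first by rewrite VN exprn_ge0// (an_ge0 hN).
  by apply: expK; rewrite t0.
have Grho0 : 0 <= G * rho by rewrite mulr_ge0 ?ltW.
have Gr1 : (G * rho) ^+ 2 < e1 ^+ 2 by rewrite ltr_pXn2r ?nnegrE ?(ltW e10).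
have Vsmall (t : R) : 0 <= t <= L -> V t < e1 ^+ 2.
  apply: (@continuous_induction_le R V 0 L) => //.
  - by move=> s sL; exact: is_derive_cvg (dV s sL).
  - apply: le_lt_trans V0 _; apply: le_lt_trans Gr1.
    rewrite ler_pXn2r ?nnegrE ?mulr_ge0 ?(ltW cd0) ?(ltW rho0) ?(ltW G0)//.
    rewrite ler_pM2r// /G ler_peMr ?(ltW cd0)// -expR0 ler_expR mulr_ge0//.
  - by move=> s sL hs; apply: le_lt_trans Gr1; exact: gr.
have Nt (t : R) : 0 <= t <= L -> N (rr t) <= G * rho.
  move=> tL; rewrite -(@ler_pXn2r _ 2) ?nnegrE ?(an_ge0 hN)// -VN.
  apply: gr => // s /andP[s0 st]; apply/ltW/Vsmall; rewrite s0 (le_trans st)//.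
  by case/andP: tL.
pose Phi t k := \sum_(i < m) phi i.+1 t * r k t ^+ i.+1.
pose E t k := \sum_(i < m)
        ((- \sum_(i' < i.+1) i'.+1%:R * phi i'.+1 t * c (i.+1 - i').-1 t del0)
           * rr t k ^+ i.+1
         + i.+1%:R * phi i.+1 t * rr t k ^+ i * F t del (rr t k)).
pose lam t := node_mx x rho (Phi t) ord_max ord0.
have dlam (t : R) : 0 <= t <= L -> is_derive t 1 lam (node_mx x rho (E t) ord_max ord0).
  move=> tL; rewrite mxE' (_ : lam = fun t => \sum_k w ord_max ord0 k * Phi t k).
    apply: is_derive_sum_seq => k; apply: is_derive_scale.
    apply: is_derive_sum_seq => i.
    have d1 := dphi i.+1 t (leq_trans (ltn_ord i) mM).
    have d2 := is_derive_pow i (dr k t tL).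
    by apply: is_derive_val (is_derive_mul d1 d2) _; rewrite /rr; ring.
  by apply/funext => s; rewrite /lam mxE'.
have Esmall (t : R) : 0 <= t <= L ->
    `|node_mx x rho (E t) ord_max ord0| <= C * (eta + (G * rho) ^+ m.+1) * 1.
  move=> tL; apply: le_trans (fro_entry _ _ _) _; rewrite mulr1.
  have NG := Nt t tL.
  apply: le_trans (h1 _ hd1 eta (ltW eta0) heta t tL _ _ hN (rr t) _) _.
    exact: le_trans NG (ltW rho1).
  by rewrite ler_wpM2l// lerD2l ler_pXn2r ?nnegrE ?(an_ge0 hN).
have H : `|lam L - lam 0| <= C * (eta + (G * rho) ^+ m.+1) * (L - 0).
  exact: (@derive_dominated R lam _ id (fun=> 1) 0 L _ L0 dlam).
have lamE : lam L - lam 0 = (phi m L - phi m 0) * rho ^+ m.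
  rewrite /lam !mxE' -sumrB (_ : \sum_k _ =
     \sum_(i < m) (phi i.+1 L - phi i.+1 0) * node_mx x rho (fun k => x k ^+ i.+1) ord_max ord0).
    have pm1 : (m.-1 < m)%N by rewrite prednK.
    rewrite (bigD1 (Ordinal pm1))//= prednK// big1 ?addr0 => [|i im].
      by rewrite (@node_mx_pow_entry _ _ _ _ inj rho0)// eqxx.
    have im' : (i.+1 == m) = false.
      apply/negbTE; apply: contraNneq im => im.
      by apply/eqP/val_inj; have := congr1 predn im.
    by rewrite (@node_mx_pow_entry _ _ _ _ inj rho0)// im' mulr0.
  rewrite (eq_bigr (fun k => \sum_(i < m) (phi i.+1 L - phi i.+1 0) *
     (w ord_max ord0 k * x k ^+ i.+1))); last first.
    move=> k _; rewrite -mulrBr -sumrB mulr_sumr; apply: eq_bigr => i _.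
    by rewrite per -/(x k); ring.
  rewrite exchange_big; apply: eq_bigr => i _ /=.
  by rewrite -mulr_sumr mxE'.
move: H; rewrite lamE normrM -/p subr0 (gtr0_norm (exprn_gt0 _ rho0)).
have -> : C * (eta + (G * rho) ^+ m.+1) * L =
    (L * C) * eta + L * (C * G ^+ d) * rho * rho ^+ m.
  by rewrite exprMn -/d /d [rho ^+ m.+1]exprS; ring.
have X0 : 0 < p * rho ^+ m by rewrite mulr_gt0// exprn_gt0.
have a1 : (L * C) * eta <= p * rho ^+ m / 4.
  have LC1 : 0 < L * C + 1 by rewrite ltr_wpDl.
  rewrite /eta mulrCA ger_pMr ?divr_gt0//.
  by rewrite ler_pdivrMr// mul1r lerDl.
have a2 : L * (C * G ^+ d) * rho * rho ^+ m <= p / 4 * rho ^+ m.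
  by rewrite ler_wpM2r// exprn_ge0// ltW.
rewrite leNgt => /negP; apply.
apply: le_lt_trans (lerD a1 a2) _.
by move: X0; lra.
Unshelve. all: by end_near. Qed.
End PeriodicSolutions.

(** * Quasi-homogeneous polar coordinates *)

Lemma cvg_exprn (R : realType) (U : Type) (F : set_system U) (FF : Filter F)
    (f : U -> R) (a : R) k : f x @[x --> F] --> a -> f x ^+ k @[x --> F] --> a ^+ k.
Proof.
move=> fa; elim: k => [|k IH].
  by under eq_fun do rewrite expr0; exact: cvg_cst.
rewrite exprS (_ : (fun _ => _) = fun x => f x * f x ^+ k); first exact: cvgM.
by apply/funext => x; rewrite exprS.
Qed.

Section PolarLift.
Variables (R : realType) (N : nat).

Definition gauge_root (x u r : R) : Prop :=
  0 < r /\ (r ^+ N) ^+ 2 * (r ^+ 2 - x ^+ 2) = u ^+ 2.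
(** The radius r of the coordinates x = r cos t, u = r^(N+1) sin t: eliminating t
    leaves the equation of [gauge_root]. *)
Definition gauge (x u : R) : R := xget 0 [set r | gauge_root x u r].

Lemma gauge_root_sqr x u r : gauge_root x u r -> 0 <= r ^+ 2 - x ^+ 2.
Proof.
move=> [r0 E]; rewrite -(@pmulr_rge0 _ ((r ^+ N) ^+ 2)) ?exprn_gt0//.
by rewrite E sqr_ge0.
Qed.

Lemma gauge_lt (x u r s : R) : gauge_root x u r -> 0 < s -> s < r ->
  (s ^+ N) ^+ 2 * (s ^+ 2 - x ^+ 2) < u ^+ 2.
Proof.
move=> hr s0 sr; have rx := gauge_root_sqr hr; move: hr => [r0 <-].
apply: (@lt_le_trans _ _ ((s ^+ N) ^+ 2 * (r ^+ 2 - x ^+ 2))).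
  by rewrite ltr_pM2l ?exprn_gt0// ltrD2r ltr_pXn2r ?nnegrE ?(ltW s0) ?(ltW r0) ?(ltW sr).
rewrite ler_wpM2r// ler_pXn2r ?nnegrE ?exprn_ge0 ?(ltW s0) ?(ltW r0) ?(ltW sr)//.
by rewrite lerXn2r ?nnegrE ?(ltW s0) ?(ltW r0) ?(ltW sr).
Qed.

Lemma gauge_gt (x u r s : R) : gauge_root x u r -> r < s ->
  u ^+ 2 < (s ^+ N) ^+ 2 * (s ^+ 2 - x ^+ 2).
Proof.
move=> hr rs; have rx := gauge_root_sqr hr; move: hr => [r0 <-].
have s0 : 0 < s by apply: lt_trans rs.
apply: (@le_lt_trans _ _ ((s ^+ N) ^+ 2 * (r ^+ 2 - x ^+ 2))).
  rewrite ler_wpM2r// ler_pXn2r ?nnegrE ?exprn_ge0 ?(ltW s0) ?(ltW r0) ?(ltW rs)//.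
  by rewrite lerXn2r ?nnegrE ?(ltW s0) ?(ltW r0) ?(ltW rs).
by rewrite ltr_pM2l ?exprn_gt0// ltrD2r ltr_pXn2r ?nnegrE ?(ltW s0) ?(ltW r0) ?(ltW rs).
Qed.

Lemma gauge_uniq x u r s : gauge_root x u r -> gauge_root x u s -> r = s.
Proof.
move=> hr hs; apply/eqP; rewrite eq_le !leNgt; apply/andP; split; apply/negP => h.
  by have := gauge_lt hr hs.1 h; rewrite hs.2 ltxx.
by have := gauge_gt hr h; rewrite hs.2 ltxx.
Qed.

Lemma gaugeP (x u : R) : x != 0 \/ u != 0 -> gauge_root x u (gauge x u).
Proof.
move=> xu; rewrite /gauge; case: xgetP => [r -> //|hno].
suff [r hr] : exists r, gauge_root x u r by case: (hno r).
move=> {hno}.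
pose h (r : R) : R := (r ^+ N) ^+ 2 * (r ^+ 2 - x ^+ 2) - u ^+ 2.
pose b : R := `|x| + `|u| + 1.
have b1 : 1 <= b by rewrite lerDr addr_ge0.
have hb : 0 <= h b.
  rewrite subr_ge0; apply: (@le_trans _ _ (b ^+ 2 - x ^+ 2)).
    rewrite -(real_normK (num_real u)) -(real_normK (num_real x)) lerBrDr /b.
    have := normr_ge0 x; have := normr_ge0 u; nra.
  apply: ler_peMl; last by rewrite !exprn_ege1.
  rewrite subr_ge0 -(real_normK (num_real x)) lerXn2r ?nnegrE ?addr_ge0//.
  by rewrite /b -addrA lerDl addr_ge0.
have ha : h `|x| <= 0.
  by rewrite /h real_normK ?num_real// subrr mulr0 sub0r oppr_le0 sqr_ge0.
have xb : `|x| <= b by rewrite /b -addrA lerDl addr_ge0.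
have ch : {within `[`|x|, b], continuous h}.
  apply: continuous_subspaceT => r.
  apply: cvgB; last exact: cvg_cst.
  apply: cvgM; first by apply: cvg_exprn; apply: cvg_exprn; exact: cvg_id.
  by apply: cvgB; [apply: cvg_exprn; exact: cvg_id|exact: cvg_cst].
have hv : Num.min (h `|x|) (h b) <= 0 <= Num.max (h `|x|) (h b).
  by rewrite ge_min le_max ha hb orbT.
have [r] := IVT xb ch hv.
rewrite in_itv /= => /andP[xr rb] hr; exists r; split; last first.
  by apply/eqP; rewrite -subr_eq0; apply/eqP.
rewrite lt_neqAle (le_trans (normr_ge0 x) xr) andbT eq_sym; apply/eqP => r0.
move: hr xr; rewrite /h r0 normr_le0 => hr /eqP x0.
have u0 : u != 0 by case: xu => //; rewrite x0 eqxx.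
move/eqP: hr; rewrite x0 subrr mulr0 sub0r oppr_eq0 sqrf_eq0.
by rewrite (negbTE u0).
Qed.

Lemma gauge_cvg (x u : R -> R) (t : R) : x t != 0 \/ u t != 0 ->
  x s @[s --> t] --> x t -> u s @[s --> t] --> u t ->
  gauge (x s) (u s) @[s --> t] --> gauge (x t) (u t).
Proof.
move=> xut cx cu; have hr := gaugeP xut.
have nz : \forall s \near t, x s != 0 \/ u s != 0.
  case: xut => h.
    by apply: filterS (cvgr_neq0 _ cx h) => s; left.
  by apply: filterS (cvgr_neq0 _ cu h) => s; right.
have ch (k : R) : (k ^+ N) ^+ 2 * (k ^+ 2 - x s ^+ 2) - u s ^+ 2 @[s --> t] -->
    (k ^+ N) ^+ 2 * (k ^+ 2 - x t ^+ 2) - u t ^+ 2.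
  apply: cvgB; last exact: cvg_exprn.
  by apply: cvgM; [exact: cvg_cst|apply: cvgB; [exact: cvg_cst|exact: cvg_exprn]].
apply/cvgrPdist_lt => e e0.
set r := gauge (x t) (u t) in hr *.
have r0 := hr.1.
pose s1 := Num.max (r / 2) (r - e / 2); pose s2 := r + e / 2.
have s10 : 0 < s1 by rewrite lt_max divr_gt0.
have s1r : s1 < r by rewrite gt_max; apply/andP; split; lra.
have s2r : r < s2 by rewrite ltrDl divr_gt0.
have h1 : (s1 ^+ N) ^+ 2 * (s1 ^+ 2 - x t ^+ 2) - u t ^+ 2 < 0.
  by rewrite subr_lt0; apply: (gauge_lt hr).
have h2 : 0 < (s2 ^+ N) ^+ 2 * (s2 ^+ 2 - x t ^+ 2) - u t ^+ 2.
  by rewrite subr_gt0; exact: gauge_gt hr _.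
apply: filterS3 nz (cvgr_lt _ (ch s1) _ h1) (cvgr_gt _ (ch s2) _ h2) => s hs a1 a2.
have hrs := gaugeP hs; set rs := gauge (x s) (u s) in hrs *.
have b1 : s1 <= rs.
  rewrite leNgt; apply/negP => h; have := gauge_gt hrs h.
  by move: a1; rewrite subr_lt0 => /lt_trans h0 /h0; rewrite ltxx.
have b2 : rs <= s2.
  rewrite leNgt; apply/negP => h; have := gauge_lt hrs (lt_trans r0 s2r) h.
  by move: a2; rewrite subr_gt0 => /lt_trans h0 /h0; rewrite ltxx.
have b3 : r - e / 2 <= s1 by rewrite le_max lexx orbT.
by rewrite ltr_norml; apply/andP; split; move: b2 b3; rewrite /s2; lra.
Qed.

Lemma is_derive_mul_cvg (g k : R -> R) (t c : R) : is_derive t 1 g c ->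
  g t = 0 -> k s @[s --> t] --> k t -> is_derive t 1 (fun s => g s * k s) (c * k t).
Proof.
move=> dg gt0 ck.
have H : h^-1 *: ((((fun s => g s * k s) \o shift t) (h *: (1 : R))) - g t * k t)
    @[h --> 0^'] --> c * k t.
  rewrite gt0 mul0r.
  have E : (fun h : R => h^-1 *: (((fun s => g s * k s) \o shift t) (h *: (1 : R)) - 0)) =
     (fun h => (h^-1 *: ((g \o shift t) (h *: (1 : R)) - g t)) * k (h + t)).
    by apply/funext => h; rewrite gt0 !subr0 /= /GRing.scale /= mulr1 mulrA.
  rewrite E; apply: cvgM.
    by case: dg => dg <-; apply: dg.
  apply/cvgrPdist_lt => e e0.
  move/cvgr_dist_lt: ck => /(_ _ e0)[d /= d0 hd].
  exists d => // h /= hh _; apply: hd => /=.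
  by rewrite opprD addrCA subrr addr0; rewrite sub0r in hh.
by split; [apply/cvg_ex; exists (c * k t)|apply/cvg_lim].
Qed.

Lemma gauge_derive (x u : R -> R) (t x1 u1 : R) : x t != 0 \/ u t != 0 ->
  is_derive t 1 x x1 -> is_derive t 1 u u1 ->
  let r := gauge (x t) (u t) in
  is_derive t 1 (fun s => gauge (x s) (u s))
    (((r ^+ N) ^+ 2 * (2 * x t * x1) + 2 * u t * u1) /
     (N.+1%:R * r ^+ N * (r ^+ N.+1 *+ 2)
        - x t ^+ 2 * ((N%:R * r ^+ N.-1) * (r ^+ N *+ 2)))).
Proof.
move=> xut dx du r.
have cx := is_derive_cvg dx; have cu := is_derive_cvg du.
have cr := gauge_cvg xut cx cu.
have hr := gaugeP xut; rewrite -/r in hr.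
pose rr s := gauge (x s) (u s).
have nz : \forall s \near t, x s != 0 \/ u s != 0.
  case: xut => h.
    by apply: filterS (cvgr_neq0 _ cx h) => s; left.
  by apply: filterS (cvgr_neq0 _ cu h) => s; right.
pose P k s := \sum_(i < k) rr s ^+ (k.-1 - i) * r ^+ i.
pose D s := P N.+1 s * (rr s ^+ N.+1 + r ^+ N.+1)
   - x s ^+ 2 * (P N s * (rr s ^+ N + r ^+ N)).
pose g s := (r ^+ N) ^+ 2 * (x s ^+ 2 - x t ^+ 2) + (u s ^+ 2 - u t ^+ 2).
have key s : x s != 0 \/ u s != 0 -> (rr s - r) * D s = g s.
  move=> /gaugeP[_ Es]; have [_ E] := hr; rewrite /g -Es -E.
  have e1 : (rr s - r) * P N.+1 s = rr s ^+ N.+1 - r ^+ N.+1 by rewrite subrXX.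
  have e2 : (rr s - r) * P N s = rr s ^+ N - r ^+ N by rewrite subrXX.
  rewrite (_ : _ * D s = ((rr s - r) * P N.+1 s) * (rr s ^+ N.+1 + r ^+ N.+1)
    - x s ^+ 2 * (((rr s - r) * P N s) * (rr s ^+ N + r ^+ N))); last first.
    by rewrite /D; ring.
  by rewrite e1 e2 -/(rr s) !exprS; ring.
have PK k : P k t = k%:R * r ^+ k.-1.
  rewrite /P (eq_bigr (fun=> r ^+ k.-1)) => [|i _]; last first.
    rewrite (_ : rr t = r)// -exprD subnK//.
    by case: k i => [[]//|k] i; rewrite -ltnS ltn_ord.
  by rewrite sumr_const card_ord mulr_natl.
have Dt : D t = N.+1%:R * r ^+ N * (r ^+ N.+1 *+ 2)
        - x t ^+ 2 * ((N%:R * r ^+ N.-1) * (r ^+ N *+ 2)).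
  by rewrite /D !PK /= -/r !mulr2n.
have r0 := hr.1.
have Dt0 : D t != 0.
  rewrite Dt gt_eqF// subr_gt0.
  have rx := gauge_root_sqr hr.
  have xr : x t ^+ 2 <= r ^+ 2 by rewrite -subr_ge0.
  apply: (@le_lt_trans _ _ (r ^+ 2 * (N%:R * r ^+ N.-1 * (r ^+ N *+ 2)))).
    by rewrite ler_wpM2r// ?mulr_ge0 ?mulrn_wge0 ?exprn_ge0 ?(ltW r0).
  have E : r ^+ 2 * (N%:R * r ^+ N.-1 * (r ^+ N *+ 2)) =
     N%:R * r ^+ N * (r ^+ N.+1 *+ 2).
    case: (N) => [|k]; first by rewrite !mul0r mulr0.
    by rewrite /= !exprS; ring.
  by rewrite E -!mulrA ltr_pM2r ?ltr_nat// mulr_gt0 ?exprn_gt0// mulrn_wgt0 ?exprn_gt0.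
have cP k : P k s @[s --> t] --> P k t.
  rewrite /P; elim: (index_enum _) => [|i s IH].
    rewrite big_nil (_ : (fun _ => _) = fun=> 0); first exact: cvg_cst.
    by apply/funext => s; rewrite big_nil.
  rewrite big_cons (_ : (fun _ => _) = fun s' => rr s' ^+ (k.-1 - i) * r ^+ i +
     \sum_(j <- s) rr s' ^+ (k.-1 - j) * r ^+ j); last first.
    by apply/funext => s'; rewrite big_cons.
  apply: cvgD; last exact: IH.
  by apply: cvgM; [apply: cvg_exprn; exact: cr|exact: cvg_cst].
have cD : D s @[s --> t] --> D t.
  apply: cvgB; first by apply: cvgM; [exact: cP|apply: cvgD; [apply: cvg_exprn; exact: cr|exact: cvg_cst]].
  apply: cvgM; first exact: cvg_exprn.
  by apply: cvgM; [exact: cP|apply: cvgD; [apply: cvg_exprn; exact: cr|exact: cvg_cst]].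
have dg : is_derive t 1 g ((r ^+ N) ^+ 2 * (2 * x t * x1) + 2 * u t * u1).
  have dx2 := is_derive_pow 1 dx; have du2 := is_derive_pow 1 du.
  have d1 := is_deriveB dx2 (is_derive_cst (x t ^+ 2) t 1).
  have d2 := is_deriveB du2 (is_derive_cst (u t ^+ 2) t 1).
  have d3 := is_derive_scale ((r ^+ N) ^+ 2) d1.
  apply: (is_derive_val (is_deriveD d3 d2)); rewrite !expr1 !subr0//.
have g0 : g t = 0 by rewrite /g !subrr mulr0 addr0.
have cV : (D s)^-1 @[s --> t] --> (D t)^-1 by apply: cvgV.
have dgk := is_derive_mul_cvg dg g0 cV.
rewrite -Dt; have d4 := is_deriveD (is_derive_cst r t 1) dgk.
rewrite add0r in d4; apply: near_eq_is_derive d4.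
have Dn : \forall s \near t, D s != 0 by exact: (cvgr_neq0 _ cD Dt0).
apply: filterS2 nz Dn => s hs Ds /=.
change (r + g s / D s = rr s).
by rewrite -(key s hs) mulfK// addrC subrK.
Qed.

Lemma is_derive_inv (f : R -> R) (t c : R) : f t != 0 -> is_derive t 1 f c ->
  is_derive t 1 (fun s => (f s)^-1) (- (c / f t ^+ 2)).
Proof.
move=> f0 df; apply: (is_derive_val (is_deriveV f0 df)).
by rewrite /GRing.scale /= mulNr mulrC.
Qed.

Lemma angle_exists (c s : R) : c ^+ 2 + s ^+ 2 = 1 ->
  exists p : R, [/\ cos p = c, sin p = s & `|p| <= pi].
Proof.
move=> cs; have c1 : -1 <= c <= 1.
  have : c ^+ 2 <= 1 by rewrite -cs lerDl sqr_ge0.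
  by rewrite -ler_norml -{1}(expr1n R 2) -(real_normK (num_real c)) ler_pXn2r ?nnegrE.
have s2 : s ^+ 2 = 1 - c ^+ 2 by rewrite -cs addrAC subrr add0r.
have [s0|s0] := leP 0 s.
  exists (acos c); rewrite acosK// sin_acos// -s2 sqrtr_sqr ger0_norm//; split=> //.
  by rewrite ger0_norm ?acos_ge0// acos_lepi.
exists (- acos c); rewrite cosN sinN acosK// sin_acos// -s2 sqrtr_sqr ltr0_norm//.
by rewrite opprK normrN ger0_norm ?acos_ge0// acos_lepi.
Qed.

(* Lifting a plane curve that avoids the origin to the quasi-homogeneous polar
   coordinates x = r cos theta, u = - r^(N+1) sin theta. *)
(** The angular velocity is positive, so the angle is built by integrating it, and
    uniqueness of the gauge radius identifies the result with the given curve. *)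
Lemma polar_lift (I : R -> Prop) (cl x u x1 u1 : R -> R) (t0 : R) :
  (forall s t v, I s -> I v -> s <= t <= v -> I t) ->
  (forall t, I (cl t)) -> (forall t, I t -> cl t = t) -> I t0 ->
  (forall t, cl s @[s --> t] --> cl t) ->
  (forall t, I t -> is_derive t 1 x (x1 t)) ->
  (forall t, I t -> is_derive t 1 u (u1 t)) ->
  (forall t, x1 (cl s) @[s --> t] --> x1 (cl t)) ->
  (forall t, u1 (cl s) @[s --> t] --> u1 (cl t)) ->
  (forall t, I t -> x t != 0 \/ u t != 0) ->
  exists r th : R -> R, `|th t0| <= pi /\ forall t, I t -> let C := cos (th t) in let S := sin (th t) in
    [/\ 0 < r t, x t = r t * C, u t = - (r t ^+ N.+1 * S),
      is_derive t 1 th (- (C * (u1 t / r t ^+ N) + N.+1%:R * S * x1 t)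
        / (r t * (C ^+ 2 + N.+1%:R * S ^+ 2))) &
      is_derive t 1 r ((C * x1 t - S * (u1 t / r t ^+ N))
        / (C ^+ 2 + N.+1%:R * S ^+ 2))].
Proof.
move=> cI Icl clI It0 ccl dx du cx1 cu1 nz.
pose r t := gauge (x t) (u t).
pose c t := x t / r t; pose s t := - (u t / r t ^+ N.+1).
have hr t (It : I t) := gaugeP (nz t It).
have rp t : I t -> 0 < r t by move=> /hr[].
have cs t : I t -> c t ^+ 2 + s t ^+ 2 = 1.
  move=> It; have [r0 E] := hr t It; rewrite -/(r t) in r0 E.
  have rn : r t != 0 by rewrite gt_eqF.
  rewrite /c /s sqrrN !expr_div_n -E [r t ^+ N.+1]exprS.
  by field; rewrite rn expf_neq0.
pose De t := c t ^+ 2 + N.+1%:R * s t ^+ 2.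
have Dp t : I t -> 0 < De t.
  move=> It; apply: (@lt_le_trans _ _ 1) => //; rewrite -(cs t It) lerD2l.
  by rewrite ler_peMl ?sqr_ge0// ler1n.
pose om t : R := - (c t * (u1 t / r t ^+ N) + N.+1%:R * s t * x1 t) / (r t * De t).
have dr t : I t -> is_derive t 1 r ((c t * x1 t - s t * (u1 t / r t ^+ N)) / De t).
  move=> It; have := gauge_derive (nz t It) (dx t It) (du t It).
  rewrite -/(r t) => /is_derive_val; apply.
  have r0 := rp t It; have rn : r t != 0 by rewrite gt_eqF.
  have D0 := Dp t It; have hcs := cs t It.
  have xE : x t = r t * c t by rewrite /c mulrC divfK.
  have uE : u t = - (r t ^+ N.+1 * s t).
    by rewrite /s mulrN opprK mulrC divfK// expf_neq0.
  have s2 : c t ^+ 2 = 1 - s t ^+ 2 by rewrite -hcs addrK.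
  have -> : N.+1%:R * r t ^+ N * (r t ^+ N.+1 *+ 2)
        - x t ^+ 2 * ((N%:R * r t ^+ N.-1) * (r t ^+ N *+ 2)) =
        2 * r t * (r t ^+ N) ^+ 2 * De t.
    rewrite xE exprMn s2 /De s2 !mulr2n -[N.+1%:R]/((1 + N)%:R) natrD.
    case: (N) => [|k] /=; first by rewrite !expr0 expr1; ring.
    by rewrite !exprS; ring.
  have A (r' q c' s' D' v w : R) : r' != 0 -> q != 0 -> D' != 0 ->
      (q ^+ 2 * (2 * (r' * c') * v) + 2 * (- (r' * q * s')) * w) / (2 * r' * q ^+ 2 * D')
      = (c' * v - s' * (w / q)) / D'.
    by move=> r'0 q0 D'0; field; rewrite r'0 q0 D'0.
  rewrite xE uE [r t ^+ N.+1]exprS; apply: A => //; [by rewrite expf_neq0|by rewrite gt_eqF].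
have dc t : I t -> is_derive t 1 c (- (om t * s t)).
  move=> It; have r0 := rp t It; have rn : r t != 0 by rewrite gt_eqF.
  have D0 := Dp t It; have hcs := cs t It.
  have := is_derive_mul (dx t It) (is_derive_inv rn (dr t It)).
  move=> /is_derive_val; apply.
  have xE : x t = r t * c t by rewrite /c mulrC divfK.
  have A (r' c' s' k D' v w : R) : r' != 0 -> D' != 0 -> D' = c' ^+ 2 + k * s' ^+ 2 ->
      r' * c' * - ((c' * v - s' * w) / D' / r' ^+ 2) + v * r'^-1 =
      - (- (c' * w + k * s' * v) / (r' * D') * s').
    move=> r'0 D'0 h2; have -> : v * r'^-1 = (c' ^+ 2 + k * s' ^+ 2) * v / (r' * D').
      by rewrite -h2; field; rewrite r'0 D'0.
    by field; rewrite r'0 D'0.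
  rewrite addrC xE /om; apply: A => //; exact: lt0r_neq0.
have ds t : I t -> is_derive t 1 s (om t * c t).
  move=> It; have r0 := rp t It; have rn : r t != 0 by rewrite gt_eqF.
  have D0 := Dp t It.
  have rN : r t ^+ N.+1 != 0 by rewrite expf_neq0.
  have dI := @is_derive_inv (fun v => r v ^+ N.+1) _ _ rN (is_derive_pow N (dr t It)).
  have := is_deriveN (is_derive_mul (du t It) dI).
  move=> /is_derive_val; apply.
  have uE : u t = - (r t ^+ N.+1 * s t).
    by rewrite /s mulrN opprK mulrC divfK// expf_neq0.
  have A (r' q c' s' k D' v w : R) : r' != 0 -> q != 0 -> D' != 0 ->
      D' = c' ^+ 2 + k * s' ^+ 2 ->
      - (- (r' * q * s') * - (k * q * ((c' * v - s' * (w / q)) / D') / (r' * q) ^+ 2)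
         + w * (r' * q)^-1) = - (c' * (w / q) + k * s' * v) / (r' * D') * c'.
    move=> r'0 q0 D'0 h2.
    have -> : w * (r' * q)^-1 = (c' ^+ 2 + k * s' ^+ 2) * w / (r' * q * D').
      by rewrite -h2; field; rewrite r'0 q0 D'0.
    by field; rewrite r'0 q0 D'0.
  rewrite addrC uE /om ![r t ^+ N.+1]exprS; apply: A => //; [by rewrite expf_neq0|exact: lt0r_neq0].
have ccx t : x (cl q) @[q --> t] --> x (cl t).
  exact: (cvg_comp _ _ (ccl t) (is_derive_cvg (dx _ (Icl t)))).
have ccu t : u (cl q) @[q --> t] --> u (cl t).
  exact: (cvg_comp _ _ (ccl t) (is_derive_cvg (du _ (Icl t)))).
have ccr t : r (cl q) @[q --> t] --> r (cl t).
  exact: (@gauge_cvg (x \o cl) (u \o cl) t (nz _ (Icl t)) (ccx t) (ccu t)).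
have com t : om (cl q) @[q --> t] --> om (cl t).
  have r0 := rp _ (Icl t); have rn : r (cl t) != 0 by rewrite gt_eqF.
  have D0 := Dp _ (Icl t).
  have cV : (r (cl q))^-1 @[q --> t] --> (r (cl t))^-1 by apply: cvgV => //; exact: ccr.
  have cc : c (cl q) @[q --> t] --> c (cl t) by apply: cvgM => //; exact: ccx.
  have rNV k : (r (cl q) ^+ k)^-1 @[q --> t] --> (r (cl t) ^+ k)^-1.
    by apply: cvgV; [rewrite expf_neq0|apply: cvg_exprn; exact: ccr].
  have cs' : s (cl q) @[q --> t] --> s (cl t).
    by apply: cvgN; apply: cvgM; [exact: ccu|exact: rNV].
  apply: cvgM.
    apply: cvgN; apply: cvgD; apply: cvgM => //.
    - by apply: cvgM; [exact: cu1|exact: rNV].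
    - by apply: cvgM => //; exact: cvg_cst.
    - exact: cx1.
  apply: cvgV; first by rewrite mulf_neq0// gt_eqF.
  apply: cvgM; first exact: ccr.
  apply: cvgD; first exact: cvg_exprn.
  by apply: cvgM; [exact: cvg_cst|exact: cvg_exprn].
have [Th [_ dTh]] := antiderivative com.
have [p0 [p0c p0s p0pi]] := angle_exists (cs t0 It0).
pose th t := Th t + (p0 - Th t0).
have dth t : I t -> is_derive t 1 th (om t).
  move=> It; have := is_deriveD (dTh t) (is_derive_cst (p0 - Th t0) t 1).
  by rewrite addr0 clI.
have th0 : th t0 = p0 by rewrite /th addrC subrK.
pose a t : R := c t * cos (th t) + s t * sin (th t).
pose b t : R := s t * cos (th t) - c t * sin (th t).
have dcos t : I t -> is_derive t 1 (fun t => cos (th t)) (- sin (th t) * om t).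
  by move=> It; exact: (@is_derive1_comp _ cos th t _ _ (is_derive_cos _) (dth t It)).
have dsin t : I t -> is_derive t 1 (fun t => sin (th t)) (cos (th t) * om t).
  by move=> It; exact: (@is_derive1_comp _ sin th t _ _ (is_derive_sin _) (dth t It)).
have da t : I t -> is_derive t 1 a 0.
  move=> It; have := is_deriveD (is_derive_mul (dc t It) (dcos t It))
    (is_derive_mul (ds t It) (dsin t It)).
  by move=> /is_derive_val; apply; ring.
have db t : I t -> is_derive t 1 b 0.
  move=> It; have := is_deriveB (is_derive_mul (ds t It) (dcos t It))
    (is_derive_mul (dc t It) (dsin t It)).
  by move=> /is_derive_val; apply; ring.
have cst (f : R -> R) : (forall t, I t -> is_derive t 1 f 0) -> forall t, I t -> f t = f t0.
  move=> df t It; apply/eqP; rewrite -subr_eq0 -normr_le0.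
  have H p q : I p -> I q -> p <= q -> `|f q - f p| <= 0.
    move=> Ip Iq pq; rewrite -(mul0r (q - p)).
    apply: (@derive_dominated R f (fun=> 0) id (fun=> 1)) => // v hv.
    - by apply: df; exact: cI hv.
    - by rewrite normr0 mul0r.
  have [tt|tt] := leP t0 t; first exact: H.
  by rewrite distrC; apply: H => //; exact: ltW.
have a1 t : I t -> a t = 1.
  move=> It; rewrite (cst a)// /a th0 p0c p0s -!expr2; exact: cs.
have b0 t : I t -> b t = 0.
  by move=> It; rewrite (cst b)// /b th0 p0c p0s mulrC subrr.
have cE t : I t -> cos (th t) = c t.
  move=> It; have h1 := a1 t It; have h2 := b0 t It; have h3 := cos2Dsin2 (th t).
  rewrite -[c t]mulr1 -h3 (_ : c t * _ = cos (th t) * a t - sin (th t) * b t).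
    by rewrite h1 h2 mulr0 subr0 mulr1.
  by rewrite /a /b; ring.
have sE t : I t -> sin (th t) = s t.
  move=> It; have h1 := a1 t It; have h2 := b0 t It; have h3 := cos2Dsin2 (th t).
  rewrite -[s t]mulr1 -h3 (_ : s t * _ = sin (th t) * a t + cos (th t) * b t).
    by rewrite h1 h2 mulr0 addr0 mulr1.
  by rewrite /a /b; ring.
exists r, th; split; first by rewrite th0.
move=> t It /=; rewrite cE// sE//.
have r0 := rp t It; have rn : r t != 0 by rewrite gt_eqF.
split=> //; [by rewrite /c mulrC divfK| |exact: dth|exact: dr].
by rewrite /s mulrN opprK mulrC divfK// expf_neq0.
Qed.
End PolarLift.

(** * Box dimension of slow sequences *)

Section BoxDim.
Variable R : realType.

Lemma limf_einf_ge (f : R -> \bar R) (c : \bar R) (F : set_system R) {FF : Filter F} :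
  (\forall e \near F, (c <= f e)%E) -> (c <= limf_einf f F)%E.
Proof.
move=> h; rewrite limf_einfE; apply: ereal_sup_ge.
exists (ereal_inf (f @` [set e | (c <= f e)%E])).
  by exists [set e | (c <= f e)%E].
by apply/ereal_infP => _ [e he <-].
Qed.

Lemma limf_einf_le (f : R -> \bar R) (c : \bar R) (F : set_system R) {FF : ProperFilter F} :
  (\forall e \near F, (f e <= c)%E) -> (limf_einf f F <= c)%E.
Proof.
move=> h; rewrite limf_einfE; apply: ge_ereal_sup => _ [V FV <-].
have [e [Ve he]] := filter_ex (filterI FV h).
by apply: le_trans he; apply: ereal_inf_lbound; exists e.
Qed.

Lemma near0_powR (c p : R) : 0 < c -> 0 < p -> \forall e \near (0 : R)^'+, e `^ p <= c.
Proof.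
move=> c0 p0; near=> e.
have e0 : 0 < e by near: e; exact: nbhs_right_gt.
have ec : e <= c `^ p^-1 by near: e; apply: nbhs_right_le; exact: powR_gt0.
rewrite (le_trans (ge0_ler_powR (ltW p0) _ _ ec)) ?nnegrE ?powR_ge0 ?(ltW e0)//.
by rewrite -powRrM mulVf ?gt_eqF// powRr1 ?(ltW c0).
Unshelve. all: by end_near. Qed.

Lemma slow_sequence_nbhd (s : nat -> R) (C : R) (b : nat) :
  (forall i, 0 < s i) -> s i @[i --> \oo] --> (0 : R) -> 0 < C ->
  (forall i, `|s i.+1 - s i| <= C * s i ^+ b.+2) ->
  exists c : R, 0 < c /\ \forall e \near (0 : R)^'+,
    `]0, c * e `^ (b.+2%:R^-1)[ `<=` eps_nbhd (range s) e.
Proof.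
move=> s0 sc C0 hs.
pose c : R := (2 ^+ b.+2 * C + 1)^-1.
have c0 : 0 < c by rewrite invr_gt0 ltr_wpDl// mulr_ge0 ?exprn_ge0 ?(ltW C0).
have c'1 : 1 <= 2 ^+ b.+2 * C + 1 by rewrite lerDr mulr_ge0 ?exprn_ge0 ?(ltW C0).
have c1 : c <= 1 by rewrite invf_le1// (lt_le_trans ltr01).
pose d : R := Num.min 1 (2 * C)^-1.
have d0 : 0 < d by rewrite lt_min ltr01 invr_gt0 mulr_gt0.
have small (y : R) : 0 < y -> exists i0, forall i, (i0 <= i)%N -> s i < y.
  move=> y0; move/cvgr_dist_lt: sc => /(_ _ y0)[i _ hi].
  by exists i => j /hi /=; rewrite sub0r normrN gtr0_norm.
have [i0 sd] := small d d0.
have half i : (i0 <= i)%N -> s i <= 2 * s i.+1.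
  move=> ii; have := hs i; have := sd i ii; rewrite lt_min => /andP[s1 s2].
  have : C * s i ^+ b.+2 <= s i / 2.
    rewrite exprS mulrCA ler_pM2l//; apply: (@le_trans _ _ (C * s i)).
      by rewrite ler_pM2l// exprS ger_pMr// exprn_ile1 ?(ltW (s0 _)) ?(ltW s1).
    move: s2; rewrite -[(2 * C)^-1]div1r ltr_pdivlMr ?mulr_gt0// => s2.
    by apply/ltW; move: s2; lra.
  by rewrite ler_norml => h /andP[h' _]; move: h h'; lra.
exists c; split=> //; near=> e.
have e0 : 0 < e by near: e; exact: nbhs_right_gt.
have ey : e `^ (b.+2%:R^-1) <= s i0.
  by near: e; apply: near0_powR => //; rewrite invr_gt0.
move=> y /=; rewrite in_itv /= => /andP[y0 yc].
have ys : y < s i0.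
  apply: (lt_le_trans yc); apply: le_trans ey; rewrite ger_pMl// powR_gt0//.
have [j hj] := small y y0.
have ex : exists i, s (i + i0)%N <= y.
  by exists j; apply/ltW/hj/leq_addr.
case: (ex_minnP ex) => i hi mi.
case: i => [|i] in hi mi *; first by move: hi; rewrite add0n leNgt ys.
have yi : y < s (i + i0)%N.
  by rewrite ltNge; apply/negP => /mi; rewrite ltnn.
have h2 : s (i + i0)%N <= 2 * y.
  by rewrite (le_trans (half _ (leq_addl _ _)))// ler_pM2l.
exists (s (i + i0).+1); first by exists (i + i0).+1.
have := hs (i + i0)%N; rewrite /ball /= => hh.
rewrite addSn in hi.
have : `|s (i + i0).+1 - y| <= C * s (i + i0)%N ^+ b.+2.
  apply: le_trans hh; rewrite !ler0_norm ?subr_le0// ?(le_trans hi) ?(ltW yi)//.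
  by rewrite lerN2 lerD2l lerN2 ltW.
move=> /le_lt_trans; apply.
apply: (@le_lt_trans _ _ (C * (2 * y) ^+ b.+2)).
  by rewrite ler_pM2l// lerXn2r// nnegrE ?mulr_ge0 ?(ltW (s0 _)) ?(ltW y0).
have yE : y ^+ b.+2 < c ^+ b.+2 * e.
  have -> : c ^+ b.+2 * e = (c * e `^ (b.+2%:R^-1)) ^+ b.+2.
    by rewrite exprMn -[(e `^ _) ^+ _]powR_mulrn ?powR_ge0// -powRrM mulVf// powRr1// ltW.
  by rewrite ltr_pXn2r// nnegrE ?mulr_ge0 ?powR_ge0 ?(ltW c0) ?(ltW y0).
have yE2 : y ^+ b.+2 < c * e.
  apply: (lt_le_trans yE); rewrite ler_pM2r// exprS ger_pMr//.
  by rewrite exprn_ile1 ?(ltW c0).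
rewrite exprMn mulrA; apply: (@lt_le_trans _ _ ((C * 2 ^+ b.+2) * (c * e))).
  by rewrite ltr_pM2l// mulr_gt0// exprn_gt0.
rewrite mulrA ger_pMl// /c ler_pdivrMr ?mul1r; last by rewrite ltr_wpDl// mulr_ge0 ?exprn_ge0 ?(ltW C0).
by rewrite mulrC lerDl.
Unshelve. all: by end_near. Qed.

Lemma eps_nbhd_measurable (A : set R) (e : R) : measurable (eps_nbhd A e).
Proof.
apply: measurable_realfun.open_measurable; rewrite /eps_nbhd; apply: bigcup_open => a _.
exact: ball_open.
Qed.

(** From the index where the steps become shorter than epsilon on, the epsilon-balls
    cover an interval of length of order epsilon^(1/N), where N is the exponent of
    the step bound; this bounds the Minkowski content from below. *)
Lemma slow_sequence_dim (s : nat -> R) (C d : R) (b : nat) :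
  (forall i, 0 < s i) -> s i @[i --> \oo] --> (0 : R) -> 0 < C ->
  (forall i, `|s i.+1 - s i| <= C * s i ^+ b.+2) ->
  has_box_dim (range s) d -> 1 - b.+2%:R^-1 <= d.
Proof.
move=> s0 sc C0 hs [hd _]; rewrite leNgt; apply/negP => db.
have := db; rewrite -lte_fin -hd => /ereal_inf_lt[_ [sg [sg0 hsg] <-]].
rewrite lte_fin => sgb.
have [c [c0 hc]] := slow_sequence_nbhd s0 sc C0 hs.
suff : (c%:E <= lower_minkowski (range s) sg)%E by rewrite hsg lee_fin leNgt c0.
apply: limf_einf_ge; near=> e.
have e0 : 0 < e by near: e; exact: nbhs_right_gt.
have e1 : e <= 1 by near: e; exact: nbhs_right_le.
have hc' : `]0, c * e `^ (b.+2%:R^-1)[ `<=` eps_nbhd (range s) e by near: e.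
have p0 : 0 < c * e `^ (b.+2%:R^-1) by rewrite mulr_gt0 ?powR_gt0.
have hm : ((c * e `^ (b.+2%:R^-1))%:E <= lebesgue_measure (eps_nbhd (range s) e))%E.
  have <- : lebesgue_measure `]0, c * e `^ (b.+2%:R^-1)[%classic = (c * e `^ (b.+2%:R^-1))%:E.
    by rewrite lebesgue_measure_itv /= lte_fin p0 oppr0 adde0.
  apply: le_measure => //; rewrite inE; first exact: measurable_itv.
  exact: eps_nbhd_measurable.
apply: (@le_trans _ _ ((c * e `^ (b.+2%:R^-1))%:E * (e `^ (1 - sg))^-1%:E)%E).
  rewrite -EFinM lee_fin -mulrA ler_peMr ?(ltW c0)// -powRN -powRD; last first.
    by rewrite (gt_eqF e0) implybT.
  rewrite -[leLHS](powRr0 e) ; apply: ger_powR; first by rewrite e0.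
  by move: (b.+2%:R^-1) sgb => v; lra.
by rewrite lee_wpmul2r// lee_fin invr_ge0 powR_ge0.
Unshelve. all: by end_near. Qed.

(** A finite set has content of order epsilon, hence no positive dimension; the
    crude bound 1/2 suffices to separate it from the dimensions in play. *)
Lemma finite_dim (s : nat -> R) (N : nat) (d : R) :
  (forall i, exists2 j, (j <= N)%N & s i = s j) ->
  has_box_dim (range s) d -> d <= 2^-1.
Proof.
move=> hN [hd _]; rewrite -lee_fin -hd; apply: ereal_inf_lbound.
exists 2^-1 => //; split; first by rewrite invr_gt0.
have cov e : eps_nbhd (range s) e `<=` \big[setU/set0]_(j < N.+1) ball (s j) e.
  move=> y [_ [i _ <-]] hy; have [j jN sj] := hN i.
  by rewrite -(bigcup_mkord N.+1 (fun j => ball (s j) e)); exists j; rewrite //= -sj.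
have mle (e : R) : 0 < e ->
  (lebesgue_measure (eps_nbhd (range s) e) <= (N.+1%:R * (e *+ 2))%:E)%E.
  move=> e0; apply: (@le_trans _ _ (\sum_(j < N.+1) (lebesgue_measure (ball (s j) e)))%E).
    apply: (@content_subadditive _ _ _ (@lebesgue_measure R) _ (fun j => ball (s j) e)) => //.
    - by move=> j _; apply: measurable_realfun.open_measurable; exact: ball_open.
    - exact: eps_nbhd_measurable.
  rewrite (eq_bigr (fun=> (e *+ 2)%:E)) => [|j _]; last first.
    by rewrite lebesgue_measure_ball// ltW.
  by rewrite sumEFin sumr_const card_ord mulr_natl.
apply/eqP; rewrite eq_le; apply/andP; split; last first.
  apply: limf_einf_ge; near=> e; rewrite mule_ge0// lee_fin invr_ge0 powR_ge0//.
suff H (eps : R) : 0 < eps -> (lower_minkowski (range s) 2^-1 <= eps%:E)%E.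
  by apply/lee_addgt0Pr => q q0; rewrite add0e; exact: H.
move=> eps0; apply: limf_einf_le; near=> e.
have e0 : 0 < e by near: e; exact: nbhs_right_gt.
have he : e `^ 2^-1 <= eps / (N.+1%:R * 2).
  by near: e; apply: near0_powR; rewrite ?invr_gt0// divr_gt0// mulr_gt0.
apply: (@le_trans _ _ ((N.+1%:R * (e *+ 2))%:E * (e `^ (1 - 2^-1))^-1%:E)%E).
  by rewrite lee_wpmul2r ?mle// lee_fin invr_ge0 powR_ge0.
rewrite (_ : 1 - 2^-1 = 2^-1 :> R); last by lra.
have eE : e = e `^ 2^-1 * e `^ 2^-1.
  rewrite -powRD; last by rewrite (gt_eqF e0) implybT.
  by rewrite (_ : 2^-1 + 2^-1 = 1 :> R) ?powRr1 ?(ltW e0)//; lra.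
have v0 : 0 < e `^ 2^-1 by exact: powR_gt0.
rewrite -EFinM lee_fin {1}eE; move: he; rewrite ler_pdivlMr ?mulr_gt0// => he.
rewrite ler_pdivrMr// -mulr_natr.
rewrite (_ : _ * _ = (e `^ 2^-1 * (N.+1%:R * 2)) * e `^ 2^-1); last by ring.
by rewrite ler_pM2r.
Unshelve. all: by end_near. Qed.
End BoxDim.

(** * Divided differences of the system *)

Section SystemGerm.
Variables (R : realType) (l : nat).
Implicit Types (x y : R) (d del : 'rV[R]_l).

Definition hvec x y d : 'I_(1 + (1 + l)) -> R :=
  fun i => row_mx x%:M (row_mx y%:M d) ord0 i.
Definition ix : 'I_(1 + (1 + l)) := lshift (1 + l) ord0.
Definition iy : 'I_(1 + (1 + l)) := rshift 1 (lshift l ord0).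

Lemma hvec_x x y d : hvec x y d ix = x.
Proof. by rewrite /hvec row_mxEl !mxE. Qed.
Lemma hvec_y x y d : hvec x y d iy = y.
Proof. by rewrite /hvec row_mxEr row_mxEl !mxE. Qed.
Lemma hvec_d x y d j : hvec x y d (rshift 1 (rshift 1 j)) = d ord0 j.
Proof. by rewrite /hvec !row_mxEr. Qed.

Lemma index_ind (P : 'I_(1 + (1 + l)) -> Prop) :
  P ix -> P iy -> (forall j, P (rshift 1 (rshift 1 j))) -> forall i, P i.
Proof.
move=> hx hy hd i; case: (split_ordP i) => j ->; first by rewrite ord1.
by case: (split_ordP j) => k ->; rewrite ?ord1.
Qed.

Lemma hvec_sub x y x' y' d :
  \sum_i `|hvec x y d i - hvec x' y' d i| = `|x - x'| + `|y - y'|.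
Proof.
rewrite !big_split_ord /= !big_ord1 (hvec_x x y d) (hvec_x x' y' d).
rewrite (hvec_y x y d) (hvec_y x' y' d) big1 ?addr0// => j _.
by rewrite !hvec_d subrr normr0.
Qed.

Lemma hvec_le x y d e : `|x| <= e -> `|y| <= e -> `|d| <= e ->
  forall i, `|hvec x y d i| <= e.
Proof.
move=> hx hy hd; apply: index_ind => [||j]; rewrite ?hvec_x ?hvec_y ?hvec_d//.
apply: le_trans hd; rewrite [`|d|]mx_normrE.
by apply: (le_bigmax _ (fun i : 'I_1 * 'I_l => `|d i.1 i.2|) (ord0, j)).
Qed.

Lemma upd_x x y d x' : upd (hvec x y d) ix x' = hvec x' y d.
Proof.
apply/funext; apply: index_ind => [||j]; rewrite /upd.
- by rewrite eqxx hvec_x.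
- by rewrite (_ : iy == ix = false)// !hvec_y.
- by rewrite (_ : _ == ix = false)// !hvec_d.
Qed.

Lemma upd_y x y d y' : upd (hvec x y d) iy y' = hvec x y' d.
Proof.
apply/funext; apply: index_ind => [||j]; rewrite /upd.
- by rewrite (_ : ix == iy = false)// !hvec_x.
- by rewrite eqxx hvec_y.
- by rewrite (_ : _ == iy = false) ?hvec_d//.
Qed.

Variable del0 : 'rV[R]_l.

Lemma jointly_analytic_germ (X : R -> R -> 'rV[R]_l -> R) :
  jointly_analytic_at X 0 0 del0 ->
  exists g, analytic_germ g /\ forall x y del, X x y del = g (hvec x y (del - del0)).
Proof.
move=> /analytic_at_germ hX; eexists; split; first exact: hX.
move=> x y del.
have -> : \row_i hvec x y (del - del0) i = row_mx x%:M (row_mx y%:M (del - del0)).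
  by apply/rowP => i; rewrite mxE.
rewrite !add_row_mx !row_mxKl !row_mxKr !row_mxKl !mxE eqxx !mulr1n !add0r.
by rewrite addrC subrK.
Qed.

Definition dd_bounds (X : R -> R -> R) (e K : R) (A B : R -> R -> R -> R) : Prop :=
  [/\ forall x y z, `|x| <= e -> `|y| <= e -> `|z| <= e ->
        X x y - X x z = (y - z) * A x y z,
      forall x y z, `|x| <= e -> `|y| <= e -> `|z| <= e ->
        X x y - X z y = (x - z) * B x y z,
      forall x y z x' y' z', `|x| <= e -> `|y| <= e -> `|z| <= e ->
        `|x'| <= e -> `|y'| <= e -> `|z'| <= e ->
        `|A x y z - A x' y' z'| <= K * (`|x - x'| + `|y - y'| + `|z - z'|) &
      forall x y z x' y' z', `|x| <= e -> `|y| <= e -> `|z| <= e ->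
        `|x'| <= e -> `|y'| <= e -> `|z'| <= e ->
        `|B x y z - B x' y' z'| <= K * (`|x - x'| + `|y - y'| + `|z - z'|)].

Lemma germ_dd_lip g i : analytic_germ g -> exists D : ('I_(1 + (1 + l)) + unit -> R) -> R,
  exists K : R, 0 <= K /\ \forall e \near (0 : R)^'+,
  (forall h k, (forall j, `|h j| <= e) -> `|k| <= e ->
     g h = g (upd h i k) + (h i - k) * D (ext h k)) /\
  forall x y d z x' y' z', `|x| <= e -> `|y| <= e -> `|z| <= e ->
        `|x'| <= e -> `|y'| <= e -> `|z'| <= e -> `|d| <= e ->
    `|D (ext (hvec x y d) z) - D (ext (hvec x' y' d) z')|
      <= K * (`|x - x'| + `|y - y'| + `|z - z'|).
Proof.
move=> hg; have [D [hD0 [rho rho0 hD]]] := germ_dd i hg.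
have [K [K0 hK]] := germ_lip (lexx (1 : R)) hD0.
exists D, K; split=> //; near=> e.
have er : e <= rho by near: e; exact: nbhs_right_le.
split=> [h k hh hk|]; first by apply: hD => [j|]; exact: le_trans er.
move=> x y d z x' y' z' hx hy hz hx' hy' hz' hd.
have hK' : forall h k : 'I_(1 + (1 + l)) + unit -> R,
  (forall i, `|h i| <= e) -> (forall i, `|k i| <= e) ->
  `|D h - D k| <= K * \sum_i `|h i - k i| by near: e.
have small u v w : `|u| <= e -> `|v| <= e -> `|w| <= e ->
    forall o, `|ext (hvec u v d) w o| <= e.
  by move=> hu hv hw [j|[]] //=; exact: hvec_le.
apply: le_trans (hK' _ _ (small _ _ _ hx hy hz) (small _ _ _ hx' hy' hz')) _.
rewrite ler_wpM2l// big_sumType /= hvec_sub lerD2l.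
by rewrite sumr_const card_unit mulr1n.
Unshelve. all: by end_near. Qed.

Lemma germ_dd_bounds (X : R -> R -> 'rV[R]_l -> R) : jointly_analytic_at X 0 0 del0 ->
  exists K : R, 0 <= K /\ \forall e \near (0 : R)^'+, forall del,
    `|del - del0| <= e -> exists A B, dd_bounds (fun x y => X x y del) e K A B.
Proof.
move=> /jointly_analytic_germ[g [hg XE]].
have [A [KA [KA0 hA]]] := germ_dd_lip iy hg.
have [B [KB [KB0 hB]]] := germ_dd_lip ix hg.
exists (KA + KB); split; first exact: addr_ge0.
apply: filterS2 hA hB => e [hA1 hA2] [hB1 hB2] del hd.
exists (fun x y z => A (ext (hvec x y (del - del0)) z)).
exists (fun x y z => B (ext (hvec x y (del - del0)) z)).
split=> [x y z hx hy hz|x y z hx hy hz|x y z x' y' z' hx hy hz hx' hy' hz'|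
         x y z x' y' z' hx hy hz hx' hy' hz'].
- rewrite !XE (hA1 (hvec x y (del - del0)) z) ?upd_y ?hvec_y//; last exact: hvec_le.
  by rewrite addrC addKr.
- rewrite !XE (hB1 (hvec x y (del - del0)) z) ?upd_x ?hvec_x//; last exact: hvec_le.
  by rewrite addrC addKr.
- apply: le_trans (hA2 _ _ _ _ _ _ _ hx hy hz hx' hy' hz' hd) _.
  by rewrite ler_wpM2r ?addr_ge0// lerDl.
- apply: le_trans (hB2 _ _ _ _ _ _ _ hx hy hz hx' hy' hz' hd) _.
  by rewrite ler_wpM2r ?addr_ge0// lerDr.
Qed.

Variable kappa : R.
Hypothesis hkappa : 1 <= kappa.

Lemma coef_del (j : 'I_l) : coef del0 (fun (_ : R) del => (del - del0) ord0 j).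
Proof.
split=> [t||eps eps0]; first exact: cvg_cst.
  by exists 0 => _; rewrite subrr mxE normr0.
near=> e => del hd t; rewrite [X in _ - X](_ : _ = 0) ?subr0; last by rewrite subrr mxE.
rewrite -(hvec_d 0 0); apply: le_trans (hvec_le (e := e) _ _ hd _) _.
- by rewrite normr0.
- by rewrite normr0.
- by near: e; exact: nbhs_right_le.
Unshelve. all: by end_near. Qed.

Lemma expandable_system n (X : R -> R -> 'rV[R]_l -> R) (H1 H2 : R -> 'rV[R]_l -> R -> R) :
  jointly_analytic_at X 0 0 del0 ->
  expandable del0 kappa n H1 -> expandable del0 kappa n H2 ->
  expandable del0 kappa n (fun t del r => X (r * H1 t del r) (r * H2 t del r) del).
Proof.
move=> /jointly_analytic_germ[g [hg XE]] h1 h2.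
pose c i (t : R) del := hvec 0 0 (del - del0) i.
pose H i t del r := hvec (H1 t del r) (H2 t del r) 0 i.
have := @expandable_germ R l del0 kappa hkappa n _ g c H hg.
have -> : (fun t del r => X (r * H1 t del r) (r * H2 t del r) del) =
   (fun t del r => g (fun i => c i t del + r * H i t del r)).
  apply/funext => t; apply/funext => del; apply/funext => r; rewrite XE; congr g.
  apply/funext; apply: index_ind => [||j]; rewrite /c /H ?hvec_x ?hvec_y ?hvec_d ?add0r//.
  by rewrite [in RHS](_ : fun_of_matrix 0 ord0 j = 0) ?mxE ?mulr0 ?addr0 //.
apply.
- apply: index_ind => [||j].
  + rewrite (_ : c ix = fun _ _ => 0); first exact: coef_cst.
    by apply/funext => t; apply/funext => del; rewrite /c hvec_x.
  + rewrite (_ : c iy = fun _ _ => 0); first exact: coef_cst.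
    by apply/funext => t; apply/funext => del; rewrite /c hvec_y.
  + rewrite (_ : c _ = fun _ del => (del - del0) ord0 j); first exact: coef_del.
    by apply/funext => t; apply/funext => del; rewrite /c hvec_d.
- by apply: index_ind => [||j] t; rewrite /c ?hvec_x ?hvec_y ?hvec_d// subrr mxE.
- apply: index_ind => [||j].
  + by rewrite (_ : H ix = H1)//; do 3!apply/funext => ?; rewrite /H hvec_x.
  + by rewrite (_ : H iy = H2)//; do 3!apply/funext => ?; rewrite /H hvec_y.
  + rewrite (_ : H _ = fun _ _ _ => 0); first exact: expandable_cst.
    by do 3!apply/funext => ?; rewrite /H hvec_d mxE.
Qed.

End SystemGerm.

(** * The characteristic curve and positivity of the angular velocity *)

Section Estimates.
Variable R : realType.

Lemma poly_taylor (p : {poly R}) : exists2 L : R, 0 <= L & forall x h : R,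
  `|x| <= 1 -> `|x + h| <= 1 ->
  [/\ `|p.[x]| <= L, `|p.[x + h] - p.[x]| <= L * `|h| &
      `|p.[x + h] - p.[x] - h * p^`().[x]| <= L * `|h| ^+ 2].
Proof.
elim/poly_ind: p => [|p c [L L0 hL]].
  exists 0 => // x h _ _; rewrite deriv0 !horner0 mulr0 !subr0 normr0 !mul0r.
  by split.
have [L1 [L10 L2 L3 L4]] : exists L1 : R, [/\ 0 <= L1, L + `|c| <= L1, 2 * L <= L1 & L <= L1].
  exists (2 * L + `|c|); split; have := normr_ge0 c; lra.
exists L1 => // x h hx hxh; have [h1 h2 h3] := hL x h hx hxh.
have hx' : 0 <= `|x| <= 1 by rewrite normr_ge0.
rewrite derivD derivC addr0 derivM derivX mulr1 !(hornerD, hornerMX, hornerC).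
split.
- apply: le_trans L2; apply: le_trans (ler_normD _ _) _; rewrite lerD2r normrM.
  by rewrite -[leRHS]mulr1 ler_pM.
- rewrite (_ : _ - _ = x * (p.[x + h] - p.[x]) + h * p.[x + h]); last by ring.
  apply: le_trans (ler_normD _ _) _; rewrite !normrM.
  have hp : `|p.[x + h]| <= L.
    by have := hL (x + h) 0; rewrite addr0 => -/(_ hxh hxh)[].
  apply: (@le_trans _ _ (1 * (L * `|h|) + `|h| * L)).
    by apply: lerD; apply: ler_pM.
  by rewrite mul1r mulrC -mulr2n -mulr_natl mulrA -mulrA [`|h| * L]mulrC mulrA ler_wpM2r.
- rewrite (_ : _ - _ = x * (p.[x + h] - p.[x] - h * p^`().[x]) + h * (p.[x + h] - p.[x])); last by ring.
  apply: le_trans (ler_normD _ _) _; rewrite !normrM.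
  apply: (@le_trans _ _ (1 * (L * `|h| ^+ 2) + `|h| * (L * `|h|))).
    by apply: lerD; apply: ler_pM.
  rewrite (_ : _ + _ = (2 * L) * `|h| ^+ 2); last by ring.
  by rewrite ler_wpM2r// exprn_ge0.
Qed.

(** Convergence at one positive point bounds the coefficients geometrically. *)
Lemma series_lead (a : nat -> R) (s : nat) (F : R -> R) :
  (\forall x \near (0 : R),
    (\sum_(s <= j < N) a j * x ^+ j) @[N --> \oo] --> F x) ->
  exists C e : R, [/\ 0 <= C, 0 < e &
    forall x, `|x| <= e -> `|F x - a s * x ^+ s| <= C * `|x| ^+ s.+1].
Proof.
move=> [d /= d0 hd].
have cvx (x : R) : `|x| < d -> (\sum_(s <= j < N) a j * x ^+ j) @[N --> \oo] --> F x.
  by move=> xd; apply: hd => /=; rewrite sub0r normrN.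
pose rho := d / 2; have rho0 : 0 < rho by rewrite divr_gt0.
have rd : `|rho| < d by rewrite gtr0_norm// ltr_pdivrMr// ltr_pMr// ltr1n.
have [M M0 hM] : exists2 M : R, 0 <= M & forall j, (s <= j)%N -> `|a j| * rho ^+ j <= M.
  have : bounded_fun (fun N => \sum_(s <= j < N) a j * rho ^+ j).
    by apply: cvg_seq_bounded; apply/cvg_ex; exists (F rho); exact: cvx.
  move=> [M [_ hM']].
  have hM j : `|\sum_(s <= i < j) a i * rho ^+ i| <= M + 1 by apply: (hM' (M + 1)); rewrite ?ltrDl.
  exists (M + 1 + (M + 1)); first by apply: addr_ge0; exact: le_trans (hM 0%N).
  move=> j sj; have := hM j.+1; rewrite big_nat_recr//= => h1.
  have h2 := hM j; rewrite -[leLHS]ger0_norm ?mulr_ge0 ?exprn_ge0 ?(ltW rho0)//.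
  rewrite normrM normr_id -normrM.
  rewrite (_ : a j * _ = (\sum_(s <= i < j) a i * rho ^+ i + a j * rho ^+ j)
     - \sum_(s <= i < j) a i * rho ^+ i); last by rewrite addrAC subrr add0r.
  by apply: le_trans (ler_normB _ _) _; apply: lerD.
exists (2 * M / rho ^+ s.+1), (rho / 2).
have C0 : 0 <= 2 * M / rho ^+ s.+1 by rewrite divr_ge0 ?mulr_ge0// exprn_ge0 ?(ltW rho0).
split=> //; first exact: divr_gt0.
move=> x hx; have q1 : 0 <= `|x| / rho <= 2^-1.
  by rewrite divr_ge0 ?(ltW rho0)//= ler_pdivrMr// mulrC.
have xd : `|x| < d.
  by apply: le_lt_trans hx _; rewrite /rho; lra.
have cx : (\sum_(s <= j < N) a j * x ^+ j) - a s * x ^+ s @[N --> \oo] --> F x - a s * x ^+ s.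
  by apply: cvgB; [exact: cvx|exact: cvg_cst].
have cn : `|\sum_(s <= j < N) a j * x ^+ j - a s * x ^+ s| @[N --> \oo]
    --> `|F x - a s * x ^+ s| by apply: cvg_norm.
apply: (cvgr_to_le cn); near=> N.
have sN : (s < N)%N by near: N; exact: nbhs_infty_gt.
rewrite big_ltn// addrAC subrr add0r.
apply: le_trans (ler_norm_sum _ _ _) _.
have tail n : \sum_(s.+1 <= j < s.+1 + n) `|a j * x ^+ j|
    <= M * (`|x| / rho) ^+ s.+1 * (2 - 2^-1 ^+ n * 2).
  elim: n => [|n IH]; first by rewrite addn0 big_geq// expr0 mul1r subrr mulr0.
  rewrite addnS big_nat_recr ?leq_addr//=.
  apply: le_trans (lerD IH (_ : _ <= M * (`|x| / rho) ^+ s.+1 * 2^-1 ^+ n)) _.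
    rewrite normrM normrX -[`|x| in leLHS](divfK (lt0r_neq0 rho0)) exprMn mulrA mulrAC.
    apply: (@le_trans _ _ (M * (`|x| / rho) ^+ (s.+1 + n))).
      by rewrite ler_wpM2r ?exprn_ge0// ?hM ?(andP q1).1// ltnW// ltn_addr.
    rewrite exprD mulrA ler_wpM2l ?mulr_ge0 ?exprn_ge0 ?(andP q1).1//.
    by rewrite lerXn2r ?nnegrE ?(andP q1).1 ?(andP q1).2.
  rewrite -mulrDr ler_wpM2l ?mulr_ge0 ?exprn_ge0 ?(andP q1).1//.
  by rewrite [2^-1 ^+ n.+1]exprS; lra.
rewrite -(subnKC sN); apply: le_trans (tail _) _.
rewrite expr_div_n [2 * M]mulrC -!mulrA ler_wpM2l//.
rewrite mulrA [2 * _]mulrC [rho ^- _ * _]mulrC ler_wpM2l//.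
  by rewrite mulr_ge0 ?exprn_ge0// invr_ge0 exprn_ge0 ?(ltW rho0).
by rewrite gerBl mulr_ge0// exprn_ge0 ?invr_ge0.
Unshelve. all: by end_near. Qed.

End Estimates.

(** * Leading order of the field near the characteristic curve *)

Section Orders.
Variables (R : realType) (n : nat).
Implicit Types (f g : R -> R -> R -> R).

Definition eventually_dom (P : R -> R -> R -> Prop) : Prop :=
  \forall e \near (0 : R)^'+, forall r x u, r != 0 -> `|r| <= e ->
    `|x| <= `|r| -> `|u| <= `|r| ^+ n -> P r x u.

Definition Oh j g : Prop := exists2 C : R, 0 <= C &
  eventually_dom (fun r x u => `|g r x u| <= C * `|r| ^+ j).

Lemma ev1 (P Q : R -> R -> R -> Prop) : (forall r x u, P r x u -> Q r x u) ->
  eventually_dom P -> eventually_dom Q.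
Proof. by move=> h; apply: filterS => e hP r x u *; apply/h/hP. Qed.

Lemma ev2 (P P' Q : R -> R -> R -> Prop) :
  (forall r x u, P r x u -> P' r x u -> Q r x u) ->
  eventually_dom P -> eventually_dom P' -> eventually_dom Q.
Proof. by move=> h; apply: filterS2 => e hP hP' r x u *; apply: h; [exact: hP|exact: hP']. Qed.

Lemma evI (P Q : R -> R -> R -> Prop) : eventually_dom P -> eventually_dom Q ->
  eventually_dom (fun r x u => P r x u /\ Q r x u).
Proof. exact: ev2. Qed.

Lemma ev_r (d : R) : 0 < d -> eventually_dom (fun r _ _ => `|r| <= d).
Proof.
move=> d0; near=> e => r x u _ hr _ _; apply: le_trans hr _.
by near: e; exact: nbhs_right_le.
Unshelve. all: by end_near. Qed.

Lemma Oh_ext j f g : eventually_dom (fun r x u => f r x u = g r x u) -> Oh j f -> Oh j g.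
Proof. by move=> h [C C0 hC]; exists C => //; apply: ev2 h hC => r x u ->. Qed.

Lemma OhD j f g : Oh j f -> Oh j g -> Oh j (fun r x u => f r x u + g r x u).
Proof.
move=> [C C0 hC] [D D0 hD]; exists (C + D); first exact: addr_ge0.
by apply: ev2 hC hD => r x u h1 h2; rewrite mulrDl (le_trans (ler_normD _ _))// lerD.
Qed.

Lemma OhN j f : Oh j f -> Oh j (fun r x u => - f r x u).
Proof. by move=> [C C0 hC]; exists C => //; apply: ev1 hC => r x u; rewrite normrN. Qed.

Lemma OhB j f g : Oh j f -> Oh j g -> Oh j (fun r x u => f r x u - g r x u).
Proof. by move=> hf /OhN; apply: OhD. Qed.

Lemma OhM i j f g : Oh i f -> Oh j g -> Oh (i + j) (fun r x u => f r x u * g r x u).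
Proof.
move=> [C C0 hC] [D D0 hD]; exists (C * D); first exact: mulr_ge0.
by apply: ev2 hC hD => r x u h1 h2; rewrite normrM exprD mulrACA ler_pM.
Qed.

Lemma Oh_le i j f : (j <= i)%N -> Oh i f -> Oh j f.
Proof.
move=> ji [C C0 hC]; exists C => //; apply: ev2 hC (ev_r ltr01) => r x u h r1.
by apply: le_trans h _; rewrite ler_wpM2l// -(subnK ji) exprD ler_piMl// exprn_ile1.
Qed.

Lemma Oh_MO i f g : Oh i f -> Oh 0 g -> Oh i (fun r x u => f r x u * g r x u).
Proof. by move=> hf hg; rewrite -(addn0 i); exact: OhM. Qed.

Lemma Oh_x : Oh 1 (fun _ x _ => x).
Proof. by exists 1 => //; near=> e => r x u _ _ hx _; rewrite mul1r expr1.
Unshelve. all: by end_near. Qed.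

Lemma Oh_u : Oh n (fun _ _ u => u).
Proof. by exists 1 => //; near=> e => r x u _ _ _ hu; rewrite mul1r.
Unshelve. all: by end_near. Qed.

Lemma Oh_rn m : Oh m (fun r _ _ => `|r| ^+ m).
Proof. by exists 1 => //; near=> e => r x u _ _ _ _; rewrite mul1r normrX normr_id.
Unshelve. all: by end_near. Qed.

Lemma Oh_cst c : Oh 0 (fun _ _ _ => c).
Proof. by exists `|c| => //; near=> e => r x u _ _ _ _; rewrite mulr1.
Unshelve. all: by end_near. Qed.

Lemma Oh_0 j : Oh j (fun _ _ _ => 0).
Proof. by exists 0 => //; near=> e => r x u _ _ _ _; rewrite normr0 mul0r.
Unshelve. all: by end_near. Qed.

Lemma Oh_small d g : 0 < d -> Oh 1 g -> eventually_dom (fun r x u => `|g r x u| <= d).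
Proof.
move=> d0 [C C0 hC]; have e0 : 0 < d / (C + 1) by rewrite divr_gt0// ltr_wpDl.
apply: ev2 hC (ev_r e0) => r x u h hr; apply: le_trans h _; rewrite expr1.
move: hr; rewrite ler_pdivlMr ?ltr_wpDl// => hr; apply: le_trans hr.
by rewrite mulrC ler_wpM2l// lerDl.
Qed.

Lemma Oh_comp j (phi : R -> R) (d C : R) g : 0 <= C -> 0 < d ->
  (forall z, `|z| <= d -> `|phi z| <= C * `|z| ^+ j) -> Oh 1 g ->
  Oh j (fun r x u => phi (g r x u)).
Proof.
move=> C0 d0 hphi hg; case: (hg) => [D D0 hD].
exists (C * D ^+ j); first by rewrite mulr_ge0// exprn_ge0.
apply: ev2 (Oh_small d0 hg) hD => r x u h1 h2.
apply: le_trans (hphi _ h1) _; rewrite -mulrA ler_wpM2l// -exprMn.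
by rewrite lerXn2r ?nnegrE ?mulr_ge0//; rewrite expr1 in h2.
Qed.

Section DividedDifference.
Variables (e0 K : R) (A : R -> R -> R -> R).
Hypotheses (e00 : 0 < e0) (K0 : 0 <= K).
Hypothesis lipA : forall x y z x' y' z', `|x| <= e0 -> `|y| <= e0 -> `|z| <= e0 ->
        `|x'| <= e0 -> `|y'| <= e0 -> `|z'| <= e0 ->
        `|A x y z - A x' y' z'| <= K * (`|x - x'| + `|y - y'| + `|z - z'|).

Lemma Oh_lip j f1 f2 f3 g1 g2 g3 : Oh 1 f1 -> Oh 1 f2 -> Oh 1 f3 ->
  Oh 1 g1 -> Oh 1 g2 -> Oh 1 g3 ->
  Oh j (fun r x u => f1 r x u - g1 r x u) -> Oh j (fun r x u => f2 r x u - g2 r x u) ->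
  Oh j (fun r x u => f3 r x u - g3 r x u) ->
  Oh j (fun r x u => A (f1 r x u) (f2 r x u) (f3 r x u)
                   - A (g1 r x u) (g2 r x u) (g3 r x u)).
Proof.
move=> /(Oh_small e00) f1s /(Oh_small e00) f2s /(Oh_small e00) f3s.
move=> /(Oh_small e00) g1s /(Oh_small e00) g2s /(Oh_small e00) g3s.
move=> [C1 C10 h1] [C2 C20 h2] [C3 C30 h3].
exists (K * (C1 + C2 + C3)); first by rewrite mulr_ge0 ?addr_ge0.
rewrite /eventually_dom; near=> e => r x u r0 hr hx hu.
have E (P : R -> R -> R -> Prop) : (forall r x u, r != 0 -> `|r| <= e ->
  `|x| <= `|r| -> `|u| <= `|r| ^+ n -> P r x u) -> P r x u by apply.
apply: le_trans (lipA _ _ _ _ _ _) _.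
- by apply: (E (fun r x u => `|f1 r x u| <= e0)); near: e.
- by apply: (E (fun r x u => `|f2 r x u| <= e0)); near: e.
- by apply: (E (fun r x u => `|f3 r x u| <= e0)); near: e.
- by apply: (E (fun r x u => `|g1 r x u| <= e0)); near: e.
- by apply: (E (fun r x u => `|g2 r x u| <= e0)); near: e.
- by apply: (E (fun r x u => `|g3 r x u| <= e0)); near: e.
rewrite -mulrA ler_wpM2l// !mulrDl; apply: lerD; first apply: lerD.
- by apply: (E (fun r x u => `|f1 r x u - g1 r x u| <= C1 * `|r| ^+ j)); near: e.
- by apply: (E (fun r x u => `|f2 r x u - g2 r x u| <= C2 * `|r| ^+ j)); near: e.
- by apply: (E (fun r x u => `|f3 r x u - g3 r x u| <= C3 * `|r| ^+ j)); near: e.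
Unshelve. all: by end_near. Qed.

Lemma Oh_dd0 f1 f2 f3 : Oh 1 f1 -> Oh 1 f2 -> Oh 1 f3 ->
  Oh 1 (fun r x u => A (f1 r x u) (f2 r x u) (f3 r x u) - A 0 0 0).
Proof.
by move=> h1 h2 h3; apply: Oh_lip => //; try exact: Oh_0;
  apply: OhB => //; exact: Oh_0.
Qed.

Lemma Oh_dd f1 f2 f3 : Oh 1 f1 -> Oh 1 f2 -> Oh 1 f3 ->
  Oh 0 (fun r x u => A (f1 r x u) (f2 r x u) (f3 r x u)).
Proof.
move=> h1 h2 h3; have h4 := Oh_le (leq0n 1) (Oh_dd0 h1 h2 h3).
apply: Oh_ext (OhD h4 (Oh_cst (A 0 0 0))).
by near=> e => r x u _ _ _ _; rewrite subrK.
Unshelve. all: by end_near. Qed.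
End DividedDifference.

(* Along the characteristic curve the origin is a zero of x' up to high order; *)
(** On the scale x of order r and u of order r^n, all terms other than those
    carried by the leading coefficients of F and G are of higher order. *)
Lemma field_lead (X Y : R -> R -> R) (f : R -> R) (p : {poly R}) (a b e0 K : R)
   (A B A' B' : R -> R -> R -> R) (d C : R) (m : nat) : (1 < n <= m)%N ->
  0 < e0 -> 0 <= K -> dd_bounds X e0 K A B -> dd_bounds Y e0 K A' B' ->
  A 0 0 0 = 0 -> p.[0] = 0 -> 0 < d -> 0 <= C ->
  (forall x, `|x| <= d -> f x + X x (f x) = 0) ->
  (forall x, `|x| <= d -> `|f x| <= `|x|) ->
  (forall x, `|x| <= d -> `|f x - p.[x]| <= C * `|x| ^+ m.*2) ->
  (forall x, `|x| <= d -> `|Y x (f x) + a * x ^+ (2 * n - 1)| <= C * `|x| ^+ (2 * n)) ->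
  (forall x, `|x| <= d -> `|B x (f x) x + A' x (f x) (f x) + b * x ^+ (n - 1)| <= C * `|x| ^+ n) ->
  let vx x u := u + p.[x] + X x (u + p.[x]) in
  Oh n.+1 (fun r x u => vx x u - u) /\
  Oh (2 * n) (fun r x u => Y x (u + p.[x]) - p^`().[x] * vx x u
                  - (- (a * x ^+ (2 * n - 1)) - b * x ^+ (n - 1) * u)).
Proof.
move=> /andP[n1 nm] e00 K0 [dX dX' lA lB] [dY dY' lA' lB'] A0 p0 d0 C0 fX fx fp FY GB vx.
have n0 : (0 < n)%N := ltnW n1.
have hx : Oh 1 (fun _ x _ : R => x) := Oh_x.
have hu : Oh n (fun _ _ u : R => u) := Oh_u.
have hu1 : Oh 1 (fun _ _ u : R => u) := Oh_le n0 Oh_u.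
have [L L0 hL] := poly_taylor p; have [L' L'0 hL'] := poly_taylor p^`().
have hp g : Oh 1 g -> Oh 1 (fun r x u => p.[g r x u]).
  apply: (@Oh_comp _ (fun z => p.[z]) 1 L) => // z z1; rewrite expr1.
  have := hL 0 z; rewrite add0r normr0 => -/(_ ler01 z1)[_ + _].
  by rewrite p0 subr0.
have hdp g : Oh 1 g -> Oh 0 (fun r x u => p^`().[g r x u]).
  apply: (@Oh_comp _ (fun z => p^`().[z]) 1 L') => // z z1; rewrite expr0 mulr1.
  by have := hL' z 0; rewrite addr0 => -/(_ z1 z1)[].
have hf g : Oh 1 g -> Oh 1 (fun r x u => f (g r x u)).
  by apply: (@Oh_comp _ f d 1) => // z; rewrite expr1 mul1r; exact: fx.
have hfp g : Oh 1 g -> Oh m.*2 (fun r x u => f (g r x u) - p.[g r x u]).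
  exact: (@Oh_comp _ (fun z => f z - p.[z]) d C).
have hfpn g : Oh 1 g -> Oh n (fun r x u => f (g r x u) - p.[g r x u]).
  by move=> /hfp; apply: Oh_le; lia.
have m2 : (2 * n <= m.*2)%N by lia.
(* e = p + X(., p) *)
have he g : Oh 1 g -> Oh m.*2 (fun r x u => p.[g r x u] + X (g r x u) p.[g r x u]).
  move=> hg.
  have h := Oh_MO (hfp g hg) (OhD (Oh_cst 1) (Oh_dd e00 K0 lA hg (hf g hg) (hp g hg))).
  apply: Oh_ext (OhN h); apply: ev1 (evI (evI (Oh_small e00 hg) (Oh_small d0 hg))
    (evI (Oh_small e00 (hf g hg)) (Oh_small e00 (hp g hg)))).
  move=> r x u [[E1 E4] [E2 E3]]; have h1 := dX _ _ _ E1 E2 E3.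
  have -> : X (g r x u) p.[g r x u] = X (g r x u) (f (g r x u)) -
     (f (g r x u) - p.[g r x u]) * A (g r x u) (f (g r x u)) p.[g r x u].
    by rewrite -h1; ring.
  have -> : X (g r x u) (f (g r x u)) = - f (g r x u).
    by apply/eqP; rewrite -addr_eq0 addrC; apply/eqP/fX.
  by ring.
have hxe := he _ hx.
have hup : Oh 1 (fun _ x u => u + p.[x]) by apply: OhD => //; exact: hp.
have hA : Oh 1 (fun _ x u => A x (u + p.[x]) p.[x]).
  have := Oh_dd0 e00 K0 lA hx hup (hp _ hx); rewrite A0; apply: Oh_ext.
  by near=> e => r x u _ _ _ _; rewrite subr0.
have vxE : eventually_dom (fun r x u => vx x u =
    (p.[x] + X x p.[x]) + u * (1 + A x (u + p.[x]) p.[x])).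
  apply: ev1 (evI (Oh_small e00 hx) (evI (Oh_small e00 hup) (Oh_small e00 (hp _ hx)))).
  move=> r x u [h0 [h1 h2]]; have := dX _ _ _ h0 h1 h2; rewrite /vx addrK => h.
  by rewrite mulrDr mulr1 -h; ring.
split.
  have h := OhD (Oh_le (_ : n.+1 <= m.*2)%N hxe) (Oh_le (_ : n.+1 <= n + 1)%N (OhM hu hA)).
  apply: Oh_ext (h _ _); [|lia|by rewrite addn1].
  by apply: ev1 vxE => r x u ->; ring.
pose E1 x := p^`().[x] * (1 + A x p.[x] p.[x]) + B x p.[x] x.
have hE1 : Oh m (fun r x u => E1 x).
  pose xs (r x u : R) := x + `|r| ^+ m.
  have hrm : Oh m (fun r _ _ => `|r| ^+ m) := Oh_rn m.
  have m0 : (0 < m)%N by exact: leq_trans nm.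
  have hxs : Oh 1 xs by apply: OhD => //; exact: Oh_le hrm.
  have hes := he _ hxs.
  pose Dp r x u := p.[xs r x u] - p.[x].
  pose T r x u := Dp r x u - `|r| ^+ m * p^`().[x].
  have dom1 : eventually_dom (fun r x u => `|x| <= 1 /\ `|xs r x u| <= 1).
    by apply: evI; apply: Oh_small.
  have hDp : Oh m Dp.
    exists L => //; apply: ev1 dom1 => r x u [h1 h2].
    by have [_ + _] := hL x (`|r| ^+ m) h1 h2; rewrite [ `| `|r| ^+ m|]ger0_norm ?exprn_ge0.
  have hT : Oh m.*2 T.
    exists L => //; apply: ev1 dom1 => r x u [h1 h2].
    have [_ _] := hL x (`|r| ^+ m) h1 h2.
    by rewrite [ `| `|r| ^+ m|]ger0_norm ?exprn_ge0// -exprM muln2.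
  have hxsx : Oh m (fun r x u => xs r x u - x).
    by apply: Oh_ext hrm; near=> e => r x u _ _ _ _; rewrite /xs addrC addKr.
  have hBd : Oh m (fun r x u => B (xs r x u) p.[xs r x u] x - B x p.[x] x).
    apply: (Oh_lip e00 K0 lB) => //; try exact: hp.
    by apply: Oh_ext (Oh_0 m); near=> e => r x u _ _ _ _; rewrite subrr.
  have hAd : Oh m (fun r x u => A x p.[xs r x u] p.[x] - A x p.[x] p.[x]).
    apply: (Oh_lip e00 K0 lA) => //; try exact: hp.
      by apply: Oh_ext (Oh_0 m); near=> e => r x u _ _ _ _; rewrite subrr.
    by apply: Oh_ext (Oh_0 m); near=> e => r x u _ _ _ _; rewrite subrr.
  have hAp : Oh 0 (fun r x u => A x p.[x] p.[x]).
    by apply: (Oh_dd e00 K0 lA) => //; exact: hp.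
  have H : Oh m.*2 (fun r x u => `|r| ^+ m * E1 x).
    have q1 := OhB hes hxe.
    have q2 := OhD (OhM hrm hBd) (OhM hDp hAd); rewrite addnn in q2.
    have q3 := OhD (OhD hT (Oh_MO hT hAp)) q2.
    apply: Oh_ext (OhB q1 q3).
    apply: ev1 (evI (evI (Oh_small e00 hx) (Oh_small e00 hxs))
      (evI (Oh_small e00 (hp _ hx)) (Oh_small e00 (hp _ hxs)))).
    move=> r x u [[h1 h2] [h3 h4]].
    have k1 := dX _ _ _ h1 h4 h3; have k2 := dX' _ _ _ h2 h4 h1.
    rewrite /T /Dp /E1; rewrite -/(Dp r x u) in k1 *.
    have k3 : xs r x u - x = `|r| ^+ m by rewrite /xs addrC addKr.
    rewrite k3 in k2.
    rewrite [p.[xs r x u] + _](_ : _ = p.[xs r x u] + X x p.[x]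
      + Dp r x u * A x p.[xs r x u] p.[x] + `|r| ^+ m * B (xs r x u) p.[xs r x u] x).
      by rewrite /Dp; ring.
    by rewrite -k1 -k2; ring.
  case: H => C1 C10 hC1; exists C1 => //.
  rewrite /eventually_dom; near=> e => r x u r0 hr hx' hu'.
  have rp : 0 < `|r| ^+ m by rewrite exprn_gt0// normr_gt0.
  have hH : `| `|r| ^+ m * E1 x| <= C1 * `|r| ^+ m.*2.
    by move: r x u r0 hr hx' hu' {rp}; near: e.
  rewrite -(ler_pM2l rp) mulrCA -exprD addnn; apply: le_trans hH.
  by rewrite normrM [X in _ <= X * _]ger0_norm// ltW.
have hfx : Oh 1 (fun _ x _ => f x) := hf _ hx.
have hpx : Oh 1 (fun _ x _ => p.[x]) := hp _ hx.
have hfpx : Oh n (fun _ x _ => f x - p.[x]) := hfpn _ hx.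
have z0 g : Oh n (fun r x u => g r x u - g r x u).
  by apply: Oh_ext (Oh_0 n); near=> e => r x u _ _ _ _; rewrite subrr.
have t1 : Oh (2 * n) (fun r x u => Y x (f x) + a * x ^+ (2 * n - 1)).
  exact: (@Oh_comp _ (fun x => Y x (f x) + a * x ^+ (2 * n - 1)) d C).
have t2 : Oh (2 * n) (fun r x u => (f x - p.[x]) * A' x (f x) p.[x]).
  by apply: Oh_le m2 _; apply: Oh_MO; [exact: hfp|exact: (Oh_dd e00 K0 lA')].
have t3 : Oh n (fun r x u => A' x (u + p.[x]) p.[x] - A' x (f x) (f x)).
  apply: (Oh_lip e00 K0 lA') => //.
    apply: Oh_ext (OhB hu hfpx); near=> e => r x u _ _ _ _; ring.
  apply: Oh_ext (OhN hfpx); near=> e => r x u _ _ _ _; ring.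
have t4 : Oh (2 * n) (fun r x u => (p.[x] + X x p.[x]) * p^`().[x]).
  by apply: Oh_le m2 _; apply: Oh_MO => //; exact: hdp.
have t5 : Oh n (fun r x u => (A x (u + p.[x]) p.[x] - A x p.[x] p.[x]) * p^`().[x]).
  apply: Oh_MO; last exact: hdp.
  apply: (Oh_lip e00 K0 lA) => //.
  by apply: Oh_ext hu; near=> e => r x u _ _ _ _; rewrite addrK.
have t6 : Oh n (fun r x u => E1 x) := Oh_le nm hE1.
have t7 : Oh n (fun r x u => B x p.[x] x - B x (f x) x).
  apply: (Oh_lip e00 K0 lB) => //.
  apply: Oh_ext (OhN hfpx); near=> e => r x u _ _ _ _; ring.
have t8 : Oh n (fun r x u => B x (f x) x + A' x (f x) (f x) + b * x ^+ (n - 1)).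
  exact: (@Oh_comp _ (fun x => B x (f x) x + A' x (f x) (f x) + b * x ^+ (n - 1)) d C).
have t9 := OhM hu (OhD (OhB (OhB t3 t5) t6) (OhD t7 t8)).
rewrite addnn -mul2n in t9.
apply: Oh_ext (OhD (OhB (OhB t1 t2) t4) t9).
apply: ev1 (evI vxE (evI (evI (Oh_small e00 hx) (Oh_small e00 hpx))
  (evI (Oh_small e00 hup) (Oh_small e00 hfx)))).
move=> r x u [-> [[h1 h2] [h3 h4]]].
have k1 := dY _ _ _ h1 h4 h2; have k2 := dY _ _ _ h1 h3 h2.
rewrite addrK in k2; rewrite /E1.
have -> : Y x (u + p.[x]) = Y x (f x) - (f x - p.[x]) * A' x (f x) p.[x]
   + u * A' x (u + p.[x]) p.[x] by rewrite -k1 -k2; ring.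
by ring.
Unshelve. all: by end_near. Qed.
End Orders.

(** * Analyticity of the polar field *)

Section FixedParameter.
Variable R : realType.

Lemma le_small_eq0 (v C d : R) : 0 <= C -> 0 < d ->
  (forall y, 0 < y -> y <= d -> `|v| <= C * y) -> v = 0.
Proof.
move=> C0 d0 h; apply/eqP; rewrite -normr_le0; apply/ler_addgt0Pl => e e0.
have e1 : 0 < Num.min d (e / (C + 1)) by rewrite lt_min d0 divr_gt0// ltr_wpDl.
apply: le_trans (h _ e1 _) _; first by rewrite ge_min lexx.
rewrite addr0; apply: (@le_trans _ _ ((C + 1) * (e / (C + 1)))); last first.
  by rewrite mulrCA divff ?mulr1// gt_eqF// ltr_wpDl.
by apply: ler_pM; rewrite ?(ltW e1)// ?lerDl// ge_min lexx orbT.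
Qed.

Lemma quad_dd (X : R -> R -> R) (e K : R) (A B : R -> R -> R -> R) : 0 < e -> 0 <= K ->
  dd_bounds X e K A B ->
  (fun p : R * R => X p.1 p.2) =O_ ((0, 0) : R * R) (fun p : R * R => `|p| ^+ 2) ->
  [/\ X 0 0 = 0, A 0 0 0 = 0 & B 0 0 0 = 0].
Proof.
move=> e0 K0 [dA dB lA lB] /eqO_exP[C C0 [[P Q] /= [[d1 /= d10 hP] [d2 /= d20 hQ]] hC]].
pose d : R := Num.min d1 d2; have d0 : 0 < d by rewrite lt_min d10.
have hC' (x y : R) : `|x| < d -> `|y| < d -> `|X x y| <= C * (Num.max `|x| `|y|) ^+ 2.
  rewrite !lt_min => /andP[x1 x2] /andP[y1 y2]; have := hC (x, y).
  rewrite /= normrX normr_id; apply; split; [apply: hP|apply: hQ] => /=.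
    by rewrite sub0r normrN.
  by rewrite sub0r normrN.
have X0 : X 0 0 = 0.
  apply/eqP; rewrite -normr_le0; have := hC' 0 0; rewrite normr0 maxxx expr0n mulr0.
  by apply.
have mpos : 0 < Num.min e (d / 2) by rewrite lt_min e0 divr_gt0.
have E0 : `|0 : R| <= e by rewrite normr0 ltW.
split=> //.
- apply: (@le_small_eq0 _ (C + K) (Num.min e (d / 2))) => //; first by rewrite addr_ge0// ltW.
  move=> y y0; rewrite le_min => /andP[ye yd].
  have ny : `|y| = y by rewrite gtr0_norm.
  have ye' : `|y| <= e by rewrite ny.
  have yd' : y < d by clear -yd d0; lra.
  have := dA 0 y 0 E0 ye' E0; rewrite X0 !subr0 => h1.
  have := hC' 0 y; rewrite normr0 h1 => -/(_ d0); rewrite ny => -/(_ yd').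
  rewrite (max_idPr _) ?(ltW y0)// normrM ny expr2 mulrCA ler_pM2l// => h2.
  have := lA 0 0 0 0 y 0 E0 E0 E0 E0 ye' E0.
  rewrite !subrr normr0 add0r addr0 sub0r normrN ny => h3.
  rewrite -[A 0 0 0](subrK (A 0 y 0)); apply: le_trans (ler_normD _ _) _.
  by rewrite mulrDl addrC lerD.
- apply: (@le_small_eq0 _ (C + K) (Num.min e (d / 2))) => //; first by rewrite addr_ge0// ltW.
  move=> y y0; rewrite le_min => /andP[ye yd].
  have ny : `|y| = y by rewrite gtr0_norm.
  have ye' : `|y| <= e by rewrite ny.
  have yd' : y < d by clear -yd d0; lra.
  have := dB y 0 0 ye' E0 E0; rewrite X0 !subr0 => h1.
  have := hC' y 0; rewrite normr0 h1 ny => -/(_ yd' d0).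
  rewrite (max_idPl _) ?(ltW y0)// normrM ny expr2 mulrCA ler_pM2l// => h2.
  have := lB 0 0 0 y 0 0 E0 E0 E0 ye' E0 E0.
  rewrite !subrr normr0 !addr0 sub0r normrN ny => h3.
  rewrite -[B 0 0 0](subrK (B y 0 0)); apply: le_trans (ler_normD _ _) _.
  by rewrite mulrDl addrC lerD.
Qed.

Lemma dd_small (A : R -> R -> R -> R) (e K eps : R) : 0 < e -> 0 <= K -> 0 < eps ->
  A 0 0 0 = 0 ->
  (forall x y z x' y' z', `|x| <= e -> `|y| <= e -> `|z| <= e ->
        `|x'| <= e -> `|y'| <= e -> `|z'| <= e ->
        `|A x y z - A x' y' z'| <= K * (`|x - x'| + `|y - y'| + `|z - z'|)) ->
  exists d, [/\ 0 < d, d <= e & forall x y z, `|x| <= d -> `|y| <= d -> `|z| <= d ->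
     `|A x y z| <= eps].
Proof.
move=> e0 K0 eps0 A0 lA; have K1 : 0 < 3 * (K + 1) by rewrite mulr_gt0// ltr_wpDl.
exists (Num.min e (eps / (3 * (K + 1)))); split.
- by rewrite lt_min e0 divr_gt0.
- by rewrite ge_min lexx.
move=> x y z; rewrite !le_min => /andP[x1 x2] /andP[y1 y2] /andP[z1 z2].
have E0 : `|0 : R| <= e by rewrite normr0 ltW.
have := lA x y z 0 0 0 x1 y1 z1 E0 E0 E0; rewrite A0 !subr0 => h; apply: le_trans h _.
apply: (@le_trans _ _ ((K + 1) * (3 * (eps / (3 * (K + 1)))))).
  by apply: ler_pM; rewrite ?addr_ge0// ?lerDl//; lra.
by rewrite mulrA [(K + 1) * 3]mulrC mulrCA divff ?mulr1// gt_eqF.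
Qed.

(** The curve is a fixed point of a map with small Lipschitz constant, because
    the nonlinearity has no linear part; continuity selects the branch. *)
Lemma char_curve_lip (l : nat) (X : R -> R -> 'rV[R]_l -> R) f del (e K : R)
    (A B : R -> R -> R -> R) : 0 < e -> 0 <= K ->
  dd_bounds (fun x y => X x y del) e K A B -> A 0 0 0 = 0 -> B 0 0 0 = 0 ->
  characteristic_curve X f del ->
  exists d : R, [/\ 0 < d,
    forall x, `|x| <= d -> f x del + X x (f x del) del = 0,
    forall x, `|x| <= d -> `|f x del| <= `|x| &
    forall x x', `|x| <= d -> `|x'| <= d -> `|f x del - f x' del| <= `|x - x'|].
Proof.
move=> e0 K0 [dA dB lA lB] A0 B0 [f0 fc fX].
have q4 : (0 : R) < 4^-1 by rewrite invr_gt0.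
have [d1 [d10 d1e hA]] := dd_small e0 K0 q4 A0 lA.
have [d2 [d20 d2e hB]] := dd_small e0 K0 q4 B0 lB.
have m0 : 0 < Num.min d1 d2 by rewrite lt_min d10.
move/cvgr_dist_lt: fc => /(_ _ m0)[d3 /= d30 fc].
case: fX => d4 /= d40 fX.
pose d : R := Num.min (Num.min d1 d2) (Num.min (d3 / 2) (d4 / 2)).
have d0 : 0 < d by rewrite !lt_min d10 d20 !divr_gt0.
have hd (x : R) : `|x| <= d -> [/\ `|x| <= d1, `|x| <= d2, `|x| < d3 & `|x| < d4].
  rewrite !le_min => /andP[/andP[h1 h2] /andP[h3 h4]]; split=> //.
    by clear -h3 d30; lra.
  by clear -h4 d40; lra.
have fs (x : R) : `|x| <= d -> `|f x del| <= d1 /\ `|f x del| <= d2.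
  move=> /hd[_ _ h _]; have := fc x; rewrite /= !sub0r !normrN => /(_ h).
  by rewrite lt_min => /andP[h1 h2]; split; exact: ltW.
have fx (x : R) : `|x| <= d -> f x del + X x (f x del) del = 0.
  by move=> /hd[_ _ _ h]; apply: fX; rewrite /= sub0r normrN.
have fl (x x' : R) : `|x| <= d -> `|x'| <= d -> `|f x del - f x' del| <= `|x - x'|.
  move=> hx hx'; have [x1 x2 _ _] := hd _ hx; have [x1' x2' _ _] := hd _ hx'.
  have [y1 y2] := fs _ hx; have [y1' y2'] := fs _ hx'.
  have k1 := dA x (f x del) (f x' del) (le_trans x1 d1e) (le_trans y1 d1e) (le_trans y1' d1e).
  have k2 := dB x (f x' del) x' (le_trans x1 d1e) (le_trans y1' d1e) (le_trans x1' d1e).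
  have k3 := hA x (f x del) (f x' del) x1 y1 y1'.
  have k4 := hB x (f x' del) x' x2 y2' x2'.
  have k5 := fx _ hx; have k6 := fx _ hx'.
  set p := A x _ _ in k1 k3; set q := B x _ _ in k2 k4.
  set v := f x del - f x' del in k1 *; set w := x - x' in k2 *.
  have E : v = - (v * p + w * q).
    by rewrite -k1 -k2 /v; clear -k5 k6; lra.
  have : `|v| <= `|v| * 4^-1 + `|w| * 4^-1.
    rewrite {1}E normrN; apply: le_trans (ler_normD _ _) _; rewrite !normrM.
    by apply: lerD; rewrite ler_wpM2l.
  by have := normr_ge0 v; have := normr_ge0 w; clear; move: `|v| `|w| => ? ?; lra.
exists d; split=> // x hx.
by have := fl x 0 hx; rewrite normr0 f0 !subr0; apply; rewrite ltW.
Qed.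

Lemma dd_derive1 (g h : R -> R) (x : R) : h v @[v --> x] --> h x ->
  (\forall v \near x, g v = g x + (v - x) * h v) -> derive1 g x = h x.
Proof.
move=> hc gE; have d1 := is_deriveB (is_derive_id x 1) (is_derive_cst x x 1).
have := @is_derive_mul_cvg _ (fun v => v - x) h x _ d1 (subrr x) hc.
rewrite subr0 mul1r => d2.
have d3 := is_deriveD (is_derive_cst (g x) x 1) d2; rewrite add0r in d3.
have : is_derive x 1 g (h x).
  by apply: near_eq_is_derive d3; apply: filterS gE => v ->.
by move=> ?; rewrite derive1E derive_val.
Qed.

Lemma lip_cvg (h : R -> R) (x d K : R) : 0 < d -> 0 <= K ->
  (forall v, `|v - x| <= d -> `|h v - h x| <= K * `|v - x|) -> h v @[v --> x] --> h x.
Proof.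
move=> d0 K0 hl; apply/cvgrPdist_le => e e0.
have K1 : 0 < K + 1 by rewrite ltr_wpDl.
have m0 : 0 < Num.min d (e / (K + 1)) by rewrite lt_min d0 divr_gt0.
exists (Num.min d (e / (K + 1))) => // v /=; rewrite lt_min => /andP[v1 v2].
rewrite distrC; apply: le_trans (hl v _) _; rewrite distrC ?(ltW v1)//.
apply: le_trans (_ : (K + 1) * (e / (K + 1)) <= e).
  by apply: ler_pM; rewrite ?(ltW v2)// lerDl.
by rewrite mulrCA divff ?mulr1// gt_eqF.
Qed.

End FixedParameter.

Section FieldComponents.
Variable R : realType.
Implicit Types (X Y : R -> R -> R) (p : {poly R}).

Definition vx X p (x u : R) : R := u + p.[x] + X x (u + p.[x]).
Definition vu X Y p (x u : R) : R := Y x (u + p.[x]) - p^`().[x] * vx X p x u.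

(** The angular velocity, up to the factor r^(n-1) / (cos^2 t + n sin^2 t). *)
Definition polar_den X Y p n (t r : R) : R :=
  let x := r * cos t in let u := - (r ^+ n * sin t) in
  - (cos t * (vu X Y p x u / r ^+ (2 * n - 1)) + n%:R * sin t * (vx X p x u / r ^+ n)).

Definition polar_num X Y p n (t r : R) : R :=
  let x := r * cos t in let u := - (r ^+ n * sin t) in
  cos t * (vx X p x u / r ^+ n) - sin t * (vu X Y p x u / r ^+ (2 * n - 1)).

(** The angular velocity to leading order.  In cos^n and sin it is a quadratic form
    of negative discriminant; the explicit lower bound is uniform in the angle. *)
Lemma definite_form (a b c s : R) n : (0 < n)%N -> 0 < a -> b ^+ 2 - 4 * n%:R * a < 0 ->
  c ^+ 2 + s ^+ 2 = 1 ->
  Num.min ((4 * n%:R * a - b ^+ 2) * 2^-1 ^+ n / (4 * n%:R))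
          ((4 * n%:R * a - b ^+ 2) / (8 * a))
    <= a * c ^+ (2 * n) - b * (c ^+ n * s) + n%:R * s ^+ 2.
Proof.
move=> n0 a0 hb cs; have nR : (0 : R) < n%:R by rewrite ltr0n.
set d := 4 * n%:R * a - b ^+ 2; have d0 : 0 < d by rewrite /d; lra.
rewrite mulnC exprM; set z := c ^+ n.
have E1 : 4 * n%:R * (a * z ^+ 2 - b * (z * s) + n%:R * s ^+ 2) =
  d * z ^+ 2 + (b * z - 2 * n%:R * s) ^+ 2 by rewrite /d; ring.
have E2 : 4 * a * (a * z ^+ 2 - b * (z * s) + n%:R * s ^+ 2) =
  d * s ^+ 2 + (2 * a * z - b * s) ^+ 2 by rewrite /d; ring.
have [hs|hs] := leP 2^-1 (s ^+ 2); rewrite ge_min; apply/orP.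
  right; rewrite ler_pdivrMr ?mulr_gt0//.
  have : d * 2^-1 <= d * s ^+ 2 by rewrite ler_pM2l.
  have := sqr_ge0 (2 * a * z - b * s); move: E2; clear.
  set q := a * z ^+ 2 - _ + _; set w := (2 * a * z - _) ^+ 2; set v := d * s ^+ 2.
  move: q w v => q w v; nra.
left; rewrite ler_pdivrMr ?mulr_gt0// [leRHS]mulrC E1.
apply: (@le_trans _ _ (d * z ^+ 2)); last by rewrite lerDl sqr_ge0.
rewrite ler_pM2l// /z -exprM mulnC exprM lerXn2r ?nnegrE ?invr_ge0 ?sqr_ge0//.
by move: cs hs; clear; lra.
Qed.

Lemma positive_perturbation (p q s c : R) : 0 < c -> c <= q ->
  `|p - q| <= c / 4 -> `|s| <= c / 4 -> 0 < p + s.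
Proof. by move=> c0 qc; rewrite !ler_norml => /andP[h1 _] /andP[h2 _]; lra. Qed.
End FieldComponents.

Section PolarField.
Variables (R : realType) (l : nat) (D : set 'rV[R]_l).
Variables (X Y : R -> R -> 'rV[R]_l -> R) (f : R -> 'rV[R]_l -> R).
Variables (n : nat) (a b : nat -> 'rV[R]_l -> R) (del0 : 'rV[R]_l) (kappa : R).
Hypothesis hkappa : 1 <= kappa.
Hypothesis D0 : \forall e \near (0 : R)^'+, forall del, `|del - del0| <= e -> D del.
Hypothesis hX : jointly_analytic_at X 0 0 del0.
Hypothesis hY : jointly_analytic_at Y 0 0 del0.
Hypothesis hXO : forall delta, D delta ->
    (fun p : R * R => X p.1 p.2 delta) =O_ ((0, 0) : R * R) (fun p : R * R => `|p| ^+ 2).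
Hypothesis hYO : forall delta, D delta ->
    (fun p : R * R => Y p.1 p.2 delta) =O_ ((0, 0) : R * R) (fun p : R * R => `|p| ^+ 2).
Hypothesis hf : forall delta, D delta -> characteristic_curve X f delta.

Notation ev P := (\forall e \near (0 : R)^'+, forall del : 'rV[R]_l, `|del - del0| <= e -> P e del).
Notation expandable := (expandable del0 kappa).
Notation coef := (coef del0).

Lemma at_center (Q : 'rV[R]_l -> Prop) : ev (fun e del => Q del) -> Q del0.
Proof.
move=> h; have [e] : exists e : R, (forall del, `|del - del0| <= e -> Q del) /\ 0 < e.
  apply: (@filter_ex _ ((0 : R)^'+)); near=> e; split; first by near: e.
  by near: e; exact: nbhs_right_gt.
by move=> [hQ e0]; apply: hQ; rewrite subrr normr0 ltW.
Unshelve. all: by end_near. Qed.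

Definition poly_family (P : 'rV[R]_l -> {poly R}) (S : nat) : Prop :=
  (forall del, (size (P del) <= S)%N) /\ forall i, coef (fun _ del => (P del)`_i).

Lemma expandable_horner P S (xi : R -> 'rV[R]_l -> R) N : poly_family P S -> coef xi ->
  expandable N (fun t del r => (P del).[r * xi t del]).
Proof.
move=> [hS hP] hxi.
have := @expandable_sum R l del0 kappa hkappa N 'I_S (index_enum _)
  (fun i t del r => (P del)`_i * (r * xi t del) ^+ i).
rewrite (_ : (fun t del r => \sum_(i <- _) _) =
    fun t del r => (P del).[r * xi t del]); last first.
  by do 3!apply/funext => ?; rewrite (horner_coef_wide _ (hS _)).
apply=> i; apply: expandableM => //; first exact: expandable_coef (hP i).
apply: expandableX => //; apply: expandableM => //; first exact: expandable_r.
exact: expandable_coef.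
Qed.

Lemma poly_family_deriv P S : poly_family P S -> poly_family (fun del => (P del)^`()) S.
Proof.
move=> [hS hP]; split=> [del|i].
  apply: leq_trans (hS del); rewrite (leq_trans (size_poly _ _))// leq_pred//.
rewrite (_ : (fun _ _ => _) = fun (_ : R) del => (P del)`_i.+1 * i.+1%:R).
  by apply: coefM; [exact: hP|exact: coef_cst].
by do 2!apply/funext => ?; rewrite coef_deriv mulr_natr.
Qed.

Lemma poly_family_drop P S : poly_family P S -> poly_family (fun del => drop_poly 1 (P del)) S.
Proof.
move=> [hS hP]; split=> [del|i].
  by rewrite size_drop_poly (leq_trans (leq_subr _ _)).
rewrite (_ : (fun _ _ => _) = fun (_ : R) del => (P del)`_(i + 1)); first exact: hP.
by do 2!apply/funext => ?; rewrite coef_drop_poly.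
Qed.

Lemma horner_drop (p : {poly R}) x : p`_0 = 0 -> p.[x] = x * (drop_poly 1 p).[x].
Proof.
move=> p0; rewrite -{1}(poly_take_drop 1 p) hornerD hornerM hornerXn expr1 mulrC.
rewrite [take_poly 1 p](_ : _ = 0) ?horner0 ?add0r//.
by apply/polyP => i; rewrite coef_take_poly coef0; case: i.
Qed.

Lemma system_dd : exists K : R, 0 <= K /\ ev (fun e del =>
  (exists A B, dd_bounds (fun x y => X x y del) e K A B) /\
  (exists A B, dd_bounds (fun x y => Y x y del) e K A B)).
Proof.
have [K [K0 hK]] := germ_dd_bounds hX; have [L [L0 hL]] := germ_dd_bounds hY.
exists (K + L); split; first exact: addr_ge0.
apply: filterS2 hK hL => e h1 h2 del hd; split.
  have [A [B [dA dB lA lB]]] := h1 del hd; exists A, B; split=> // x y z x' y' z' *.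
    by apply: le_trans (lA _ _ _ _ _ _ _ _ _ _ _ _) _ => //; rewrite ler_wpM2r ?addr_ge0// lerDl.
  by apply: le_trans (lB _ _ _ _ _ _ _ _ _ _ _ _) _ => //; rewrite ler_wpM2r ?addr_ge0// lerDl.
have [A [B [dA dB lA lB]]] := h2 del hd; exists A, B; split=> // x y z x' y' z' *.
  by apply: le_trans (lA _ _ _ _ _ _ _ _ _ _ _ _) _ => //; rewrite ler_wpM2r ?addr_ge0// lerDr.
by apply: le_trans (lB _ _ _ _ _ _ _ _ _ _ _ _) _ => //; rewrite ler_wpM2r ?addr_ge0// lerDr.
Qed.

Lemma char_poly k : exists P S, [/\ poly_family P S, forall del, (P del)`_0 = 0 &
  ev (fun e del => exists C d : R, [/\ 0 <= C, 0 < d & forall x : R, `|x| <= d ->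
    `|f x del - (P del).[x]| <= C * `|x| ^+ k.+1])].
Proof.
have [K [K0 hK]] := system_dd.
elim: k => [|k [P [S [hP P0 IH]]]].
  exists (fun _ => 0), 0%N; split=> [|del|].
  - split=> [del|i]; first by rewrite size_poly0.
    by under eq_fun do under eq_fun do rewrite coef0; exact: coef_cst.
  - by rewrite coef0.
  - near=> e => del hd; have e0 : 0 < e by near: e; exact: nbhs_right_gt.
    have hK' : forall del, `|del - del0| <= e ->
       (exists A B, dd_bounds (fun x y => X x y del) e K A B) /\
       (exists A B, dd_bounds (fun x y => Y x y del) e K A B) by near: e.
    have Dd : D del by move: del hd; near: e.
    have [[A [B hAB]] _] := hK' _ hd.
    have [X0 A0 B0] := quad_dd e0 K0 hAB (hXO Dd).
    have [d [d0 _ fd _]] := char_curve_lip e0 K0 hAB A0 B0 (hf Dd).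
    exists 1, d; split=> // x hx; rewrite horner0 subr0 expr1 mul1r; exact: fd.
have hW : expandable k.+2 (fun t del r =>
    X (r * 1) (r * (1 * (drop_poly 1 (P del)).[r * 1])) del).
  apply: expandable_system => //; first exact: expandable_cst.
  apply: expandableM => //; first exact: expandable_cst.
  by apply: expandable_horner (poly_family_drop hP) _; exact: coef_cst.
have [c [hc hT]] := expandable_taylor hkappa hW.
have [Q [hQ WE]] := hT _ (leqnn _).
have [KQ [KQ0 hKQ]] := bnd_scalar hkappa hQ.
pose P' del := - \poly_(j < k.+2) (if j == 0%N then 0 else c j 0 del).
exists P', k.+2; split.
- split=> [del|i]; first by rewrite size_polyN size_poly.
  have -> : (fun (_ : R) del => (P' del)`_i) = fun _ del =>
      - (if (i < k.+2)%N && (i != 0%N) then c i 0 del else 0).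
    by do 2!apply/funext => ?; rewrite poly.coefN coef_poly; case: ltnP => //=; case: eqP.
  apply: coefN; case: ((i < k.+2)%N && _); last exact: coef_cst.
  have [c1 c2 c3] := hc i; split=> [t||eps eps0]; first exact: cvg_cst.
    by have [M hM] := c2; exists M => _.
  by apply: filterS (c3 _ eps0) => e h del hd _; exact: h.
- by move=> del; rewrite poly.coefN coef_poly /= oppr0.
near=> e => del hd; have e0 : 0 < e by near: e; exact: nbhs_right_gt.
have hK' : forall del, `|del - del0| <= e ->
       (exists A B, dd_bounds (fun x y => X x y del) e K A B) /\
       (exists A B, dd_bounds (fun x y => Y x y del) e K A B) by near: e.
have Dd : D del by move: del hd; near: e.
have [[A [B hAB]] _] := hK' _ hd.
have [X0 A0 B0] := quad_dd e0 K0 hAB (hXO Dd).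
have [d [d0 fX fd _]] := char_curve_lip e0 K0 hAB A0 B0 (hf Dd).
have [C [d' [C0 d'0 fP]]] : exists C d : R, [/\ 0 <= C, 0 < d & forall x : R, `|x| <= d ->
    `|f x del - (P del).[x]| <= C * `|x| ^+ k.+1] by move: del hd {Dd A B hAB X0 A0 B0 d d0 fX fd}; near: e.
have WE' : forall del, `|del - del0| <= e -> forall t r : R, `|r| <= e ->
   X (r * 1) (r * (1 * (drop_poly 1 (P del)).[r * 1])) del =
   \sum_(j < k.+2) c j t del * r ^+ j + r ^+ k.+2 * Q t del r by near: e.
have hKQ' : forall del, `|del - del0| <= e -> forall t r : R, `|r| <= e ->
   `|Q t del r| <= KQ by near: e.
have [L L0 hL] := poly_taylor (P del).
have c00 : c 0%N 0 del = 0.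
  have := WE' del hd 0 0; rewrite normr0 => /(_ (ltW e0)).
  rewrite !mul0r X0 exprS !mul0r addr0 big_ord_recl /= expr0 mulr1 big1 ?addr0//.
  by move=> i _; rewrite /= exprS mul0r mulr0.
pose d3 : R := Num.min (Num.min d d') (Num.min (Num.min e 1) (e / (L + 1))).
have L1 : 0 < L + 1 by rewrite ltr_wpDl.
exists (C * (K * (1 + 1 + L)) + KQ), d3; split.
- by rewrite addr_ge0 ?mulr_ge0 ?addr_ge0.
- by rewrite !lt_min d0 d'0 e0 ltr01 divr_gt0.
move=> x; rewrite !le_min => /andP[/andP[xd xd'] /andP[/andP[xe x1] xL]].
have Px : `|(P del).[x]| <= L * `|x|.
  have := hL 0 x; rewrite normr0 add0r => -/(_ ler01 x1)[_ + _].
  by rewrite horner_coef0 P0 subr0.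
have Pe : `|(P del).[x]| <= e.
  apply: le_trans Px _; rewrite ler_pdivlMr// in xL; apply: le_trans xL.
  by rewrite mulrC ler_wpM2l// lerDl.
have fe : `|f x del| <= e by apply: le_trans (fd _ xd) xe.
have W1 := WE' del hd 0 x xe; rewrite mulr1 mul1r -horner_drop// in W1.
have P'E : (P' del).[x] = - \sum_(j < k.+2) c j 0 del * x ^+ j.
  rewrite hornerN horner_poly !big_ord_recl /= c00 !mul0r !add0r.
  by congr (- _); apply: eq_bigr.
have [dA _ lA _] := hAB.
have E0 : `|0 : R| <= e by rewrite normr0 ltW.
have hA := lA x (f x del) (P del).[x] 0 0 0 xe fe Pe E0 E0 E0.
rewrite A0 !subr0 in hA.
have -> : f x del - (P' del).[x] =
    - ((f x del - (P del).[x]) * A x (f x del) (P del).[x]) - x ^+ k.+2 * Q 0 del x.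
  rewrite -dA// P'E W1.
  have -> : X x (f x del) del = - f x del.
    by apply/eqP; rewrite -addr_eq0 addrC; apply/eqP/fX.
  by ring.
apply: le_trans (ler_normD _ _) _; rewrite [_ * `|x| ^+ k.+2]mulrDl !normrN.
rewrite [`|x ^+ _ * _|]normrM normrX [`|_ * A _ _ _|]normrM; apply: lerD.
  apply: (@le_trans _ _ ((C * `|x| ^+ k.+1) * (K * (`|x| + `|x| + L * `|x|)))).
    apply: ler_pM => //; first exact: fP.
    by apply: le_trans hA _; rewrite ler_wpM2l// !lerD// fd.
  by rewrite le_eqVlt; apply/orP; left; apply/eqP; rewrite [`|x| ^+ k.+2]exprSr; ring.
by rewrite mulrC ler_wpM2r ?exprn_ge0// hKQ'.
Unshelve. all: by end_near. Qed.


Hypothesis hn : (2 <= n)%N.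
Hypothesis hF : forall delta, D delta -> \forall x \near (0 : R),
    (\sum_(2 * n - 1 <= j < N) a j delta * x ^+ j) @[N --> \oo]
      --> char_F Y f x delta.
Hypothesis ha : forall delta, D delta -> 0 < a (2 * n - 1)%N delta.
Hypothesis hG : forall delta, D delta -> \forall x \near (0 : R),
    (\sum_(n - 1 <= j < N) b j delta * x ^+ j) @[N --> \oo]
      --> char_G X Y f x delta.
Hypothesis hb : forall delta, D delta ->
    b (n - 1)%N delta ^+ 2 - 4 * n%:R * a (2 * n - 1)%N delta < 0.

Notation X_ del := (fun x y => X x y del).
Notation Y_ del := (fun x y => Y x y del).

Lemma char_G_dd del (e K : R) (A B A' B' : R -> R -> R -> R) (x : R) : 0 < e -> 0 <= K ->
  dd_bounds (X_ del) e K A B -> dd_bounds (Y_ del) e K A' B' ->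
  `|x| < e -> `|f x del| < e ->
  char_G X Y f x del = - (B x (f x del) x + A' x (f x del) (f x del)).
Proof.
move=> e0 K0 [_ dB _ lB] [dA' _ lA' _] xe fe; congr (- (_ + _)).
  have ex : 0 < e - `|x| by rewrite subr_gt0.
  have ve v : `|v - x| <= e - `|x| -> `|v| <= e.
    move=> h; rewrite -(subrK x v); apply: le_trans (ler_normD _ _) _.
    by move: h; rewrite -lerBrDr.
  apply: (@dd_derive1 _ (fun u => X u (f x del) del) (fun v => B v (f x del) x)).
    apply: (lip_cvg ex K0) => v hv.
    have := lB v (f x del) x x (f x del) x (ve _ hv) (ltW fe) (ltW xe) (ltW xe) (ltW fe) (ltW xe).
    by rewrite !subrr normr0 !addr0.
  exists (e - `|x|) => // v /=; rewrite distrC => hv.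
  by rewrite -(dB v (f x del) x (ve _ (ltW hv)) (ltW fe) (ltW xe)) addrC subrK.
set y := f x del in fe *; have ex : 0 < e - `|y| by rewrite subr_gt0.
have ve v : `|v - y| <= e - `|y| -> `|v| <= e.
  move=> h; rewrite -(subrK y v); apply: le_trans (ler_normD _ _) _.
  by move: h; rewrite -lerBrDr.
apply: (@dd_derive1 _ (fun v => Y x v del) (fun v => A' x v y)).
  apply: (lip_cvg ex K0) => v hv.
  have := lA' x v y x y y (ltW xe) (ve _ hv) (ltW fe) (ltW xe) (ltW fe) (ltW fe).
  by rewrite !subrr normr0 !addr0 add0r.
exists (e - `|y|) => // v /=; rewrite distrC => hv.
by rewrite -(dA' x v y (ltW xe) (ve _ (ltW hv)) (ltW fe)) addrC subrK.
Qed.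

Lemma field_lead_family (P : 'rV[R]_l -> {poly R}) m : (n <= m)%N -> (forall del, (P del)`_0 = 0) ->
  ev (fun e del => exists C d : R, [/\ 0 <= C, 0 < d & forall x : R, `|x| <= d ->
    `|f x del - (P del).[x]| <= C * `|x| ^+ m.*2]) ->
  ev (fun e del =>
    Oh n n.+1 (fun r x u => vx (X_ del) (P del) x u - u) /\
    Oh n (2 * n) (fun r x u => vu (X_ del) (Y_ del) (P del) x u
      - (- (a (2 * n - 1)%N del * x ^+ (2 * n - 1)) - b (n - 1)%N del * x ^+ (n - 1) * u))).
Proof.
move=> nm P0 hP; have [K [K0 hK]] := system_dd; near=> e => del hd.
have e0 : 0 < e by near: e; exact: nbhs_right_gt.
have hK' : forall del, `|del - del0| <= e ->
       (exists A B, dd_bounds (fun x y => X x y del) e K A B) /\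
       (exists A B, dd_bounds (fun x y => Y x y del) e K A B) by near: e.
have Dd : D del by move: del hd; near: e.
have [[A [B hAB]] [A' [B' hAB']]] := hK' _ hd.
have [X0 A0 B0] := quad_dd e0 K0 hAB (hXO Dd).
have [d1 [d10 fX fd _]] := char_curve_lip e0 K0 hAB A0 B0 (hf Dd).
have [C2 [d2 [C20 d20 fP]]] : exists C d : R, [/\ 0 <= C, 0 < d & forall x : R, `|x| <= d ->
    `|f x del - (P del).[x]| <= C * `|x| ^+ m.*2] by move: del hd {Dd A B hAB X0 A0 B0 d1 d10 fX fd A' B' hAB'}; near: e.
have [C3 [d3 [C30 d30 F3]]] := series_lead (hF Dd).
have [C4 [d4 [C40 d40 G4]]] := series_lead (hG Dd).
pose d : R := Num.min (Num.min d1 d2) (Num.min (Num.min d3 d4) (e / 2)).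
have d0 : 0 < d by rewrite !lt_min d10 d20 d30 d40 divr_gt0.
have hd' (x : R) : `|x| <= d -> [/\ `|x| <= d1, `|x| <= d2, `|x| <= d3, `|x| <= d4 & `|x| < e].
  rewrite !le_min => /andP[/andP[h1 h2] /andP[/andP[h3 h4] h5]]; split=> //.
  by apply: le_lt_trans h5 _; rewrite ltr_pdivrMr// ltr_pMr// ltr1n.
have n1 : (2 * n - 1).+1 = (2 * n)%N by clear -hn; lia.
have n2 : (n - 1).+1 = n by clear -hn; lia.
have := @field_lead R n (X_ del) (Y_ del) (f^~ del) (P del) (a (2 * n - 1)%N del)
  (b (n - 1)%N del) e K A B A' B' d (C2 + C3 + C4) m.
apply=> //.
- by rewrite hn.
- by rewrite horner_coef0.
- by rewrite !addr_ge0.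
- by move=> x /hd'[h *]; exact: fX.
- by move=> x /hd'[h *]; exact: fd.
- move=> x /hd'[_ h *]; apply: le_trans (fP x h) _.
  by rewrite ler_wpM2r ?exprn_ge0// -addrA lerDl addr_ge0.
- move=> x /hd'[_ _ h *]; have := F3 x h; rewrite /char_F n1 -opprD normrN => /le_trans; apply.
  by rewrite ler_wpM2r ?exprn_ge0// addrAC lerDr addr_ge0.
- move=> x /hd'[h1 _ _ h h5]; have := G4 x h.
  rewrite (char_G_dd e0 K0 hAB hAB' h5) ?(le_lt_trans (fd _ h1))// n2 -opprD normrN => /le_trans; apply.
  by rewrite ler_wpM2r ?exprn_ge0// lerDr addr_ge0.
Unshelve. all: by end_near. Qed.

Lemma coef_cos : coef (fun t _ => cos t).
Proof.
split=> [t||eps e0]; first exact: continuous_cos.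
  by exists 1 => t; rewrite ler_norml cos_geN1 cos_le1.
by near=> e => del _ t; rewrite subrr normr0 ltW.
Unshelve. all: by end_near. Qed.

Lemma coef_sin : coef (fun t _ => sin t).
Proof.
split=> [t||eps e0]; first exact: continuous_sin.
  by exists 1 => t; rewrite ler_norml sin_geN1 sin_le1.
by near=> e => del _ t; rewrite subrr normr0 ltW.
Unshelve. all: by end_near. Qed.

Lemma expandable_field P S N : poly_family P S -> (forall del, (P del)`_0 = 0) ->
  expandable N (fun t del r => vx (X_ del) (P del) (r * cos t) (- (r ^+ n * sin t))) /\
  expandable N (fun t del r => vu (X_ del) (Y_ del) (P del) (r * cos t) (- (r ^+ n * sin t))).
Proof.
move=> hP P0.
have ec := expandable_coef hkappa N coef_cos; have es := expandable_coef hkappa N coef_sin.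
have er := expandable_r del0 hkappa N.
pose Hy t del r := cos t * (drop_poly 1 (P del)).[r * cos t] - r ^+ n.-1 * sin t.
have yE t del r : - (r ^+ n * sin t) + (P del).[r * cos t] = r * Hy t del r.
  by rewrite (horner_drop _ (P0 del)) /Hy -{1}(prednK (ltnW hn)) exprS; ring.
have hHy : expandable N Hy.
  apply: expandableB => //; apply: expandableM => //.
    by apply: expandable_horner (poly_family_drop hP) _; exact: coef_cos.
  exact: expandableX.
have evx : expandable N (fun t del r => vx (X_ del) (P del) (r * cos t) (- (r ^+ n * sin t))).
  have -> : (fun t del r => vx (X_ del) (P del) (r * cos t) (- (r ^+ n * sin t))) =
    (fun t del r => r * Hy t del r + X (r * cos t) (r * Hy t del r) del).
    by do 3!apply/funext => ?; rewrite /vx yE.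
  apply: expandableD => //; first exact: expandableM.
  exact: expandable_system.
split=> //.
have -> : (fun t del r => vu (X_ del) (Y_ del) (P del) (r * cos t) (- (r ^+ n * sin t))) =
    (fun t del r => Y (r * cos t) (r * Hy t del r) del - (P del)^`().[r * cos t] *
       vx (X_ del) (P del) (r * cos t) (- (r ^+ n * sin t))).
  by do 3!apply/funext => ?; rewrite /vu yE.
apply: expandableB => //; first exact: expandable_system.
apply: expandableM => //.
by apply: expandable_horner (poly_family_deriv hP) _; exact: coef_cos.
Qed.

(** Truncating the characteristic curve to a polynomial keeps the change of
    variables expandable; the denominator is positive by [definite_form], so the
    quotient is expandable too. *)
Lemma polar_field M m : exists (P : 'rV[R]_l -> {poly R}) (F1 : R -> 'rV[R]_l -> R -> R) (K : R),
  [/\ forall del, (P del)`_0 = 0, expandable M F1 /\ 0 <= K,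
    ev (fun e del => forall x : R, `|x| <= e -> `|(P del).[x]| <= K * `|x|),
    ev (fun e del => exists C d : R, [/\ 0 <= C, 0 < d & forall x : R, `|x| <= d ->
      `|f x del - (P del).[x]| <= C * `|x| ^+ m]) &
    ev (fun e del => forall t r : R, r != 0 -> `|r| <= e ->
      0 < polar_den (X_ del) (Y_ del) (P del) n t r /\
      r * F1 t del r = r * (polar_num (X_ del) (Y_ del) (P del) n t r
                            / polar_den (X_ del) (Y_ del) (P del) n t r))].
Proof.
pose m' := maxn n m; have nm : (n <= m')%N := leq_maxl _ _.
have mm : (m <= m')%N := leq_maxr _ _.
have [P [S [hP P0 fP]]] := char_poly m'.*2.-1.
have n0 : (0 < n)%N := ltnW hn.
rewrite prednK in fP; last by clear -nm hn; lia.
have lead := field_lead_family nm P0 fP.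
have [evx _] := expandable_field (n + M.+1) hP P0.
have [_ evu] := expandable_field (2 * n - 1 + M.+1) hP P0.
have absr (t r : R) : [/\ `|r * cos t| <= `|r| & `| - (r ^+ n * sin t)| <= `|r| ^+ n].
  split; first by rewrite normrM ler_piMr// ler_norml cos_geN1 cos_le1.
  by rewrite normrN normrM normrX ler_piMr ?exprn_ge0// ler_norml sin_geN1 sin_le1.
have [cx [qx [hcx hqx cxE vxE]]] : exists c q', [/\ coef c, expandable M q',
    ev (fun e del => forall t, c t del = - sin t) &
    near_eq del0 (fun t del r => vx (X_ del) (P del) (r * cos t) (- (r ^+ n * sin t)))
      (fun t del r => r ^+ n * (c t del + r * q' t del r))].
  apply: (expandable_lead hkappa evx).
  apply: filterS lead => e h del /h[[C C0 hC] _] t.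
  case: hC => d /= d0 hC; exists C, (d / 2); split; first exact: divr_gt0.
  move=> r r0 hr; have [h1 h2] := absr t r.
  have := hC (d / 2); rewrite /= sub0r normrN gtr0_norm ?divr_gt0// => /(_ _ _) H.
  have := H _ _ r _ _ r0 hr h1 h2.
  rewrite (_ : - sin t * r ^+ n = - (r ^+ n * sin t)); last by ring.
  by apply=> //; rewrite ltr_pdivrMr// ltr_pMr// ltr1n.
have [cu [qu [hcu hqu cuE vuE]]] : exists c q', [/\ coef c, expandable M q',
    ev (fun e del => forall t, c t del = - (a (2 * n - 1)%N del * cos t ^+ (2 * n - 1))
         + b (n - 1)%N del * cos t ^+ (n - 1) * sin t) &
    near_eq del0 (fun t del r => vu (X_ del) (Y_ del) (P del) (r * cos t) (- (r ^+ n * sin t)))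
      (fun t del r => r ^+ (2 * n - 1) * (c t del + r * q' t del r))].
  apply: (expandable_lead hkappa evu).
  apply: filterS lead => e h del /h[_ [C C0 hC]] t.
  case: hC => d /= d0 hC; exists C, (d / 2); split; first exact: divr_gt0.
  move=> r r0 hr; have [h1 h2] := absr t r.
  have := hC (d / 2); rewrite /= sub0r normrN gtr0_norm ?divr_gt0// => /(_ _ _) H.
  have := H _ _ r _ _ r0 hr h1 h2.
  have n1 : (2 * n - 1).+1 = (2 * n)%N by clear -hn; lia.
  rewrite n1.
  rewrite (_ : (- (a (2 * n - 1)%N del * cos t ^+ (2 * n - 1))
         + b (n - 1)%N del * cos t ^+ (n - 1) * sin t) * r ^+ (2 * n - 1) =
    - (a (2 * n - 1)%N del * (r * cos t) ^+ (2 * n - 1)) - b (n - 1)%N del * (r * cos t) ^+ (n - 1)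
      * - (r ^+ n * sin t)); last first.
    rewrite !exprMn (_ : r ^+ (2 * n - 1) = r ^+ (n - 1) * r ^+ n); first by ring.
    by rewrite -exprD; congr (_ ^+ _); clear -hn; lia.
  by apply=> //; rewrite ltr_pdivrMr// ltr_pMr// ltr1n.
pose cD t del := - (cos t * cu t del + n%:R * sin t * cx t del).
pose qD t del r := - (cos t * qu t del r + n%:R * sin t * qx t del r).
have hcD : coef cD.
  apply: coefN; apply: coefD; apply: coefM => //; first exact: coef_cos.
  by apply: coefM; [exact: coef_cst|exact: coef_sin].
have ec := expandable_coef hkappa M coef_cos; have es := expandable_coef hkappa M coef_sin.
have en := expandable_cst del0 hkappa M n%:R.
have hqD : expandable M qD.
  by apply: expandableN => //; apply: expandableD => //; apply: expandableM => //; exact: expandableM.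
have Dd0 : D del0 := at_center D0.
pose c0 : R := let d := 4 * n%:R * a (2 * n - 1)%N del0 - b (n - 1)%N del0 ^+ 2 in
   Num.min (d * 2^-1 ^+ n / (4 * n%:R)) (d / (8 * a (2 * n - 1)%N del0)).
have nR : (0 : R) < n%:R by rewrite ltr0n.
have c00 : 0 < c0.
  have d0 : 0 < 4 * n%:R * a (2 * n - 1)%N del0 - b (n - 1)%N del0 ^+ 2.
    by rewrite -oppr_lt0 opprB hb.
  rewrite lt_min; apply/andP; split; apply: divr_gt0; rewrite ?mulr_gt0 ?exprn_gt0 ?invr_gt0//.
  exact: ha.
have cD0 t : c0 <= cD t del0.
  have h1 := at_center (Q := fun del => forall t, cx t del = - sin t) cxE t.
  have h2 := at_center (Q := fun del => forall t, cu t del =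
    - (a (2 * n - 1)%N del * cos t ^+ (2 * n - 1))
         + b (n - 1)%N del * cos t ^+ (n - 1) * sin t) cuE t.
  rewrite /cD h1 h2; apply: le_trans (definite_form n0 (ha Dd0) (hb Dd0) (cos2Dsin2 t)) _.
  rewrite le_eqVlt; apply/orP; left; apply/eqP.
  have -> : cos t ^+ (2 * n) = cos t * cos t ^+ (2 * n - 1).
    by rewrite -exprS; congr (_ ^+ _); clear -hn; lia.
  have -> : cos t ^+ n = cos t * cos t ^+ (n - 1).
    by rewrite -exprS; congr (_ ^+ _); clear -hn; lia.
  by ring.
pose Den t del r := cD t del + r * qD t del r.
have hDen : expandable M (fun t del r => (Den t del r)^-1).
  by apply: (expandable_inv hkappa c00 hcD cD0 hqD); exact: near_eq_refl.
pose F1 t del r := (cos t * (cx t del + r * qx t del r) - sin t * (cu t del + r * qu t del r))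
   * (Den t del r)^-1.
have hF1 : expandable M F1.
  have er := expandable_r del0 hkappa M.
  apply: expandableM => //; apply: expandableB => //; apply: expandableM => //;
    apply: expandableD => //; try exact: expandable_coef; exact: expandableM.
have eP := expandable_horner 0 (poly_family_drop hP) (coef_cst del0 1).
have [K [K0 hK]] := bnd_scalar hkappa (expandable_bnd hkappa eP).
have [Kq [Kq0 hKq]] := bnd_scalar hkappa (expandable_bnd hkappa hqD).
exists P, F1, K; split=> //.
- apply: filterS hK => e h del hd x hx; have := h del hd 0 x hx; rewrite mulr1 => h1.
  by rewrite horner_drop// normrM mulrC ler_wpM2r.
- apply: filterS fP => e h del hd; have [C [d [C0 d0 hC]]] := h del hd.
  exists C, (Num.min d 1); split=> //; first by rewrite lt_min d0 ltr01.
  move=> x; rewrite le_min => /andP[x1 x2]; apply: le_trans (hC _ x1) _.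
  by rewrite ler_wpM2l// ler_wiXn2l// (leq_trans mm)// -addnn leq_addr.
have [_ _ hcD3] := hcD; have c40 : 0 < c0 / 4 by rewrite divr_gt0.
near=> e => del hd t r r0 hr.
have e0 : 0 < e by near: e; exact: nbhs_right_gt.
have k1 : forall del, `|del - del0| <= e -> forall t, `|cD t del - cD t del0| <= c0 / 4.
  by near: e; exact: hcD3.
have k2 : forall del, `|del - del0| <= e -> forall t r : R, `|r| <= e -> `|qD t del r| <= Kq.
  by near: e.
have k3 : e * Kq <= c0 / 4.
  by near: e; apply: near0_mul.
have k4 : forall del, `|del - del0| <= e -> forall t r : R, `|r| <= e ->
   vx (X_ del) (P del) (r * cos t) (- (r ^+ n * sin t)) = r ^+ n * (cx t del + r * qx t del r).
  by near: e.
have k5 : forall del, `|del - del0| <= e -> forall t r : R, `|r| <= e ->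
   vu (X_ del) (Y_ del) (P del) (r * cos t) (- (r ^+ n * sin t))
     = r ^+ (2 * n - 1) * (cu t del + r * qu t del r).
  by near: e.
have rn k : r ^+ k != 0 by rewrite expf_neq0.
have DE : polar_den (X_ del) (Y_ del) (P del) n t r = Den t del r.
  rewrite /polar_den k4// k5// ![r ^+ _ * _]mulrC !mulfK// /Den /cD /qD.
  by ring.
have NE : polar_num (X_ del) (Y_ del) (P del) n t r =
   cos t * (cx t del + r * qx t del r) - sin t * (cu t del + r * qu t del r).
  by rewrite /polar_num k4// k5// ![r ^+ _ * _]mulrC !mulfK.
rewrite DE NE; split; last by [].
have h1 := k1 del hd t; have h2 := cD0 t.
have h3 : `|r * qD t del r| <= c0 / 4.
  by rewrite normrM; apply: le_trans k3; apply: ler_pM => //; exact: k2.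
exact: positive_perturbation c00 h2 h1 h3.
Unshelve. all: by end_near. Qed.

End PolarField.

(** * Closed orbits as periodic solutions of the polar equation *)

Section Signs.
Variable R : realType.

Lemma sign_zero (d d' th w : R -> R) (a b K : R) : a <= b ->
  (forall t, a <= t <= b -> is_derive t 1 d (d' t)) ->
  (forall t, a <= t <= b -> is_derive t 1 th (w t)) ->
  (forall t, a <= t <= b -> `|d' t| <= K * w t * `|d t|) ->
  (d a == 0) = (d b == 0).
Proof.
move=> ab dd dth hd.
have dV t : a <= t <= b -> is_derive t 1 (fun t => d t ^+ 2) (2 * d t * d' t).
  move=> ht; apply: (is_derive_val (is_derive_pow 1 (dd t ht))).
  by rewrite expr1.
have bV t : a <= t <= b -> `|2 * d t * d' t| <= (2 * K) * w t * d t ^+ 2.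
  move=> ht; rewrite !normrM normr_nat -(real_normK (num_real (d t))) expr2.
  rewrite (_ : _ * _ * (_ * _) = 2 * `|d t| * (K * w t * `|d t|)); last by ring.
  by rewrite ler_wpM2l ?mulr_ge0// hd.
have g1 := @gronwall R (fun t => d t ^+ 2) (fun t => 2 * d t * d' t) th w a b (2 * K) ab dV dth.
have g2 := @gronwall_lower R (fun t => d t ^+ 2) (fun t => 2 * d t * d' t) th w a b (2 * K) ab dV dth.
have {}g1 : d b ^+ 2 <= d a ^+ 2 * expR (2 * K * (th b - th a)).
  by apply: g1 => t ht; apply: le_trans (bV t ht); exact: ler_norm.
have {}g2 : d a ^+ 2 <= d b ^+ 2 * expR (2 * K * (th b - th a)).
  by apply: g2 => t ht; have := bV t ht; rewrite ler_norml => /andP[].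
apply/idP/idP => /eqP h0.
  by move: g1; rewrite h0 expr0n mul0r => h1; rewrite -sqrf_eq0 eq_le h1 sqr_ge0.
by move: g2; rewrite h0 expr0n mul0r => h1; rewrite -sqrf_eq0 eq_le h1 sqr_ge0.
Qed.

Lemma sign_preserved (d d' th w : R -> R) (a b K : R) : a <= b ->
  (forall t, a <= t <= b -> is_derive t 1 d (d' t)) ->
  (forall t, a <= t <= b -> is_derive t 1 th (w t)) ->
  (forall t, a <= t <= b -> `|d' t| <= K * w t * `|d t|) ->
  (0 < d a) = (0 < d b).
Proof.
move=> ab dd dth hd.
have key c : a <= c <= b -> (d a == 0) = (d c == 0).
  move=> /andP[ac cb]; have sub t : a <= t <= c -> a <= t <= b.
    by move=> /andP[-> tc]; exact: le_trans tc cb.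
  by apply: (@sign_zero d d' th w a c K) => // t /sub ht; [exact: dd|exact: dth|exact: hd].
have cd : {within `[a, b], continuous d}.
  apply: derivable_within_continuous => t; rewrite in_itv /= => ht.
  by have [] := dd t ht.
have kb : (d a == 0) = (d b == 0) by apply: key; rewrite ab lexx.
have zero : Num.min (d a) (d b) <= 0 <= Num.max (d a) (d b) -> d a == 0.
  by move=> /(IVT ab cd)[c]; rewrite in_itv /= => /key -> /eqP.
apply/idP/idP => h; rewrite ltNge; apply/negP => h'.
  have : d a == 0 by apply: zero; rewrite ge_min le_max h' orbT (ltW h).
  by rewrite gt_eqF.
have : d a == 0 by apply: zero; rewrite ge_min le_max h' (ltW h) orbT.
by rewrite kb gt_eqF.
Qed.

Lemma quadratic_growth (q s L : R) : 0 <= L ->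
  2 * q * (s + L * (q + s)) + 2 * s * (L * (q + s)) <= (1 + 4 * L) * (q ^+ 2 + s ^+ 2).
Proof.
move=> L0; have : 0 <= (1 + 2 * L) * (q - s) ^+ 2.
  by rewrite mulr_ge0 ?sqr_ge0// addr_ge0// mulr_ge0.
by rewrite !expr2; lra.
Qed.

Lemma three_quarters (e x : R) : x ^+ 2 <= e ^+ 2 * 2^-1 ^+ 2 ->
  e ^+ 2 * 2^-1 ^+ 2 <= e ^+ 2 - x ^+ 2.
Proof.
have := sqr_ge0 e; rewrite !expr2; move: (e * e) (x * x) => ee xx.
by move=> *; lra.
Qed.

Lemma gauge_root_polar n (r t x u : R) : (0 < n)%N -> 0 < r ->
  x = r * cos t -> u = - (r ^+ n * sin t) -> gauge_root n.-1 x u r.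
Proof.
case: n => // m _ r0 -> ->; split=> //=; rewrite [r ^+ m.+1]exprS sqrrN.
have h : cos t ^+ 2 = 1 - sin t ^+ 2 by rewrite -(cos2Dsin2 t) addrK.
by rewrite [(r * cos t) ^+ 2]exprMn h; move: (r ^+ m) => q; ring.
Qed.

Lemma cos_eq1_ge (d : R) : 0 < d -> cos d = 1 -> pi *+ 2 <= d.
Proof.
move=> d0 cd; rewrite leNgt; apply/negP => h.
have h2 : 0 < sin (d / 2).
  by apply: sin_gt0_pi; rewrite divr_gt0//= ltr_pdivrMr// mulr_natr.
have := cosD (d / 2) (d / 2); rewrite -splitr cd => h3.
have := cos2Dsin2 (d / 2); rewrite !expr2.
have : 0 < sin (d / 2) * sin (d / 2) by rewrite mulr_gt0.
by move: h3; clear; lra.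
Qed.

Lemma same_angle (a b : R) : a < b -> cos a = cos b -> sin a = sin b ->
  exists2 j : nat, (0 < j)%N & b = a + (pi *+ 2) *+ j.
Proof.
move=> ab hc hs; pose p2 : R := pi *+ 2.
have p0 : 0 < p2 by rewrite mulrn_wgt0 ?pi_gt0.
have cosj (x : R) j : cos (x - p2 *+ j) = cos x.
  elim: j => [|j IH]; first by rewrite mulr0n subr0.
  by rewrite mulrSr opprD addrA cosB /p2 cos2pi sin2pi mulr1 mulr0 addr0.
pose d := b - a; have d0 : 0 < d by rewrite subr_gt0.
have cd : cos d = 1.
  by rewrite /d cosB hc hs -!expr2 cos2Dsin2.
pose j := Num.trunc (d / p2).
have : (j%:R <= d / p2 < j.+1%:R) by apply: truncn_itv; rewrite divr_ge0// ltW.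
rewrite ler_pdivlMr// ltr_pdivrMr// => /andP[j1 j2].
have dj : d = p2 *+ j.
  apply/eqP; rewrite -subr_eq0 eq_le subr_le0; apply/andP; split; last first.
    by rewrite subr_ge0 -mulr_natl.
  rewrite leNgt; apply/negP; rewrite -subr_gt0 => h.
  have := @cos_eq1_ge _ h; rewrite cosj => /(_ cd); rewrite leNgt => /negP; apply.
  by rewrite ltrBlDr -/p2 -mulrS -mulr_natl.
exists j; last by rewrite -/p2 -dj /d addrC subrK.
by rewrite lt0n; apply/eqP => j0; move: d0; rewrite dj j0 mulr0n ltxx.
Qed.

End Signs.

(** Everything about a fixed parameter that the study of trajectories uses; the
    constants L and KF do not depend on the parameter, which makes the resulting
    neighbourhoods uniform. *)
Record polar_data (R : realType) (n : nat) (X Y : R -> R -> R) (p : {poly R})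
    (F : R -> R -> R) (b e L KF : R) : Prop := PolarData {
  pd_n : (0 < n)%N;
  pd_b0 : 0 < b;
  pd_b1 : b <= 1;
  pd_be : b <= e / 2;
  pd_e0 : 0 < e;
  pd_L0 : 0 <= L;
  pd_p0 : p.[0] = 0;
  pd_hp : forall x : R, `|x| <= b -> `|p.[x]| + b <= e ^+ n / 2;
  pd_X0 : X 0 0 = 0;
  pd_Y0 : Y 0 0 = 0;
  pd_lipX : forall x y x' y', `|x| <= b -> `|y| <= b -> `|x'| <= b -> `|y'| <= b ->
    `|X x y - X x' y'| <= L * (`|x - x'| + `|y - y'|);
  pd_lipY : forall x y x' y', `|x| <= b -> `|y| <= b -> `|x'| <= b -> `|y'| <= b ->
    `|Y x y - Y x' y'| <= L * (`|x - x'| + `|y - y'|);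
  pd_hF : forall t r : R, r != 0 -> `|r| <= e -> 0 < polar_den X Y p n t r /\
    F t r = r * (polar_num X Y p n t r / polar_den X Y p n t r);
  pd_KF0 : 0 <= KF;
  pd_lipF : forall t r1 r2 : R, `|r1| <= e -> `|r2| <= e ->
    `|F t r1 - F t r2| <= KF * `|r1 - r2|;
  pd_F0 : forall t, F t 0 = 0 }.

Section Trajectories.
Variables (R : realType) (n : nat) (X Y : R -> R -> R) (p : {poly R}) (F : R -> R -> R).
Variables (b e L KF : R).
Hypothesis hpd : polar_data n X Y p F b e L KF.
Let n0 := pd_n hpd.
Let b0 := pd_b0 hpd.
Let be := pd_be hpd.
Let e0 := pd_e0 hpd.
Let L0 := pd_L0 hpd.
Let p0 := pd_p0 hpd.
Let hp := pd_hp hpd.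
Let X0 := pd_X0 hpd.
Let Y0 := pd_Y0 hpd.
Let lipX := pd_lipX hpd.
Let lipY := pd_lipY hpd.
Let hF := pd_hF hpd.
Let KF0 := pd_KF0 hpd.
Let lipF := pd_lipF hpd.
Let F0 := pd_F0 hpd.

Definition solution (I : R -> Prop) (x y : R -> R) : Prop := forall t, I t ->
  [/\ is_derive t 1 x (y t + X (x t) (y t)), is_derive t 1 y (Y (x t) (y t)),
      `|x t| <= b & `|y t| <= b].

(** The origin is an equilibrium, so uniqueness keeps other orbits away from it. *)
Lemma never_zero x y (t0 t1 : R) : t0 <= t1 -> solution (fun t => t0 <= t <= t1) x y ->
  (x t0 ^+ 2 + y t0 ^+ 2 == 0) = (x t1 ^+ 2 + y t1 ^+ 2 == 0).
Proof.
move=> t01 hs; pose V t := x t ^+ 2 + y t ^+ 2.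
pose v t := 2 * x t * (y t + X (x t) (y t)) + 2 * y t * Y (x t) (y t).
have B0 : `|0 : R| <= b by rewrite normr0 ltW.
apply: (@sign_zero _ V v id (fun=> 1) t0 t1 (1 + 4 * L)) => // t ht.
  have [dx dy _ _] := hs t ht.
  have := is_deriveD (is_derive_pow 1 dx) (is_derive_pow 1 dy).
  by rewrite !expr1.
have [_ _ hx hy] := hs t ht.
have := lipX hx hy B0 B0; have := lipY hx hy B0 B0; rewrite X0 Y0 !subr0 mulr1.
rewrite [`|V t|]ger0_norm ?addr_ge0 ?sqr_ge0// /V /v => h1 h2.
rewrite -(real_normK (num_real (x t))) -(real_normK (num_real (y t))).
apply: le_trans (ler_normD _ _) _; rewrite !normrM !normr_nat.
apply: (@le_trans _ _ (2 * `|x t| * (`|y t| + L * (`|x t| + `|y t|)) + 2 * `|y t| * (L * (`|x t| + `|y t|)))).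
  apply: lerD; rewrite ler_wpM2l ?mulr_ge0//.
  by apply: le_trans (ler_normD _ _) _; rewrite lerD2l.
exact: quadratic_growth.
Qed.

Lemma cvg_lip2 (Z : R -> R -> R) (x y : R -> R) (t : R) :
  (forall x y x' y', `|x| <= b -> `|y| <= b -> `|x'| <= b -> `|y'| <= b ->
    `|Z x y - Z x' y'| <= L * (`|x - x'| + `|y - y'|)) ->
  (forall s, `|x s| <= b) -> (forall s, `|y s| <= b) ->
  x s @[s --> t] --> x t -> y s @[s --> t] --> y t ->
  Z (x s) (y s) @[s --> t] --> Z (x t) (y t).
Proof.
move=> lZ xb yb cx cy; apply/cvgrPdist_le => eps eps0.
have c : L * (`|x t - x s| + `|y t - y s|) @[s --> t] --> L * (`|x t - x t| + `|y t - y t|).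
  apply: cvgM; first exact: cvg_cst.
  apply: cvgD; apply: cvg_norm; (apply: cvgB; first exact: cvg_cst) => //.
rewrite !subrr normr0 addr0 mulr0 in c.
move/cvgr_dist_le: c => /(_ _ eps0); apply: filterS => s.
rewrite sub0r normrN => h; apply: le_trans (lZ _ _ _ _ _ _ _ _) _ => //.
by apply: le_trans h; exact: ler_norm.
Qed.

Definition lifted (I : R -> Prop) (x y r th w : R -> R) : Prop := forall t, I t ->
  [/\ 0 < r t <= e, x t = r t * cos (th t), y t = p.[x t] - r t ^+ n * sin (th t),
      0 < w t & is_derive t 1 th (w t) /\ is_derive t 1 r (F (th t) (r t) * w t)].

Lemma cvg_horner (q : {poly R}) (x : R -> R) (t : R) : x s @[s --> t] --> x t ->
  q.[x s] @[s --> t] --> q.[x t].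
Proof.
move=> cx; elim/poly_ind: q => [|q c IH].
  by under eq_fun do rewrite horner0; rewrite horner0; exact: cvg_cst.
under eq_fun do rewrite hornerD hornerMX hornerC.
by rewrite hornerD hornerMX hornerC; apply: cvgD; [exact: cvgM|exact: cvg_cst].
Qed.

Lemma derive_horner (q : {poly R}) (x : R -> R) (t x1 : R) : is_derive t 1 x x1 ->
  is_derive t 1 (fun s => q.[x s]) (q^`().[x t] * x1).
Proof.
move=> dx; elim/poly_ind: q => [|q c IH].
  under eq_fun do rewrite horner0.
  by rewrite deriv0 horner0 mul0r; exact: is_derive_cst.
have -> : (fun s => (q * 'X + c%:P).[x s]) = (fun s => q.[x s] * x s + c).
  by apply/funext => s; rewrite hornerD hornerMX hornerC.
rewrite derivD derivC addr0 derivM derivX mulr1 hornerD hornerMX.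
have := is_deriveD (is_derive_mul IH dx) (is_derive_cst c t 1).
by move=> /is_derive_val; apply; ring.
Qed.

Lemma lift_exists (I : R -> Prop) (cl x y : R -> R) (t0 : R) :
  (forall s t v, I s -> I v -> s <= t <= v -> I t) ->
  (forall t, I (cl t)) -> (forall t, I t -> cl t = t) -> I t0 ->
  (forall t, cl s @[s --> t] --> cl t) ->
  solution I x y -> x t0 ^+ 2 + y t0 ^+ 2 != 0 ->
  exists r th w : R -> R, `|th t0| <= pi /\ lifted I x y r th w.
Proof.
move=> cI Icl clI It0 ccl hs hz.
have nz t : I t -> x t ^+ 2 + y t ^+ 2 != 0.
  move=> It; have [tt|tt] := leP t0 t.
    rewrite -(@never_zero x y t0 t) => // s hs'; apply: hs; exact: (cI t0 s t).
  rewrite (@never_zero x y t t0) ?(ltW tt)// => s hs'; apply: hs; exact: (cI t s t0).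
pose u t := y t - p.[x t].
pose x1 t := vx X p (x t) (u t); pose u1 t := vu X Y p (x t) (u t).
have yE t : u t + p.[x t] = y t by rewrite subrK.
have dx t : I t -> is_derive t 1 x (x1 t).
  by move=> /hs[h _ _ _]; rewrite /x1 /vx yE.
have du t : I t -> is_derive t 1 u (u1 t).
  move=> It; have [_ h _ _] := hs t It.
  by have := is_deriveB h (derive_horner p (dx t It)); rewrite /u1 /vu yE.
have cclf (f f1 : R -> R) : (forall t, I t -> is_derive t 1 f (f1 t)) ->
    forall t, f (cl s) @[s --> t] --> f (cl t).
  by move=> df t; exact: (cvg_comp _ _ (ccl t) (is_derive_cvg (df _ (Icl t)))).
have ccx := cclf x x1 dx.
have ccy : forall t, y (cl s) @[s --> t] --> y (cl t).
  by apply: (cclf y (fun t => Y (x t) (y t))) => t /hs[].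
have bx s : `|x (cl s)| <= b by have [] := hs _ (Icl s).
have by' s : `|y (cl s)| <= b by have [] := hs _ (Icl s).
have cX t : X (x (cl s)) (y (cl s)) @[s --> t] --> X (x (cl t)) (y (cl t)).
  exact: (@cvg_lip2 X (x \o cl) (y \o cl)).
have cY t : Y (x (cl s)) (y (cl s)) @[s --> t] --> Y (x (cl t)) (y (cl t)).
  exact: (@cvg_lip2 Y (x \o cl) (y \o cl)).
have cx1 t : x1 (cl s) @[s --> t] --> x1 (cl t).
  rewrite /x1 /vx yE; under eq_fun do rewrite yE.
  by apply: cvgD; [exact: ccy|exact: cX].
have cu1 t : u1 (cl s) @[s --> t] --> u1 (cl t).
  rewrite /u1 /vu yE; under eq_fun do rewrite yE.
  apply: cvgB; first exact: cY.
  by apply: cvgM; [exact: (@cvg_horner _ (x \o cl))|exact: cx1].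
have xu t : I t -> x t != 0 \/ u t != 0.
  move=> /nz; case: (eqVneq (x t) 0) => [xt0|]; last by left.
  by rewrite /u xt0 p0 subr0 expr0n add0r sqrf_eq0; right.
have [r [th [th0 H]]] := polar_lift n.-1 cI Icl clI It0 ccl dx du cx1 cu1 xu.
pose De t := cos (th t) ^+ 2 + n%:R * sin (th t) ^+ 2.
exists r, th, (fun t => r t ^+ n.-1 * polar_den X Y p n (th t) (r t) / De t).
split=> // t It; have /= := H t It; rewrite (prednK n0) => -[r0 xE uE dth dr].
have [hx hy] : `|x t| <= b /\ `|y t| <= b by have [] := hs t It.
have re : r t <= e.
  rewrite leNgt; apply/negP => er.
  have hr := gauge_root_polar n0 r0 xE uE.
  have := gauge_lt hr e0 er; apply/negP; rewrite -leNgt.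
  have hu : `|u t| <= e ^+ n / 2.
    by apply: le_trans (hp hx); apply: le_trans (ler_normB _ _) _; rewrite addrC lerD2l.
  apply: (@le_trans _ _ ((e ^+ n / 2) ^+ 2)).
    by rewrite -(real_normK (num_real (u t))) lerXn2r ?nnegrE ?divr_ge0 ?exprn_ge0 ?(ltW e0).
  have hxe : x t ^+ 2 <= (e / 2) ^+ 2.
    rewrite -(real_normK (num_real (x t))) lerXn2r ?nnegrE ?divr_ge0 ?(ltW e0)//.
    exact: le_trans be.
  have -> : (e ^+ n / 2) ^+ 2 = (e ^+ n.-1) ^+ 2 * (e ^+ 2 * 2^-1 ^+ 2).
    by rewrite -{1}(prednK n0) [e ^+ _.+1]exprS; move: (e ^+ n.-1) => q; ring.
  rewrite ler_wpM2l ?sqr_ge0//; apply: three_quarters.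
  by rewrite -exprMn.
have rn : r t != 0 by rewrite gt_eqF.
have [D0 FE] : 0 < polar_den X Y p n (th t) (r t) /\
  F (th t) (r t) = r t * (polar_num X Y p n (th t) (r t) / polar_den X Y p n (th t) (r t)).
  by apply: hF => //; rewrite gtr0_norm.
have De0 : 0 < De t.
  apply: (@lt_le_trans _ _ 1) => //; rewrite -(cos2Dsin2 (th t)) lerD2l.
  by rewrite ler_peMl ?sqr_ge0// ler1n.
have pdE : polar_den X Y p n (th t) (r t) =
    - (cos (th t) * (u1 t / r t ^+ (2 * n - 1)) + n%:R * sin (th t) * (x1 t / r t ^+ n)).
  by rewrite /polar_den -xE -uE.
have pnE : polar_num X Y p n (th t) (r t) =
    cos (th t) * (x1 t / r t ^+ n) - sin (th t) * (u1 t / r t ^+ (2 * n - 1)).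
  by rewrite /polar_num -xE -uE.
have e1 : r t ^+ n = r t * r t ^+ n.-1 by rewrite -exprS prednK.
have e2 : r t ^+ (2 * n - 1) = r t * r t ^+ n.-1 * r t ^+ n.-1.
  by rewrite -exprS -exprD; congr (_ ^+ _); clear -n0; lia.
have q0 : r t ^+ n.-1 != 0 by rewrite expf_neq0.
split=> //.
- by rewrite r0.
- by rewrite -uE /u addrC subrK.
- by rewrite divr_gt0// mulr_gt0// exprn_gt0.
split.
  apply: (is_derive_val dth); rewrite pdE e1 e2 -/(De t); move: De0 => /lt0r_neq0 De0.
  move: (De t) (r t) (r t ^+ n.-1) (cos (th t)) (sin (th t)) De0 rn q0 => D q s c v.
  by move=> D'0 q0 s0; field; rewrite D'0 q0 s0.
apply: (is_derive_val dr); rewrite FE; move: D0 De0 => /lt0r_neq0 + /lt0r_neq0.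
rewrite -/(De t) => D0 De0.
rewrite (_ : r t * (_ / _) * (_ * _ / _) = r t ^+ n * polar_num X Y p n (th t) (r t) / De t).
  rewrite pnE e1 e2; move: rn q0 De0.
  move: (De t) (r t) (r t ^+ n.-1) (cos (th t)) (sin (th t)) => D q s c v.
  by move=> q0 s0 D'0; field; rewrite D'0 q0 s0.
rewrite e1; move: (polar_num _ _ _ _ _ _) (polar_den _ _ _ _ _ _) D0 => A B B0.
by field; rewrite B0 De0.
Qed.

Definition shift_inv (c : R) : Prop := forall t r : R, 0 < r <= e -> F (t + c) r = F t r.

Lemma shift_invN c : shift_inv c -> shift_inv (- c).
Proof. by move=> h t r hr; rewrite -(h (t - c)) ?subrK. Qed.

Lemma shift_inv2pi j : shift_inv ((pi *+ 2) *+ j).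
Proof.
have cs (t : R) : cos (t + pi *+ 2) = cos t /\ sin (t + pi *+ 2) = sin t.
  by rewrite cosD sinD cos2pi sin2pi !mulr1 !mulr0 subr0 addr0.
elim: j => [|j IH] t r hr; first by rewrite mulr0n addr0.
rewrite mulrSr addrA -(IH t r hr); move/andP: hr => [r0 re].
have re' : `|r| <= e by rewrite gtr0_norm.
have [_ ->] := hF (t + pi *+ 2 *+ j + pi *+ 2) (lt0r_neq0 r0) re'.
have [_ ->] := hF (t + pi *+ 2 *+ j) (lt0r_neq0 r0) re'.
by rewrite /polar_num /polar_den; have [-> ->] := cs (t + pi *+ 2 *+ j).
Qed.

Definition curve (r th w : R -> R) (t : R) : Prop :=
  [/\ 0 < r t <= e, 0 < w t, is_derive t 1 th (w t) & is_derive t 1 r (F (th t) (r t) * w t)].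

Lemma lifted_curve I x y r th w t : lifted I x y r th w -> I t -> curve r th w t.
Proof. by move=> h /h[h1 _ _ h2 [h3 h4]]. Qed.

Lemma bound_F t r : 0 < r <= e -> `|F t r| <= KF * r.
Proof.
move=> /andP[r0 re]; have := @lipF t r 0; rewrite F0 !subr0 normr0 gtr0_norm//.
by apply=> //; exact: ltW.
Qed.

Lemma curve_growth r th w s t : s <= t -> (forall v, s <= v <= t -> curve r th w v) ->
  r t <= r s * expR (KF * (th t - th s)) /\ r s <= r t * expR (KF * (th t - th s)).
Proof.
move=> st hc; have hb v : s <= v <= t -> `|F (th v) (r v) * w v| <= KF * w v * r v.
  move=> /hc[hr w0 _ _]; rewrite normrM (gtr0_norm w0) mulrAC ler_wpM2r ?(ltW w0)//.
  exact: bound_F.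
split.
- apply: (gronwall st (v := fun v => F (th v) (r v) * w v) (w := w)) => v hv;
    try by have [] := hc v hv.
  by apply: le_trans (hb v hv); exact: ler_norm.
- apply: (gronwall_lower st (v := fun v => F (th v) (r v) * w v) (w := w)) => v hv;
    try by have [] := hc v hv.
  by have := hb v hv; rewrite ler_norml => /andP[].
Qed.

Definition flow (rho : R -> R) (q : R) : Prop :=
  0 < rho q <= e /\ is_derive q 1 rho (F q (rho q)).

(** Two solutions of the same scalar equation keep their order, by uniqueness. *)
Lemma compare_curves r th w rho c s t : s <= t -> shift_inv c ->
  (forall v, s <= v <= t -> curve r th w v) ->
  (forall v, s <= v <= t -> flow rho (th v + c)) ->
  (0 < rho (th s + c) - r s) = (0 < rho (th t + c) - r t) /\
  (rho (th s + c) - r s == 0) = (rho (th t + c) - r t == 0).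
Proof.
move=> st hcc hc hf.
pose d v := rho (th v + c) - r v.
pose d' v := F (th v + c) (rho (th v + c)) * w v - F (th v) (r v) * w v.
have dd v : s <= v <= t -> is_derive v 1 d (d' v).
  move=> hv; have [_ _ dth dr] := hc v hv; have [_ drho] := hf v hv.
  have dthc := is_deriveD dth (is_derive_cst c v 1); rewrite addr0 in dthc.
  have := is_deriveB (@is_derive1_comp _ rho (fun v => th v + c) v _ _ drho dthc) dr.
  exact.
have dth v : s <= v <= t -> is_derive v 1 th (w v) by move=> /hc[].
have hd v : s <= v <= t -> `|d' v| <= KF * w v * `|d v|.
  move=> hv; have [hr w0 _ _] := hc v hv; have [hrho _] := hf v hv.
  rewrite /d' hcc// -mulrBl normrM (gtr0_norm w0) mulrAC ler_wpM2r ?(ltW w0)//.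
  move/andP: hr => [r0 re]; move/andP: hrho => [ro0 roe].
  by apply: lipF; rewrite gtr0_norm.
by split; [exact: (sign_preserved st dd dth hd)|exact: (sign_zero st dd dth hd)].
Qed.

Lemma flow_curve rho q : flow rho q -> curve rho id (fun=> 1) q.
Proof. by move=> [h1 h2]; split=> //; [exact: is_derive_id|rewrite mulr1]. Qed.

Lemma curve_mono (I : R -> Prop) r th w s t :
  (forall s t v, I s -> I v -> s <= t <= v -> I t) ->
  (forall v, I v -> curve r th w v) -> I s -> I t -> s < t -> th s < th t.
Proof.
move=> cI hc Is It st.
have H v : v \in `]s, t[ -> is_derive v 1 th (w v).
  rewrite in_itv /= => /andP[h1 h2]; have Iv : I v by apply: (cI s v t) => //; rewrite !ltW.
  by have [] := hc v Iv.
have cth : {within `[s, t], continuous th}.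
  apply: derivable_within_continuous => v; rewrite in_itv /= => hv.
  by have [_ _ [] ] := hc v (cI s v t Is It hv).
have [v hv E] := MVT st H cth.
rewrite in_itv /= in hv; have /andP[h1 h2] := hv.
have Iv : I v by apply: (cI s v t) => //; rewrite !ltW.
by rewrite -subr_gt0 E mulr_gt0 ?subr_gt0//; have [] := hc v Iv.
Qed.

Lemma reparam (I : R -> Prop) r th w :
  (forall s t v, I s -> I v -> s <= t <= v -> I t) ->
  (forall v, I v -> curve r th w v) ->
  exists T : R -> R, forall q t1 t2, I t1 -> I t2 -> th t1 < q < th t2 ->
    [/\ I (T q), th (T q) = q & flow (fun q => r (T q)) q].
Proof.
move=> cI hc.
have dth t : I t -> is_derive t 1 th (w t) by move=> /hc[].
have w0 t : I t -> 0 < w t by move=> /hc[].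
have [T hT] := inverse_increasing cI dth w0; exists T => q t1 t2 I1 I2 hq.
have [IT thT dT] := hT q t1 t2 I1 I2 hq; split=> //.
have [hr wT _ dr] := hc _ IT; split=> //.
have := @is_derive1_comp _ r T q _ _ dr dT; rewrite thT.
by move=> /is_derive_val; apply; rewrite mulfK// gt_eqF.
Qed.

Lemma lifted_polar I x y r th w t : lifted I x y r th w -> I t ->
  gauge_root n.-1 (x t) (y t - p.[x t]) (r t).
Proof.
move=> h It; have [/andP[r0 _] xE yE _ _] := h t It.
by apply: (@gauge_root_polar _ n (r t) (th t)) => //; rewrite yE addrAC subrr add0r.
Qed.

Lemma same_point I J x y x' y' r th w r' th' w' s t :
  lifted I x y r th w -> lifted J x' y' r' th' w' -> I s -> J t ->
  x s = x' t -> y s = y' t -> [/\ r s = r' t, cos (th s) = cos (th' t) & sin (th s) = sin (th' t)].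
Proof.
move=> h h' Is Jt xE yE; have g1 := lifted_polar h Is; have g2 := lifted_polar h' Jt.
rewrite xE yE in g1; have rE := gauge_uniq g1 g2.
have [/andP[r0 _] xs ys _ _] := h s Is; have [_ xt yt _ _] := h' t Jt.
have rn : r' t != 0 by rewrite -rE gt_eqF.
split=> //; first by apply: (mulfI rn); rewrite -xt -xE xs rE.
have rnn : r' t ^+ n != 0 by rewrite expf_neq0.
by apply: (mulfI rnn); apply/oppr_inj/(addrI p.[x' t]); rewrite -yt -yE ys xE rE.
Qed.

(** If the value after one turn were larger (or smaller), it would go on growing
    (or decreasing) with each turn, and could not come back after j of them. *)
Lemma monotone_periodic (rho : R -> R) (q : R) (j : nat) : (0 < j)%N ->
  (forall q, flow rho q) -> rho (q + (pi *+ 2) *+ j) = rho q ->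
  forall v, rho (v + pi *+ 2) = rho v.
Proof.
move=> j0 hf hq; pose c : R := pi *+ 2.
have hc : shift_inv c by have := shift_inv2pi 1; rewrite mulr1n.
have cmp s t : s <= t -> (0 < rho (s + c) - rho s) = (0 < rho (t + c) - rho t) /\
    (rho (s + c) - rho s == 0) = (rho (t + c) - rho t == 0).
  by move=> st; apply: (@compare_curves rho id (fun=> 1) rho c s t) => // v _; exact: flow_curve.
have cmp' s t : (0 < rho (s + c) - rho s) = (0 < rho (t + c) - rho t) /\
    (rho (s + c) - rho s == 0) = (rho (t + c) - rho t == 0).
  have [st|/ltW ts] := leP s t; first exact: cmp.
  by have [-> ->] := cmp _ _ ts.
suff hz : rho (q + c) - rho q == 0.
  by move=> v; apply/eqP; rewrite -subr_eq0 -(cmp' q v).2.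
have step i : q + c *+ i.+1 = q + c *+ i + c by rewrite mulrSr addrA.
have [h|h|//] := ltgtP 0 (rho (q + c) - rho q).
- have inc i : rho q < rho (q + c *+ i.+1).
    elim: i => [|i IH]; first by rewrite mulr1n -subr_gt0.
    apply: lt_trans IH _; rewrite (step i.+1) -subr_gt0 -(cmp' q _).1//.
  by have := inc j.-1; rewrite prednK// hq ltxx.
have h' v : rho (v + c) < rho v.
  rewrite -subr_lt0 lt_neqAle -(cmp' q v).2 lt_eqF//= leNgt -(cmp' q v).1.
  by rewrite -leNgt ltW.
have dec i : rho (q + c *+ i.+1) < rho q.
  elim: i => [|i IH]; first by rewrite mulr1n h'.
  by apply: lt_trans IH; rewrite (step i.+1) h'.
by have := dec j.-1; rewrite prednK// hq ltxx.
Qed.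

(** A closed orbit near the origin winds around it, so its angle increases by a
    positive multiple of 2 pi over a period and its radius is a periodic function of
    the angle. *)
Lemma periodic_lift x y (T : R) : 0 < T -> solution (fun=> True) x y ->
  (forall t, x (t + T) = x t /\ y (t + T) = y t) ->
  (exists t, (x t, y t) <> (x 0, y 0)) ->
  exists rho : R -> R, [/\ forall q, flow rho q, forall q, rho (q + pi *+ 2) = rho q &
    range (fun t => (x t, y t)) =
    range (fun q => (rho q * cos q, p.[rho q * cos q] - rho q ^+ n * sin q))].
Proof.
move=> T0 hs hT [t1 ht1].
have sq0 (a c : R) : a ^+ 2 + c ^+ 2 == 0 -> a = 0 /\ c = 0.
  by rewrite paddr_eq0 ?sqr_ge0// !sqrf_eq0 => /andP[/eqP -> /eqP ->].
have nz : x 0 ^+ 2 + y 0 ^+ 2 != 0.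
  apply/negP => h0; apply: ht1.
  have h1 : x t1 ^+ 2 + y t1 ^+ 2 == 0.
    have [tt|/ltW tt] := leP 0 t1.
      by rewrite -(@never_zero x y 0 t1)// => s _; exact: hs.
    by rewrite (@never_zero x y t1 0)// => s _; exact: hs.
  by have [-> ->] := sq0 _ _ h0; have [-> ->] := sq0 _ _ h1.
have [r [th [w [_ hl]]]] := @lift_exists (fun=> True) id x y 0 (fun _ _ _ _ _ _ => I)
  (fun=> I) (fun _ _ => erefl) I (fun t => cvg_id) hs nz.
have hc t : curve r th w t by exact: (lifted_curve hl I).
have mono := @curve_mono (fun=> True) r th w _ _ (fun _ _ _ _ _ _ => I) (fun v _ => hc v) I I.
have jump t : exists2 j : nat, (0 < j)%N & th (t + T) = th t + (pi *+ 2) *+ j.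
  have [_ h1 h2] := same_point hl hl I I (hT t).1 (hT t).2.
  by apply: same_angle => //; apply: mono; rewrite ltrDl.
have p2 : 0 < (pi *+ 2 : R) by rewrite mulrn_wgt0 ?pi_gt0.
have big t : th t + pi *+ 2 <= th (t + T).
  by have [[//|j] _ ->] := jump t; rewrite lerD2l [pi *+ 2 *+ j.+1]mulrS lerDl mulrn_wge0// ltW.
have up i t : th t + (pi *+ 2) *+ i <= th (t + T *+ i).
  elim: i => [|i IH]; first by rewrite !mulr0n !addr0.
  rewrite [pi *+ 2 *+ i.+1]mulrSr [T *+ i.+1]mulrSr (addrA (th t)) (addrA t).
  by apply: le_trans (big _); rewrite lerD2r.
have arch (v : R) : exists i : nat, v < (pi *+ 2) *+ i.
  have [i hi] : exists i : nat, `|v / (pi *+ 2)| < i%:R.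
    by exists (Num.trunc `|v / (pi *+ 2)|).+1; have /andP[] := truncn_itv (normr_ge0 (v / (pi *+ 2))).
  exists i; rewrite -mulr_natl -ltr_pdivrMr//; apply: le_lt_trans hi; exact: ler_norm.
have bnds q : exists t1 t2, th t1 < q < th t2.
  have [i hi] := arch (th 0 - q); have [j hj] := arch (q - th 0).
  exists (0 - T *+ i), (0 + T *+ j); apply/andP; split.
    have := up i (0 - T *+ i); rewrite subrK => h; move: hi h; set z := _ *+ i.
    by move: (th _) (th 0) z => u v z; lra.
  have := up j 0 => h; move: hj h; set z := pi *+ 2 *+ j.
  by move: (th _) (th 0) z => u v z; lra.
have [Ti hTi] := @reparam (fun=> True) r th w (fun _ _ _ _ _ _ => I) (fun v _ => hc v).
have hTi' q : th (Ti q) = q /\ flow (fun q => r (Ti q)) q.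
  by have [s [t st]] := bnds q; have [] := hTi q s t I I st.
have inj s t : th s = th t -> s = t.
  move=> h; have [st|st|//] := ltgtP s t; by have := mono _ _ st; rewrite h ltxx.
have TiK t : Ti (th t) = t by apply: inj; exact: (hTi' _).1.
exists (fun q => r (Ti q)); split.
- by move=> q; exact: (hTi' q).2.
- have [j j0 hj] := jump 0; apply: (@monotone_periodic _ (th 0) j j0) => [q|].
    exact: (hTi' q).2.
  rewrite -hj !TiK; have [-> _ _] := same_point hl hl I I (hT 0).1 (hT 0).2.
  by [].
apply/seteqP; split=> [_ [t _ <-]|_ [q _ <-]].
  by exists (th t) => //; rewrite TiK; have [_ h1 h2 _ _] := hl t I; rewrite -h1 -h2.
exists (Ti q) => //; have [_ h1 h2 _ _] := hl (Ti q) I.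
by rewrite h2 h1 (hTi' q).1.
Qed.

End Trajectories.

(** * Few limit cycles when a coefficient is not periodic *)

Lemma card_distinct (T : pointedType) (A : set T) k : ~ (A #<= `I_k)%card ->
  exists g : nat -> T, (forall i, (i <= k)%N -> A (g i)) /\
    forall i j, (i <= k)%N -> (j <= k)%N -> g i = g j -> i = j.
Proof.
move=> hA; have : (`I_k.+1 #<= A)%card.
  have [fA|iA] := pselect (finite_set A).
    have [m hm] := (finite_setP A).1 fA.
    rewrite (card_le_eqr hm) card_le_II ltnNge; apply/negP => mk; apply: hA.
    by rewrite (card_le_eql hm) card_le_II.
  apply: card_le_trans ((infiniteP A).1 iA).
  exact: subset_card_le.
move=> /pcard_leP[f]; exists f; split=> [i ik|i j ik jk].
  by have := @funS _ _ _ _ f; apply.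
by apply: (@inj _ _ _ f); rewrite inE.
Qed.

Lemma near_rV (R : realType) l (del0 : 'rV[R]_l) (e : R) : 0 < e ->
  \forall del \near del0, `|del - del0| <= e.
Proof.
move=> e0; apply/nbhs_ballP; exists e => //= del hd.
rewrite [`|_|]mx_normrE; apply: bigmax_le => [|[i j] _]; first exact: ltW.
case: hd => _ /(_ i j); rewrite /ball /= !mxE distrC => /ltW; exact.
Qed.

Section Reflection.
Variables (R : realType) (n : nat) (X Y : R -> R -> R) (p : {poly R}) (F : R -> R -> R).
Variables (b e L KF : R).
Hypothesis hpd : polar_data n X Y p F b e L KF.

Lemma field_reflect_odd (t r : R) : odd n -> 0 < r <= e -> F t (- r) = - F (t + pi) r.
Proof.
move=> on /andP[r0 re]; have rn : r != 0 by rewrite gt_eqF.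
have re' : `|r| <= e by rewrite gtr0_norm.
have rn' : - r != 0 by rewrite oppr_eq0.
have re2 : `|- r| <= e by rewrite normrN.
have [_ ->] := pd_hF hpd t rn' re2; have [_ ->] := pd_hF hpd (t + pi) rn re'.
have cE : cos (t + pi) = - cos t by rewrite cosD cospi sinpi mulr0 subr0 mulrN1.
have sE : sin (t + pi) = - sin t by rewrite sinD cospi sinpi mulr0 addr0 mulrN1.
have pn : (- r) ^+ n = - r ^+ n by rewrite exprNn -signr_odd on expr1 mulN1r.
have n0 := pd_n hpd.
have p2n : (- r) ^+ (2 * n - 1) = - r ^+ (2 * n - 1).
  by rewrite exprNn -signr_odd (_ : odd _ = true) ?expr1 ?mulN1r//; clear -n0; lia.
have e1 : - r * cos t = r * cos (t + pi) by rewrite cE mulrN mulNr.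
have e2 : - ((- r) ^+ n * sin t) = - (r ^+ n * sin (t + pi)) by rewrite pn sE; ring.
rewrite mulNr; congr (- (_ * (_ / _))); rewrite /polar_num /polar_den e1 e2.
  by move: (vx _ _ _ _) (vu _ _ _ _ _) => A B; rewrite pn p2n cE sE !invrN; ring.
by move: (vx _ _ _ _) (vu _ _ _ _ _) => A B; rewrite pn p2n cE sE !invrN; ring.
Qed.

Lemma field_reflect_even (t r : R) : ~~ odd n -> 0 < r <= e -> F t (- r) = F (pi - t) r.
Proof.
move=> on /andP[r0 re]; have rn : r != 0 by rewrite gt_eqF.
have re' : `|r| <= e by rewrite gtr0_norm.
have rn' : - r != 0 by rewrite oppr_eq0.
have re2 : `|- r| <= e by rewrite normrN.
have [_ ->] := pd_hF hpd t rn' re2; have [_ ->] := pd_hF hpd (pi - t) rn re'.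
have cE : cos (pi - t) = - cos t by rewrite cosB cospi sinpi mul0r addr0 mulN1r.
have sE : sin (pi - t) = sin t by rewrite sinB cospi sinpi mul0r sub0r mulN1r opprK.
have pn : (- r) ^+ n = r ^+ n by rewrite exprNn -signr_odd (negbTE on) expr0 mul1r.
have n0 := pd_n hpd.
have p2n : (- r) ^+ (2 * n - 1) = - r ^+ (2 * n - 1).
  by rewrite exprNn -signr_odd (_ : odd _ = true) ?expr1 ?mulN1r//; clear -n0; lia.
have e1 : - r * cos t = r * cos (pi - t) by rewrite cE mulrN mulNr.
have e2 : - ((- r) ^+ n * sin t) = - (r ^+ n * sin (pi - t)) by rewrite pn sE.
rewrite mulNr -mulrN -mulNr; congr (_ * (_ / _)); rewrite /polar_num /polar_den e1 e2.
  by move: (vx _ _ _ _) (vu _ _ _ _ _) => A B; rewrite pn p2n cE sE !invrN; ring.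
by move: (vx _ _ _ _) (vu _ _ _ _ _) => A B; rewrite pn p2n cE sE !invrN; ring.
Qed.

(* The reflected closed orbit, as a negative solution. *)
(** The polar coordinates (r, t) and (- r, t') describe the same point for a
    suitable t', which depends on the parity of n; so every solution has a negative
    companion. *)
Definition reflect (rho : R -> R) (q : R) : R :=
  if odd n then - rho (q + pi) else - rho (pi - q).

Lemma reflect_derive rho : (forall q, flow F e rho q) ->
  forall q : R, is_derive q 1 (reflect rho) (F q (reflect rho q)).
Proof.
move=> hf q; rewrite /reflect; case: ifPn => on.
  have [hr dr] := hf (q + pi); rewrite field_reflect_odd//.
  have ds := is_deriveD (is_derive_id q 1) (is_derive_cst pi q 1).
  have := is_deriveN (@is_derive1_comp _ rho (fun q => q + pi) q _ _ dr ds).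
  by rewrite addr0 mulr1.
have [hr dr] := hf (pi - q); rewrite field_reflect_even//.
have ds := is_deriveB (is_derive_cst pi q 1) (is_derive_id q 1).
have := is_deriveN (@is_derive1_comp _ rho (fun q => pi - q) q _ _ dr ds).
by rewrite sub0r mulrN1 opprK.
Qed.

Lemma flow_unique rho rho' q0 : (forall q, flow F e rho q) -> (forall q, flow F e rho' q) ->
  rho q0 = rho' q0 -> forall q, rho q = rho' q.
Proof.
move=> h h' E q; have s0 : shift_inv F e 0 by move=> t r _; rewrite addr0.
have cmp s t : s <= t -> (rho s - rho' s == 0) = (rho t - rho' t == 0).
  move=> st; have := @compare_curves _ _ _ _ _ _ _ _ _ _ hpd rho' id (fun=> 1) rho 0 s t st s0.
  rewrite !addr0 => -[||//] v _; first exact: flow_curve.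
  by rewrite addr0.
apply/eqP; rewrite -subr_eq0; have [qq|/ltW qq] := leP q0 q.
  by rewrite -(cmp _ _ qq) E subrr.
by rewrite (cmp _ _ qq) E subrr.
Qed.
End Reflection.


Section Cyclicity.
Variables (R : realType) (l : nat) (X Y : R -> R -> 'rV[R]_l -> R) (n : nat).
Variables (P : 'rV[R]_l -> {poly R}) (F1 : R -> 'rV[R]_l -> R -> R) (del0 : 'rV[R]_l).
Variables (k M : nat) (L KF : R).
Notation X_ del := (fun x y => X x y del).
Notation Y_ del := (fun x y => Y x y del).
Notation F_ del := (fun t r => r * F1 t del r).
Hypothesis hM : M = k.*2.+2.
Hypothesis hdata : \forall e \near (0 : R)^'+, exists b : R,
  forall del, `|del - del0| <= e ->
    polar_data n (X_ del) (Y_ del) (P del) (F_ del) b e L KF.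

(** Each closed orbit yields two periodic solutions, of opposite signs, and r = 0 is
    one more: k + 1 orbits yield 2k + 3 of them, more than
    [periodic_solutions_bound] allows. *)
Lemma few_cycles m (phi : nat -> R -> R) (c : nat -> R -> 'rV[R]_l -> R) :
  (0 < m <= M)%N -> (forall j, coef del0 (c j)) ->
  (forall p, (p <= M)%N -> exists Q, bnd del0 M.+1%:R Q /\ near_eq del0 (fun t del r => r * F1 t del r)
     (fun t del r => r * (\sum_(j < p) c j t del * r ^+ j + r ^+ p * Q t del r))) ->
  (forall j (t : R), (j <= M)%N -> is_derive t 1 (phi j)
      (- \sum_(i < j) i.+1%:R * phi i.+1 t * c (j - i).-1 t del0)) ->
  phi m (pi *+ 2) != phi m 0 ->
  exists2 U : set (R * R), nbhs ((0, 0) : R * R) U &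
        \forall delta \near del0,
          ([set C | limit_cycle X Y delta C /\ C `<=` U] #<= `I_k)%card.
Proof.
move=> hm hc hF dphi pm.
have p2 : (0 : R) <= pi *+ 2 by rewrite mulrn_wge0// ltW// pi_gt0.
have hper := periodic_solutions_bound p2 hm hc hF dphi pm.
have [e [e0 [[b hb] he]]] : exists e : R, 0 < e /\ ((exists b : R,
    forall del, `|del - del0| <= e -> polar_data n (X_ del) (Y_ del) (P del) (F_ del) b e L KF) /\
    forall del : 'rV[R]_l, `|del - del0| <= e ->
    forall r : 'I_m.+1 -> R -> R,
    (forall i (t : R), 0 <= t <= pi *+ 2 -> is_derive t 1 (r i) (r i t * F1 t del (r i t))) ->
    (forall i, r i (pi *+ 2) = r i 0) -> injective (fun i => r i 0) ->
    (forall i, `|r i 0| <= e) -> False).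
  apply: (@filter_ex _ ((0 : R)^'+)); near=> e; split; [|split].
  - by near: e; exact: nbhs_right_gt.
  - by near: e.
  - by near: e.
have b0 : 0 < b by apply: (pd_b0 (hb del0 _)); rewrite subrr normr0 ltW.
exists [set q | `|q.1| <= b /\ `|q.2| <= b].
  by exists ([set x | `|x| <= b], [set x | `|x| <= b]) => /=; [split;
     exists b => // x /=; rewrite sub0r normrN => /ltW|].
apply: filterS (near_rV del0 e0) => del hdel.
have hpd := hb del hdel.
apply: contrapT => /card_distinct[g [hg ginj]].
have hrho i : exists rho : R -> R, (i <= k)%N -> [/\ forall q, flow (F_ del) e rho q,
    forall q, rho (q + pi *+ 2) = rho q &
    g i = range (fun q => (rho q * cos q, (P del).[rho q * cos q] - rho q ^+ n * sin q))].
  have [ik|] := leqP i k; last by exists (fun=> 0).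
  have [[[x [y [T [T0 hs hT hnc gE]]]] _] gU] := hg i ik.
  have hsol : solution (X_ del) (Y_ del) b (fun=> True) x y.
    move=> t _; have [dx dy] := hs t I.
    by have [h1 h2] : [set q : R * R | `|q.1| <= b /\ `|q.2| <= b] (x t, y t) by apply: gU; rewrite gE; exists t.
  have [rho [h1 h2 h3]] := periodic_lift hpd T0 hsol hT hnc.
  by exists rho => _; split=> //; rewrite gE h3.
have [rho hrho'] := choice hrho.
pose node (i : nat) : R -> R := if i == 0%N then fun=> 0 else
  if odd i then rho i./2 else reflect n (rho i.-1./2).
have half (i : 'I_m.+1) : odd i -> (i./2 <= k)%N.
  have := ltn_ord i; move: hm; rewrite hM; clear; lia.
have half' (i : 'I_m.+1) : (i.-1./2 <= k)%N.
  have := ltn_ord i; move: hm; rewrite hM; clear; lia.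
have pos i q : (i <= k)%N -> 0 < rho i q <= e by move=> /hrho'[h _ _]; have [] := h q.
have posr i q : (i <= k)%N -> - e <= reflect n (rho i) q < 0.
  move=> ik; rewrite /reflect; case: ifP => _.
    by rewrite lerN2 oppr_lt0 andbC; apply: pos.
  by rewrite lerN2 oppr_lt0 andbC; apply: pos.
have eqrho i j q : (i <= k)%N -> (j <= k)%N -> rho i q = rho j q -> i = j.
  move=> ik jk E; apply: ginj => //; have [fi _ ->] := hrho' i ik; have [fj _ ->] := hrho' j jk.
  have h := flow_unique hpd fi fj E.
  by congr (_ @` _); apply/funext => s; rewrite h.
apply: (he del hdel (fun i : 'I_m.+1 => node i)) => [i t _|i|i j|i]; rewrite /node.
- case: eqP => _; first by rewrite mul0r; exact: is_derive_cst.
  case: ifPn => oi; first by have [h _ _] := hrho' _ (half i oi); have [] := h t.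
  have [h _ _] := hrho' _ (half' i); exact: (reflect_derive hpd h t).
- case: eqP => // _; case: ifPn => oi.
    by have [_ h _] := hrho' _ (half i oi); rewrite -(h 0) add0r.
  have [_ h _] := hrho' _ (half' i); rewrite /reflect; case: ifP => _.
    by rewrite add0r addrC h.
  by rewrite subr0 -{1}(h (pi - pi *+ 2)) subrK.
- move=> E; apply: val_inj => /=; move: E.
  case: eqP => [->|/eqP i0]; case: eqP => [->//|/eqP j0].
  + case: ifPn => oj E; first by have := pos _ 0 (half j oj); rewrite -E ltxx.
    by have := posr _ 0 (half' j); rewrite -E ltxx andbF.
  + case: ifPn => oi E; first by have := pos _ 0 (half i oi); rewrite E ltxx.
    by have := posr _ 0 (half' i); rewrite E ltxx andbF.
  case: ifPn => oi; case: ifPn => oj E.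
  + have := eqrho _ _ _ (half i oi) (half j oj) E.
    by move: oi oj; clear; lia.
  + have /andP[h1 _] := pos _ 0 (half i oi); have /andP[_] := posr _ 0 (half' j).
    by rewrite -E => /(lt_trans h1); rewrite ltxx.
  + have /andP[h1 _] := pos _ 0 (half j oj); have /andP[_] := posr _ 0 (half' i).
    by rewrite E => /(lt_trans h1); rewrite ltxx.
  + have {}E : rho i.-1./2 pi = rho j.-1./2 pi.
      by move: E; rewrite /reflect add0r subr0; case: ifP => _ /oppr_inj.
    have := eqrho _ _ _ (half' i) (half' j) E.
    by move: i0 j0 oi oj; clear; lia.
- case: eqP => _; first by rewrite normr0 ltW.
  case: ifPn => oi.
    by have /andP[h1 h2] := pos _ 0 (half i oi); rewrite gtr0_norm.
  by have /andP[h1 h2] := posr _ 0 (half' i); rewrite ltr0_norm// lerNl.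
Unshelve. all: by end_near. Qed.

End Cyclicity.

(** * The return map when all low coefficients are periodic *)

Section Analysis.
Variable R : realType.

Lemma derive_eps (f : R -> R) (t c eps : R) : is_derive t 1 f c -> 0 < eps ->
  exists eta : R, 0 < eta /\ forall s, `|s - t| < eta ->
    `|f s - f t - c * (s - t)| <= eps * `|s - t|.
Proof.
move=> df eps0.
have H : h^-1 *: ((f \o shift t) (h *: (1 : R)) - f t) @[h --> 0^'] --> c.
  by case: df => df <-; apply: df.
move/cvgr_dist_le: H => /(_ _ eps0)[eta /= eta0 H]; exists eta; split=> // s hs.
have [->|st] := eqVneq s t; first by rewrite !subrr mulr0 subrr normr0 mulr0.
have hn : s - t != 0 by rewrite subr_eq0.
have := H (s - t); rewrite /= sub0r normrN => /(_ hs hn).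
rewrite /GRing.scale /= mulr1 subrK => h.
rewrite -(ler_pM2r (_ : 0 < `|s - t|)) ?normr_gt0// in h.
rewrite -normrM mulrBl mulrAC mulVf// mul1r in h.
by rewrite distrC.
Qed.

Lemma cos_gt0_abs (a : R) : `|a| <= pi -> 0 < cos a -> `|a| < pi / 2.
Proof.
have -> : cos a = cos `|a|.
  by have [h|h] := leP 0 a; [rewrite ger0_norm|rewrite ltr0_norm// cosN].
move: `|a| => s spi cs; rewrite ltNge; apply/negP => h.
have : 0 <= sin (s - pi / 2).
  apply: sin_ge0_pi; rewrite subr_ge0 h /=.
  by apply: le_trans spi; rewrite gerBl divr_ge0// pi_ge0.
by rewrite sinB cos_pihalf sin_pihalf mulr0 sub0r mulr1 oppr_ge0 leNgt cs.
Qed.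

Lemma cos_le0_mid (a : R) : pi / 2 <= a -> a <= pi + pi / 2 -> cos a <= 0.
Proof.
move=> h1 h2; have : 0 <= sin (a - pi / 2).
  apply: sin_ge0_pi; rewrite subr_ge0 h1 /=.
  by rewrite lerBlDr.
by rewrite sinB cos_pihalf sin_pihalf mulr0 sub0r mulr1 oppr_ge0.
Qed.

Lemma angle_le_sin (a : R) : `|a| < pi / 2 -> `|sin a| <= 2^-1 -> `|a| <= 2 * `|sin a|.
Proof.
wlog a0 : a / 0 <= a.
  move=> H; have [h|h] := leP 0 a; first exact: H.
  by move=> h1 h2; have := H (- a); rewrite oppr_ge0 sinN !normrN; apply=> //; exact: ltW.
rewrite ger0_norm// => api; have s0 : 0 <= sin a.
  apply: sin_ge0_pi; rewrite a0 /=; apply: ltW; apply: lt_le_trans api _.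
  by rewrite ler_pdivrMr// ler_peMr ?pi_ge0// ler1n.
rewrite ger0_norm// => s2.
have c0 t : 0 <= t <= a -> 0 <= cos t - 2^-1.
  move=> /andP[t0 ta]; have tpi : t < pi / 2 by apply: le_lt_trans api.
  have ct : 0 < cos t.
    by apply: cos_gt0_pihalf; rewrite tpi andbT (lt_le_trans _ t0)// oppr_lt0 divr_gt0 ?pi_gt0.
  have st : sin t <= sin a.
    rewrite le_eqVlt; have [->|ne] := eqVneq t a; first by rewrite eqxx.
    apply/orP; right; rewrite ltr_sin ?lt_neqAle ?ne//.
      by rewrite in_itv /= (ltW tpi) andbT (le_trans _ t0)// oppr_le0 divr_ge0 ?pi_ge0.
    by rewrite in_itv /= (ltW api) andbT (le_trans _ a0)// oppr_le0 divr_ge0 ?pi_ge0.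
  have st0 : 0 <= sin t.
    apply: sin_ge0_pi; rewrite t0 /=; apply: ltW; apply: lt_le_trans tpi _.
    by rewrite ler_pdivrMr// ler_peMr ?pi_ge0// ler1n.
  have := cos2Dsin2 t; move: (cos t) (sin t) ct st st0 => c s c0 ss s00 E.
  rewrite leNgt; apply/negP => h.
  by move: s2 E ss; move: (sin a) => sa *; nra.
have := @derive_nonincr R (fun t => t * 2^-1 - sin t) (fun t => 2^-1 - cos t) 0 a a0.
rewrite mul0r sin0 subrr => H.
have : a * 2^-1 - sin a <= 0.
  apply: H => t ht; last by have := c0 t ht; lra.
  have := is_deriveB (is_derive_mul (is_derive_id t 1) (is_derive_cst (2^-1 : R) t 1)) (is_derive_sin t).
  by move=> /is_derive_val; apply; rewrite mulr0 addr0 mul1r.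
by lra.
Qed.

Lemma angle_range (q v a c : R) : 0 < q -> - (q / 2) < a -> c < q / 2 -> a <= v ->
  v <= q *+ 2 + c -> - (q *+ 4) <= v <= q *+ 4 /\ v - a <= q *+ 4.
Proof.
rewrite (_ : 4 = 2 + 2)%N// mulrnDr [q *+ 2]mulr2n => *.
by split; [apply/andP; split|]; lra.
Qed.

Lemma cos_sin_2pi (v : R) : cos (pi *+ 2 + v) = cos v /\ sin (pi *+ 2 + v) = sin v.
Proof.
split; first by rewrite cosD cos2pi sin2pi mul1r mul0r subr0.
by rewrite sinD cos2pi sin2pi mul1r mul0r add0r.
Qed.

End Analysis.

Section Returns.
Variables (R : realType) (n : nat) (X Y : R -> R -> R) (p : {poly R}) (F : R -> R -> R).
Variables (b e L KF Kp C : R) (N : nat) (f : R -> R).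
Hypothesis hpd : polar_data n X Y p F b e L KF.
Hypothesis e1 : e <= 1.
Hypotheses (Kp0 : 0 <= Kp) (C0 : 0 <= C).
Hypothesis hKp : forall x : R, `|x| <= b -> `|p.[x]| <= Kp * `|x|.
Hypothesis f0 : f 0 = 0.
Hypothesis fX : forall x : R, `|x| <= b -> f x + X x (f x) = 0.
Hypothesis flip : forall x x' : R, `|x| <= b -> `|x'| <= b -> `|f x - f x'| <= `|x - x'|.
Hypothesis fp : forall x : R, `|x| <= b -> `|f x - p.[x]| <= C * `|x| ^+ (n + N).
Hypothesis Yneg : forall x : R, 0 < x -> x <= b -> Y x (f x) < 0.

Definition section_point (s rho al : R) : Prop :=
  [/\ 0 < rho, s = rho * cos al, f s - p.[s] = - (rho ^+ n * sin al) & `|al| < pi / 2].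

Lemma section_exists (s : R) : 0 < s -> exists rho al, section_point s rho al.
Proof.
move=> s0; have sn : s != 0 \/ f s - p.[s] != 0 by left; rewrite gt_eqF.
have [r0 E] := @gaugeP R n.-1 s (f s - p.[s]) sn; set r := gauge _ _ _ in r0 E.
have rn : r != 0 by rewrite gt_eqF.
have nE : r ^+ n = r * r ^+ n.-1 by rewrite -exprS (prednK (pd_n hpd)).
have q0 : r ^+ n.-1 != 0 by rewrite expf_neq0.
have [al [ca sa api]] : exists al : R, [/\ cos al = s / r, sin al = - ((f s - p.[s]) / r ^+ n) & `|al| <= pi].
  apply: angle_exists; rewrite sqrrN !expr_div_n -E nE.
  by move: (r ^+ n.-1) q0 => q q0; field; rewrite rn q0.
exists r, al; split=> //.
- by rewrite ca mulrC divfK.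
- by rewrite sa mulrN opprK mulrC divfK// nE mulf_neq0.
- by apply: cos_gt0_abs => //; rewrite ca divr_gt0.
Qed.

Lemma section_bounds s rho al : section_point s rho al -> 0 < s -> s <= b ->
  C * s ^+ N <= 2^-1 -> [/\ s <= rho, rho <= 2 * s, `|al| <= 2 * C * s ^+ N &
    `|rho - s| <= rho * (C * s ^+ N)].
Proof.
move=> [r0 sE uE al2] s0 sb hs.
have cs1 : cos al <= 1 by exact: cos_le1.
have sr : s <= rho by rewrite sE ger_pMr.
have sin_le : `|sin al| <= C * s ^+ N.
  have : `|f s - p.[s]| <= C * s ^+ (n + N).
    by have := fp (x := s); rewrite gtr0_norm//; apply.
  rewrite uE normrN normrM gtr0_norm ?exprn_gt0// exprD => h.
  have rn : 0 < rho ^+ n by rewrite exprn_gt0.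
  rewrite -(ler_pM2l rn); apply: le_trans h _; rewrite mulrCA ler_wpM2r ?mulr_ge0 ?exprn_ge0 ?(ltW s0)//.
  by rewrite lerXn2r ?nnegrE ?(ltW s0) ?(ltW r0).
have cpos : 0 < cos al by rewrite -(pmulr_rgt0 _ r0) -sE.
have s2 : sin al ^+ 2 <= `|sin al|.
  rewrite -(real_normK (num_real (sin al))) expr2 ler_piMr//.
  by apply: le_trans sin_le (le_trans hs _); rewrite invf_le1 ?ler1n.
have c1 : 1 - cos al <= `|sin al|.
  apply: le_trans s2; have := cos2Dsin2 al; move: (cos al) (sin al) cs1 cpos => c s' h1 h2 h3.
  by nra.
split=> //.
- have : rho * 2^-1 <= s; last by lra.
  rewrite sE ler_pM2l//; have := le_trans c1 (le_trans sin_le hs); lra.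
- rewrite -mulrA; apply: le_trans (angle_le_sin al2 (le_trans sin_le hs)) _.
  by rewrite ler_wpM2l.
- rewrite ger0_norm ?subr_ge0// {1}sE -{1}[rho]mulr1 -mulrBr ler_pM2l//.
  exact: le_trans c1 sin_le.
Qed.

Lemma section_unique s rho al rho' al' : section_point s rho al ->
  section_point s rho' al' -> rho = rho' /\ al = al'.
Proof.
move=> [r0 sE uE a1] [r0' sE' uE' a1'].
have g := gauge_root_polar (pd_n hpd) r0 sE uE.
have g' := gauge_root_polar (pd_n hpd) r0' sE' uE'.
have rE := gauge_uniq g g'; split=> //.
have rn : rho != 0 by rewrite gt_eqF.
have cE : cos al = cos al' by apply: (mulfI rn); rewrite -sE {1}rE -sE'.
have snE : sin al = sin al'.
  have rnn : rho ^+ n != 0 by rewrite expf_neq0.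
  by apply: (mulfI rnn); apply: oppr_inj; rewrite -uE {1}rE -uE'.
move: a1 a1'; rewrite !ltr_norml => /andP[h1 h2] /andP[h3 h4].
have p0 : 0 < (pi : R) := pi_gt0 R.
have no (u v : R) : - (pi / 2) < u -> v < pi / 2 -> u < v -> cos u = cos v -> sin u = sin v -> False.
  move=> hu hv uv cc ss; have [[//|j] _ vE] := same_angle uv cc ss.
  have : pi *+ 2 <= (pi *+ 2) *+ j.+1 :> R.
    by rewrite [X in _ <= X]mulrS lerDl mulrn_wge0// mulrn_wge0// ltW.
  move: vE; move: (pi *+ 2 *+ j.+1) => z; rewrite [pi *+ 2]mulr2n; lra.
have [h|h|//] := ltgtP al al'; first by case: (no _ _ h1 h4 h).
by case: (no _ _ h3 h2 h).
Qed.

Definition clampb (v : R) : R := Num.max (- b) (Num.min b v).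

Lemma clampb_id v : `|v| <= b -> clampb v = v.
Proof. by rewrite ler_norml => /andP[h1 h2]; rewrite /clampb (min_idPr h2) (max_idPr h1). Qed.

Lemma clampb_le v : `|clampb v| <= b.
Proof.
have b0 := pd_b0 hpd; rewrite ler_norml /clampb le_max lexx /= ge_max ge_min lexx andbT.
by rewrite lerNl (le_trans _ (ltW b0))// oppr_le0 ltW.
Qed.

Lemma clampb_lip v v' : `|clampb v - clampb v'| <= `|v - v'|.
Proof.
have b0 := pd_b0 hpd.
wlog vv : v v' / v' <= v.
  by move=> H; have [h|/ltW h] := leP v' v; [exact: H|rewrite distrC [leRHS]distrC; exact: H].
have mono : clampb v' <= clampb v.
  rewrite /clampb ge_max !le_max lexx /=; apply/orP; right.
  by rewrite le_min ge_min lexx /= ge_min vv orbT.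
rewrite !ger0_norm ?subr_ge0// /clampb.
have [h1|h1] := leP b v; have [h2|h2] := leP b v'; rewrite ?maxEle; do ?case: ifP => ?; lra.
Qed.

Definition gap (x y : R -> R) (s : R) : R := y s - f (clampb (x s)).

Lemma gap_cvg (x y : R -> R) (s : R) : x v @[v --> s] --> x s -> y v @[v --> s] --> y s ->
  gap x y v @[v --> s] --> gap x y s.
Proof.
move=> cx cy; apply: cvgB => //.
apply: (cvg_comp _ (fun v => f (clampb v)) cx).
apply: (@lip_cvg _ (fun v => f (clampb v)) (x s) 1 1) => // v _; rewrite mul1r.
by apply: le_trans (clampb_lip _ _); apply: flip; exact: clampb_le.
Qed.

Lemma gap_zero (x y : R -> R) (s1 s2 : R) : s1 <= s2 -> solution X Y b (fun t => s1 <= t <= s2) x y ->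
  gap x y s1 * gap x y s2 < 0 -> exists s, s1 < s < s2 /\ y s = f (x s).
Proof.
move=> s12 hs hneg.
have cg : {within `[s1, s2], continuous (gap x y)}.
  have cg s : s1 <= s <= s2 -> {for s, continuous (gap x y)}.
    move=> /hs[dx dy _ _]; apply: gap_cvg; exact: is_derive_cvg.
  by apply: continuous_in_subspaceT => s; rewrite inE /= in_itv /= => /cg.
have h0 : Num.min (gap x y s1) (gap x y s2) <= 0 <= Num.max (gap x y s1) (gap x y s2).
  rewrite ge_min le_max; move: hneg.
  have [h|h|h] := ltgtP (gap x y s1) 0; have [k|k|k] := ltgtP (gap x y s2) 0; rewrite //=.
  - by rewrite ltNge ltW// nmulr_rgt0.
  - by rewrite ltNge ltW// mulr_gt0.
have [s] := IVT s12 cg h0; rewrite in_itv /= => /andP[h1 h2] hz.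
have n1 : s1 != s by apply/eqP => E; move: hneg; rewrite E hz mul0r ltxx.
have n2 : s != s2 by apply/eqP => E; move: hneg; rewrite -E hz mulr0 ltxx.
exists s; split; first by rewrite !lt_neqAle n1 n2 h1 h2.
have [_ _ xb _] := hs s (introT andP (conj h1 h2)).
by apply/eqP; rewrite -subr_eq0 -hz /gap clampb_id.
Qed.

Lemma hit_crossing (x y : R -> R) (s0 : R) : is_derive s0 1 x (y s0 + X (x s0) (y s0)) ->
  is_derive s0 1 y (Y (x s0) (y s0)) -> y s0 = f (x s0) -> 0 < x s0 -> x s0 <= b ->
  exists eta : R, 0 < eta /\ forall s, `|s - s0| < eta -> s != s0 -> `|x s| <= b ->
    gap x y s * (s - s0) < 0.
Proof.
move=> dx dy yE x0 xb; have xb' : `|x s0| <= b by rewrite gtr0_norm.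
rewrite yE fX// in dx; rewrite yE in dy.
have g0 := Yneg x0 xb; set g := Y (x s0) (f (x s0)) in g0 dy.
have q0 : 0 < - g / 4 by rewrite divr_gt0// oppr_gt0.
have [e1' [e10 h1]] := derive_eps dx q0; have [e2 [e20 h2]] := derive_eps dy q0.
exists (Num.min e1' e2); split; first by rewrite lt_min e10.
move=> s; rewrite lt_min => /andP[s1 s2] sn xs.
have := h1 s s1; rewrite mul0r subr0 => k1; have k2 := h2 s s2.
have k3 := flip xs xb'.
have z0 : 0 < `|s - s0| by rewrite normr_gt0 subr_eq0.
have k4 : `|gap x y s - g * (s - s0)| <= - g / 2 * `|s - s0|.
  rewrite /gap clampb_id// (_ : y s - f (x s) - g * (s - s0) = (y s - y s0 - g * (s - s0)) - (f (x s) - f (x s0))); last first.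
    by rewrite yE; ring.
  apply: le_trans (ler_normB _ _) _; move: (le_trans k3 k1) k2.
  by move: `|y s - _ - _| `|f _ - _| `|s - s0| => A B Z *; lra.
set W := gap x y s in k4 *; set z := s - s0 in z0 k4 *.
have k5 : `|(W - g * z) * z| <= - g / 2 * (z * z).
  by rewrite normrM -expr2 -(real_normK (num_real z)) expr2 mulrA ler_wpM2r.
have zz : 0 < z * z by rewrite -expr2 -(real_normK (num_real z)) exprn_gt0.
move: k5; rewrite ler_norml => /andP[_ k5].
have : g * (z * z) < 0 by rewrite nmulr_rlt0.
move: k5; rewrite (_ : (W - g * z) * z = W * z - g * (z * z)); last by ring.
rewrite (_ : - g / 2 * (z * z) = - (g * (z * z)) / 2); last by field.
by move: (W * z) (g * (z * z)) => A Z; lra.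
Qed.

Lemma gap_lifted (x y r th w : R -> R) (I : R -> Prop) (t : R) : lifted n p F e I x y r th w -> I t -> `|x t| <= b ->
  cos (th t) = 0 -> gap x y t = - (r t ^+ n * sin (th t)).
Proof.
move=> hl It xb c0; have [_ xE yE _ _] := hl t It.
have x0 : x t = 0 by rewrite xE c0 mulr0.
by rewrite /gap clampb_id// x0 f0 subr0 yE x0 (pd_p0 hpd) sub0r.
Qed.

Section OneReturn.
Variables (x y : R -> R) (tau x0 : R).
Hypotheses (x00 : 0 < x0) (tau0 : 0 < tau).
Hypothesis sol : forall t, 0 <= t <= tau ->
  is_derive t 1 x (y t + X (x t) (y t)) /\ is_derive t 1 y (Y (x t) (y t)).
Hypotheses (xi : x 0 = x0) (yi : y 0 = f x0).
Hypothesis nohit : forall t, 0 < t < tau -> 0 < x t -> y t <> f (x t).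

Lemma sub_int (t s z v : R) : 0 <= s <= t -> 0 <= v <= t -> s <= z <= v -> 0 <= z <= t.
Proof.
by move=> /andP[h1 _] /andP[_ h2] /andP[h3 h4]; rewrite (le_trans h1 h3) (le_trans h4 h2).
Qed.

Lemma no_overshoot t r th w : 0 <= t <= tau -> solution X Y b (fun s => 0 <= s <= t) x y ->
  lifted n p F e (fun s => 0 <= s <= t) x y r th w -> `|th 0| < pi / 2 ->
  th t < pi *+ 2 + pi / 2.
Proof.
move=> /andP[t0 ttau] hs hl th0; rewrite ltNge; apply/negP => ht.
have p0 := pi_gt0 R.
have cI := @sub_int t.
have hc (s : R) : 0 <= s <= t -> curve F e r th w s by move=> hst; exact: (lifted_curve hl hst).
have mono := curve_mono (I := fun s => 0 <= s <= t) cI hc.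
have mono' u v : 0 <= u <= t -> 0 <= v <= t -> th u < th v -> u < v.
  move=> hu hv uv; rewrite ltNge; apply/negP; rewrite le_eqVlt => /orP[/eqP E|h].
    by move: uv; rewrite E ltxx.
  by have := mono _ _ hv hu h; move/(lt_trans uv); rewrite ltxx.
have cth : {within `[0, t], continuous th}.
  apply: derivable_within_continuous => v; rewrite in_itv /= => hv.
  by have [_ _ []] := hc v hv.
have reach (v : R) : th 0 <= v -> v <= th t -> exists2 s, 0 <= s <= t & th s = v.
  move=> h1 h2; have : Num.min (th 0) (th t) <= v <= Num.max (th 0) (th t).
    by rewrite ge_min le_max h1 h2 orbT.
  by move=> /(IVT t0 cth)[s hs' E]; exists s.
have th0' : th 0 < pi / 2 by move: th0; rewrite ltr_norml => /andP[].
have [s1 hs1 E1] : exists2 s, 0 <= s <= t & th s = pi *+ 2 - pi / 2.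
  by apply: reach; [|apply: le_trans ht]; move: th0' p0; rewrite [pi *+ 2]mulr2n; move: (th 0) (pi : R) => v q *; lra.
have [s2 hs2 E2] : exists2 s, 0 <= s <= t & th s = pi *+ 2 + pi / 2.
  by apply: reach => //; move: th0' p0; rewrite [pi *+ 2]mulr2n; move: (th 0) (pi : R) => v q *; lra.
have s12 : s1 < s2.
  by apply: mono' => //; rewrite E1 E2; move: p0; rewrite [pi *+ 2]mulr2n; move: (pi : R) => q *; lra.
have cos2 (v : R) : cos (pi *+ 2 + v) = cos v /\ sin (pi *+ 2 + v) = sin v.
  exact: cos_sin_2pi.
have [c1 z1] := cos2 (- (pi / 2)); have [c2 z2] := cos2 (pi / 2).
rewrite cosN cos_pihalf in c1; rewrite sinN sin_pihalf in z1.
rewrite cos_pihalf in c2; rewrite sin_pihalf in z2.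
have [_ _ xb1 _] := hs s1 hs1; have [_ _ xb2 _] := hs s2 hs2.
have g1 := gap_lifted hl hs1 xb1; rewrite E1 c1 z1 in g1.
have g2 := gap_lifted hl hs2 xb2; rewrite E2 c2 z2 in g2.
have [/andP[r1 _] _ _ _ _] := hl s1 hs1; have [/andP[r2 _] _ _ _ _] := hl s2 hs2.
have subs v : s1 <= v <= s2 -> 0 <= v <= t by exact: cI.
have [s [/andP[ss1 ss2] hit]] : exists s, s1 < s < s2 /\ y s = f (x s).
  apply: gap_zero; [exact: ltW|by move=> v /subs; exact: hs|].
  by rewrite g1// g2// mulrN1 opprK mulr1 mulrN oppr_lt0 mulr_gt0// exprn_gt0.
have hst : 0 <= s <= t by apply: subs; rewrite !ltW.
have [/andP[rs _] xE _ _ _] := hl s hst.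
apply: (nohit (t := s)) => //.
  move/andP: hs1 => [h1 _]; move/andP: hs2 => [_ h2].
  by rewrite (le_lt_trans h1 ss1) (lt_le_trans ss2 (le_trans h2 ttau)).
rewrite xE mulr_gt0//.
have k1 := mono _ _ hs1 hst ss1; have k2 := mono _ _ hst hs2 ss2.
rewrite E1 in k1; rewrite E2 in k2.
have -> : cos (th s) = cos (th s - pi *+ 2) by have [<- _] := cos2 (th s - pi *+ 2); rewrite addrC subrK.
by apply: cos_gt0_pihalf; move: k1 k2; rewrite [pi *+ 2]mulr2n; move: (th s) (pi : R) => v q *; apply/andP; split; lra.
Qed.

Definition clamp0 (t s : R) : R := Num.max 0 (Num.min s t).

Lemma clamp0_cvg t s : clamp0 t v @[v --> s] --> clamp0 t s.
Proof.
apply: (@lip_cvg _ (clamp0 t) s 1 1) => // v _; rewrite mul1r /clamp0.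
rewrite maxEle minEle [Num.min s t]minEle maxEle.
have [h1|h1] := leP v t; have [h2|h2] := leP s t; do ?case: ifP => ?;
  have := ler_norm (v - s); have := ler_norm (s - v); rewrite [`|s - v|]distrC => k1 k2;
  rewrite ?subrr ?normr0// ler_norml; apply/andP; split; lra.
Qed.

Variables (rho al : R).
Hypothesis hsec : section_point x0 rho al.
Hypothesis x0b : x0 <= b.

Lemma lift_prefix t : 0 <= t <= tau -> solution X Y b (fun s => 0 <= s <= t) x y ->
  exists r th w, [/\ lifted n p F e (fun s => 0 <= s <= t) x y r th w, r 0 = rho, th 0 = al &
     th t < pi *+ 2 + pi / 2].
Proof.
move=> htt hs; have /andP[t0 ttau] := htt.
have I0 : 0 <= (0 : R) <= t by rewrite lexx.
have nz : x 0 ^+ 2 + y 0 ^+ 2 != 0.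
  by rewrite gt_eqF// xi ltr_wpDr ?sqr_ge0// exprn_gt0.
have cl1 s : 0 <= clamp0 t s <= t by rewrite /clamp0 le_max lexx /= ge_max t0 ge_min lexx orbT.
have cl2 s : 0 <= s <= t -> clamp0 t s = s.
  by move=> /andP[h1 h2]; rewrite /clamp0 (min_idPl h2) (max_idPr h1).
have [r [th [w [thpi hl]]]] := lift_exists hpd (I := fun s => 0 <= s <= t) (@sub_int t) cl1 cl2 I0 (@clamp0_cvg t) hs nz.
have [/andP[r0 re] xE yE w0 _] := hl 0 I0.
have th2 : `|th 0| < pi / 2.
  by apply: cos_gt0_abs => //; rewrite -(pmulr_rgt0 _ r0) -xE xi.
have hsec' : section_point x0 (r 0) (th 0).
  by split=> //; [rewrite -xE xi|rewrite -yi yE xi addrAC subrr add0r].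
have [E1 E2] := section_unique hsec' hsec.
exists r, th, w; split=> //; exact: (no_overshoot htt hs hl).
Qed.

Lemma lifted_small t r th w : 0 <= t <= tau -> solution X Y b (fun s => 0 <= s <= t) x y ->
  lifted n p F e (fun s => 0 <= s <= t) x y r th w -> r 0 = rho -> th 0 = al ->
  th t < pi *+ 2 + pi / 2 ->
  r t <= rho * expR (KF * (pi *+ 4)) /\ `|x t| + `|y t| <= (2 + Kp) * r t.
Proof.
move=> /andP[t0 _] hs hl r0 th0 tht; have It : 0 <= t <= t by rewrite t0 lexx.
have hc (s : R) : 0 <= s <= t -> curve F e r th w s by move=> h; exact: (lifted_curve hl h).
have [h1 _] := curve_growth hpd t0 hc.
have [/andP[rt re] xE yE _ _] := hl t It; have [_ _ xb _] := hs t It.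
split.
  apply: le_trans h1 _; rewrite r0; have [rho0 _ _ al2] := hsec.
  rewrite ler_pM2l// ler_expR ler_wpM2l ?(pd_KF0 hpd)// th0.
  move: al2 tht; rewrite ltr_norml => /andP[k1 k2].
  have := pi_gt0 R; rewrite (_ : 4 = 2 + 2)%N// mulrnDr [pi *+ 2]mulr2n.
  by move: k1; move: (th t) (pi : R) => v q *; lra.
have xr : `|x t| <= r t by rewrite xE normrM gtr0_norm// ger_pMr// ler_norml cos_geN1 cos_le1.
have rn : r t ^+ n <= r t.
  rewrite -{2}[r t]expr1 ler_wiXn2l ?(ltW rt)//; last exact: pd_n hpd.
  exact: le_trans e1.
have yr : `|y t| <= Kp * r t + r t.
  rewrite yE; apply: le_trans (ler_normB _ _) _; apply: lerD.
    by apply: le_trans (hKp xb) _; rewrite ler_wpM2l.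
  rewrite normrM [`|r t ^+ n|]ger0_norm ?exprn_ge0 ?(ltW rt)//.
  apply: le_trans rn; rewrite ger_pMr ?exprn_gt0// ler_norml sin_geN1 sin_le1//.
by move: xr yr; move: `|x t| `|y t| => u v; lra.
Qed.

Hypothesis small : (2 + Kp) * (rho * expR (KF * (pi *+ 4))) < b.
Hypothesis hitx : 0 < x tau.
Hypothesis hity : y tau = f (x tau).

(** Before the first return the angle has not increased by more than two turns, so
    the growth rate KF of the radius keeps the orbit in the box. *)
Lemma trapped : solution X Y b (fun t => 0 <= t <= tau) x y.
Proof.
have key t : 0 <= t <= tau -> `|x t| + `|y t| < b.
  apply: (@continuous_induction_le R (fun t => `|x t| + `|y t|) 0 tau b (ltW tau0)).
  - move=> s /sol[dx dy]; have cx := is_derive_cvg dx; have cy := is_derive_cvg dy.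
    by apply: cvgD; exact: cvg_norm.
  - rewrite xi yi; apply: le_lt_trans small.
    have [rho0 x0E _ _] := hsec.
    have xb : `|x0| <= b by rewrite gtr0_norm.
    have z0 : `|0 : R| <= b by rewrite normr0 ltW// (pd_b0 hpd).
    have fx0 : `|f x0| <= x0.
      by have := flip xb z0; rewrite f0 !subr0 [`|x0|]gtr0_norm.
    have xr : x0 <= rho by rewrite x0E ger_pMr// cos_le1.
    apply: (@le_trans _ _ (2 * rho)); first by rewrite gtr0_norm// mulr_natl mulr2n lerD// (le_trans fx0).
    apply: ler_pM; rewrite ?(ltW rho0)// ?lerDl// ler_peMr ?(ltW rho0)//.
    by rewrite -expR0 ler_expR mulr_ge0 ?(pd_KF0 hpd)// mulrn_wge0// pi_ge0.
  move=> s hsn hb; have hs : solution X Y b (fun v => 0 <= v <= s) x y.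
    move=> v hv; have [h1 h2] : is_derive v 1 x (y v + X (x v) (y v)) /\ is_derive v 1 y (Y (x v) (y v)).
      by apply: sol; move/andP: hv => [-> k]; move/andP: hsn => [_ k']; exact: le_trans k'.
    have := hb v hv => k; split=> //.
      by apply: le_trans k; rewrite lerDl.
    by apply: le_trans k; rewrite lerDr.
  have [r [th [w [hl r0 th0 tht]]]] := lift_prefix hsn hs.
  have [k1 k2] := lifted_small hsn hs hl r0 th0 tht.
  apply: le_lt_trans k2 _; apply: le_lt_trans small.
  by rewrite ler_wpM2l// addr_ge0.
move=> t ht; have [dx dy] := sol ht; have h := key t ht; split=> //.
  by apply: le_trans (ltW h); rewrite lerDl.
by apply: le_trans (ltW h); rewrite lerDr.
Qed.

(** The first return with x > 0 happens exactly one turn later: crossings of the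
    characteristic curve with x < 0 are not returns, and the curve stays within a
    quarter turn of the axis. *)
Lemma return_lift : exists r th w al1,
  [/\ lifted n p F e (fun t => 0 <= t <= tau) x y r th w, r 0 = rho, th 0 = al,
      th tau = pi *+ 2 + al1 & section_point (x tau) (r tau) al1].
Proof.
have tt : 0 <= tau <= tau by rewrite lexx ltW.
have I0 : 0 <= (0 : R) <= tau by rewrite lexx ltW.
have [r [th [w [hl r0 th0 tht]]]] := lift_prefix tt trapped.
have hc (s : R) : 0 <= s <= tau -> curve F e r th w s by move=> h; exact: (lifted_curve hl h).
have mono := curve_mono (I := fun s => 0 <= s <= tau) (@sub_int tau) hc.
have [/andP[rt re] xE yE _ _] := hl tau tt.
have p0 := pi_gt0 R; have [_ _ _ al2] := hsec.
have th0t := mono _ _ I0 tt tau0; rewrite th0 in th0t.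
have ct : 0 < cos (th tau) by rewrite -(pmulr_rgt0 _ rt) -xE.
have al2' := al2; move: al2'; rewrite ltr_norml => /andP[a1 a2].
have far : pi + pi / 2 < th tau.
  rewrite ltNge; apply/negP => h.
  have th_small : th tau < pi / 2.
    rewrite ltNge; apply/negP => h'; have := cos_le0_mid h' h; rewrite leNgt ct//.
  have xpos s : 0 <= s <= tau -> 0 < x s.
    move=> hs; have [/andP[rs _] xs _ _ _] := hl s hs; rewrite xs mulr_gt0//.
    apply: cos_gt0_pihalf; apply/andP; split.
      have [<-|s0] := eqVneq 0 s; first by rewrite th0.
      move/andP: (hs) => [h1 _]; apply: (lt_trans a1); rewrite -th0.
      by apply: mono => //; rewrite lt_neqAle s0.
    have [->|s0] := eqVneq s tau => //; move/andP: (hs) => [_ h1]; apply: lt_trans th_small.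
    by apply: mono => //; rewrite lt_neqAle s0.
  have [dx0 dy0 xb0 _] := trapped I0; have [dx1 dy1 xb1 _] := trapped tt.
  have [e1' [e10 c0]] : exists eta : R, 0 < eta /\ forall s, `|s - 0| < eta -> s != 0 -> `|x s| <= b ->
      gap x y s * (s - 0) < 0.
    by apply: (hit_crossing dx0 dy0); rewrite ?xi.
  have [e2 [e20 c1]] : exists eta : R, 0 < eta /\ forall s, `|s - tau| < eta -> s != tau -> `|x s| <= b ->
      gap x y s * (s - tau) < 0.
    by apply: (hit_crossing dx1 dy1) => //; rewrite gtr0_norm// in xb1.
  pose s1 := Num.min (e1' / 2) (tau / 3); pose s2 := tau - Num.min (e2 / 2) (tau / 3).
  have s10 : 0 < s1 by rewrite lt_min !divr_gt0.
  have s1e : s1 <= e1' / 2 by rewrite ge_min lexx.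
  have s1t : s1 <= tau / 3 by rewrite ge_min lexx orbT.
  have s20 : s2 < tau by rewrite ltrBlDr ltrDl lt_min !divr_gt0.
  have s2e : tau - e2 / 2 <= s2 by rewrite lerD2l lerN2 ge_min lexx.
  have s2t : tau - tau / 3 <= s2 by rewrite lerD2l lerN2 ge_min lexx orbT.
  have s12 : s1 <= s2 by move: s1t s2t tau0; lra.
  have i1 : 0 <= s1 <= tau by rewrite (ltW s10) (le_trans s12)// ltW.
  have i2 : 0 <= s2 <= tau by rewrite (ltW s20) (le_trans (ltW s10)).
  have [_ _ xs1 _] := trapped i1; have [_ _ xs2 _] := trapped i2.
  have n1 : gap x y s1 < 0.
    have := c0 s1; rewrite subr0 gtr0_norm// => /(_ _ (lt0r_neq0 s10) xs1).
    by rewrite pmulr_llt0//; apply; move: s1e e10; lra.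
  have n2 : 0 < gap x y s2.
    have := c1 s2; rewrite ltr0_norm ?subr_lt0// opprB => hh.
    have sn : s2 != tau by rewrite lt_eqF.
    have se : tau - s2 < e2 by move: s2e e20; lra.
    by have := hh se sn xs2; rewrite nmulr_llt0// subr_lt0.
  have [s [/andP[ss1 ss2] hit]] : exists s, s1 < s < s2 /\ y s = f (x s).
    apply: (gap_zero s12); last by rewrite nmulr_rlt0.
    by move=> v hv; apply: trapped; exact: sub_int hv.
  have hs : 0 <= s <= tau by rewrite (ltW (lt_trans s10 ss1)) (ltW (lt_trans ss2 s20)).
  apply: (nohit (t := s)) => //; last exact: xpos.
  by rewrite (lt_trans s10 ss1) (lt_trans ss2 s20).
exists r, th, w, (th tau - pi *+ 2); split=> //; first by rewrite addrC subrK.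
have cos2 (v : R) : cos (pi *+ 2 + v) = cos v /\ sin (pi *+ 2 + v) = sin v.
  exact: cos_sin_2pi.
have [c2 z2] := cos2 (th tau - pi *+ 2); rewrite addrC subrK in c2 z2.
split=> //.
- by rewrite -c2.
- by rewrite -hity yE -z2 addrAC subrr add0r.
- by move: far tht; rewrite ltr_norml [pi *+ 2]mulr2n; move: (th tau) (pi : R) => v q *; apply/andP; split; lra.
Qed.

End OneReturn.
Definition returns (x0 x1 : R) : Prop := exists (x y : R -> R) (tau : R),
  [/\ 0 < tau,
    forall t, 0 <= t <= tau -> is_derive t 1 x (y t + X (x t) (y t)) /\ is_derive t 1 y (Y (x t) (y t)),
    x 0 = x0 /\ y 0 = f x0,
    (y tau = f (x tau) /\ 0 < x0 * x tau) /\
      (forall t, 0 < t < tau -> ~ (y t = f (x t) /\ 0 < x0 * x t)) &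
    x1 = x tau].

Variable xmax : R.
Hypotheses (xmax0 : 0 < xmax) (xmaxb : xmax <= b) (N0 : (0 < N)%N).
Hypothesis xmaxC : C * xmax ^+ N <= 2^-1.
Let G : R := 2 * expR (KF * (pi *+ 4)).
Hypothesis xmaxG : (2 + Kp) * (G * xmax) < b.

Lemma exp_ge1 : 1 <= expR (KF * (pi *+ 4)).
Proof. by rewrite -expR0 ler_expR mulr_ge0 ?(pd_KF0 hpd)// mulrn_wge0// pi_ge0. Qed.

Lemma small_point s : 0 < s -> s <= xmax -> C * s ^+ N <= 2^-1.
Proof.
move=> s0 sx; apply: le_trans xmaxC; rewrite ler_wpM2l// lerXn2r// nnegrE ltW//.
Qed.

Lemma link (x0 x1 rho al : R) : 0 < x0 -> x0 <= xmax -> returns x0 x1 ->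
  section_point x0 rho al -> exists (r th w : R -> R) (tau al1 : R),
  [/\ 0 < tau, forall t, 0 <= t <= tau -> curve F e r th w t /\ r t <= G * x0,
    r 0 = rho /\ th 0 = al, th tau = pi *+ 2 + al1 & section_point x1 (r tau) al1 /\ 0 < x1].
Proof.
move=> x00 x0m [x [y [tau [tau0 sol [xi yi] [[hy hx] noh] ->]]]] hsec.
rewrite (pmulr_rgt0 _ x00) in hx.
have noh' t : 0 < t < tau -> 0 < x t -> y t <> f (x t).
  by move=> ht xt E; apply: (noh t ht); split=> //; exact: mulr_gt0.
have x0b := le_trans x0m xmaxb.
have [_ rho2 _ _] := section_bounds hsec x00 x0b (small_point x00 x0m).
have rG : rho * expR (KF * (pi *+ 4)) <= G * x0.
  by rewrite /G mulrAC ler_wpM2r ?expR_ge0.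
have small : (2 + Kp) * (rho * expR (KF * (pi *+ 4))) < b.
  apply: le_lt_trans xmaxG; rewrite ler_wpM2l ?addr_ge0//; apply: (le_trans rG).
  by rewrite ler_wpM2l// /G mulr_ge0// expR_ge0.
have [r [th [w [al1 [hl r0 th0 tht hs1]]]]] :=
  return_lift x00 tau0 sol xi yi noh' hsec x0b small hx hy.
have hc (t : R) : 0 <= t <= tau -> curve F e r th w t by move=> h; exact: (lifted_curve hl h).
exists r, th, w, tau, al1; split=> // t ht; split; first exact: hc.
have /andP[t0 tt] := ht.
have hct (s : R) : 0 <= s <= t -> curve F e r th w s.
  by move=> /andP[h1 h2]; apply: hc; rewrite h1 (le_trans h2).
have [k1 _] := curve_growth hpd t0 hct.
apply: le_trans k1 _; apply: le_trans rG; rewrite r0; have [rho0 _ _ al2] := hsec.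
rewrite ler_pM2l// ler_expR ler_wpM2l ?(pd_KF0 hpd)// th0.
have tle : th t <= th tau.
  have [->//|ne] := eqVneq t tau; apply: ltW.
  apply: (curve_mono (I := fun s => 0 <= s <= tau) (@sub_int tau) hc) => //.
    by rewrite lexx ltW.
  by rewrite lt_neqAle ne.
have tge : al <= th t.
  rewrite -th0; have [->//|ne] := eqVneq t 0; apply: ltW.
  apply: (curve_mono (I := fun s => 0 <= s <= tau) (@sub_int tau) hc) => //.
    by rewrite lexx ltW.
  by rewrite lt_neqAle eq_sym ne.
rewrite tht in tle; have [_ _ _ al3] := hs1.
move: al2 al3; rewrite !ltr_norml => /andP[k1' _] /andP[_ k3].
by have [] := angle_range (pi_gt0 R) k1' k3 tge tle.
Qed.

Lemma derive_local_lip (phi : nat -> R -> R) (dphi : nat -> R -> R) (t : R) (m : nat) :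
  (forall j (t : R), (j <= m)%N -> is_derive t 1 (phi j) (dphi j t)) ->
  exists K eta : R, [/\ 0 <= K, 0 < eta & forall j, (j <= m)%N -> forall h, `|h| < eta ->
    `|phi j (t + h) - phi j t| <= K * `|h|].
Proof.
move=> dp; suff H k : (k <= m.+1)%N -> exists K eta : R, [/\ 0 <= K, 0 < eta &
    forall j, (j < k)%N -> forall h, `|h| < eta -> `|phi j (t + h) - phi j t| <= K * `|h|].
  by have [K [eta [? ? h]]] := H _ (leqnn _); exists K, eta; split.
elim: k => [_|k IH km]; first by exists 0, 1; split.
have [K [eta [K0 eta0 hK]]] := IH (ltnW km).
have [eta' [eta'0 h']] := derive_eps (dp k t km) ltr01.
have L0 : 0 <= `|dphi k t| + 1 by rewrite addr_ge0.
exists (K + (`|dphi k t| + 1)), (Num.min eta eta'); split.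
- exact: addr_ge0.
- by rewrite lt_min eta0.
move=> j; rewrite ltnS leq_eqVlt => /orP[/eqP ->|jk] h; rewrite lt_min => /andP[h1 h2].
  have := h' (t + h); rewrite addrAC subrr add0r => /(_ h2); rewrite mul1r => k1.
  rewrite -[_ - _](subrK (dphi k t * h)); apply: le_trans (ler_normD _ _) _.
  apply: le_trans (lerD k1 (lexx _)) _; rewrite normrM mulrDl mulrDl mul1r.
  by rewrite [`|h| + _]addrC lerDr mulr_ge0.
by apply: le_trans (hK j jk h h1) _; rewrite ler_wpM2r// lerDl.
Qed.

(** V is almost constant during one turn and takes the same values at angles 0 and
    2 pi, hence the radius changes by O(r^N); the point of the section differs from
    the radius by O(r^N) as well. *)
Lemma step_bound (phi dphi : nat -> R -> R) (CE : R) (m : nat) : 0 <= CE ->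
  (forall j (t : R), (j <= m)%N -> is_derive t 1 (phi j) (dphi j t)) ->
  (forall j, phi j 0 = (j == 1)%:R) -> (forall j, (j <= m)%N -> phi j (pi *+ 2) = phi j 0) ->
  (0 < m)%N ->
  (forall t r, - (pi *+ 4) <= t <= pi *+ 4 -> 0 < r <= e ->
    `|\sum_(i < m) (dphi i.+1 t * r ^+ i.+1 + i.+1%:R * phi i.+1 t * r ^+ i * F t r)| <= CE * r ^+ N) ->
  exists K x2 : R, [/\ 0 < K, 0 < x2, x2 <= xmax & forall x0 x1 : R, 0 < x0 -> x0 <= x2 ->
    returns x0 x1 -> `|x1 - x0| <= K * x0 ^+ N].
Proof.
move=> CE0 dp phi0 phi2 m0 hE; have G2 : 2 <= G.
  by rewrite /G ler_peMr// exp_ge1.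
have G0 : 0 < G by apply: lt_le_trans G2.
have [K1 [eta1 [K10 eta10 h1]]] := @derive_local_lip phi dphi 0 m dp.
have [K2 [eta2 [K20 eta20 h2]]] := @derive_local_lip phi dphi (pi *+ 2) m dp.
pose eta := Num.min (Num.min eta1 eta2) 1.
have eta0 : 0 < eta by rewrite !lt_min eta10 eta20 ltr01.
have C1 : 0 < 4 * C + 1 by rewrite ltr_wpDl// mulr_ge0.
pose lim : R := Num.min (Num.min 1 xmax) (eta / (4 * C + 1)).
have lim0 : 0 < lim by rewrite !lt_min ltr01 xmax0 divr_gt0.
pose K := (CE * (pi *+ 4) + (m%:R * (K1 + K2) * (2 * C) + (m%:R * (K1 + K2) * (2 * C)))
   + (C + C)) * G ^+ N.
have p4 : 0 <= (pi *+ 4 : R) by rewrite mulrn_wge0// pi_ge0.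
have mK0 : 0 <= m%:R * (K1 + K2) * (2 * C) by rewrite !mulr_ge0 ?addr_ge0.
have K0 : 0 <= K.
  apply: mulr_ge0; last by rewrite exprn_ge0 ?(ltW G0).
  apply: addr_ge0; last exact: addr_ge0.
  by apply: addr_ge0; [exact: mulr_ge0|exact: addr_ge0].
exists (K + 1), (lim / G); split.
- by rewrite ltr_wpDl.
- exact: divr_gt0.
- rewrite ler_pdivrMr//; apply: (@le_trans _ _ xmax); first by rewrite !ge_min lexx orbT.
  by rewrite ler_peMr ?(ltW xmax0)// (le_trans _ G2)// ler1n.
move=> x0 x1 x00; rewrite ler_pdivlMr// mulrC => xl hret.
set A := G * x0 in xl *.
have [A1 [Am Aeta]] : A <= 1 /\ (A <= xmax /\ A <= eta / (4 * C + 1)).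
  by move: xl; rewrite !le_min => /andP[/andP[]].
have A0 : 0 < A by rewrite mulr_gt0.
have x0A : x0 <= A by rewrite /A ler_peMl ?(ltW x00)// (le_trans _ G2)// ler1n.
have x0m := le_trans x0A Am.
have [rho [al hsec]] := section_exists x00.
have [r [th [w [tau [al1 [tau0 hc [r0 th0] tht [hsec1 x10]]]]]]] := link x00 x0m hret hsec.
have It : 0 <= tau <= tau by rewrite lexx ltW.
have I0 : 0 <= (0 : R) <= tau by rewrite lexx ltW.
have [_ rtA] := hc tau It.
have [b1 _ b3 b4] := section_bounds hsec x00 (le_trans x0m xmaxb) (small_point x00 x0m).
have x1r : x1 <= r tau by have [rt -> _ _] := hsec1; rewrite ger_pMr// cos_le1.
have x1A := le_trans x1r rtA; have x1m := le_trans x1A Am.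
have [_ _ c3 c4] := section_bounds hsec1 x10 (le_trans x1m xmaxb) (small_point x10 x1m).
have [rho0 _ _ al2] := hsec; have [r10 _ _ al12] := hsec1.
have rhoA : rho <= A by have [_] := hc 0 I0; rewrite r0.
have AN : 0 <= A ^+ N by rewrite exprn_ge0// ltW.
have xN (z : R) : 0 < z -> z <= A -> z ^+ N <= A ^+ N.
  by move=> z0 zA; rewrite lerXn2r// nnegrE ltW.
have ANA : A ^+ N <= A by rewrite -[leRHS]expr1 ler_wiXn2l// ltW.
have al_small (z : R) : `|z| <= 2 * C * A ^+ N -> `|z| < eta.
  move=> hz; apply: le_lt_trans hz _; rewrite ler_pdivlMr// mulrC in Aeta.
  apply: lt_le_trans Aeta; apply: le_lt_trans (_ : 2 * C * A < _).
    by rewrite ler_wpM2l ?mulr_ge0.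
  by rewrite ltr_pM2r//; move: C0; move: C => c; lra.
have al0A : `|al| <= 2 * C * A ^+ N.
  by apply: le_trans b3 _; rewrite ler_wpM2l ?mulr_ge0// xN.
have al1A : `|al1| <= 2 * C * A ^+ N.
  by apply: le_trans c3 _; rewrite ler_wpM2l ?mulr_ge0// xN.
pose Psi t := \sum_(i < m) phi i.+1 (th t) * r t ^+ i.+1.
have dPsi t : 0 <= t <= tau -> is_derive t 1 Psi
   ((\sum_(i < m) (dphi i.+1 (th t) * r t ^+ i.+1
      + i.+1%:R * phi i.+1 (th t) * r t ^+ i * F (th t) (r t))) * w t).
  move=> ht; have [[_ _ dth dr] _] := hc t ht.
  have := @is_derive_sum_seq R 'I_m (index_enum _) (fun i t => phi i.+1 (th t) * r t ^+ i.+1) t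
    (fun i => (dphi i.+1 (th t) * r t ^+ i.+1
      + i.+1%:R * phi i.+1 (th t) * r t ^+ i * F (th t) (r t)) * w t).
  rewrite -mulr_suml; apply=> i.
  have d1 := @is_derive1_comp _ (phi i.+1) th t _ _ (dp i.+1 (th t) (ltn_ord i)) dth.
  have d2 := is_derive_pow i dr.
  apply: (is_derive_val (is_derive_mul d1 d2)); rewrite /comp.
  move: (dphi _ _) (phi _ _) (r t ^+ i.+1) (r t ^+ i) (F _ _) (i.+1%:R : R) => a1 a2 a3 a4 a5 a6.
  by ring.
have trange t : 0 <= t <= tau -> - (pi *+ 4) <= th t <= pi *+ 4.
  move=> /andP[t0 tt].
  have mono := curve_mono (I := fun s => 0 <= s <= tau) (@sub_int tau) (fun v hv => (hc v hv).1).
  have t1 : th 0 <= th t.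
    have [->//|ne] := eqVneq t 0; apply/ltW/mono; rewrite ?t0// ?lexx ?(ltW tau0)//.
    by rewrite lt_neqAle eq_sym ne.
  have t2 : th t <= th tau.
    have [->//|ne] := eqVneq t tau; apply/ltW/mono; rewrite ?t0 ?lexx ?(ltW tau0)//.
    by rewrite lt_neqAle ne.
  rewrite th0 in t1; rewrite tht in t2.
  move: al2 al12; rewrite !ltr_norml => /andP[k1 _] /andP[_ k2].
  by have [] := angle_range (pi_gt0 R) k1 k2 t1 t2.
have main : `|Psi tau - Psi 0| <= CE * A ^+ N * (th tau - th 0).
  apply: (@derive_dominated R Psi _ th w 0 tau (CE * A ^+ N) (ltW tau0) dPsi).
    by move=> t ht; have [[]] := hc t ht.
  move=> t ht; have [[hr w0 _ _] rA] := hc t ht; have /andP[rt0 _] := hr.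
  rewrite normrM (gtr0_norm w0) ler_wpM2r ?(ltW w0)//.
  by apply: le_trans (hE _ _ (trange t ht) hr) _; rewrite ler_wpM2l// xN.
have ends : th tau - th 0 <= pi *+ 4.
  have mono := curve_mono (I := fun s => 0 <= s <= tau) (@sub_int tau) (fun v hv => (hc v hv).1).
  have t1 : al <= th tau by rewrite -th0; apply/ltW/mono.
  have t2 : th tau <= pi *+ 2 + al1 by rewrite tht.
  move: al2 al12; rewrite !ltr_norml th0 => /andP[k1 _] /andP[_ k2].
  by have [] := angle_range (pi_gt0 R) k1 k2 t1 t2.
have lin (q s : R) : (forall j, (j <= m)%N -> phi j q = phi j 0) -> 0 < s ->
    \sum_(i < m) phi i.+1 q * s ^+ i.+1 = s.
  move=> hq s0; rewrite (bigD1 (Ordinal m0))//= hq// phi0 eqxx mul1r expr1 big1 ?addr0//.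
  move=> i hi; rewrite hq ?ltn_ord// phi0 (_ : (i.+1 == 1)%N = false) ?mul0r//.
  by apply/negP => /eqP[i0]; move/eqP: hi; apply; apply: val_inj.
have comp (q h s K' : R) : 0 <= K' -> 0 < s -> s <= 1 -> (forall j, (j <= m)%N -> phi j q = phi j 0) ->
    (forall j, (j <= m)%N -> `|phi j (q + h) - phi j q| <= K' * `|h|) ->
    `|\sum_(i < m) phi i.+1 (q + h) * s ^+ i.+1 - s| <= m%:R * (K' * `|h|).
  move=> K'0 s0 s1 hq hh; rewrite -{2}(lin q s hq s0) -sumrB.
  apply: le_trans (ler_norm_sum _ _ _) _.
  apply: (@le_trans _ _ (\sum_(i < m) K' * `|h|)); last first.
    by rewrite sumr_const card_ord mulr_natl.
  apply: ler_sum => i _; rewrite -mulrBl normrM; apply: le_trans (ler_piMr _ _) (hh _ (ltn_ord i)) => //.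
  by rewrite normrX exprn_ile1// ger0_norm// ltW.
have heta (z : R) : `|z| < eta -> `|z| < eta1 /\ `|z| < eta2.
  by rewrite !lt_min => /andP[/andP[]].
have [al_e1 _] := heta _ (al_small _ al0A); have [_ al_e2] := heta _ (al_small _ al1A).
have P0 : `|Psi 0 - rho| <= m%:R * (K1 + K2) * (2 * C) * A ^+ N.
  have := comp 0 al rho K1 K10 rho0 (le_trans rhoA A1) (fun _ _ => erefl)
    (fun j jm => h1 j jm al al_e1).
  rewrite add0r /Psi r0 th0 => /le_trans; apply.
  rewrite -!mulrA ler_wpM2l//; apply: ler_pM => //; first by rewrite lerDl.
  by rewrite mulrA.
have P1 : `|Psi tau - r tau| <= m%:R * (K1 + K2) * (2 * C) * A ^+ N.
  rewrite /Psi tht.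
  apply: le_trans (comp (pi *+ 2) al1 (r tau) K2 K20 r10 (le_trans rtA A1) phi2 _) _ => //.
    by move=> j jm; exact: h2.
  rewrite -!mulrA ler_wpM2l//; apply: ler_pM => //; first by rewrite lerDr.
  by rewrite mulrA.
have Q0 : `|rho - x0| <= C * A ^+ N.
  apply: le_trans b4 _; rewrite -[leRHS]mul1r; apply: ler_pM; rewrite ?(ltW rho0) ?mulr_ge0 ?exprn_ge0 ?(ltW x00)//.
    exact: le_trans A1.
  by rewrite ler_wpM2l// xN.
have Q1 : `|r tau - x1| <= C * A ^+ N.
  apply: le_trans c4 _; rewrite -[leRHS]mul1r; apply: ler_pM; rewrite ?(ltW r10) ?mulr_ge0 ?exprn_ge0 ?(ltW x10)//.
    exact: le_trans A1.
  by rewrite ler_wpM2l// xN.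
have main' : `|Psi tau - Psi 0| <= CE * (pi *+ 4) * A ^+ N.
  by apply: le_trans main _; rewrite mulrAC -!mulrA ler_wpM2l// ler_wpM2r.
apply: (@le_trans _ _ (K * x0 ^+ N)); last first.
  by rewrite ler_wpM2r ?exprn_ge0 ?(ltW x00)// lerDl.
have -> : K * x0 ^+ N = CE * (pi *+ 4) * A ^+ N + (m%:R * (K1 + K2) * (2 * C) * A ^+ N
    + m%:R * (K1 + K2) * (2 * C) * A ^+ N) + (C * A ^+ N + C * A ^+ N).
  have AE : A ^+ N = G ^+ N * x0 ^+ N by rewrite /A exprMn.
  rewrite AE /K -[LHS]mulrA; move: (G ^+ N * _) (CE * _) (m%:R * _ * _) => z u v.
  by rewrite !mulrDl.
have -> : x1 - x0 = (Psi tau - Psi 0) + (- (Psi tau - r tau) + (Psi 0 - rho))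
    + (- (r tau - x1) + (rho - x0)) by ring.
apply: le_trans (ler_normD _ _) _; apply: lerD.
  apply: le_trans (ler_normD _ _) _; apply: lerD => //.
  by apply: le_trans (ler_normD _ _) _; apply: lerD => //; rewrite normrN.
by apply: le_trans (ler_normD _ _) _; apply: lerD => //; rewrite normrN.
Qed.

Lemma radius_small (I : R -> Prop) (x y r th w : R -> R) (t eps : R) : lifted n p F e I x y r th w -> I t ->
  0 < eps -> `|x t| <= eps / 2 -> `|y t - p.[x t]| <= eps ^+ n / 2 -> r t <= eps.
Proof.
move=> hl It eps0 hx hu; rewrite leNgt; apply/negP => er.
have [/andP[r0 _] xE yE _ _] := hl t It.
have rn : eps ^+ n <= r t ^+ n by rewrite lerXn2r ?nnegrE ?(ltW eps0) ?(ltW r0) ?(ltW er).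
have c2 : `|cos (th t)| <= 2^-1.
  rewrite -(ler_pM2l eps0); apply: le_trans hx; rewrite xE normrM gtr0_norm//.
  by rewrite ler_wpM2r// ltW.
have s2 : `|sin (th t)| <= 2^-1.
  have en : 0 < eps ^+ n by rewrite exprn_gt0.
  rewrite -(ler_pM2l en); apply: le_trans hu; rewrite yE addrAC subrr add0r normrN normrM.
  by rewrite ler_wpM2r// ger0_norm// exprn_ge0// ltW.
have := cos2Dsin2 (th t); rewrite -(real_normK (num_real (cos _))) -(real_normK (num_real (sin _))).
move: `|cos _| `|sin _| (normr_ge0 (cos (th t))) (normr_ge0 (sin (th t))) c2 s2 => c s c0 s0 *.
by nra.
Qed.

Lemma tail_small (Q : set_system R) {FQ : Filter Q} (x y : R -> R) (eps : R) : 0 < eps ->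
  x t @[t --> Q] --> (0 : R) -> y t @[t --> Q] --> (0 : R) ->
  \forall t \near Q, [/\ `|x t| <= b, `|y t| <= b, `|x t| <= eps / 2 & `|y t - p.[x t]| <= eps ^+ n / 2].
Proof.
move=> eps0 cx cy; have b0 := pd_b0 hpd.
have q0 : 0 < eps ^+ n / 2 by rewrite divr_gt0// exprn_gt0.
have k0 : 0 < eps ^+ n / 2 / (Kp + 1) by rewrite divr_gt0// ltr_wpDl.
have e20 : 0 < eps / 2 by rewrite divr_gt0.
have q20 : 0 < eps ^+ n / 2 / 2 by rewrite divr_gt0.
have q2k : 0 < eps ^+ n / 2 / 2 / (Kp + 1) by rewrite divr_gt0// ltr_wpDl.
have m1 : 0 < Num.min (Num.min b (eps / 2)) (eps ^+ n / 2 / 2 / (Kp + 1)) by rewrite !lt_min b0 e20.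
have m2 : 0 < Num.min b (eps ^+ n / 2 / 2) by rewrite lt_min b0.
move/cvgr_dist_le: cx => /(_ _ m1) cx; move/cvgr_dist_le: cy => /(_ _ m2) cy.
apply: filterS2 cx cy => t; rewrite !sub0r !normrN !le_min => /andP[/andP[h1 h2] h3] /andP[h4 h5].
split=> //; apply: le_trans (ler_normB _ _) _.
have h6 := hKp h1; rewrite ler_pdivlMr ?ltr_wpDl// in h3.
have h7 : Kp * `|x t| <= eps ^+ n / 2 / 2.
  by apply: le_trans h3; rewrite mulrC ler_wpM2l// lerDl.
by have := lerD h5 (le_trans h6 h7); rewrite -splitr.
Qed.

Lemma stable_flow (x y : R -> R) (t0 : R) :
  (forall t, t0 <= t -> is_derive t 1 x (y t + X (x t) (y t)) /\ is_derive t 1 y (Y (x t) (y t))) ->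
  (forall t, t0 <= t -> x t ^+ 2 + y t ^+ 2 != 0) ->
  x t @[t --> +oo] --> (0 : R) -> y t @[t --> +oo] --> (0 : R) ->
  exists rho : R -> R, forall eps : R, 0 < eps -> exists q1 : R, forall q, q1 <= q ->
    flow F e rho q /\ rho q <= eps.
Proof.
move=> hs nz cx cy.
have tail eps : 0 < eps -> exists t1, forall t, t1 < t ->
    [/\ `|x t| <= b, `|y t| <= b, `|x t| <= eps / 2 & `|y t - p.[x t]| <= eps ^+ n / 2].
  by move=> eps0; have [t1 [_ ht1]] := tail_small eps0 cx cy; exists t1.
have [t1 ht1] := tail 1 ltr01.
pose s0 := Num.max t0 (t1 + 1).
have s0t0 : t0 <= s0 by rewrite le_max lexx.
have s0t1 : t1 < s0 by rewrite lt_max ltrDl ltr01 orbT.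
have cI (s t v : R) : s0 <= s -> s0 <= v -> s <= t <= v -> s0 <= t.
  by move=> h _ /andP[h1 _]; exact: le_trans h1.
have hsol : solution X Y b (fun t => s0 <= t) x y.
  move=> t ht; have [d1 d2] := hs t (le_trans s0t0 ht).
  by have [h1 h2 _ _] := ht1 t (lt_le_trans s0t1 ht).
have cl1 (t : R) : s0 <= Num.max s0 t by rewrite le_max lexx.
have cl2 (t : R) : s0 <= t -> Num.max s0 t = t by move=> h; exact: (max_idPr h).
have ccl (t : R) : Num.max s0 v @[v --> t] --> Num.max s0 t.
  apply: (@lip_cvg _ (fun v => Num.max s0 v) t 1 1) => // v _; rewrite mul1r.
  rewrite !maxEle; do 2!case: ifP => ?; rewrite ?subrr ?normr0//.
    by rewrite ler_norml; have := ler_norm (v - t); have := ler_norm (t - v);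
      rewrite [`|t - v|]distrC => *; apply/andP; split; lra.
  by rewrite ler_norml; have := ler_norm (v - t); have := ler_norm (t - v);
    rewrite [`|t - v|]distrC => *; apply/andP; split; lra.
have [r [th [w [_ hl]]]] := lift_exists hpd (I := fun t => s0 <= t) cI cl1 cl2 (lexx s0) ccl hsol (nz _ s0t0).
have hc (t : R) : s0 <= t -> curve F e r th w t by move=> h; exact: (lifted_curve hl h).
have mono (u v : R) : s0 <= u -> u < v -> th u < th v.
  by move=> h uv; apply: (curve_mono (I := fun t => s0 <= t) cI hc) => //; exact: le_trans (ltW uv).
have rsmall eps : 0 < eps -> exists t2, s0 <= t2 /\ forall t, t2 <= t -> r t <= eps.
  move=> eps0; have [t2 ht2] := tail eps eps0; exists (Num.max s0 (t2 + 1)); split; first by rewrite le_max lexx.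
  move=> t; rewrite ge_max => /andP[h1 h2].
  have [_ _ h3 h4] := ht2 t (lt_le_trans (ltr_pwDr ltr01 (lexx t2)) h2).
  exact: (radius_small hl h1 eps0 h3 h4).
have unb v : exists t, s0 <= t /\ v < th t.
  apply: contrapT => hno.
  have r00 : 0 < r s0 by have [/andP[]] := hc s0 (lexx s0).
  pose eps := r s0 * expR (- (KF * (v - th s0))) / 2.
  have eps0 : 0 < eps by rewrite divr_gt0// mulr_gt0// expR_gt0.
  have [t2 [st2 ht2]] := rsmall eps eps0.
  have tv : th t2 <= v by rewrite leNgt; apply/negP => h; apply: hno; exists t2.
  have hct (s : R) : s0 <= s <= t2 -> curve F e r th w s by move=> /andP[h _]; exact: hc.
  have [_ k2] := curve_growth hpd st2 hct.
  have k3 : r s0 * expR (- (KF * (v - th s0))) <= r t2.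
    rewrite expRN ler_pdivrMr ?expR_gt0//; apply: le_trans k2 _.
    rewrite ler_pM2l ?ler_expR ?ler_wpM2l ?(pd_KF0 hpd) ?lerD2r//.
    by have [/andP[]] := hc t2 st2.
  have := le_trans k3 (ht2 t2 (lexx t2)); rewrite /eps.
  have : 0 < r s0 * expR (- (KF * (v - th s0))) by rewrite mulr_gt0// expR_gt0.
  by move: (r s0 * _) => z; lra.
have [T hT] := reparam (I := fun t => s0 <= t) cI hc.
exists (fun q => r (T q)) => eps eps0.
have [t2 [st2 ht2]] := rsmall eps eps0.
exists (th t2 + 1) => q hq.
have tq : th t2 < q by apply: lt_le_trans hq; rewrite ltrDl.
have [t3 [st3 ht3]] := unb q.
have [IT thT fl] := hT q t2 t3 st2 st3 (introT andP (conj tq ht3)).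
split=> //; apply: ht2; rewrite leNgt; apply/negP => h.
by have := mono _ _ IT h; rewrite thT => /(lt_trans tq); rewrite ltxx.
Qed.

Lemma unstable_flow (x y : R -> R) (t0 : R) :
  (forall t, t <= t0 -> is_derive t 1 x (y t + X (x t) (y t)) /\ is_derive t 1 y (Y (x t) (y t))) ->
  (forall t, t <= t0 -> x t ^+ 2 + y t ^+ 2 != 0) ->
  x t @[t --> -oo] --> (0 : R) -> y t @[t --> -oo] --> (0 : R) ->
  exists rho : R -> R, forall eps : R, 0 < eps -> exists q1 : R, forall q, q <= q1 ->
    flow F e rho q /\ rho q <= eps.
Proof.
move=> hs nz cx cy.
have tail eps : 0 < eps -> exists t1, forall t, t < t1 ->
    [/\ `|x t| <= b, `|y t| <= b, `|x t| <= eps / 2 & `|y t - p.[x t]| <= eps ^+ n / 2].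
  by move=> eps0; have [t1 [_ ht1]] := tail_small eps0 cx cy; exists t1.
have [t1 ht1] := tail 1 ltr01.
pose s0 := Num.min t0 (t1 - 1).
have s0t0 : s0 <= t0 by rewrite ge_min lexx.
have s0t1 : s0 < t1 by rewrite gt_min ltrBlDr ltrDl ltr01 orbT.
have cI (s t v : R) : s <= s0 -> v <= s0 -> s <= t <= v -> t <= s0.
  by move=> _ h /andP[_ h1]; exact: le_trans h.
have hsol : solution X Y b (fun t => t <= s0) x y.
  move=> t ht; have [d1 d2] := hs t (le_trans ht s0t0).
  by have [h1 h2 _ _] := ht1 t (le_lt_trans ht s0t1).
have cl1 (t : R) : Num.min s0 t <= s0 by rewrite ge_min lexx.
have cl2 (t : R) : t <= s0 -> Num.min s0 t = t by move=> h; exact: (min_idPr h).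
have ccl (t : R) : Num.min s0 v @[v --> t] --> Num.min s0 t.
  apply: (@lip_cvg _ (fun v => Num.min s0 v) t 1 1) => // v _; rewrite mul1r.
  rewrite !minEle; do 2!case: ifP => ?; rewrite ?subrr ?normr0//.
    by rewrite ler_norml; have := ler_norm (v - t); have := ler_norm (t - v);
      rewrite [`|t - v|]distrC => *; apply/andP; split; lra.
  by rewrite ler_norml; have := ler_norm (v - t); have := ler_norm (t - v);
    rewrite [`|t - v|]distrC => *; apply/andP; split; lra.
have [r [th [w [_ hl]]]] := lift_exists hpd (I := fun t => t <= s0) cI cl1 cl2 (lexx s0) ccl hsol (nz _ s0t0).
have hc (t : R) : t <= s0 -> curve F e r th w t by move=> h; exact: (lifted_curve hl h).
have mono (u v : R) : v <= s0 -> u < v -> th u < th v.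
  by move=> h uv; apply: (curve_mono (I := fun t => t <= s0) cI hc) => //; exact: le_trans (ltW uv) h.
have rsmall eps : 0 < eps -> exists t2, t2 <= s0 /\ forall t, t <= t2 -> r t <= eps.
  move=> eps0; have [t2 ht2] := tail eps eps0; exists (Num.min s0 (t2 - 1)); split; first by rewrite ge_min lexx.
  move=> t; rewrite le_min => /andP[h1 h2].
  have h20 : t < t2 by apply: (le_lt_trans h2); rewrite ltrBlDr ltrDl.
  have [_ _ h3 h4] := ht2 t h20.
  exact: (radius_small hl h1 eps0 h3 h4).
have unb v : exists t, t <= s0 /\ th t < v.
  apply: contrapT => hno.
  have r00 : 0 < r s0 by have [/andP[]] := hc s0 (lexx s0).
  pose eps := r s0 * expR (- (KF * (th s0 - v))) / 2.
  have eps0 : 0 < eps by rewrite divr_gt0// mulr_gt0// expR_gt0.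
  have [t2 [st2 ht2]] := rsmall eps eps0.
  have tv : v <= th t2 by rewrite leNgt; apply/negP => h; apply: hno; exists t2.
  have hct (s : R) : t2 <= s <= s0 -> curve F e r th w s by move=> /andP[_ h]; exact: hc.
  have [k2 _] := curve_growth hpd st2 hct.
  have k3 : r s0 * expR (- (KF * (th s0 - v))) <= r t2.
    rewrite expRN ler_pdivrMr ?expR_gt0//; apply: le_trans k2 _.
    rewrite ler_pM2l ?ler_expR ?ler_wpM2l ?(pd_KF0 hpd) ?lerD2l ?lerN2//.
    by have [/andP[]] := hc t2 st2.
  have := le_trans k3 (ht2 t2 (lexx t2)); rewrite /eps.
  have : 0 < r s0 * expR (- (KF * (th s0 - v))) by rewrite mulr_gt0// expR_gt0.
  by move: (r s0 * _) => z; lra.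
have [T hT] := reparam (I := fun t => t <= s0) cI hc.
exists (fun q => r (T q)) => eps eps0.
have [t2 [st2 ht2]] := rsmall eps eps0.
exists (th t2 - 1) => q hq.
have tq : q < th t2 by apply: (le_lt_trans hq); rewrite ltrBlDr ltrDl.
have [t3 [st3 ht3]] := unb q.
have [IT thT fl] := hT q t3 t2 st3 st2 (introT andP (conj ht3 tq)).
split=> //; apply: ht2; rewrite leNgt; apply/negP => h.
by have := mono _ _ IT h; rewrite thT => /lt_trans/(_ tq); rewrite ltxx.
Qed.

Lemma flow_lower (rho : R -> R) (u v : R) : u <= v -> (forall q, u <= q <= v -> flow F e rho q) ->
  rho u <= rho v * expR (KF * (v - u)) /\ rho v <= rho u * expR (KF * (v - u)).
Proof.
move=> uv hf; have [h1 h2] := curve_growth hpd uv (fun q hq => flow_curve (hf q hq)).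
by split.
Qed.

(** The orbit through s_i stays inside the next turn of the spiral, and the
    turns of the spiral tend to the origin. *)
Lemma stable_sequence (rho : R -> R) (x2 : R) : 0 < x2 -> x2 <= xmax ->
  (forall eps : R, 0 < eps -> exists q1 : R, forall q, q1 <= q -> flow F e rho q /\ rho q <= eps) ->
  exists2 r0 : R, 0 < r0 & forall s : nat -> R, 0 < s 0%N < r0 ->
    (forall i, returns (s i) (s i.+1)) ->
    [/\ forall i, 0 < s i, forall i, s i <= x2 & s i @[i --> \oo] --> (0 : R)].
Proof.
move=> x20 x2m hrho; have [q0 hq0] := hrho x2 x20.
have p2 : 0 < (pi *+ 2 : R) by rewrite mulrn_wgt0 ?pi_gt0.
have arch (v : R) : exists i : nat, v < (pi *+ 2) *+ i.
  have [i hi] : exists i : nat, `|v / (pi *+ 2)| < i%:R.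
    by exists (Num.trunc `|v / (pi *+ 2)|).+1; have /andP[] := truncn_itv (normr_ge0 (v / (pi *+ 2))).
  exists i; rewrite -mulr_natl -ltr_pdivrMr//; apply: le_lt_trans hi; exact: ler_norm.
have [j0 hj0] := arch (q0 + pi).
pose c i : R := (pi *+ 2) *+ (i + j0).
have cS i : c i.+1 = pi *+ 2 + c i by rewrite /c addSn [in LHS]mulrS.
have cge i : q0 + pi <= c i.
  by apply: le_trans (ltW hj0) _; rewrite /c addnC mulrnDr lerDl mulrn_wge0// ltW.
have pp := pi_gt0 R.
have ok i v : - (pi / 2) < v -> q0 <= v + c i.
  by move=> hv; have := cge i; move: hv pp; move: (pi : R) (c i) => q z; lra.
pose u0 := - (pi / 2) + c 0%N.
have qu0 : q0 <= u0 by rewrite /u0; have := cge 0%N; move: pp; move: (pi : R) (c 0%N) => q z; lra.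
have [[/andP[ru0 _] _] _] := hq0 u0 qu0.
pose low := rho u0 / expR (KF * pi).
have low0 : 0 < low by rewrite divr_gt0// expR_gt0.
exists (Num.min x2 (low / 2)); first by rewrite lt_min x20 divr_gt0.
move=> s; rewrite lt_min => /andP[s00 /andP[s0x s0l]] hret.
have inv i : exists r al, [/\ 0 < s i, s i <= x2, section_point (s i) r al & r < rho (al + c i)].
  elim: i => [|i [r [al [si0 six hsec hr]]]].
    have [r [al hsec]] := section_exists s00.
    have s0m := le_trans (ltW s0x) x2m.
    have [_ r2 _ _] := section_bounds hsec s00 (le_trans s0m xmaxb) (small_point s00 s0m).
    exists r, al; split=> //; first exact: ltW.
    apply: (@le_lt_trans _ _ (2 * s 0%N)) => //; apply: (@lt_le_trans _ _ low).
      by move: s0l; lra.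
    have [_ _ _ al2] := hsec; move: al2; rewrite ltr_norml => /andP[a1 a2].
    have uv : u0 <= al + c 0%N by rewrite /u0 lerD2r ltW.
    have [h _] := @flow_lower rho u0 (al + c 0%N) uv (fun q hq => (hq0 q (le_trans qu0 (andP hq).1)).1).
    rewrite /low ler_pdivrMr ?expR_gt0//; apply: le_trans h _.
    have [[/andP[rp _] _] _] := hq0 _ (le_trans qu0 uv).
    rewrite ler_pM2l// ler_expR ler_wpM2l ?(pd_KF0 hpd)// /u0.
    by move: a2; move: (pi : R) (c 0%N) => q z; lra.
  have [r' [th [w [tau [al1 [tau0 hc [r0 th0] tht [hsec1 x10]]]]]]] :=
    link si0 (le_trans six x2m) (hret i) hsec.
  have al2 : - (pi / 2) < al by have [_ _ _] := hsec; rewrite ltr_norml => /andP[].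
  have mono := curve_mono (I := fun s => 0 <= s <= tau) (@sub_int tau) (fun v hv => (hc v hv).1).
  have fl v : 0 <= v <= tau -> flow F e rho (th v + c i).
    move=> hv; apply: (hq0 _ _).1; apply: ok; apply: (lt_le_trans al2); rewrite -th0.
    have [->//|ne] := eqVneq v 0; move/andP: (hv) => [v0 vt]; apply/ltW/mono => //.
      by rewrite lexx ltW.
    by rewrite lt_neqAle eq_sym ne.
  have [E _] := compare_curves hpd (ltW tau0) (shift_inv2pi hpd (i + j0)) (fun v hv => (hc v hv).1) fl.
  have hr1 : r' tau < rho (al1 + c i.+1).
    rewrite -subr_gt0 (_ : al1 + c i.+1 = th tau + c i); last by rewrite tht cS; ring.
    by rewrite -E th0 r0 subr_gt0.
  exists (r' tau), al1; split=> //.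
  have [_ _ _ al12] := hsec1; have : s i.+1 <= r' tau.
    by have [rt -> _ _] := hsec1; rewrite ger_pMr// cos_le1.
  move=> /le_trans; apply; apply: le_trans (ltW hr1) (hq0 _ _).2; apply: ok.
  by move: al12; rewrite ltr_norml => /andP[].
have pos i : 0 < s i by have [r [al []]] := inv i.
split=> // [i|]; first by have [r [al []]] := inv i.
apply/cvgrPdist_le => eps eps0; have [q1 hq1] := hrho eps eps0.
have [j1 hj1] := arch (q1 + pi).
exists j1 => // i /= ji; rewrite sub0r normrN gtr0_norm//.
have [r [al [si0 six [rp sE _ al2] hr]]] := inv i.
have : s i <= r by rewrite sE ger_pMr// cos_le1.
move=> /le_trans; apply; apply: le_trans (ltW hr) (hq1 _ _).2.
have : (pi *+ 2) *+ j1 <= c i by rewrite /c -(subnK ji) -addnA addnCA mulrnDr lerDl mulrn_wge0// ltW.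
move: al2; rewrite ltr_norml => /andP[a1 _]; move: hj1 a1 pp.
by move: (pi : R) (pi *+ 2 *+ j1) (c i) => q z1 z; lra.
Qed.

(** Backwards in time, the same comparison; the choice of r0 puts the whole sequence
    below one turn of the spiral. *)
Lemma unstable_sequence (rho : R -> R) (x2 : R) : 0 < x2 -> x2 <= xmax ->
  (forall eps : R, 0 < eps -> exists q1 : R, forall q, q <= q1 -> flow F e rho q /\ rho q <= eps) ->
  exists2 r0 : R, 0 < r0 & forall s : nat -> R, 0 < s 0%N < r0 ->
    (forall i, 0 < s i.+1 < r0) ->
    (forall i, returns (s i.+1) (s i)) ->
    [/\ forall i, 0 < s i, forall i, s i <= x2 & s i @[i --> \oo] --> (0 : R)].
Proof.
move=> x20 x2m hrho; have [q0 hq0] := hrho x2 x20.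
have p2 : 0 < (pi *+ 2 : R) by rewrite mulrn_wgt0 ?pi_gt0.
have arch (v : R) : exists i : nat, v < (pi *+ 2) *+ i.
  have [i hi] : exists i : nat, `|v / (pi *+ 2)| < i%:R.
    by exists (Num.trunc `|v / (pi *+ 2)|).+1; have /andP[] := truncn_itv (normr_ge0 (v / (pi *+ 2))).
  exists i; rewrite -mulr_natl -ltr_pdivrMr//; apply: le_lt_trans hi; exact: ler_norm.
have [j0 hj0] := arch (- q0 + pi).
pose c i : R := - ((pi *+ 2) *+ (i + j0)).
have cS i : c i = pi *+ 2 + c i.+1 by rewrite /c addSn [in RHS]mulrS; ring.
have cge i : c i <= q0 - pi.
  rewrite /c lerNl opprB addrC; apply: le_trans (ltW hj0) _.
  by rewrite addnC mulrnDr lerDl mulrn_wge0// ltW.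
have pp := pi_gt0 R.
have ok i v : v < pi / 2 -> v + c i <= q0.
  by move=> hv; have := cge i; move: hv pp; move: (pi : R) (c i) => q z; lra.
pose u0 := - (pi / 2) + c 0%N.
have qu0 : u0 <= q0 by apply: ok; move: pp; move: (pi : R) => q; lra.
have [[/andP[ru0 _] _] _] := hq0 u0 qu0.
pose low := rho u0 / expR (KF * pi).
have low0 : 0 < low by rewrite divr_gt0// expR_gt0.
exists (Num.min x2 (low / 2)); first by rewrite lt_min x20 divr_gt0.
move=> s s00' sb hret.
have sall i : [/\ 0 < s i, s i <= x2 & s i < low / 2].
  by case: i => [|i]; [move: s00'|move: (sb i)]; rewrite lt_min => /andP[h1 /andP[h2 h3]]; rewrite h1 (ltW h2) h3.
have pos i : 0 < s i by have [] := sall i.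
have inv i : exists r al, section_point (s i) r al /\ r < rho (al + c i).
  elim: i => [|i [r [al [hsec hr]]]].
    have [s00 s0x s0l] := sall 0%N.
    have [r [al hsec]] := section_exists s00.
    have s0m := le_trans s0x x2m.
    have [_ r2 _ _] := section_bounds hsec s00 (le_trans s0m xmaxb) (small_point s00 s0m).
    exists r, al; split=> //.
    apply: (@le_lt_trans _ _ (2 * s 0%N)) => //; apply: (@lt_le_trans _ _ low).
      by move: s0l; lra.
    have [_ _ _ al2] := hsec; move: al2; rewrite ltr_norml => /andP[a1 a2].
    have uv : u0 <= al + c 0%N by rewrite /u0 lerD2r ltW.
    have [h _] := @flow_lower rho u0 (al + c 0%N) uv
      (fun q hq => (hq0 q (le_trans (andP hq).2 (ok 0%N al a2))).1).
    rewrite /low ler_pdivrMr ?expR_gt0//; apply: le_trans h _.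
    have [[/andP[rp _] _] _] := hq0 _ (ok 0%N al a2).
    rewrite ler_pM2l// ler_expR ler_wpM2l ?(pd_KF0 hpd)// /u0.
    by move: a2; move: (pi : R) (c 0%N) => q z; lra.
  have [si0 six _] := sall i.+1.
  have [r2 [al2 hsec2]] := section_exists si0.
  have [r' [th [w [tau [al1 [tau0 hc [r0 th0] tht [hsec1 x10]]]]]]] :=
    link si0 (le_trans six x2m) (hret i) hsec2.
  have [rE alE] := section_unique hsec1 hsec.
  have alb : al < pi / 2 by have [_ _ _] := hsec; rewrite ltr_norml => /andP[].
  have mono := curve_mono (I := fun s => 0 <= s <= tau) (@sub_int tau) (fun v hv => (hc v hv).1).
  have fl v : 0 <= v <= tau -> flow F e rho (th v + c i.+1).
    move=> hv; apply: (hq0 _ _).1; apply: le_trans (ok i al alb); rewrite (cS i).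
    rewrite addrA [al + _]addrC -alE -tht lerD2r.
    have [->//|ne] := eqVneq v tau; move/andP: (hv) => [v0 vt]; apply/ltW/mono => //.
      by rewrite lexx ltW.
    by rewrite lt_neqAle ne.
  have [E _] := compare_curves hpd (ltW tau0) (shift_invN (shift_inv2pi hpd (i.+1 + j0)))
    (fun v hv => (hc v hv).1) fl.
  exists r2, al2; split=> //; rewrite -subr_gt0 -th0 -r0 E subr_gt0 rE.
  by rewrite (_ : th tau - _ = al + c i)// tht alE (cS i) [pi *+ 2 + al]addrC -addrA.
split=> // [i|]; first by have [] := sall i.
apply/cvgrPdist_le => eps eps0; have [q1 hq1] := hrho eps eps0.
have [j1 hj1] := arch (- q1 + pi).
exists j1 => // i /= ji; rewrite sub0r normrN gtr0_norm//.
have [r [al [[rp sE _ al2] hr]]] := inv i.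
have : s i <= r by rewrite sE ger_pMr// cos_le1.
move=> /le_trans; apply; apply: le_trans (ltW hr) (hq1 _ _).2.
have : (pi *+ 2) *+ j1 <= - c i.
  by rewrite /c opprK -(subnK ji) -addnA addnCA mulrnDr lerDl mulrn_wge0// ltW.
move: al2; rewrite ltr_norml => /andP[_ a1]; move: hj1 a1 pp.
by move: (pi : R) (pi *+ 2 *+ j1) (c i) => q z1 z; lra.
Qed.

End Returns.

(** * Box dimension of the return sequence *)

Section SpiralDimension.
Variables (R : realType) (l : nat) (X Y : R -> R -> 'rV[R]_l -> R) (f : R -> 'rV[R]_l -> R).
Variable delta : 'rV[R]_l.
Local Notation X1 := (fun x y => X x y delta).
Local Notation Y1 := (fun x y => Y x y delta).
Local Notation f1 := (fun x => f x delta).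

Lemma first_return_returns x0 x1 : first_return X Y f delta x0 x1 -> returns X1 Y1 f1 x0 x1.
Proof.
move=> [x [y [tau [t0 hs h0 hh hx]]]]; by exists x, y, tau.
Qed.

Lemma poincare_map_cases x :
  returns X1 Y1 f1 x (poincare_map X Y f x delta) \/ poincare_map X Y f x delta = 0.
Proof.
have [h|h] := pselect (exists x1, first_return X Y f delta x x1).
  by left; apply: first_return_returns; rewrite /poincare_map; exact: xgetPex.
by right; rewrite /poincare_map xgetPN// => x1 h1; apply: h; exists x1.
Qed.

Lemma returns_neq0 x : ~ returns X1 Y1 f1 0 x.
Proof. by move=> [x' [y [tau [_ _ _ [[_ +] _] _]]]]; rewrite mul0r ltxx. Qed.

Variables (gx gy : R -> R) (n : nat) (p : {poly R}) (F : R -> R -> R).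
Variables (b e L KF Kp C : R) (N' : nat).
Let N := N'.+2.
Hypothesis hpd : polar_data n X1 Y1 p F b e L KF.
Hypothesis e1 : e <= 1.
Hypothesis Kp0 : 0 <= Kp.
Hypothesis C0 : 0 <= C.
Hypothesis hKp : forall x : R, `|x| <= b -> `|p.[x]| <= Kp * `|x|.
Hypothesis f0 : f 0 delta = 0.
Hypothesis fX : forall x : R, `|x| <= b -> f x delta + X x (f x delta) delta = 0.
Hypothesis flip : forall x x' : R, `|x| <= b -> `|x'| <= b ->
  `|f x delta - f x' delta| <= `|x - x'|.
Hypothesis fp : forall x : R, `|x| <= b -> `|f x delta - p.[x]| <= C * `|x| ^+ (n + N).
Hypothesis Yneg : forall x : R, 0 < x -> x <= b -> Y x (f x delta) delta < 0.
Variable xmax : R.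
Hypothesis xmax0 : 0 < xmax.
Hypothesis xmaxb : xmax <= b.
Hypothesis xmaxC : C * xmax ^+ N <= 2^-1.
Hypothesis xmaxG : (2 + Kp) * (2 * expR (KF * (pi *+ 4)) * xmax) < b.
Variables (K x2 : R).
Hypothesis K0 : 0 < K.
Hypothesis x20 : 0 < x2.
Hypothesis x2m : x2 <= xmax.
Hypothesis hstep : forall x0 x1 : R, 0 < x0 -> x0 <= x2 ->
  returns X1 Y1 f1 x0 x1 -> `|x1 - x0| <= K * x0 ^+ N.

Let small := Num.min x2 (2 * K + 1)^-1.

(** The sequence runs backwards along the return map in the unstable case; close to
    the origin both endpoints of a step are comparable, so the bound transfers. *)
Lemma reverse_step x0 x1 : 0 < x0 -> x0 <= small -> 0 < x1 ->
  `|x1 - x0| <= K * x0 ^+ N -> `|x0 - x1| <= K * 2 ^+ N * x1 ^+ N.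
Proof.
rewrite /small le_min => x00 /andP[x0x x0K] x10 h.
have K1 : 0 < 2 * K + 1 by rewrite addr_gt0// mulr_gt0.
have x01 : x0 <= 1.
  by apply: le_trans x0K _; rewrite invf_le1// lerDr mulr_ge0// ltW.
have hK : K * x0 ^+ N <= x0 / 2.
  have a1 : x0 ^+ N'.+1 <= x0.
    by rewrite exprS; apply: ler_piMr; [exact: ltW|apply: exprn_ile1 => //; exact: ltW].
  have a2 : K * x0 ^+ N'.+1 <= 2^-1.
    apply: (@le_trans _ _ (K * (2 * K + 1)^-1)).
      by rewrite ler_pM2l//; apply: le_trans a1 x0K.
    by rewrite ler_pdivrMr//; move: K0; lra.
  by rewrite /N exprS mulrCA ler_pM2l.
have x012 : x0 <= 2 * x1.
  by move: h hK; rewrite ler_norml => /andP[h1 h2] h3; lra.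
rewrite distrC; apply: le_trans h _.
by rewrite -mulrA -exprMn ler_pM2l// lerXn2r// nnegrE ltW// mulr_gt0.
Qed.

(** A map with a return error of order N is too slow for its orbits to have box
    dimension below 1 - 1/N; orbits that leave the domain of the return map are
    finite, and have dimension 0. *)
Lemma spiral_dimension : exists2 r : R, 0 < r &
  forall s : nat -> R, 0 < s 0%N < r ->
    (stable_spiral X Y delta gx gy /\
       (forall i, s i.+1 = poincare_map X Y f (s i) delta) \/
     unstable_spiral X Y delta gx gy /\
       (forall i, 0 < s i.+1 < r /\ poincare_map X Y f (s i.+1) delta = s i)) ->
    forall d, has_box_dim (range s) d -> d <= 2^-1 \/ 1 - N%:R^-1 <= d.
Proof.
have K1 : 0 < 2 * K + 1 by rewrite addr_gt0// mulr_gt0.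
have sm0 : 0 < small by rewrite lt_min x20 invr_gt0.
have smx : small <= x2 by rewrite ge_min lexx.
have smm : small <= xmax by exact: le_trans smx x2m.
have nz (u v : R) (rho th : R) : 0 < rho -> u = rho * cos th -> v = rho * sin th ->
    u ^+ 2 + v ^+ 2 != 0.
  move=> r0 -> ->; rewrite !exprMn -mulrDr cos2Dsin2 mulr1.
  by rewrite sqrf_eq0 gt_eqF.
have [r1 r10 hr1] : exists2 r1 : R, 0 < r1 & stable_spiral X Y delta gx gy ->
    forall s : nat -> R, 0 < s 0%N < r1 -> (forall i, returns X1 Y1 f1 (s i) (s i.+1)) ->
    [/\ forall i, 0 < s i, forall i, s i <= small & s i @[i --> \oo] --> (0 : R)].
  have [[hs hx hy [rho [th [_ hp _]]]]|h] := pselect (stable_spiral X Y delta gx gy); last by exists 1.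
  have hs' (t : R) : 0 <= t -> is_derive t 1 gx (gy t + X1 (gx t) (gy t)) /\
      is_derive t 1 gy (Y1 (gx t) (gy t)).
    by move=> ht; apply: hs; rewrite /= in_itv/= andbT.
  have hn (t : R) : 0 <= t -> gx t ^+ 2 + gy t ^+ 2 != 0.
    by move=> /hp[? ? ?]; exact: (nz _ _ (rho t) (th t)).
  have [q hq] := stable_flow hpd Kp0 hKp hs' hn hx hy.
  have [r0 r00 h] := stable_sequence hpd e1 Kp0 C0 hKp f0 fX flip fp Yneg
    xmax0 xmaxb xmaxC xmaxG sm0 smm hq.
  by exists r0 => // _.
have [r2 r20 hr2] : exists2 r2 : R, 0 < r2 & unstable_spiral X Y delta gx gy ->
    forall s : nat -> R, 0 < s 0%N < r2 -> (forall i, 0 < s i.+1 < r2) ->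
    (forall i, returns X1 Y1 f1 (s i.+1) (s i)) ->
    [/\ forall i, 0 < s i, forall i, s i <= small & s i @[i --> \oo] --> (0 : R)].
  have [[hs hx hy [rho [th [_ hp _]]]]|h] := pselect (unstable_spiral X Y delta gx gy); last by exists 1.
  have hs' (t : R) : t <= 0 -> is_derive t 1 gx (gy t + X1 (gx t) (gy t)) /\
      is_derive t 1 gy (Y1 (gx t) (gy t)).
    by move=> ht; apply: hs; rewrite /= in_itv/=.
  have hn (t : R) : t <= 0 -> gx t ^+ 2 + gy t ^+ 2 != 0.
    by move=> /hp[? ? ?]; exact: (nz _ _ (rho t) (th t)).
  have [q hq] := unstable_flow hpd Kp0 hKp hs' hn hx hy.
  have [r0 r00 h] := unstable_sequence hpd e1 Kp0 C0 hKp f0 fX flip fp Yneg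
    xmax0 xmaxb xmaxC xmaxG sm0 smm hq.
  by exists r0 => // _.
exists (Num.min r1 r2); first by rewrite lt_min r10.
move=> s; rewrite lt_min => /andP[s0 /andP[s01 s02]] [[hst hP]|[hun hP]] d hd.
  have [hret|hnot] := pselect (forall i, returns X1 Y1 f1 (s i) (s i.+1)).
    have [pos sle slim] := hr1 hst s (introT andP (conj s0 s01)) hret.
    right; apply: (slow_sequence_dim pos slim K0 _ hd) => i.
    by apply: hstep => //; exact: le_trans (sle i) smx.
  have [i0 hi0] : exists i, ~ returns X1 Y1 f1 (s i) (s i.+1) by exact/existsNP.
  have z0 : s i0.+1 = 0 by have := poincare_map_cases (s i0); rewrite -hP => -[].
  have zS i : s i = 0 -> s i.+1 = 0.
    move=> si; have := poincare_map_cases (s i); rewrite -hP => -[|//].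
    by rewrite si => /returns_neq0.
  have zall j : s (j + i0.+1)%N = 0 by elim: j => [//|j IH]; rewrite addSn zS.
  left; apply: (@finite_dim _ s i0.+1 d _ hd) => i.
  have [le|lt] := leqP i i0.+1; first by exists i.
  by exists i0.+1 => //; rewrite z0 -(subnK (ltnW lt)) zall.
have pos i : 0 < s i by case: i => [//|i]; have [/andP[]] := hP i.
have hret i : returns X1 Y1 f1 (s i.+1) (s i).
  have [_ E] := hP i; have := poincare_map_cases (s i.+1); rewrite E => -[//|z].
  by have := pos i; rewrite z ltxx.
have sb i : 0 < s i.+1 < r2.
  by have [/andP[a1]] := hP i; rewrite lt_min a1 => /andP[].
have [_ sle slim] := hr2 hun s (introT andP (conj s0 s02)) sb hret.
right; apply: (@slow_sequence_dim _ s (K * 2 ^+ N) d N' pos slim _ _ hd).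
  by rewrite mulr_gt0// exprn_gt0.
move=> i; apply: reverse_step => //.
by apply: hstep => //; exact: le_trans (sle _) smx.
Qed.

End SpiralDimension.

Section UniformData.
Variable R : realType.

Lemma dd_lip (X : R -> R -> R) (e K : R) (A B : R -> R -> R -> R) :
  0 < e -> e <= 1 -> 0 <= K -> dd_bounds X e K A B -> A 0 0 0 = 0 -> B 0 0 0 = 0 ->
  forall x y x' y', `|x| <= e -> `|y| <= e -> `|x'| <= e -> `|y'| <= e ->
  `|X x y - X x' y'| <= 3 * K * (`|x - x'| + `|y - y'|).
Proof.
move=> e0 e1 K0 [h1 h2 hA hB] A0 B0 x y x' y' hx hy hx' hy'.
have z0 : `|0 : R| <= e by rewrite normr0 ltW.
have bd (u v w z : R) : `|u| <= e -> `|v| <= e -> `|w| <= e ->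
    z <= K * (`|u - 0| + `|v - 0| + `|w - 0|) -> z <= 3 * K.
  move=> u1 v1 w1 /le_trans; apply; rewrite !subr0 mulrC ler_wpM2r//.
  by move: u1 v1 w1 e1; move: (`|u|) (`|v|) (`|w|) => u' v' w'; lra.
have a1 : `|A x y y'| <= 3 * K.
  by apply: (bd _ _ _ _ hx hy hy'); have := hA x y y' 0 0 0 hx hy hy' z0 z0 z0; rewrite A0 subr0.
have b1 : `|B x y' x'| <= 3 * K.
  by apply: (bd _ _ _ _ hx hy' hx'); have := hB x y' x' 0 0 0 hx hy' hx' z0 z0 z0; rewrite B0 subr0.
have -> : X x y - X x' y' = (X x y - X x y') + (X x y' - X x' y') by ring.
rewrite h1// h2//; apply: le_trans (ler_normD _ _) _.
rewrite !normrM addrC mulrDr; apply: lerD; rewrite mulrC ler_wpM2r//.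
Qed.

Variables (l : nat) (D : set 'rV[R]_l) (X Y : R -> R -> 'rV[R]_l -> R).
Variables (n : nat) (del0 : 'rV[R]_l).
Hypothesis n0 : (0 < n)%N.
Hypothesis hD : \forall e \near (0 : R)^'+, forall del : 'rV[R]_l, `|del - del0| <= e -> D del.
Hypothesis hXO : forall delta, D delta ->
  (fun q : R * R => X q.1 q.2 delta) =O_ ((0, 0) : R * R) (fun q : R * R => `|q| ^+ 2).
Hypothesis hYO : forall delta, D delta ->
  (fun q : R * R => Y q.1 q.2 delta) =O_ ((0, 0) : R * R) (fun q : R * R => `|q| ^+ 2).
Variables (K KP KF : R) (P : 'rV[R]_l -> {poly R}) (F1 : R -> 'rV[R]_l -> R -> R).
Hypotheses (K0 : 0 <= K) (KP0 : 0 <= KP) (KF0 : 0 <= KF).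
Hypothesis hdd : \forall e \near (0 : R)^'+, forall del : 'rV[R]_l, `|del - del0| <= e ->
  (exists A B, dd_bounds (fun x y => X x y del) e K A B) /\
  (exists A B, dd_bounds (fun x y => Y x y del) e K A B).
Hypothesis P0 : forall del, (P del)`_0 = 0.
Hypothesis hP : \forall e \near (0 : R)^'+, forall del : 'rV[R]_l, `|del - del0| <= e ->
  forall x : R, `|x| <= e -> `|(P del).[x]| <= KP * `|x|.
Hypothesis hpol : \forall e \near (0 : R)^'+, forall del : 'rV[R]_l, `|del - del0| <= e ->
  forall t r : R, r != 0 -> `|r| <= e ->
  0 < polar_den (fun x y => X x y del) (fun x y => Y x y del) (P del) n t r /\
  r * F1 t del r = r * (polar_num (fun x y => X x y del) (fun x y => Y x y del) (P del) n t r /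
                        polar_den (fun x y => X x y del) (fun x y => Y x y del) (P del) n t r).
Hypothesis hlip : \forall e \near (0 : R)^'+, forall del : 'rV[R]_l, `|del - del0| <= e ->
  forall t r1 r2 : R, `|r1| <= e -> `|r2| <= e ->
  `|r1 * F1 t del r1 - r2 * F1 t del r2| <= KF * `|r1 - r2|.

Lemma uniform_polar_data : \forall e \near (0 : R)^'+, [/\ 0 < e, e <= 1 &
  forall b : R, 0 < b -> b <= e / 2 -> b * (KP + 1) <= e ^+ n / 2 ->
  forall del : 'rV[R]_l, `|del - del0| <= e ->
  polar_data n (fun x y => X x y del) (fun x y => Y x y del) (P del)
    (fun t r => r * F1 t del r) b e (3 * K) KF].
Proof.
have E0 : \forall e \near (0 : R)^'+, 0 < e by exact: nbhs_right_gt.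
have E1 : \forall e \near (0 : R)^'+, e <= 1 by exact: nbhs_right_le.
apply: filterS (filterI (filterI (filterI hdd hD) (filterI hP hpol)) (filterI hlip (filterI E0 E1))).
move=> e [[[dd_e D_e] [P_e pol_e]] [lip_e [e0 e1]]].
split=> // b b0 be bn del hdel.
have bE : b <= e by move: be e0; lra.
have [[A [B hX]] [A' [B' hY]]] := dd_e del hdel.
have Dd := D_e del hdel.
have [X00 A0 B0] := quad_dd e0 K0 hX (hXO Dd).
have [Y00 A'0 B'0] := quad_dd e0 K0 hY (hYO Dd).
have lX := dd_lip e0 e1 K0 hX A0 B0; have lY := dd_lip e0 e1 K0 hY A'0 B'0.
have hPe := P_e del hdel.
constructor=> //.
- by move: be e1; lra.
- by rewrite mulr_ge0.
- by rewrite horner_coef0 P0.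
- move=> x hx; apply: le_trans bn; rewrite mulrDr mulr1 lerD2r mulrC.
  apply: le_trans (hPe x (le_trans hx bE)) _.
  by rewrite ler_wpM2l.
- by move=> x y x' y' hx hy hx' hy'; apply: lX; exact: le_trans bE.
- by move=> x y x' y' hx hy hx' hy'; apply: lY; exact: le_trans bE.
- exact: pol_e.
- exact: lip_e.
- by move=> t; rewrite mul0r.
Qed.

End UniformData.

(** A power series has the sign of its leading term. *)
Lemma restoring_sign (R : realType) (a : nat -> R) (m : nat) (F : R -> R) :
  (\forall x \near (0 : R), (\sum_(m <= j < N) a j * x ^+ j) @[N --> \oo] --> F x) ->
  0 < a m -> exists2 d : R, 0 < d & forall x, 0 < x -> x <= d -> 0 < F x.
Proof.
move=> /series_lead[C [e [C0 e0 h]]] am.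
have C1 : 0 < 2 * C + 1 by rewrite ltr_wpDl// mulr_ge0.
exists (Num.min e (a m / (2 * C + 1))); first by rewrite lt_min e0 divr_gt0.
move=> x x0; rewrite le_min => /andP[xe xa].
have := h x; rewrite gtr0_norm// => /(_ xe); rewrite ler_norml => /andP[h1 _].
have xm : 0 < x ^+ m by rewrite exprn_gt0.
have : C * x ^+ m.+1 < a m * x ^+ m.
  rewrite exprS mulrA ltr_pM2r//; move: xa; rewrite ler_pdivlMr//.
  have : 0 <= x * C by rewrite mulr_ge0// ltW.
  by move: x0; move: (a m) => z; nra.
by move: h1; lra.
Qed.

(** * The cyclicity bound *)

Lemma dimension_gap (R : realType) (k : nat) (d : R) : (1 <= k)%N ->
  d = 1 - (2 * k + 1)%:R^-1 \/ d = 1 - (2 * k + 2)%:R^-1 ->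
  2^-1 < d < 1 - k.*2.+3%:R^-1.
Proof.
move=> hk; have inv (u v : nat) : (0 < u < v)%N -> (v%:R^-1 : R) < u%:R^-1.
  by move=> /andP[u0 uv]; rewrite ltf_pV2 ?posrE ?ltr0n ?ltr_nat//; exact: ltn_trans uv.
have i1 : (2 * k + 1)%:R^-1 < (2%:R^-1 : R) by apply: inv; lia.
have i2 : (2 * k + 2)%:R^-1 < (2%:R^-1 : R) by apply: inv; lia.
have i3 : k.*2.+3%:R^-1 < ((2 * k + 1)%:R^-1 : R) by apply: inv; lia.
have i4 : k.*2.+3%:R^-1 < ((2 * k + 2)%:R^-1 : R) by apply: inv; lia.
move: i1 i2 i3 i4; move: (k.*2.+3%:R^-1) ((2 * k + 1)%:R^-1) ((2 * k + 2)%:R^-1) => w u v i1 i2 i3 i4.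
by case=> ->; apply/andP; split; lra.
Qed.

Theorem theorem5 (R : realType) (l : nat) (D : set 'rV[R]_l)
  (X Y : R -> R -> 'rV[R]_l -> R) (f : R -> 'rV[R]_l -> R)
  (n : nat) (a b : nat -> 'rV[R]_l -> R)
  (hD : simply_connected_domain D)
  (hXan : forall delta, D delta -> jointly_analytic_at X 0 0 delta)
  (hYan : forall delta, D delta -> jointly_analytic_at Y 0 0 delta)
  (hXO : forall delta, D delta ->
    (fun p : R * R => X p.1 p.2 delta) =O_ ((0, 0) : R * R)
      (fun p : R * R => `|p| ^+ 2))
  (hYO : forall delta, D delta ->
    (fun p : R * R => Y p.1 p.2 delta) =O_ ((0, 0) : R * R)
      (fun p : R * R => `|p| ^+ 2))
  (hf : forall delta, D delta -> characteristic_curve X f delta)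
  (hn : (2 <= n)%N)
  (hF : forall delta, D delta -> \forall x \near (0 : R),
    (\sum_(2 * n - 1 <= j < N) a j delta * x ^+ j) @[N --> \oo]
      --> char_F Y f x delta)
  (ha : forall delta, D delta -> 0 < a (2 * n - 1)%N delta)
  (hG : forall delta, D delta -> \forall x \near (0 : R),
    (\sum_(n - 1 <= j < N) b j delta * x ^+ j) @[N --> \oo]
      --> char_G X Y f x delta)
  (hb : forall delta, D delta ->
    b (n - 1)%N delta ^+ 2 - 4 * n%:R * a (2 * n - 1)%N delta < 0)
  (delta0 : 'rV[R]_l) (hdelta0 : D delta0)
  (gx gy : R -> R)
  (hGamma : stable_spiral X Y delta0 gx gy \/ unstable_spiral X Y delta0 gx gy)
  (k : nat) (hk : (1 <= k)%N) :
  let P x := poincare_map X Y f x delta0 in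
  exists2 r : R, 0 < r &
    forall s : nat -> R,
      0 < s 0%N < r ->
      (stable_spiral X Y delta0 gx gy /\ (forall i, s i.+1 = P (s i)) \/
       unstable_spiral X Y delta0 gx gy /\
         (forall i, 0 < s i.+1 < r /\ P (s i.+1) = s i)) ->
      has_box_dim (range s) (1 - (2 * k + 1)%:R^-1) \/
      has_box_dim (range s) (1 - (2 * k + 2)%:R^-1) ->
      exists2 U : set (R * R), nbhs ((0, 0) : R * R) U &
        \forall delta \near delta0, D delta ->
          ([set C | limit_cycle X Y delta C /\ C `<=` U] #<= `I_k)%card.
Proof.
move=> P.
have hDn : \forall e \near (0 : R)^'+, forall del : 'rV[R]_l, `|del - delta0| <= e -> D del.
  have [oD _ _] := hD.
  have /nbhs_ballP[e0 /= e00 hb0] : nbhs delta0 D by exact: open_nbhs_nbhs.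
  near=> e => del hdel; apply: hb0; rewrite -ball_normE /= distrC.
  by apply: le_lt_trans hdel _; near: e; exact: nbhs_right_lt.
pose M := k.*2.+2; pose kappa : R := M.+1%:R.
have kappa1 : 1 <= kappa by rewrite ler1n.
have [Pp [F1 [KP [P0 [hexp KP0] hPK hfP hpol]]]] :=
  polar_field kappa1 hDn (hXan _ hdelta0) (hYan _ hdelta0) hXO hf hn hF ha hG hb M (n + M.+1).
have [K [K0 hdd]] := system_dd (hXan _ hdelta0) (hYan _ hdelta0).
have [KL [KL0 hKL]] := bnd_lip kappa1
  (expandable_bnd kappa1 (expandableM kappa1 (expandable_r delta0 kappa1 M) hexp)).
have n0 : (0 < n)%N by exact: ltnW.
have hdata := uniform_polar_data n0 hDn hXO hYO K0 KP0 KL0 hdd P0 hPK hpol hKL.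
have [c [hc hcQ]] := expandable_taylor kappa1 hexp.
have hcQ' p : (p <= M)%N -> exists Q, bnd delta0 kappa Q /\
    near_eq delta0 (fun t del r => r * F1 t del r)
      (fun t del r => r * (\sum_(j < p) c j t del * r ^+ j + r ^+ p * Q t del r)).
  move=> /hcQ[Q [hQ hE]]; exists Q; split=> //.
  by apply: filterS hE => e he del hdel t r hr; rewrite he.
have [phi [phi0 hphi]] := transport_coefficients (T := fun j t => c j.-1 t delta0) M
  (fun j t => let: And3 h _ _ := hc j.-1 in h t).
have wit e : 0 < e -> 0 < Num.min (e / 2) (e ^+ n / 2 / (KP + 1)).
  by move=> e0; rewrite lt_min !divr_gt0 ?exprn_gt0// ltr_wpDl.
have witn e v : v <= e ^+ n / 2 / (KP + 1) -> v * (KP + 1) <= e ^+ n / 2.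
  by rewrite ler_pdivlMr// ltr_wpDl.
have [[m hm hne]|hflat] := pselect (exists2 m, (0 < m <= M)%N & phi m (pi *+ 2) != phi m 0).
  have hdata' : \forall e \near (0 : R)^'+, exists b : R, forall del : 'rV[R]_l, `|del - delta0| <= e ->
      polar_data n (fun x y => X x y del) (fun x y => Y x y del) (Pp del)
        (fun t r => r * F1 t del r) b e (3 * K) KL.
    apply: filterS hdata => e [e0 e1 he]; exists (Num.min (e / 2) (e ^+ n / 2 / (KP + 1))).
    by apply: he; [exact: wit|rewrite ge_min lexx|apply: witn; rewrite ge_min lexx orbT].
  have [U hU hcard] := few_cycles (erefl M) hdata' hm hc hcQ' hphi hne.
  exists 1 => // s _ _ _; exists U => //.
  by apply: filterS hcard => delta h _.
have flat m : (m <= M)%N -> phi m (pi *+ 2) = phi m 0.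
  case: m => [_|m hm]; last first.
    by apply/eqP; apply: contrapT => h; apply: hflat; exists m.+1 => //; exact/negP.
  have h0 (t : R) : is_derive t 1 (phi 0%N) (0 : R).
    by have := hphi 0%N t (leq0n _); rewrite big_ord0 oppr0.
  exact: (@is_derive_0_is_cst _ (phi 0%N) (pi *+ 2) 0 h0).
have [CE [CE0 hCE]] := transport_bound kappa1 (- (pi *+ 4)) (pi *+ 4) (leqnn M) hc hcQ' hphi.
have Dd0 := hdelta0.
have [C [d [C0 d0 hfp]]] := at_center hfP.
have := hf _ Dd0; have [e [[[[e0 e1 he] hPe] hCEe] hdde]] :=
  filter_ex (filterI (filterI (filterI hdata hPK) hCE) hdd).
have z0 : `|delta0 - delta0| <= e by rewrite subrr normr0 ltW.
have [[A [B hA]] _] := hdde _ z0; have [_ A00 B00] := quad_dd e0 K0 hA (hXO _ Dd0).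
move=> hfc; have [f00 _ _] := hfc.
have [d1 [d10 fX _ flip]] := char_curve_lip e0 K0 hA A00 B00 hfc.
have [d2 d20 Yn] := restoring_sign (hF _ Dd0) (ha _ Dd0).
pose b' := Num.min (Num.min (e / 2) (e ^+ n / 2 / (KP + 1))) (Num.min (Num.min d d1) d2).
have b0 : 0 < b' by rewrite lt_min wit// !lt_min d0 d10 d20.
have /andP[/andP[be bn] /andP[/andP[bd bd1] bd2]] :
  (b' <= e / 2) && (b' <= e ^+ n / 2 / (KP + 1)) && ((b' <= d) && (b' <= d1) && (b' <= d2)).
  by rewrite -!le_min lexx.
have hpd := he b' b0 be (witn _ _ bn) delta0 z0.
have bE : b' <= e by move: be e0; lra.
have hKp x : `|x| <= b' -> `|(Pp delta0).[x]| <= KP * `|x|.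
  by move=> hx; apply: hPe => //; exact: le_trans hx bE.
have fX' x : `|x| <= b' -> f x delta0 + X x (f x delta0) delta0 = 0.
  by move=> hx; apply: fX; exact: le_trans hx bd1.
have flip' x x' : `|x| <= b' -> `|x'| <= b' -> `|f x delta0 - f x' delta0| <= `|x - x'|.
  by move=> hx hx'; apply: flip; [exact: le_trans hx bd1|exact: le_trans hx' bd1].
have fp x : `|x| <= b' -> `|f x delta0 - (Pp delta0).[x]| <= C * `|x| ^+ (n + M.+1).
  by move=> hx; apply: hfp; exact: le_trans hx bd.
have Yneg x : 0 < x -> x <= b' -> Y x (f x delta0) delta0 < 0.
  by move=> x0 hx; have := Yn x x0 (le_trans hx bd2); rewrite /char_F oppr_gt0.
pose E : R := 2 * expR (KL * (pi *+ 4)).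
have E0 : 0 < E by rewrite mulr_gt0// expR_gt0.
have KP2 : 0 < (2 + KP) * E by apply: mulr_gt0 => //; move: KP0; lra.
have KPE : 0 < 2 * ((2 + KP) * E) by exact: mulr_gt0.
have C10 : 0 < 2 * (C + 1) by rewrite mulr_gt0// ltr_wpDl.
pose xmax := Num.min b' (Num.min (b' / (2 * ((2 + KP) * E))) (2 * (C + 1))^-1).
have xmax0 : 0 < xmax by rewrite lt_min b0/= lt_min (divr_gt0 b0 KPE) invr_gt0.
have /and3P[xb xG xC] :
  [&& xmax <= b', xmax <= b' / (2 * ((2 + KP) * E)) & xmax <= (2 * (C + 1))^-1].
  by rewrite -!le_min lexx.
have b1 := pd_b1 hpd.
have xmaxC : C * xmax ^+ M.+1 <= 2^-1.
  apply: (@le_trans _ _ ((C + 1) * xmax)).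
    apply: ler_pM => //; first by rewrite exprn_ge0// ltW.
      by rewrite lerDl.
    rewrite exprS; apply: ler_piMr; first exact: ltW.
    by apply: exprn_ile1; [exact: ltW|exact: le_trans xb b1].
  by move: xC; rewrite -[_^-1]mul1r ler_pdivlMr//; move: (C + 1) => z; lra.
have xmaxG : (2 + KP) * (2 * expR (KL * (pi *+ 4)) * xmax) < b'.
  move: xG; rewrite -/E ler_pdivlMr// => h; rewrite mulrA.
  have : 0 < (2 + KP) * E * xmax by exact: mulr_gt0.
  by move: h; move: ((2 + KP) * E) => z; lra.
have hbound (t r : R) : - (pi *+ 4) <= t <= pi *+ 4 -> 0 < r <= e ->
    `|\sum_(i < M) (- (\sum_(j < i.+1) j.+1%:R * phi j.+1 t * c (i.+1 - j).-1 t delta0) * r ^+ i.+1 +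
       i.+1%:R * phi i.+1 t * r ^+ i * (r * F1 t delta0 r))| <= CE * r ^+ M.+1.
  move=> ht /andP[r0 re].
  have := hCEe delta0 z0 0 (lexx _) _ t ht 1%N _ (algnorm_abs kappa1) (fun=> r).
  rewrite gtr0_norm// add0r; apply=> // j t' _.
  by rewrite subrr normr0.
have [Ks [x2 [Ks0 x20 x2m hstep]]] := step_bound hpd e1 KP0 C0 hKp f00 fX' flip' fp Yneg
  xmax0 xb (ltn0Sn _) xmaxC xmaxG CE0 (fun j t hj => hphi j t hj) phi0 flat (ltn0Sn _) hbound.
have [r r0 hr] := spiral_dimension gx gy hpd e1 KP0 C0 hKp f00 fX' flip' fp Yneg
  xmax0 xb xmaxC xmaxG Ks0 x20 x2m hstep.
exists r => // s hs hPs hdim; exfalso.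
have [d' hd' hgap] : exists2 d' : R, has_box_dim (range s) d' & 2^-1 < d' < 1 - k.*2.+3%:R^-1.
  case: hdim => hd; [exists (1 - (2 * k + 1)%:R^-1)|exists (1 - (2 * k + 2)%:R^-1)] => //.
    by apply: dimension_gap => //; left.
  by apply: dimension_gap => //; right.
move/andP: hgap => [g1 g2]; have [h|h] := hr s hs hPs d' hd'.
  by have := lt_le_trans g1 h; rewrite ltxx.
by have := lt_le_trans g2 h; rewrite ltxx.
Unshelve. all: end_near. Qed.
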